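(* Let $\mathcal G$ be a connected metric graph, $N\ge1$, and let $u\in H^1(\mathbb R^N\times\mathcal G)$ be a nonnegative function, with $y$-symmetric rearrangement $\widehat u^{y}:\mathbb R^N\times\widehat{\mathcal G}\to\mathbb R$. Then $\widehat u^{y}\in H^1(\mathbb R^N\times\widehat{\mathcal G})$, and: (i) $\|\widehat u^{y}\|_{L^p(\mathbb R^N\times\widehat{\mathcal G})}^p=\|u\|_{L^p(\mathbb R^N\times\mathcal G)}^p$ for every $p\ge1$; (ii) $\|\nabla_x\widehat u^{y}\|_{L^2(\mathbb R^N\times\widehat{\mathcal G})}^2\le\|\nabla_xu\|_{L^2(\mathbb R^N\times\mathcal G)}^2$; (iii) $\|\partial_y\widehat u^{y}\|_{L^2(\mathbb R^N\times\widehat{\mathcal G})}^2\le\|\partial_yu\|_{L^2(\mathbb R^N\times\mathcal G)}^2$, if, for almost every $x\in\mathbb R^N$, $u(x,\cdot)$ attains at least twice almost every value in its image.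
   Context: A metric graph $\mathcal G$ is given by (at most countable) sets of edges and vertices; each edge $e$ has a length $\ell_e\in(0,+\infty]$ and is identified with $[0,\ell_e]$ (endpoints glued at vertices, self-loops allowed) or with $[0,+\infty)$ (with $0$ glued at a vertex). $l(\mathcal G)=\sum_e\ell_e\in(0,\infty]$. $H^1(\mathcal G)$ is the set of $w=\{w_e\}$ with $w_e\in H^1(e)$, $\sum_e\|w_e\|_{H^1(e)}^2<\infty$, $w$ continuous at every vertex. $H^1(\mathbb R^N\times\mathcal G)$ is the set of real-valued $u=\{u_e\}$ with $u_e\in H^1(\mathbb R^N\times e)$ for every edge, $\sum_e\|u_e\|_{H^1(\mathbb R^N\times e)}^2<\infty$, and equal traces on $\mathbb R^N\times\{v\}$ from any two edges meeting at the vertex $v$; equivalently, $u(\cdot,y)\in H^1(\mathbb R^N)$ for a.e. $y$, $u(x,\cdot)\in H^1(\mathcal G)$ for a.e. $x$, with $\int_{\mathcal G}\|u(\cdot,y)\|_{H^1(\mathbb R^N)}^2dy+\int_{\mathbb R^N}\|u(x,\cdot)\|_{H^1(\mathcal G)}^2dx<\infty$. $\widehat{\mathcal G}$ is the circle of length $l(\mathcal G)$ if $l(\mathcal G)<\infty$, identified with $[-l(\mathcal G)/2,l(\mathcal G)/2]$ with endpoints glued (functions in $H^1$ of the circle are the $H^1$ functions on the interval with equal values at the two endpoints), and $\widehat{\mathcal G}=\mathbb R$ if $l(\mathcal G)=\infty$; it is regarded as a metric graph. For nonnegative $f\in H^1(\mathcal G)$ put $\rho_f(t)=|\{y\in\mathcal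 G:f(y)>t\}|$; the symmetric rearrangement is $\widehat f(y)=\inf\{t\ge0:\rho_f(t)\le2|y|\}$, $y\in\widehat{\mathcal G}$. For nonnegative $u\in H^1(\mathbb R^N\times\mathcal G)$, $\widehat u^{y}(x,y)=\widehat{u(x,\cdot)}(y)$ for a.e. $x$ (those with $u(x,\cdot)\in H^1(\mathcal G)$) and $y\in\widehat{\mathcal G}$. *)

(* Defs.v *)
From HB Require Import structures.
From mathcomp Require Import all_boot all_order all_algebra.
From mathcomp Require Import all_classical all_reals all_analysis.
From Stdlib Require Import Relation_Operators.

Set Implicit Arguments.
Unset Strict Implicit.
Unset Printing Implicit Defensive.

Import Order.TTheory GRing.Theory Num.Theory.
Import numFieldNormedType.Exports.
Local Open Scope classical_set_scope.
Local Open Scope ring_scope.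

Section rV_measurable.
Context {R : realType} {n : nat}.

Definition rV_coor (i : 'I_n) (v : 'rV[R]_n) : R := v ord0 i.

Let rV_set0 : g_sigma_preimage rV_coor set0.
Proof. exact: sigma_algebra0. Qed.

Let rV_setC A : g_sigma_preimage rV_coor A -> g_sigma_preimage rV_coor (~` A).
Proof. exact: sigma_algebraC. Qed.

Let rV_bigcup (F : (set 'rV[R]_n)^nat) :
  (forall i, g_sigma_preimage rV_coor (F i)) ->
  g_sigma_preimage rV_coor (\bigcup_i F i).
Proof. exact: sigma_algebra_bigcup. Qed.

(* The sigma-algebra generated by the coordinates, i.e. the Borel sets. *)
HB.instance Definition _ := @isMeasurable.Build default_measure_display
  'rV[R]_n (g_sigma_preimage rV_coor) rV_set0 rV_setC rV_bigcup.

Lemma measurable_rV_coor (i : 'I_n) :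
  measurable_fun [set: 'rV[R]_n] (rV_coor i).
Proof.
move=> _ Y mY; rewrite setTI; apply: sub_sigma_algebra => /=.
rewrite -bigcup_seq/=; exists i => /=; first by rewrite mem_index_enum.
by exists Y => //; rewrite setTI.
Qed.

Lemma measurable_fun_rVP d (T : measurableType d) (f : T -> 'rV[R]_n) :
  (forall i, measurable_fun [set: T] (rV_coor i \o f)) ->
  measurable_fun [set: T] f.
Proof.
move=> mf.
have : g_sigma_preimage (fun i => rV_coor i \o f) `<=` measurable.
  apply: smallest_sub; first exact: sigma_algebra_measurable.
  by rewrite -bigcup_seq; apply: bigcup_sub => i _ A [B mB <-]; exact: mf.
rewrite g_sigma_preimage_comp => sub _ A mA.
by apply: sub; exists A.
Qed.

End rV_measurable.

Section lebesgue_rV.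
Context {R : realType}.

Definition rV_cons n (p : R * 'rV[R]_n) : 'rV[R]_n.+1 :=
  row_mx (p.1)%:M p.2 : 'rV[R]_(1 + n).

Definition rV_uncons n (v : 'rV[R]_n.+1) : R * 'rV[R]_n :=
  (v ord0 ord0, rsubmx (v : 'rV[R]_(1 + n))).

Lemma rV_cons_ord0 n (p : R * 'rV[R]_n) : rV_cons p ord0 ord0 = p.1.
Proof.
have -> : ord0 = lshift n (ord0 : 'I_1) :> 'I_(1 + n) by exact/val_inj.
by rewrite /rV_cons (@row_mxEl _ 1 1 n) mxE eqxx mulr1n.
Qed.

Lemma rV_cons_lift n (p : R * 'rV[R]_n) j :
  rV_cons p ord0 (lift ord0 j) = p.2 ord0 j.
Proof.
have -> : lift ord0 j = rshift 1 j :> 'I_(1 + n) by exact/val_inj.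
by rewrite /rV_cons (@row_mxEr _ 1 1 n).
Qed.

Lemma rV_consK n : cancel (@rV_cons n) (@rV_uncons n).
Proof.
move=> [a v]; rewrite /rV_uncons rV_cons_ord0; congr pair.
by rewrite /rV_cons/= row_mxKr.
Qed.

Lemma measurable_rV_cons n : measurable_fun [set: R * 'rV[R]_n] (@rV_cons n).
Proof.
apply: measurable_fun_rVP => i.
case: (unliftP ord0 i) => [j ->|->].
  rewrite (_ : _ \o _ = rV_coor j \o snd).
    by apply: measurableT_comp; [exact: measurable_rV_coor|exact: measurable_snd].
  by apply/funext => p /=; rewrite /rV_coor rV_cons_lift.
rewrite (_ : _ \o _ = fst); first exact: measurable_fst.
by apply/funext => p /=; rewrite /rV_coor rV_cons_ord0.
Qed.

Lemma measurable_rV_uncons n :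
  measurable_fun [set: 'rV[R]_n.+1] (@rV_uncons n).
Proof.
apply: measurable_fun_pair; first exact: (measurable_rV_coor ord0).
apply: measurable_fun_rVP => j.
rewrite (_ : _ \o _ = rV_coor (rshift 1 j)).
  exact: measurable_rV_coor.
by apply/funext => v /=; rewrite /rV_coor mxE.
Qed.

Section step.
Variables (n : nat) (m : {sigma_finite_measure set 'rV[R]_n -> \bar R}).
Local Open Scope ereal_scope.

Definition lebesgue_rV_step : set 'rV[R]_n.+1 -> \bar R :=
  pushforward (lebesgue_measure \x m) (@rV_cons n).

Let step0 : lebesgue_rV_step set0 = 0.
Proof. by rewrite /lebesgue_rV_step /pushforward preimage_set0 measure0. Qed.

Let step_ge0 A : 0 <= lebesgue_rV_step A.
Proof. by rewrite /lebesgue_rV_step /pushforward; exact: measure_ge0. Qed.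

Let measurable_preimage_rV_cons (A : set 'rV[R]_n.+1) :
  measurable A -> measurable (@rV_cons n @^-1` A).
Proof.
by move=> mA; rewrite -[X in measurable X]setTI; exact: measurable_rV_cons.
Qed.

Let step_sigma_additive : semi_sigma_additive lebesgue_rV_step.
Proof.
move=> F mF tF mUF; rewrite /lebesgue_rV_step /pushforward preimage_bigcup.
apply: measure_semi_sigma_additive.
- by move=> i; exact: measurable_preimage_rV_cons.
- apply/trivIsetP => /= i j _ _ ij; rewrite -preimage_setI.
  by move/trivIsetP : tF => /(_ _ _ _ _ ij) ->//; rewrite preimage_set0.
- by rewrite -preimage_bigcup; exact: measurable_preimage_rV_cons.
Qed.

HB.instance Definition _ := isMeasure.Build _ _ _ lebesgue_rV_step
  step0 step_ge0 step_sigma_additive.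

Let product_sigma_finite : sigma_finite setT (lebesgue_measure \x m).
Proof.
have /sigma_finiteP[F [TF ndF Foo]] := sigma_finiteT (@lebesgue_measure R).
have /sigma_finiteP[G [TG ndG Goo]] := sigma_finiteT m.
exists (fun k => F k `*` G k).
  rewrite -setXTT TF TG predeqE => -[x y]; split.
    move=> [/= [i _ Fix] [j _ Gjy]]; exists (maxn i j) => //; split.
    - by move: x Fix; exact/subsetPset/ndF/leq_maxl.
    - by move: y Gjy; exact/subsetPset/ndG/leq_maxr.
  by move=> [i _ []/= ? ?]; split; exists i.
move=> k; have [? ?] := Foo k; have [? ?] := Goo k.
split; first exact: measurableX.
by rewrite product_measure1E// lte_mul_pinfty// ge0_fin_numE.
Qed.

Let step_sigma_finite : sigma_finite setT lebesgue_rV_step.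
Proof.
have [F UF mF] := product_sigma_finite.
exists (fun k => @rV_uncons n @^-1` F k).
  by rewrite -preimage_bigcup -UF preimage_setT.
move=> k; have [mFk Fkoo] := mF k; split.
  by rewrite -[X in measurable X]setTI; exact: measurable_rV_uncons.
rewrite /= /lebesgue_rV_step /pushforward -comp_preimage.
rewrite (_ : _ \o _ = id) ?preimage_id//.
by apply/funext => p /=; rewrite rV_consK.
Qed.

HB.instance Definition _ := Measure_isSigmaFinite.Build _ _ _ lebesgue_rV_step
  step_sigma_finite.

End step.

Fixpoint lebesgue_rV (n : nat) : {sigma_finite_measure set 'rV[R]_n -> \bar R} :=
  match n with
  | 0%N => dirac (0 : 'rV[R]_0)
  | k.+1 => lebesgue_rV_step (lebesgue_rV k)
  end.

Lemma measurable_rV_box n (A : 'I_n -> set R) :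
  (forall i, measurable (A i)) ->
  measurable [set v : 'rV[R]_n | forall i, A i (v ord0 i)].
Proof.
move=> mA.
rewrite (_ : [set _ | _] =
    \bigcap_(i in [set: 'I_n]) (rV_coor i @^-1` A i : set 'rV[R]_n)).
  apply: fin_bigcap_measurable => // i _.
  by rewrite -[X in measurable X]setTI; exact: measurable_rV_coor.
apply/seteqP; split => v /= H i; first by move=> _; exact: H.
exact: (H i I).
Qed.

Lemma lebesgue_rV_box n (A : 'I_n -> set R) :
  (forall i, measurable (A i)) ->
  lebesgue_rV n [set v : 'rV[R]_n | forall i, A i (v ord0 i)] =
  (\prod_(i < n) lebesgue_measure (A i))%E.
Proof.
elim: n A => [|n IH] A mA.
  rewrite big_ord0 (_ : [set _ | _] = setT) /= ?diracT//.
  by apply/seteqP; split => // v _ [].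
have mB := measurable_rV_box (fun i => mA (lift ord0 i)).
rewrite big_ord_recl -(IH _ (fun i => mA (lift ord0 i))).
rewrite /= /lebesgue_rV_step /pushforward.
rewrite (_ : _ @^-1` _ =
    A ord0 `*` [set v : 'rV[R]_n | forall i, A (lift ord0 i) (v ord0 i)]).
  by rewrite (product_measure1E (@lebesgue_measure R) (lebesgue_rV n) (mA _) mB).
apply/seteqP; split => [p /= H|p /= [H1 H2] i].
  split=> [|i]; first by move: (H ord0); rewrite rV_cons_ord0.
  by move: (H (lift ord0 i)); rewrite rV_cons_lift.
by case: (unliftP ord0 i) => [j ->|->]; rewrite ?rV_cons_lift ?rV_cons_ord0.
Qed.

End lebesgue_rV.
Arguments lebesgue_rV R n : clear implicits.

(* Edge e is [0, len e], or [0, +oo[ if len e = +oo; its coordinate 0 is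
   glued to src e and, when len e is finite, its coordinate len e is glued
   to tgt e. If len e = +oo, tgt e is meaningless and never used. *)
Record metric_graph (R : realType) := MetricGraph {
  edge : countType;
  vertex : countType;
  len : edge -> \bar R;
  src : edge -> vertex;
  tgt : edge -> vertex;
  len_gt0 : forall e, (0 < len e)%E;
  edge_inh : inhabited edge }.

Section metric_graph_theory.
Context {R : realType} (G : metric_graph R).

Definition glued (p : edge G * R) (v : vertex G) : Prop :=
  (p.2 = 0 /\ src p.1 = v) \/ ((p.2)%:E = len p.1 /\ tgt p.1 = v).

(* Points of G are the pairs (e, s) with 0 <= s <= len e, up to same_point. *)
Definition on_graph (p : edge G * R) : Prop :=
  0 <= p.2 /\ ((p.2)%:E <= len p.1)%E.

Definition same_point (p q : edge G * R) : Prop :=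
  p = q \/ exists v, glued p v /\ glued q v.

Definition adjacent (v w : vertex G) : Prop :=
  exists e s t, glued (e, s) v /\ glued (e, t) w.

Definition connected_graph : Prop :=
  forall v w, clos_refl_trans _ adjacent v w.

Definition total_length : \bar R := \esum_(e in [set: edge G]) len e.

Lemma total_length_gt0 : (0 < total_length)%E.
Proof.
case: (edge_inh G) => e; apply: (lt_le_trans (len_gt0 e)).
apply: esum_ge; exists [set e]; first by split.
by rewrite fsbig_set1.
Qed.

End metric_graph_theory.

(* A metric graph together with, on each edge, a parametrization of the edge
   by a subset of R: edge_coord e s is the abscissa of the point (e, s). *)
Record coord_graph (R : realType) := CoordGraph {
  coord_graph_graph :> metric_graph R;
  edge_coord : edge coord_graph_graph -> R -> R }.

Section hat_graph.
Context {R : realType}.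

(* [-L/2, L/2] with both endpoints glued: one edge [0, L], shifted by L/2. *)
Definition circle_graph (L : R) (L0 : (0 < L%:E)%E) : coord_graph R :=
  @CoordGraph R
    (@MetricGraph R unit unit (fun=> L%:E) id id (fun=> L0) (inhabits tt))
    (fun _ s => s - L / 2).

(* R as two half-lines glued at 0: the edge true is [0, +oo[ and the edge
   false is ]-oo, 0]. *)
Definition line_graph : coord_graph R :=
  @CoordGraph R
    (@MetricGraph R bool unit (fun=> +oo%E) (fun=> tt) (fun=> tt)
      (fun=> ltey 0) (inhabits true))
    (fun b s => if b then s else - s).

Definition hat_graph (G : metric_graph R) : coord_graph R :=
  match total_length G as l return (0 < l)%E -> coord_graph R with
  | L%:E => fun L0 => circle_graph L0
  | _ => fun=> line_graph
  end (total_length_gt0 G).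

End hat_graph.

Section sobolev.
Context {R : realType} {N : nat}.
Local Notation V := ('rV[R]_N * R)%type.

Definition lebesgue_strip :
    {measure set ('rV[R]_N * measurableTypeR R) -> \bar R} :=
  (lebesgue_rV R N \x lebesgue_measure)%E.

(* Since R^N x {0} and R^N x {l} are negligible, norms and weak derivatives
   on R^N x [0, l] are taken over the open strip. *)
Definition strip (l : \bar R) : set ('rV[R]_N * measurableTypeR R) :=
  [set z : V | 0 < z.2 /\ ((z.2)%:E < l)%E].

Definition dir_x (i : 'I_N) : V := (delta_mx ord0 i, 0).
Definition dir_y : V := (0, 1).

(* C^oo: all iterated directional derivatives exist and are continuous. *)
Definition smooth (f : V -> R) : Prop :=
  forall (vs : seq V) (v : V),
    let g := foldr (fun w (h : V -> R) => 'D_w h) f vs in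
    continuous g /\ forall z, derivable g z v.

Definition supp (f : V -> R) : set V := closure [set z | f z != 0].

Definition test_function (f : V -> R) : Prop := smooth f /\ compact (supp f).

Definition sqr_norm (l : \bar R) (f : V -> R) : \bar R :=
  (\int[lebesgue_strip]_(z in strip l) (f z ^+ 2)%:E)%E.

Definition L2 (l : \bar R) (f : V -> R) : Prop :=
  measurable_fun (strip l) f /\ (sqr_norm l f < +oo)%E.

Definition is_weak_deriv (l : \bar R) (v : V) (f g : V -> R) : Prop :=
  L2 l g /\ forall phi, test_function phi -> supp phi `<=` strip l ->
    (\int[lebesgue_strip]_(z in strip l) (f z * 'D_v phi z)%:E =
     - \int[lebesgue_strip]_(z in strip l) (g z * phi z)%:E)%E.

(* The weak derivative, unique up to a negligible set when it exists. *)
Definition weak_deriv (l : \bar R) (v : V) (f : V -> R) : V -> R :=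
  xget (cst 0) [set g | is_weak_deriv l v f g].

Definition H1_strip (l : \bar R) (f : V -> R) : Prop :=
  [/\ L2 l f, forall i, exists g, is_weak_deriv l (dir_x i) f g
    & exists g, is_weak_deriv l dir_y f g].

Definition sqr_grad_x (l : \bar R) (f : V -> R) : \bar R :=
  (\sum_(i < N) sqr_norm l (weak_deriv l (dir_x i) f))%E.

Definition sqr_deriv_y (l : \bar R) (f : V -> R) : \bar R :=
  sqr_norm l (weak_deriv l dir_y f).

Definition sqr_H1_norm (l : \bar R) (f : V -> R) : \bar R :=
  (sqr_norm l f + sqr_grad_x l f + sqr_deriv_y l f)%E.

(* g is the trace of f on R^N x {s}, s an endpoint of [0, l]: the value at f
   of the continuous extension to H^1 of the restriction to R^N x {s} of
   smooth functions. *)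
Definition has_trace (l : \bar R) (f : V -> R) (s : R)
    (g : 'rV[R]_N -> R) : Prop :=
  measurable_fun [set: 'rV[R]_N] g /\
  exists phi : (V -> R)^nat,
    [/\ forall n, test_function (phi n),
        (fun n => sqr_H1_norm l (phi n \- f)) @ \oo --> 0%E
      & (fun n => (\int[lebesgue_rV R N]_x ((phi n (x, s) - g x)%R ^+ 2)%:E)%E)
          @ \oo --> 0%E].

End sobolev.

Section graph_functions.
Context {R : realType} {N : nat} (G : metric_graph R).
Implicit Types u : edge G -> 'rV[R]_N * R -> R.
Local Open Scope ereal_scope.

Definition H1_graph u : Prop :=
  [/\ forall e, H1_strip (len e) (u e),
      \esum_(e in [set: edge G]) sqr_H1_norm (len e) (u e) < +oo
    & exists tau : vertex G -> 'rV[R]_N -> R, forall e s v,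
        glued (e, s) v -> has_trace (len e) (u e) s (tau v)].

Definition Lp_pow (p : R) u : \bar R :=
  \esum_(e in [set: edge G])
    \int[lebesgue_strip]_(z in strip (len e)) (`|u e z| `^ p)%:E.

Definition grad_x_sqr_norm u : \bar R :=
  \esum_(e in [set: edge G]) sqr_grad_x (len e) (u e).

Definition deriv_y_sqr_norm u : \bar R :=
  \esum_(e in [set: edge G]) sqr_deriv_y (len e) (u e).

Definition nonneg_graph u : Prop :=
  forall e, {ae lebesgue_strip, forall z, strip (len e) z -> (0 <= u e z)%R}.

End graph_functions.

Section rearrangement.
Context {R : realType} (G : metric_graph R).
Implicit Types f w : edge G -> R -> R.

Definition distribution_fun f (t : R) : \bar R :=
  \esum_(e in [set: edge G])
    lebesgue_measure [set s | on_graph (e, s) /\ t < f e s].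

Definition rearrangement f (y : R) : R :=
  inf [set t | 0 <= t /\ (distribution_fun f t <= (2 * `|y|)%:E)%E].

Definition y_rearrangement N (u : edge G -> 'rV[R]_N * R -> R) :
    edge (hat_graph G) -> 'rV[R]_N * R -> R :=
  fun e z => rearrangement (fun e' s => u e' (z.1, s)) (edge_coord e z.2).

(* w is the continuous representative of the class of f. *)
Definition continuous_rep f w : Prop :=
  [/\ forall e, {within [set s | on_graph (e, s)], continuous (w e)},
      forall p q, on_graph p -> on_graph q -> same_point p q ->
        w p.1 p.2 = w q.1 q.2
    & forall e, {ae lebesgue_measure, forall s, on_graph (e, s) ->
        w e s = f e s}].

Definition attains_twice w : Prop :=
  {ae lebesgue_measure, forall t,
    (exists2 p, on_graph p & w p.1 p.2 = t) ->
    exists p q, [/\ on_graph p, on_graph q, ~ same_point p q,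
      w p.1 p.2 = t & w q.1 q.2 = t]}.

(* u(x, .), i.e. its continuous representative, attains at least twice almost
   every value in its image, for almost every x. *)
Definition attains_twice_ae N (u : edge G -> 'rV[R]_N * R -> R) : Prop :=
  {ae lebesgue_rV R N, forall x, forall w,
    continuous_rep (fun e s => u e (x, s)) w -> attains_twice w}.

End rearrangement.

(* Main.v *)
Require Import Defs.
From HB Require Import structures.
From mathcomp Require Import all_boot all_order all_algebra.
From mathcomp Require Import all_classical all_reals all_analysis.
From mathcomp Require Import measurable_realfun ring lra.
From Stdlib Require Import Relation_Operators.
Set Implicit Arguments.
Unset Strict Implicit.
Unset Printing Implicit Defensive.
Import Order.TTheory GRing.Theory Num.Theory.
Import numFieldNormedType.Exports.
Local Open Scope classical_set_scope.
Local Open Scope ring_scope.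

(* For almost every x the section u(x, .) is absolutely continuous along the graph, and its
   symmetric rearrangement satisfies two inequalities. Rearrangement is nonexpansive in L^2
   (layer-cake formula), so the difference quotients of uhat in x are bounded by those of u.
   By connectedness u(x, .) attains every intermediate value, so a coarea inequality bounds a
   drop b - a of the rearrangement by the integral of |d_y u| over {a < u < b}, and 2 (b - a) if
   almost every value is attained twice; Cauchy-Schwarz and an integration over translations then
   bound the difference quotients of uhat in y by 4 (resp. 1) times |d_y u|^2.
   Since uhat is even and decreasing in |y|, it can be dilated slightly in y and mollified:
   bounds on difference quotients thus yield even test functions with almost the same bounds on
   each partial derivative. The parallelogram identity makes those of nearly least energy a
   Cauchy sequence in H^1, whose limits give the weak derivatives of uhat and, at y = 0 or at the
   glued endpoints y = -L/2 and y = L/2, its traces. *)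

(** * Mean square calculus *)

(** [H1_graph] asks for more than weak derivatives: at each vertex one function must be the trace of
    every edge meeting there, as a limit of test functions that converge in H^1 of the edge. One
    sequence of test functions on R^N x R, restricted to the band |y| < b with b half the total
    length, serves all edges of the unfolded graph, and evenness makes its values at y = -b and y =
    b agree, as the gluing of the circle demands. Items (ii) and (iii) are separate sharp
    inequalities, so each partial derivative carries its own constant through every approximation.
    For finite b the rearrangement may jump to 0 at |y| = b: its difference quotients in y are
    controlled only while y and y + h stay in the band, and the dilation gives the mollifier room to
    avoid the jump. In 4 = 2 * 2, one factor 2|h| bounds the measure of the set where u(x, .) lies
    between the values of the rearrangement at y and y + h, the other the set of y for which a given
    level is passed between y and y + h; attaining values k times divides the result by k^2. *)

Section ereal_limits.
Context {R : realType}.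
Local Open Scope ereal_scope.
Implicit Types u v : nat -> \bar R.

Lemma cvge0P u : (forall n, 0 <= u n) ->
  (u @ \oo --> 0 <->
   forall e : R, (0 < e)%R -> exists N, forall n, (N <= n)%N -> u n <= e%:E).
Proof.
move=> u0; split => [cu e e0|H].
  move/fine_cvgP : cu => [[N _ fu] /cvgrPdist_le /(_ e e0) [M _ Mu]].
  exists (maxn N M) => n; rewrite geq_max => /andP[Nn Mn].
  rewrite -(fineK (fu _ Nn)) lee_fin; apply: le_trans (Mu _ Mn) => /=.
  by rewrite sub0r normrN ler_norm.
apply/fine_cvgP; split.
  have [N HN] := H 1%R ltr01; exists N => // n /= Nn.
  by rewrite ge0_fin_numE//; apply: le_lt_trans (HN _ Nn) _; rewrite ltry.
apply/cvgrPdist_le => e e0; have [N HN] := H e e0.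
exists N => // n /= Nn; rewrite sub0r normrN ger0_norm ?fine_ge0//.
rewrite -lee_fin fineK ?HN// ge0_fin_numE//.
by apply: le_lt_trans (HN _ Nn) _; rewrite ltry.
Qed.

Lemma squeeze0e u v : (forall n, 0 <= u n) -> (forall n, u n <= v n) ->
  v @ \oo --> 0 -> u @ \oo --> 0.
Proof.
move=> u0 uv v0; apply: (@squeeze_cvge _ _ _ _ (cst 0) _ v) => //.
- by apply: nearW => n; rewrite u0 uv.
- exact: cvg_cst.
Qed.

Lemma cvge0D u v : u @ \oo --> 0 -> v @ \oo --> 0 ->
  (fun n => u n + v n) @ \oo --> 0.
Proof. by move=> cu cv; rewrite -[X in _ --> X](add0e 0); apply: cvgeD. Qed.

Lemma cvge0Z (k : R) u : u @ \oo --> 0 -> (fun n => k%:E * u n) @ \oo --> 0.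
Proof. by move=> cu; rewrite -[X in _ --> X](mule0 k%:E); apply: cvgeZl. Qed.

Lemma nneseries_geometric_half :
  \sum_(0 <= k <oo) ((2 ^+ k.+1)^-1)%:E = 1 :> \bar R.
Proof.
have := @cvg_geometric_eseries_half R 1 0; rewrite expr0 divr1.
move/(cvg_lim (@ereal_hausdorff _)) => <-.
apply: congr_lim; apply/funext => n; rewrite /eseries /=.
by apply: eq_bigr => k _; rewrite addn1 div1r natrX.
Qed.

Lemma lee_add_epsilon (x y : \bar R) (c : R) : 0 <= c%:E ->
  (forall e : R, (0 < e)%R -> x <= y + (c * e)%:E) -> x <= y.
Proof.
move=> c0 H; apply/lee_addgt0Pr => e e0.
have c1 : (0 < c + 1)%R by rewrite lee_fin in c0; lra.
apply: (le_trans (H (e / (c + 1))%R _)); first exact: divr_gt0.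
rewrite leeD2l// lee_fin mulrA ler_pdivrMr// mulrC; nra.
Qed.

End ereal_limits.

Lemma ae_imp d (T : sigmaRingType d) (R : realType)
    (mu : {measure set T -> \bar R}) (P Q : T -> Prop) :
  {ae mu, forall x, P x} -> (forall x, P x -> Q x) -> {ae mu, forall x, Q x}.
Proof.
by move=> aeP PQ; apply: negligibleS aeP => x /= nQ Px; apply: nQ; exact: PQ.
Qed.

Lemma ae_imp2 d (T : sigmaRingType d) (R : realType)
    (mu : {measure set T -> \bar R}) (P P' Q : T -> Prop) :
  {ae mu, forall x, P x} -> {ae mu, forall x, P' x} ->
  (forall x, P x -> P' x -> Q x) -> {ae mu, forall x, Q x}.
Proof.
move=> aeP aeP' PQ; apply: negligibleS (negligibleU aeP aeP') => x /= nQ.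
by have [Px|nPx] := pselect (P x); [right => P'x; apply: nQ; exact: PQ|left].
Qed.

Lemma measurable_preimage_between d (T : measurableType d) (R : realType) (f : T -> R) (a b : R) :
  measurable_fun setT f -> measurable [set x | a < f x < b].
Proof.
move=> mf; rewrite (_ : [set x | _] = f @^-1` `]a, b[%classic).
  by rewrite -[X in measurable X]setTI; exact: mf.
by apply/seteqP; split => x /=; rewrite in_itv.
Qed.

Lemma measurable_snd_set d1 d2 (T1 : measurableType d1) (T2 : measurableType d2) (A : set T2) :
  measurable A -> measurable [set z : T1 * T2 | A z.2].
Proof.
move=> mA; rewrite (_ : [set z | _] = setT `*` A); first exact: measurableX.
by apply/seteqP; split => z //= [].
Qed.

Section square_norm.
Context d (T : measurableType d) (R : realType) (mu : {measure set T -> \bar R}).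
Implicit Types (D : set T) (f g : T -> R).
Local Open Scope ereal_scope.

(** Squared L^2 norm over [D]. It stays in the extended reals, so that bounds can be chained before
    finiteness is known; on a strip it unfolds to [sqr_norm]. *)
Definition n2 D f : \bar R := \int[mu]_(x in D) (f x ^+ 2)%:E.

Arguments n2 D%_classic f%_R.

Lemma n2_ge0 D f : 0 <= n2 D f.
Proof. by apply: integral_ge0 => x _; rewrite lee_fin sqr_ge0. Qed.

Lemma measurable_sqrE D f : measurable_fun D f ->
  measurable_fun D (fun x => (f x ^+ 2)%:E).
Proof. by move=> mf; apply/measurable_EFinP; exact: measurable_funX. Qed.

Lemma eq_n2 D f g : (forall x, D x -> f x = g x) -> n2 D f = n2 D g.
Proof. by move=> fg; apply: eq_integral => x /[!inE] Dx; rewrite fg. Qed.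

Lemma integral_lin D f g (a b : R) : measurable D ->
  measurable_fun D f -> measurable_fun D g ->
  (forall x, D x -> (0 <= f x)%R) -> (forall x, D x -> (0 <= g x)%R) ->
  (0 <= a)%R -> (0 <= b)%R ->
  \int[mu]_(x in D) (a * f x + b * g x)%:E =
  a%:E * (\int[mu]_(x in D) (f x)%:E) + b%:E * (\int[mu]_(x in D) (g x)%:E).
Proof.
move=> mD mf mg f0 g0 a0 b0.
have Ef : measurable_fun D (fun x => (f x)%:E) by exact/measurable_EFinP.
have Eg : measurable_fun D (fun x => (g x)%:E) by exact/measurable_EFinP.
rewrite -(ge0_integralZl_EFin mu mD _ Ef a0)//.
rewrite -(ge0_integralZl_EFin mu mD _ Eg b0)//.
rewrite -ge0_integralD//.
- by move=> x Dx; rewrite -EFinM lee_fin mulr_ge0// f0.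
- by apply/measurable_EFinP; apply: measurable_funM => //; exact: measurable_cst.
- by move=> x Dx; rewrite -EFinM lee_fin mulr_ge0// g0.
- by apply/measurable_EFinP; apply: measurable_funM => //; exact: measurable_cst.
Qed.

Lemma le_n2 D f g : measurable D -> measurable_fun D f -> measurable_fun D g ->
  (forall x, D x -> (f x ^+ 2 <= g x ^+ 2)%R) -> n2 D f <= n2 D g.
Proof.
move=> mD mf mg fg; apply: ge0_le_integral => //; do ?exact: measurable_sqrE.
by move=> x _; rewrite lee_fin sqr_ge0.
Qed.

Lemma n2_lin_le D f g (h : T -> R) (a b : R) : measurable D ->
  measurable_fun D f -> measurable_fun D g -> measurable_fun D h ->
  (0 <= a)%R -> (0 <= b)%R ->
  (forall x, D x -> (h x ^+ 2 <= a * f x ^+ 2 + b * g x ^+ 2)%R) ->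
  n2 D h <= a%:E * n2 D f + b%:E * n2 D g.
Proof.
move=> mD mf mg mh a0 b0 H; rewrite /n2 -integral_lin//.
- apply: ge0_le_integral => //.
  + by move=> x _; rewrite lee_fin sqr_ge0.
  + exact: measurable_sqrE.
  + apply/measurable_EFinP; apply: measurable_funD; apply: measurable_funM => //;
      exact: measurable_funX.
- exact: measurable_funX.
- exact: measurable_funX.
- by move=> x _; exact: sqr_ge0.
- by move=> x _; exact: sqr_ge0.
Qed.

(** Young's inequality 2fg <= e f^2 + g^2 / e. Keeping [e] free lets the factor in front of [f] tend
    to 1, so that sharp constants survive small perturbations. *)
Lemma n2D_le D f g (e : R) : (0 < e)%R -> measurable D ->
  measurable_fun D f -> measurable_fun D g ->
  n2 D (f \+ g) <= (1 + e)%:E * n2 D f + (1 + e^-1)%:E * n2 D g.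
Proof.
move=> e0 mD mf mg; have ei0 : (0 < e^-1)%R by rewrite invr_gt0.
apply: n2_lin_le => //; [exact: measurable_funD|lra|lra|].
move=> x _ /=; have : (0 <= e^-1 * (e * f x - g x) ^+ 2)%R.
  by rewrite mulr_ge0 ?sqr_ge0// ltW.
have -> : (e^-1 * (e * f x - g x) ^+ 2 =
   e * f x ^+ 2 - 2 * f x * g x + e^-1 * g x ^+ 2)%R.
  by field; rewrite gt_eqF.
nra.
Qed.

Lemma n2D_le2 D f g : measurable D ->
  measurable_fun D f -> measurable_fun D g ->
  n2 D (f \+ g) <= 2%:E * (n2 D f + n2 D g).
Proof.
move=> mD mf mg; apply: le_trans (n2D_le ltr01 mD mf mg) _.
by rewrite invr1 (@ge0_muleDr _ 2%:E (n2 D f) (n2 D g)) ?n2_ge0.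
Qed.

Lemma n2N D f : n2 D (\- f) = n2 D f.
Proof. by apply: eq_integral => x _ /=; rewrite sqrrN. Qed.

Lemma n2B_le2 D f g : measurable D ->
  measurable_fun D f -> measurable_fun D g ->
  n2 D (f \- g) <= 2%:E * (n2 D f + n2 D g).
Proof.
move=> mD mf mg; apply: le_trans (n2D_le2 mD mf (measurable_funN mg)) _.
by rewrite n2N.
Qed.

Lemma n2BC D f g : n2 D (f \- g) = n2 D (g \- f).
Proof. by apply: eq_integral => x _ /=; rewrite -sqrrN opprB. Qed.

Lemma n2Z D f (k : R) : measurable D -> measurable_fun D f ->
  n2 D (fun x => k * f x)%R = (k ^+ 2)%:E * n2 D f.
Proof.
move=> mD mf; rewrite /n2 -ge0_integralZl_EFin ?sqr_ge0//.
- by apply: eq_integral => x _; rewrite exprMn EFinM.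
- by move=> x _; rewrite lee_fin sqr_ge0.
- exact: measurable_sqrE.
Qed.

Lemma n2_fin D f : n2 D f < +oo -> n2 D f = (fine (n2 D f))%:E.
Proof. by move=> h; rewrite fineK// ge0_fin_numE// n2_ge0. Qed.

Lemma n2D_lty D f g : measurable D ->
  measurable_fun D f -> measurable_fun D g ->
  n2 D f < +oo -> n2 D g < +oo -> n2 D (f \+ g) < +oo.
Proof.
move=> mD mf mg Hf Hg; apply: le_lt_trans (n2D_le2 mD mf mg) _.
by rewrite lte_mul_pinfty ?lee_fin// lte_add_pinfty.
Qed.

Lemma n2B_lty D f g : measurable D ->
  measurable_fun D f -> measurable_fun D g ->
  n2 D f < +oo -> n2 D g < +oo -> n2 D (f \- g) < +oo.
Proof.
move=> mD mf mg Hf Hg; apply: le_lt_trans (n2B_le2 mD mf mg) _.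
by rewrite lte_mul_pinfty ?lee_fin// lte_add_pinfty.
Qed.

(** Mean square limits inherit bounds without loss: f = F n + (f - F n), and Young's inequality with
    parameter e costs only a factor 1 + e on the first term. *)
Lemma n2_limit_le D (F : nat -> T -> R) f (C : R) : measurable D ->
  (forall n, measurable_fun D (F n)) -> measurable_fun D f ->
  (fun n => n2 D (F n \- f)) @ \oo --> 0 ->
  (forall e : R, (0 < e)%R -> exists N, forall n, (N <= n)%N ->
     n2 D (F n) <= (C + e)%:E) ->
  n2 D f <= C%:E.
Proof.
move=> mD mF mf cF HC.
have /cvge0P c0 := cF; have {}c0 := c0 (fun n => n2_ge0 _ _).
have C0 : (0 <= C)%R.
  apply/ler_addgt0Pr => e e0; have [N HN] := HC e e0.
  by rewrite -lee_fin; apply: le_trans (HN N _); rewrite ?n2_ge0.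
(* For e <= 1 the total (1 + e)(C + e) + e^2 + e is at most C + (C + 4) e. *)
apply: (@lee_add_epsilon _ _ _ (C + 4)); first by rewrite lee_fin; lra.
move=> e e0; wlog e1 : e e0 / (e <= 1)%R.
  move=> W; have [e1|e1] := leP e 1%R; first exact: W.
  apply: le_trans (W 1%R _ _) _ => //.
  rewrite -!EFinD lee_fin; nra.
have [N HN] := HC e e0.
(* The error is taken below e^2 because Young's inequality multiplies it by 1 + 1/e. *)
have [M HM] := c0 (e ^+ 2)%R (exprn_gt0 _ e0).
set n := maxn N M.
have := @n2D_le D (F n) (f \- F n)%R e e0 mD (mF n) (measurable_funB mf (mF n)).
rewrite (@eq_n2 _ _ f); last by move=> x _ /=; rewrite addrC subrK.
move=> /le_trans; apply; rewrite n2BC.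
have A1 : (1 + e)%:E * n2 D (F n) <= (1 + e)%:E * (C + e)%:E.
  by rewrite lee_pmul2l ?lte_fin ?fin_numE//; [apply: HN; exact: leq_maxl|lra].
have A2 : (1 + e^-1)%:E * n2 D (F n \- f) <= (1 + e^-1)%:E * (e ^+ 2)%:E.
  rewrite lee_pmul2l ?lte_fin ?fin_numE//; first by apply: HM; exact: leq_maxr.
  by rewrite addr_gt0// invr_gt0.
apply: le_trans (leeD A1 A2) _; rewrite -!EFinM -!EFinD lee_fin.
have -> : ((1 + e^-1) * e ^+ 2 = e ^+ 2 + e)%R by field; rewrite gt_eqF.
nra.
Qed.

Lemma integral_abs_mul_le D f g (e : R) : (0 < e)%R -> measurable D ->
  measurable_fun D f -> measurable_fun D g ->
  \int[mu]_(x in D) (`|f x * g x|)%:E <= e%:E * n2 D f + e^-1%:E * n2 D g.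
Proof.
move=> e0 mD mf mg; have ei0 : (0 < e^-1)%R by rewrite invr_gt0.
rewrite /n2 -integral_lin//; [|exact: measurable_funX|exact: measurable_funX|
  by move=> x _; exact: sqr_ge0|by move=> x _; exact: sqr_ge0|exact: ltW|
  exact: ltW].
apply: ge0_le_integral => //.
- apply/measurable_EFinP; apply: measurableT_comp => //.
  exact: measurable_funM.
- apply/measurable_EFinP; apply: measurable_funD; apply: measurable_funM => //;
    exact: measurable_funX.
- move=> x _; rewrite lee_fin normrM -(real_normK (num_real (f x))).
  rewrite -(real_normK (num_real (g x))).
  have : (0 <= e^-1 * (e * `|f x| - `|g x|) ^+ 2)%R.
    by rewrite mulr_ge0 ?sqr_ge0// ltW.
  have -> : (e^-1 * (e * `|f x| - `|g x|) ^+ 2 =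
    e * `|f x| ^+ 2 - 2 * `|f x| * `|g x| + e^-1 * `|g x| ^+ 2)%R.
    by field; rewrite gt_eqF.
  have := normr_ge0 (f x); have := normr_ge0 (g x); nra.
Qed.

Lemma integrable_mul D f g : measurable D ->
  measurable_fun D f -> measurable_fun D g ->
  n2 D f < +oo -> n2 D g < +oo -> mu.-integrable D (fun x => (f x * g x)%:E).
Proof.
move=> mD mf mg Hf Hg; apply/integrableP; split.
  by apply/measurable_EFinP; exact: measurable_funM.
apply: le_lt_trans (integral_abs_mul_le ltr01 mD mf mg) _.
by rewrite invr1 !mul1e lte_add_pinfty.
Qed.

Lemma integral_mul_cvg D (F : nat -> T -> R) f g : measurable D ->
  (forall n, measurable_fun D (F n)) -> measurable_fun D f ->
  measurable_fun D g -> n2 D f < +oo -> n2 D g < +oo ->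
  (forall n, n2 D (F n) < +oo) ->
  (fun n => n2 D (F n \- f)) @ \oo --> 0 ->
  (fun n => \int[mu]_(x in D) (F n x * g x)%:E) @ \oo -->
    \int[mu]_(x in D) (f x * g x)%:E.
Proof.
move=> mD mF mf mg Hf Hg HF cF.
have If := integrable_mul mD mf mg Hf Hg.
have IF n := integrable_mul mD (mF n) mg (HF n) Hg.
apply/sube_cvg0; first exact: integrable_fin_num.
apply/cvg_abse0P; apply/cvge0P; first by move=> n; exact: abse_ge0.
move=> e e0; have /cvge0P c0 := cF; have {}c0 := c0 (fun n => n2_ge0 _ _).
set G := fine (n2 D g); have G0 : (0 <= G)%R by exact/fine_ge0/n2_ge0.
(* Weight of Young's inequality: the fixed factor [g] is divided by [k], hence contributes at most
   e/2, and the error of [F n] is then taken below e / (2k). *)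
set k := ((2 * (G + 1)) / e)%R.
have k0 : (0 < k)%R by rewrite divr_gt0// mulr_gt0//; lra.
have ek0 : (0 < e / 2 / k)%R by apply: divr_gt0 => //; exact: divr_gt0.
have [N HN] := c0 _ ek0.
exists N => n /HN {}HN /=.
rewrite -integralB//; apply: le_trans (le_abse_integral _ _ _) _ => //.
  by apply: measurable_int; exact: integrableB.
under eq_integral => x _ do rewrite /= -mulrBl.
apply: le_trans (@integral_abs_mul_le D (F n \- f)%R g k k0 mD _ mg) _.
  exact: measurable_funB.
apply: (@le_trans _ _ (k%:E * (e / 2 / k)%:E + k^-1%:E * G%:E)).
  rewrite leeD//; first by rewrite lee_pmul2l ?lte_fin ?fin_numE.
  by rewrite /G fineK// ge0_fin_numE ?n2_ge0.
rewrite -!EFinM -EFinD lee_fin.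
have -> : (k * (e / 2 / k) = e / 2)%R by field; rewrite gt_eqF.
have -> : (k^-1 * G = e / 2 * (G / (G + 1)))%R.
  by rewrite /k; field; rewrite !gt_eqF//; lra.
have : (G / (G + 1) <= 1)%R by rewrite ler_pdivrMr//; lra.
nra.
Qed.

End square_norm.

Section square_norm_complete.
Context d (T : measurableType d) (R : realType) (mu : {measure set T -> \bar R}).
Local Open Scope ereal_scope.

Lemma integral_nneseries_lty D (h : nat -> T -> R) : measurable D ->
  (forall k, measurable_fun D (h k)) -> (forall k x, (0 <= h k x)%R) ->
  \sum_(0 <= k <oo) \int[mu]_(x in D) (h k x)%:E < +oo ->
  {ae mu, forall x, D x -> cvgn (series (h^~ x))}.
Proof.
move=> mD mh h0; rewrite -integral_nneseries//; last 2 first.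
- by move=> k; exact/measurable_EFinP.
- by move=> k x _; rewrite lee_fin.
move=> Hoo.
have : mu.-integrable D (fun x => \sum_(0 <= k <oo) (h k x)%:E).
  apply/integrableP; split.
    apply: ge0_emeasurable_sum => //; last by move=> k _; exact/measurable_EFinP.
    by move=> k x _ _; rewrite lee_fin.
  under eq_integral => x _.
    rewrite gee0_abs; last by apply: nneseries_ge0 => *; rewrite lee_fin.
    over.
  by [].
move/(integrable_ae mD); apply: filterS => x Hx Dx.
apply: nnseries_is_cvg => //.
by have := Hx Dx; rewrite ge0_fin_numE// nneseries_ge0// => *; rewrite lee_fin.
Qed.

(** Along indices where the integrals are below 2^-(k+1) the terms have a finite sum almost
    everywhere, hence tend to 0. [phi] is only asked to dominate the identity, which is enough to
    carry over any limit already known. *)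
Lemma integral_cvg0_subseq D (h : nat -> T -> R) : measurable D ->
  (forall k, measurable_fun D (h k)) -> (forall k x, (0 <= h k x)%R) ->
  (fun n => \int[mu]_(x in D) (h n x)%:E) @ \oo --> 0 ->
  exists2 phi : nat -> nat, (forall n, (n <= phi n)%N) &
    {ae mu, forall x, D x -> (fun n => h (phi n) x) @ \oo --> 0%R}.
Proof.
move=> mD mh h0 /cvge0P H.
have {}H := H (fun n => integral_ge0 mu (fun x _ => _ : 0 <= (h n x)%:E)).
have /choice[phi0 Hphi] : forall k : nat, exists N, forall n, (N <= n)%N ->
    \int[mu]_(x in D) (h n x)%:E <= ((2 ^+ k.+1)^-1)%:E.
  by move=> k; apply: H => [n x|]; rewrite ?lee_fin// invr_gt0 exprn_gt0.
exists (fun k => maxn k (phi0 k)); first by move=> n; exact: leq_maxl.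
have := @integral_nneseries_lty D (fun k => h (maxn k (phi0 k))) mD
  (fun k => mh _) (fun k => h0 _).
move=> W; have {W} : {ae mu, forall x, D x -> cvgn (series
    (fun k => h (maxn k (phi0 k)) x))}.
  apply: W; apply: (@le_lt_trans _ _ 1); last by rewrite ltry.
  rewrite -(@nneseries_geometric_half R); apply: lee_nneseries.
    by move=> k _ _; apply: integral_ge0 => x _; rewrite lee_fin.
  by move=> k _; apply: Hphi; exact: leq_maxr.
by apply: filterS => x Hx Dx; apply: cvg_series_cvg_0; exact: Hx.
Qed.

(** Riesz-Fischer: a fast subsequence converges almost everywhere, and Fatou's lemma turns the
    Cauchy bound into a bound on the distance to its limit. *)
Lemma n2_complete D (F : nat -> T -> R) : measurable D ->
  (forall n, measurable_fun D (F n)) ->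
  (forall e : R, (0 < e)%R -> exists N, forall n m, (N <= n)%N -> (N <= m)%N ->
     n2 mu D (F n \- F m)%R <= e%:E) ->
  exists2 f, measurable_fun D f & (fun n => n2 mu D (F n \- f)%R) @ \oo --> 0.
Proof.
move=> mD mF cF.
have /choice[N0 HN0] : forall k : nat, exists N, forall n m, (N <= n)%N ->
    (N <= m)%N -> n2 mu D (F n \- F m)%R <= ((8 ^+ k.+1)^-1)%:E.
  by move=> k; apply: cF; rewrite invr_gt0 exprn_gt0.
pose phi k := (k + \sum_(i < k.+1) N0 i)%N.
have phi_ge k : (N0 k <= phi k)%N by rewrite /phi big_ord_recr/= addnA leq_addl.
have phiS k : (phi k <= phi k.+1)%N by rewrite /phi leq_add// [leqRHS]big_ord_recr leq_addr.
pose g k := F (phi k).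
(* The weight 2^(k+1) passes from squares to absolute values: |t| <= 2^(k+1) t^2 + 2^-(k+1) makes
   the increments absolutely summable, while the bound 8^-(k+1) leaves the integral of [h k] below
   2^-(k+1). *)
pose h k x := (2 ^+ k.+1 * (g k.+1 x - g k x) ^+ 2)%R.
have mg k : measurable_fun D (g k) by exact: mF.
have h0 k x : (0 <= h k x)%R by rewrite mulr_ge0 ?sqr_ge0// exprn_ge0.
have mh k : measurable_fun D (h k).
  apply: measurable_funM; first exact: measurable_cst.
  by apply: measurable_funX; exact: measurable_funB.
have Ih : \sum_(0 <= k <oo) \int[mu]_(x in D) (h k x)%:E < +oo.
  apply: (@le_lt_trans _ _ 1); last by rewrite ltry.
  rewrite -(@nneseries_geometric_half R); apply: lee_nneseries.
    by move=> k _ _; apply: integral_ge0 => x _; rewrite lee_fin.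
  move=> k _.
  have -> : \int[mu]_(x in D) (h k x)%:E =
      (2 ^+ k.+1)%:E * n2 mu D (g k.+1 \- g k)%R.
    rewrite /n2 -ge0_integralZl_EFin ?exprn_ge0//.
    - by move=> x _; rewrite lee_fin sqr_ge0.
    - by apply: measurable_sqrE; exact: measurable_funB.
  apply: (@le_trans _ _ ((2 ^+ k.+1)%:E * ((8 ^+ k.+1)^-1)%:E)).
    rewrite lee_pmul2l ?lte_fin ?exprn_gt0//; apply: HN0; last exact: phi_ge.
    exact: leq_trans (phi_ge k) (phiS k).
  rewrite -EFinM lee_fin -exprVn -exprMn -exprVn lerXn2r ?nnegrE//; lra.
have {Ih} cvgh := integral_nneseries_lty mD mh h0 Ih.
have cvgg : {ae mu, forall x, D x -> cvgn (g^~ x)}.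
  apply: filterS cvgh => x Hx Dx.
  have cs : cvgn (series (fun k => g k.+1 x - g k x)%R).
    apply: normed_cvg.
    apply: (@series_le_cvg _ _ (fun k => h k x + (2 ^+ k.+1)^-1)%R).
    - by move=> k; exact: normr_ge0.
    - by move=> k; rewrite addr_ge0// invr_ge0 exprn_ge0.
    - move=> k; rewrite /h; set t := (g k.+1 x - g k x)%R.
      rewrite -(real_normK (num_real t)).
      set c : R := (2 ^+ k.+1)%R; have c0 : (0 < c)%R by exact: exprn_gt0.
      have : (0 <= c^-1 * (c * `|t| - 2^-1) ^+ 2)%R.
        by rewrite mulr_ge0 ?sqr_ge0// invr_ge0 ltW.
      have -> : (c^-1 * (c * `|t| - 2^-1) ^+ 2 =
          c * `|t| ^+ 2 - `|t| + c^-1 / 4)%R by field; rewrite gt_eqF.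
      have : (0 < c^-1)%R by rewrite invr_gt0.
      by rewrite /= -/t; lra.
    - have -> : (series (fun k => h k x + (2 ^+ k.+1)^-1)%R =
          series (h^~ x) \+ series (geometric 2^-1 2^-1))%R.
        apply/funext => n /=; rewrite /series/= -big_split/=.
        by apply: eq_bigr => k _; rewrite exprVn exprS invfM.
      apply: is_cvgD; first exact: Hx.
      apply: is_cvg_geometric_series; rewrite ger0_norm ?invr_ge0//.
      by rewrite invf_lt1// ltr1n.
  have -> : g^~ x = (fun n => g 0%N x + series (fun k => g k.+1 x - g k x) n)%R.
    apply/funext => n; rewrite /series/= telescope_sumr// addrC subrK//.
  by apply: is_cvgD => //; exact: is_cvg_cst.
(* An upper limit, so that [f] is measurable without regard to the points where the subsequence
   diverges. *)
pose f x := fine (limn_esup (fun k => (g k x)%:E)).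
have mf : measurable_fun D f.
  apply: measurableT_comp; first exact: fine_measurable.
  by apply: measurable_fun_limn_esup => k; exact/measurable_EFinP.
have gf : {ae mu, forall x, D x -> (g^~ x) @ \oo --> f x}.
  apply: filterS cvgg => x Hx Dx; have {}Hx := Hx Dx.
  rewrite /f; have : (fun k => (g k x)%:E) @ \oo --> (limn (g^~ x))%:E.
    by apply: cvg_EFin; [exact: nearW|exact: Hx].
  by move/cvg_limn_einf_sup => [_ ->].
exists f => //; apply/cvge0P; first by move=> n; exact: n2_ge0.
move=> e e0; have [N HN] := cF e e0; exists N => n Nn.
have -> : n2 mu D (F n \- f)%R =
    \int[mu]_(x in D) limn_einf (fun k => ((F n x - g k x) ^+ 2)%:E).
  apply: ge0_ae_eq_integral => //.
  - by apply: measurable_sqrE; exact: measurable_funB.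
  - rewrite (_ : (fun x => limn_einf _) = (fun x => - limn_esup
      (fun k => - ((F n x - g k x) ^+ 2)%:E))); last first.
      by apply/funext => x; rewrite -limn_einfN; congr limn_einf;
        apply/funext => k; rewrite /comp oppeK.
    apply: measurableT_comp => //; apply: measurable_fun_limn_esup => k.
    by apply: measurableT_comp => //; apply: measurable_sqrE;
      exact: measurable_funB.
  - by move=> x _; rewrite lee_fin sqr_ge0.
  - move=> x _; rewrite limn_einf_lim; apply: lime_ge; first exact: is_cvg_einfs.
    by apply: nearW => k; apply: le_ereal_inf_tmp => _ [m _ <-];
      rewrite lee_fin sqr_ge0.
  - apply: filterS gf => x Hx Dx; have {}Hx := Hx Dx.
    have : (fun k => ((F n x - g k x) ^+ 2)%:E) @ \oo --> ((F n x - f x) ^+ 2)%:E.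
      apply: cvg_EFin; first exact: nearW.
      under eq_fun do rewrite /= expr2.
      by rewrite expr2; apply: cvgM; apply: cvgB => //; exact: cvg_cst.
    by move/cvg_limn_einf_sup => [-> _].
apply: le_trans (fatou _ mD _ _) _.
- by move=> k; apply: measurable_sqrE; exact: measurable_funB.
- by move=> k x _; rewrite lee_fin sqr_ge0.
rewrite limn_einf_lim; apply: lime_le; first exact: is_cvg_einfs.
apply: nearW => k; apply: (@le_trans _ _ (n2 mu D (F n \- g (maxn k N))%R)).
  by apply: ereal_inf_lbound; exists (maxn k N) => //=; exact: leq_maxl.
apply: HN => //; apply: leq_trans (leq_maxr k N) _.
exact: leq_addr.
Qed.

End square_norm_complete.

(** * Invariance of Lebesgue measure *)

Section lebesgue_affine.
Context {R : realType}.
Local Open Scope ereal_scope.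
Local Notation lam := (@lebesgue_measure R).

Lemma measurable_affine (c a : R) :
  measurable_fun [set: measurableTypeR R] (fun x => c * x + a : measurableTypeR R)%R.
Proof.
apply: measurable_funD; last exact: measurable_cst.
by apply: measurable_funM; [exact: measurable_cst|exact: measurable_id].
Qed.

(** Both sides are measures in [A] that agree on half-open intervals, which characterises Lebesgue
    measure. *)
Lemma lebesgue_measure_affine (c a : R) (A : set R) : (0 < c)%R ->
  measurable A -> c%:E * lam ((fun x => c * x + a)%R @^-1` A) = lam A.
Proof.
move=> c0 mA; pose cn : {nonneg R} := NngNum (ltW c0).
pose phi (x : measurableTypeR R) : measurableTypeR R := (c * x + a)%R.
have mphi : measurable_fun setT phi := measurable_affine c a.
pose push := [the measure _ _ of pushforward lam phi].
pose mu := mscale cn (push mphi).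
rewrite -[LHS]/(mu A); apply/esym.
apply: (@lebesgue_measure_unique R [the measure _ _ of mu]) => // X [[u v] _ <-] /=.
rewrite /mscale/= /pushforward lebesgue_measure_itv /=.
have -> : phi @^-1` `]u, v]%classic = `]((u - a) / c)%R, ((v - a) / c)%R]%classic.
  apply/seteqP; split => x /=; rewrite !in_itv /= /phi => /andP[h1 h2];
    rewrite ?ltr_pdivrMr ?ler_pdivlMr// in h1 h2 *; apply/andP; split; lra.
rewrite lebesgue_measure_itv /= !lte_fin ltr_pM2r ?invr_gt0// ltrD2r.
case: ifPn => uv; last by rewrite mule0.
by rewrite -!EFinD -EFinM; congr EFin; field; rewrite gt_eqF.
Qed.

Lemma ge0_integral_affine (c a : R) (f : R -> \bar R) : (0 < c)%R ->
  measurable_fun setT f -> (forall x, 0 <= f x) ->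
  c%:E * \int[lam]_x f (c * x + a)%R = \int[lam]_x f x.
Proof.
move=> c0 mf f0; pose cn : {nonneg R} := NngNum (ltW c0).
pose phi (x : measurableTypeR R) : measurableTypeR R := (c * x + a)%R.
have mphi : measurable_fun setT phi := measurable_affine c a.
have mpf : measurable_fun setT (f \o phi) by exact: measurableT_comp.
pose push := [the measure _ _ of pushforward lam phi]; pose mu := push mphi.
have -> : \int[lam]_x f x = \int[[the measure _ _ of mscale cn mu]]_x f x.
  by apply: eq_measure_integral => A mA _; exact/esym/lebesgue_measure_affine.
rewrite ge0_integral_mscale//; congr (_ * _).
by rewrite ge0_integral_pushforward.
Qed.

Lemma ge0_integral_opp (f : R -> \bar R) :
  measurable_fun setT f -> (forall x, 0 <= f x) ->
  \int[lam]_x f (- x)%R = \int[lam]_x f x.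
Proof.
move=> mf f0.
pose phi (x : measurableTypeR R) : measurableTypeR R := (- x)%R.
have mphi : measurable_fun setT phi by exact: oppr_measurable.
have mpf : measurable_fun setT (f \o phi) by exact: measurableT_comp.
pose push := [the measure _ _ of pushforward lam phi]; pose mu := push mphi.
have -> : \int[lam]_x f x = \int[mu]_x f x.
  by apply: eq_measure_integral => A mA _; exact/esym/lebesgue_measureN.
by rewrite ge0_integral_pushforward.
Qed.

End lebesgue_affine.

Section strip_invariance.
Context {R : realType}.
Local Open Scope ereal_scope.
Local Notation lam := (@lebesgue_measure R).

Lemma measurable_rV_translate n (w : 'rV[R]_n) :
  measurable_fun setT (fun v : 'rV[R]_n => v + w)%R.
Proof.
apply: measurable_fun_rVP => i.
rewrite (_ : _ \o _ = (fun v => rV_coor i v + w ord0 i)%R).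
  apply: measurable_funD; first exact: measurable_rV_coor.
  exact: measurable_cst.
by apply/funext => v; rewrite /rV_coor/= mxE.
Qed.

(** Induction on the dimension along the recursive construction of [lebesgue_rV]: Tonelli separates
    the first coordinate, whose translation is the one-dimensional case. *)
Lemma ge0_integral_rV_translate n (w : 'rV[R]_n) (f : 'rV[R]_n -> \bar R) :
  measurable_fun setT f -> (forall v, 0 <= f v) ->
  \int[lebesgue_rV R n]_v f (v + w)%R = \int[lebesgue_rV R n]_v f v.
Proof.
elim: n w f => [|n IH] w f mf f0.
  by apply: eq_integral => v _; congr f; apply/matrixP => i [].
have mft : measurable_fun setT (fun v : 'rV[R]_n.+1 => f (v + w)%R).
  by apply: measurableT_comp => //; exact: measurable_rV_translate.
have unconsE (g : 'rV[R]_n.+1 -> \bar R) : measurable_fun setT g ->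
    (forall v, 0 <= g v) -> \int[lebesgue_rV R n.+1]_v g v =
    \int[lam \x lebesgue_rV R n]_p g (rV_cons p).
  move=> mg g0; have mc : measurable_fun [set: measurableTypeR R * 'rV[R]_n]
    (@rV_cons R n) by exact: measurable_rV_cons.
  pose push := [the measure _ _ of pushforward
    (lam \x lebesgue_rV R n) (@rV_cons R n)].
  transitivity (\int[push mc]_v g v).
    exact: eq_measure_integral.
  by rewrite (ge0_integral_pushforward mc _ measurableT mg).
rewrite !unconsE//.
have mfc := measurableT_comp mf (@measurable_rV_cons R n).
have mfct := measurableT_comp mft (@measurable_rV_cons R n).
transitivity (\int[lam]_x fubini_F (lebesgue_rV R n) (fun p : measurableTypeR R * 'rV[R]_n => f (rV_cons p + w)%R) x).
  exact: (@fubini_tonelli1 _ _ (measurableTypeR R) 'rV[R]_n R lam (lebesgue_rV R n) _ mfct (fun p => f0 _)).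
transitivity (\int[lam]_x fubini_F (lebesgue_rV R n) (fun p : measurableTypeR R * 'rV[R]_n => f (rV_cons p)) x); last first.
  exact: esym (@fubini_tonelli1 _ _ (measurableTypeR R) 'rV[R]_n R lam (lebesgue_rV R n) _ mfc (fun p => f0 _)).
pose w1 := (rV_uncons w).1; pose w2 := (rV_uncons w).2.
rewrite -[RHS](@ge0_integral_affine R 1 w1)//; last 2 first.
- exact: measurable_fun_fubini_tonelli_F.
- by move=> x; exact: integral_ge0.
rewrite mul1e; apply: eq_integral => a _; rewrite mul1r.
rewrite /fubini_F -[RHS](IH w2)//; last first.
  by apply: (measurableT_comp mfc); exact: pair1_measurable.
apply: eq_integral => v _ /=; congr f; apply/rowP => i.
rewrite mxE; case: (unliftP ord0 i) => [j ->|->].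
  by rewrite !rV_cons_lift /= !mxE; congr (_ + w _ _)%R; exact/val_inj.
by rewrite !rV_cons_ord0.
Qed.

Context {N : nat}.
Local Notation Z := ('rV[R]_N * measurableTypeR R)%type.
Local Notation strip_measure := (@lebesgue_strip R N).

Lemma measurable_strip_map (w : 'rV[R]_N) (c a : R) :
  measurable_fun [set: Z] (fun z : Z => (z.1 + w, c * z.2 + a)%R : Z).
Proof.
apply: measurable_fun_pair.
  exact: measurableT_comp (measurable_rV_translate w) measurable_fst.
exact: measurableT_comp (measurable_affine c a) measurable_snd.
Qed.

Lemma integral_strip_iterated (f : Z -> \bar R) :
  measurable_fun setT f -> (forall z, 0 <= f z) ->
  \int[strip_measure]_z f z = \int[lebesgue_rV R N]_x \int[lam]_y f (x, y).
Proof. by move=> mf f0; rewrite /lebesgue_strip fubini_tonelli1. Qed.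

(** Tonelli, with a translation in x and an affine change of variable in y. The factor [c] is the
    Jacobian: c = 1 gives the translations, other values the dilations in y. *)
Lemma ge0_integral_strip_map (w : 'rV[R]_N) (c a : R) (f : Z -> \bar R) :
  (0 < c)%R -> measurable_fun setT f -> (forall z, 0 <= f z) ->
  c%:E * \int[strip_measure]_z f (z.1 + w, c * z.2 + a)%R =
  \int[strip_measure]_z f z.
Proof.
move=> c0 mf f0.
have mfm := measurableT_comp mf (measurable_strip_map w c a).
rewrite !integral_strip_iterated// -ge0_integralZl_EFin ?ltW//; last 2 first.
- by move=> x _; exact: integral_ge0.
- exact: measurable_fun_fubini_tonelli_F mfm (fun=> f0 _).
have mF := @measurable_fun_fubini_tonelli_F _ _ _ _ _ lam f mf f0.
rewrite -[RHS](@ge0_integral_rV_translate N w)//; last first.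
  by move=> x; exact: integral_ge0.
apply: eq_integral => x _ /=.
rewrite (ge0_integral_affine a c0 (f := fun y => f (x + w, y)%R))//.
by apply: (measurableT_comp mf); exact: pair1_measurable.
Qed.

Lemma ge0_integral_strip_translate (w : 'rV[R]_N * R) (f : Z -> \bar R) :
  measurable_fun setT f -> (forall z, 0 <= f z) ->
  \int[strip_measure]_z f (z + w)%R = \int[strip_measure]_z f z.
Proof.
move=> mf f0; rewrite -(ge0_integral_strip_map w.1 w.2 ltr01 mf f0) mul1e.
by apply: eq_integral => z _; rewrite mul1r.
Qed.

Lemma ge0_integral_strip_opp (f : Z -> \bar R) :
  measurable_fun setT f -> (forall z, 0 <= f z) ->
  \int[strip_measure]_z f (z.1, - z.2)%R = \int[strip_measure]_z f z.
Proof.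
move=> mf f0; have mo : measurable_fun setT (fun z : Z => f (z.1, - z.2)%R).
  apply: (measurableT_comp mf); apply: measurable_fun_pair => //.
  by apply: measurableT_comp => //; exact: oppr_measurable.
rewrite (integral_strip_iterated mo (fun z => f0 _)) (integral_strip_iterated mf f0).
apply: eq_integral => x _ /=.
rewrite (ge0_integral_opp (f := fun y => f (x, y)))//.
by apply: (measurableT_comp mf); exact: pair1_measurable.
Qed.

Lemma integral_strip_translate (w : 'rV[R]_N * R) (f : Z -> \bar R) :
  measurable_fun setT f ->
  \int[strip_measure]_z f (z + w)%R = \int[strip_measure]_z f z.
Proof.
move=> mf; rewrite integralE [RHS]integralE; congr (_ - _).
  have <- := @ge0_integral_strip_translate w (f^\+)%E
    (measurable_funepos mf) (fun=> funepos_ge0 _ _).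
  by apply: eq_integral => z _; rewrite !funeposE.
have <- := @ge0_integral_strip_translate w (f^\-)%E
  (measurable_funeneg mf) (fun=> funeneg_ge0 _ _).
by apply: eq_integral => z _; rewrite !funenegE.
Qed.

Lemma measurable_ball_strip (q : 'rV[R]_N * R) (e : R) :
  measurable (ball q e : set Z).
Proof.
have [e0|e0] := ltP 0%R e; last first.
  by rewrite (_ : ball q e = set0)// -subset0 => z [_ /=]; rewrite /ball/= => /(le_lt_trans (normr_ge0 _));
    rewrite ltNge e0.
rewrite (_ : ball q e = [set v : 'rV[R]_N | forall i, ball (q.1 ord0 i) e (v ord0 i)]
   `*` ball q.2 e).
  apply: measurableX; last exact: measurable_ball.
  apply: (@measurable_rV_box R N (fun i => ball (q.1 ord0 i) e)) => i.
  exact: measurable_ball.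
apply/seteqP; split => -[v y] [/= h1 h2]; split => //=.
  by case: h1 => _ h i; exact: h.
by split => // i j; rewrite (ord1 i); exact: h1.
Qed.

(** The sigma-algebra is generated by the coordinates, so open sets have to be recovered from it: an
    open set is the countable union of the balls of rational centre and radius 1/(n+1) that it
    contains, and balls of the sup norm are cubes. *)
Lemma open_measurable_strip (O : set ('rV[R]_N * R)) : open O ->
  measurable (O : set Z).
Proof.
move=> oO.
pose c (k : 'rV[rat]_N * rat * nat) : 'rV[R]_N * R :=
  (map_mx ratr k.1.1, ratr k.1.2).
pose r (k : 'rV[rat]_N * rat * nat) : R := (k.2.+1%:R^-1)%R.
rewrite (_ : O = \bigcup_(k in [set k | ball (c k) (r k) `<=` O]) ball (c k) (r k)).
  rewrite bigcup_mkcond; apply: countable_bigcupT_measurable => [|k].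
    exact: countableP.
  by case: ifP => _; [exact: measurable_ball_strip|exact: measurable0].
apply/seteqP; split => [z Oz|z [k /= kO]]; last exact: kO.
have /nbhs_ballP[e /= e0 eO] := open_nbhs_nbhs (conj oO Oz).
have [n ne] : exists n, (n.+1%:R^-1 < e / 2)%R.
  have e20 : (0 < e / 2)%R by rewrite divr_gt0.
  have i0 : (0 <= (e / 2)^-1)%R by rewrite invr_ge0 ltW.
  exists (Num.bound (e / 2)^-1).
  rewrite invf_plt ?posrE//; apply: lt_le_trans (archi_boundP i0) _.
  by rewrite ler_nat.
have n0 : (0 < n.+1%:R^-1 :> R)%R by rewrite invr_gt0.
have near_rat (x : R) : exists q : rat, ball (ratr q : R) n.+1%:R^-1 x.
  have [q] : exists q : rat, ratr q \in `](x - n.+1%:R^-1)%R, (x + n.+1%:R^-1)%R[.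
    apply: rat_in_itvoo; rewrite ltrD2l; apply: lt_trans n0.
    by rewrite oppr_lt0.
  by rewrite in_itv/= => qx; exists q; rewrite /ball/= distrC ltr_distlC.
have /choice[q1 Hq1] : forall i, exists q : rat, ball (ratr q : R) n.+1%:R^-1 (z.1 ord0 i).
  by move=> i; exact: near_rat.
have [q2 Hq2] := near_rat z.2.
pose k := (\row_i q1 i, q2, n).
have zk : ball (c k) (r k) z.
  by split => //; split => // i j; rewrite !mxE (ord1 i); exact: Hq1.
exists k => //= y ky; apply: eO; apply: (@ball_split _ _ (c k)).
  by apply: ball_sym; apply: le_ball zk; exact: ltW.
by apply: le_ball ky; exact: ltW.
Qed.

Lemma continuous_measurable_strip (f : 'rV[R]_N * R -> R) : continuous f ->
  measurable_fun [set: Z] f.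
Proof.
move=> /continuousP cf; apply: (measurability _ (RGenOpens.measurableE R)).
move=> _ [_ [a [b ->] <-]]; rewrite setTI.
by apply: open_measurable_strip; apply: cf; exact: interval_open.
Qed.

End strip_invariance.

(** * Smooth functions and test functions *)

Section smooth_theory.
Context {R : realType} {N : nat}.
Local Notation V := ('rV[R]_N * R)%type.
Implicit Types (f g : V -> R) (v w z : V).

Definition diff_once f := continuous f /\ forall z v, derivable f z v.

(** [smooth] differentiates along a list of directions; recursion on the order, with the innermost
    derivative taken off first, is the form in which closure properties go through by induction. *)
Fixpoint diff_times n f : Prop :=
  if n is m.+1 then diff_once f /\ forall w, diff_times m ('D_w f)
  else diff_once f.

Lemma diff_timesS n f : diff_times n.+1 f -> diff_times n f.
Proof.
elim: n f => [|n IH] f; first by case.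
by move=> [h1 h2]; split => // w; apply: IH; exact: h2.
Qed.

Lemma diff_times_once n f : diff_times n f -> diff_once f.
Proof. by case: n => [|n] // []. Qed.

Lemma smoothP f : smooth f <-> forall n, diff_times n f.
Proof.
split => [H n|H vs v].
  elim: n f H => [|n IH] f H.
    by split => [|z v]; [have [] := H [::] 0|have [] := H [::] v].
  split; first by split => [|z v]; [have [] := H [::] 0|have [] := H [::] v].
  by move=> w; apply: IH => vs v; have := H (rcons vs w) v; rewrite foldr_rcons.
elim/last_ind: vs f H v => [|vs w IH] f H v /=.
  by have [h1 h2] := H 0%N; split => // z; exact: h2.
by rewrite foldr_rcons; apply: IH => n; have [_] := H n.+1; apply.
Qed.

Lemma smooth_cont f : smooth f -> continuous f.
Proof. by move=> /smoothP /(_ 0%N) []. Qed.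

Lemma smooth_derivable f z v : smooth f -> derivable f z v.
Proof. by move=> /smoothP /(_ 0%N) [_]; exact. Qed.

Lemma smooth_D f w : smooth f -> smooth ('D_w f).
Proof. by move=> /smoothP H; apply/smoothP => n; have [_] := H n.+1; apply. Qed.

Lemma diff_once_cst (c : R) : diff_once (cst c : V -> R).
Proof.
by split => [z|z v]; [exact: cst_continuous|exact: derivable_cst].
Qed.

Lemma diff_times_cst n (c : R) : diff_times n (cst c).
Proof.
elim: n c => [|n IH] c; first exact: diff_once_cst.
split => [|w]; first exact: diff_once_cst.
rewrite (_ : 'D_w _ = cst 0); first exact: IH.
by apply/funext => z; rewrite derive_cst.
Qed.

Lemma smooth_cst (c : R) : smooth (cst c : V -> R).
Proof. by apply/smoothP => n; exact: diff_times_cst. Qed.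

Lemma diff_onceD f g : diff_once f -> diff_once g -> diff_once (f \+ g).
Proof.
move=> [cf df] [cg dg]; split => [z|z v]; first by apply: cvgD; [exact: cf|exact: cg].
exact: derivableD.
Qed.

Lemma diff_timesD n f g : diff_times n f -> diff_times n g -> diff_times n (f \+ g).
Proof.
elim: n f g => [|n IH] f g; first exact: diff_onceD.
move=> [hf Hf] [hg Hg]; split => [|w]; first exact: diff_onceD.
rewrite (_ : 'D_w _ = 'D_w f \+ 'D_w g); first exact: IH (Hf w) (Hg w).
by apply/funext => z; rewrite deriveD//; [case: hf => _; exact|case: hg => _; exact].
Qed.

Lemma smoothD f g : smooth f -> smooth g -> smooth (f \+ g).
Proof.
by move=> /smoothP hf /smoothP hg; apply/smoothP => n; exact: diff_timesD.
Qed.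

Lemma diff_onceM f g : diff_once f -> diff_once g -> diff_once (f \* g).
Proof.
move=> [cf df] [cg dg]; split => [z|z v]; first by apply: cvgM; [exact: cf|exact: cg].
exact: derivableM.
Qed.

Lemma D_mul f g w : diff_once f -> diff_once g ->
  'D_w (f \* g) = (f \* 'D_w g) \+ (g \* 'D_w f).
Proof.
by move=> [_ df] [_ dg]; apply/funext => z; rewrite (deriveM (df z w) (dg z w)).
Qed.

Lemma diff_timesM n f g : diff_times n f -> diff_times n g -> diff_times n (f \* g).
Proof.
elim: n f g => [|n IH] f g; first exact: diff_onceM.
move=> hf hg; have [of_ og] := (diff_times_once hf, diff_times_once hg).
split => [|w]; first exact: diff_onceM.
rewrite D_mul//; apply: diff_timesD; apply: IH.
- exact: diff_timesS.
- by have [_ ] := hg; apply.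
- exact: diff_timesS.
- by have [_ ] := hf; apply.
Qed.

Lemma smoothM f g : smooth f -> smooth g -> smooth (f \* g).
Proof.
by move=> /smoothP hf /smoothP hg; apply/smoothP => n; exact: diff_timesM.
Qed.

Lemma smoothZ (c : R) f : smooth f -> smooth (fun z => c * f z).
Proof. by move=> sf; exact: (smoothM (smooth_cst c) sf). Qed.

Lemma smooth_prod (I : Type) (s : seq I) (F : I -> V -> R) :
  (forall i, smooth (F i)) -> smooth (fun z => \prod_(i <- s) F i z).
Proof.
move=> sF; elim: s => [|i s IH].
  by rewrite (_ : (fun _ => _) = cst 1); [exact: smooth_cst|
    apply/funext => z; rewrite big_nil].
rewrite (_ : (fun _ => _) = F i \* (fun z => \prod_(j <- s) F j z)).
  exact: (smoothM (sF i) IH).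
by apply/funext => z; rewrite big_cons.
Qed.

(** Along a line an affine map turns the difference quotient of [f \o A] into that of [f] in the
    direction [L v], so that directional derivability suffices. *)
Lemma derive_precomp (A : V -> V) (L : V -> V) f z v : continuous A ->
  (forall z h v, A (z + h *: v) = A z + h *: L v) ->
  derivable f (A z) (L v) ->
  is_derive z v (f \o A) ('D_(L v) f (A z)).
Proof.
move=> cA HA df.
have E : (fun h : R => h^-1 *: ((f \o A) (h *: v + z) - (f \o A) z)) =
    (fun h : R => h^-1 *: (f (h *: L v + A z) - f (A z))).
  by apply/funext => h /=; rewrite [h *: v + z]addrC HA [A z + _]addrC.
by apply: DeriveDef; rewrite /derivable /derive /= E.
Qed.

Lemma smooth_precomp (A : V -> V) (L : V -> V) f : continuous A ->
  (forall z h v, A (z + h *: v) = A z + h *: L v) ->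
  smooth f -> smooth (f \o A).
Proof.
move=> cA HA /smoothP H; apply/smoothP => n; have {H} := H n.
have once g : diff_once g -> diff_once (g \o A).
  move=> [cg dg]; split => [z|z v]; first by apply: continuous_comp; [exact: cA|exact: cg].
  by have [] := @derive_precomp A L g z v cA HA (dg _ _).
elim: n f => [|n IH] f; first exact: once.
move=> [of_ Hf]; split => [|w]; first exact: once.
rewrite (_ : 'D_w _ = ('D_(L w) f) \o A); first exact: IH (Hf _).
apply/funext => z; have [_ dg] := of_.
by have [_ ->] := @derive_precomp A L f z w cA HA (dg _ _).
Qed.

End smooth_theory.

Section flat_function.
Context {R : realType}.
Implicit Types (t x : R) (k : nat).

(* All derivatives of a function t^-k e^(-1/t), extended by 0 to t <= 0, are
   linear combinations of such functions. *)
Definition flat k t : R := if 0 < t then t^-1 ^+ k * expR (- t^-1) else 0.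

Lemma expR_lower n x : 0 <= x -> (x / n.+1%:R) ^+ n.+1 <= expR x.
Proof.
move=> x0; have n0 : 0 < n.+1%:R :> R by rewrite ltr0n.
have -> : expR x = expR (x / n.+1%:R) ^+ n.+1.
  by rewrite -expRM_natl -mulr_natl mulrCA mulfV ?mulr1// gt_eqF.
have h0 : 0 <= x / n.+1%:R by rewrite divr_ge0// ltW.
rewrite lerXn2r// ?nnegrE ?expR_ge0//.
by apply: le_trans (expR_ge1Dx _); rewrite lerDr.
Qed.

Lemma flat_ge0 k t : 0 <= flat k t.
Proof.
rewrite /flat; case: ifPn => // t0.
by rewrite mulr_ge0 ?expR_ge0// exprn_ge0// invr_ge0 ltW.
Qed.

(** The bound e^x >= (x / (k + 2))^(k + 2) at x = 1/t. Quadratic decay at 0 is what makes the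
    derivative there exist and vanish. *)
Lemma flat_le_sqr k t : flat k t <= k.+2%:R ^+ k.+2 * t ^+ 2.
Proof.
rewrite /flat; case: ifPn => [t0|_]; last by rewrite mulr_ge0 ?sqr_ge0 ?exprn_ge0.
have := @expR_lower k.+1 t^-1 (ltW (eqbRL (invr_gt0 t) t0)).
rewrite expRN -(ler_pV2 (x := expR _)) ?inE ?unitf_gt0 ?expR_gt0 ?exprn_gt0 ?divr_gt0 ?invr_gt0//.
move=> /(ler_wpM2l (exprn_ge0 k (ltW (eqbRL (invr_gt0 t) t0)))).
move=> /le_trans; apply; rewrite le_eqVlt; apply/orP; left; apply/eqP.
rewrite exprMn !exprVn invfM !invrK mulrCA mulrA mulrC; congr (_ * _).
by rewrite -addn2 exprD mulrAC mulfV ?mul1r// gt_eqF// exprn_gt0.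
Qed.

Lemma is_derive_flat k t : is_derive t 1 (flat k) (flat k.+2 t - k%:R * flat k.+1 t).
Proof.
have [t0|t0|->] := ltgtP t 0.
- have E : \near t, cst 0 t = flat k t.
    near=> s; rewrite /flat ifF//; apply/negbTE; rewrite -leNgt.
    by apply: ltW; near: s; exact: lt_nbhsl.
  have -> : flat k.+2 t - k%:R * flat k.+1 t = 0.
    by rewrite /flat ltNge (ltW t0) /= mulr0 subr0.
  exact: near_eq_is_derive E (is_derive_cst _ _ _).
- have E : \near t, ((fun s => s^-1) ^+ k * (expR \o (fun s => - s^-1))) t = flat k t.
    near=> s; rewrite /flat ifT ?fctE//; near: s; exact: lt_nbhsr.
  have tn0 : t != 0 by rewrite gt_eqF.
  have dV : is_derive t 1 (fun s : R => s^-1) (- t ^- 2 *: 1).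
    exact: is_deriveV.
  have dX := is_deriveX k dV.
  have dE := is_derive1_comp (is_derive_expR _) (is_deriveN dV).
  apply: near_eq_is_derive E _; apply: is_derive_eq (is_deriveM dX dE) _.
  rewrite /flat !t0 /= !fctE /GRing.scale /= !mulr1 opprK.
  case: k {dX} => [|k] /=; rewrite ?exprS ?expr0; field; rewrite ?tn0//.
- have -> : flat k.+2 0 - k%:R * flat k.+1 0 = 0 :> R.
    by rewrite /flat ltxx mulr0 subr0.
  have H : (fun h : R => h^-1 *: (flat k (h *: 1 + 0) - flat k 0)) @ 0^' --> (0 : R).
    apply/cvgr0Pnorm_le => e e0.
    set C : R := k.+2%:R ^+ k.+2; have C0 : 0 < C by rewrite exprn_gt0.
    near=> h; have hn0 : h != 0 by near: h; exact: nbhs_dnbhs_neq.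
    rewrite /flat ltxx subr0 -/(flat k _) addr0 /GRing.scale /= mulr1.
    rewrite normrM normfV ger0_norm ?flat_ge0//.
    apply: (@le_trans _ _ (`|h|^-1 * (C * h ^+ 2))).
      by rewrite ler_wpM2l ?invr_ge0// flat_le_sqr.
    rewrite -(real_normK (num_real h)).
    rewrite mulrCA expr2 mulKf ?normr_eq0// -ler_pdivlMl// mulrC.
    near: h; apply: dnbhs0_le; exact: divr_gt0.
  apply: DeriveDef; first exact: cvgP H.
  exact: cvg_lim H.
Unshelve. all: by end_near. Qed.

End flat_function.


(** * Bump functions on boxes *)

Section bumps.
Context {R : realType} {N : nat}.
Local Notation V := ('rV[R]_N * R)%type.
Implicit Types (f g : V -> R) (v w z : V).

Definition affine_form (l : V -> R) :=
  exists2 l' : V -> R, continuous l & forall z h v, l (z + h *: v) = l z + h * l' v.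

Lemma flat_continuous k : continuous (@flat R k).
Proof.
move=> t; apply: differentiable_continuous; apply/derivable1_diffP.
by have [] := is_derive_flat k t.
Qed.

(** The chain rule is applied on the line h -> l z + h l'(v), where only one-variable derivatives
    occur. *)
Lemma derive_flat_form k (l : V -> R) l' z v :
  (forall z h v, l (z + h *: v) = l z + h * l' v) ->
  is_derive z v (flat k \o l) (l' v * (flat k.+2 (l z) - k%:R * flat k.+1 (l z))).
Proof.
move=> Hl; set df := _ - _.
have dl : is_derive (0 : R) (1 : R) (fun h : R => l z + h * l' v) (l' v).
  apply: (is_derive_eq (is_deriveD (is_derive_cst (l z) (0 : R) (1 : R))
    (is_deriveM (is_derive_id (0 : R) (1 : R))
      (is_derive_cst (l' v) (0 : R) (1 : R))))).
  by rewrite /GRing.scale/= mulr0 !add0r mulr1.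
have df' : is_derive (l z + 0 * l' v) 1 (flat k) df.
  by rewrite mul0r addr0; exact: is_derive_flat.
have [d1 e1] := @is_derive1_comp R (flat k) (fun h => l z + h * l' v) 0 _ _ df' dl.
have E : (fun h : R => h^-1 *: ((flat k \o l) (h *: v + z) - (flat k \o l) z)) =
    (fun h : R => h^-1 *: ((flat k \o (fun h => l z + h * l' v)) (h *: 1 + 0) -
       (flat k \o (fun h => l z + h * l' v)) 0)).
  apply/funext => h /=; rewrite [h *: v + z]addrC Hl mul0r !addr0.
  by rewrite /GRing.scale /= mulr1.
by apply: DeriveDef; rewrite /derivable /derive E// [LHS]e1 mulrC.
Qed.

Lemma smooth_flat_form (l : V -> R) : affine_form l -> smooth (flat 0 \o l).
Proof.
move=> [l' cl Hl]; apply/smoothP => n.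
suff H k : diff_times n (flat k \o l) by exact: H.
have once j : diff_once (flat j \o l).
  split => [z|z v].
    by apply: continuous_comp; [exact: cl|exact: flat_continuous].
  by have [] := derive_flat_form j z v Hl.
elim: n k => [|n IH] k; first exact: once.
split => [|w]; first exact: once.
rewrite (_ : 'D_w _ = (cst (l' w) \* ((flat k.+2 \o l) \+
    (cst (- k%:R) \* (flat k.+1 \o l))))); last first.
  by apply/funext => z; have [_ ->] := derive_flat_form k z w Hl; rewrite /= mulNr.
apply: diff_timesM; first exact: diff_times_cst.
apply: diff_timesD => //; apply: diff_timesM => //; exact: diff_times_cst.
Qed.

(** [option 'I_N] indexes all N + 1 coordinates, [None] standing for y, so that x and y derivatives
    are treated by the same statements. *)
Definition vcoor (i : option 'I_N) z : R :=
  if i is Some j then z.1 ord0 j else z.2.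

Lemma vcoor_continuous i : continuous (vcoor i).
Proof.
case: i => [j|] z /=; last exact: cvg_snd.
apply: (@continuous_comp _ _ _ fst (fun x : 'rV[R]_N => x ord0 j)).
  exact: cvg_fst.
exact: coord_continuous.
Qed.

Lemma affine_vcoor i (a b : R) : affine_form (fun z => a * vcoor i z + b).
Proof.
exists (fun v => a * vcoor i v).
  move=> z; apply: cvgD; last exact: cvg_cst.
  by apply: cvgM; [exact: cvg_cst|exact: vcoor_continuous].
by move=> z h v; case: i => [j|]; rewrite /= ?mxE /GRing.scale /=; ring.
Qed.

Lemma deriveZdir f z v (c : R) : derivable f z v ->
  'D_(c *: v) f z = c * 'D_v f z.
Proof.
move=> df.
have E u : (fun h : R => h^-1 *: (f (h *: u + z) - f z)) =
    (fun h : R => h^-1 *: ((fun h => f (z + h *: u)) (h *: 1 + 0) -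
       (fun h => f (z + h *: u)) 0)).
  by apply/funext => h /=; rewrite scale0r !addr0 [z + _]addrC /GRing.scale /= mulr1.
have d0 : is_derive (c * 0) 1 (fun h : R => f (z + h *: v)) ('D_v f z).
  rewrite mulr0; apply: DeriveDef.
    by move: df; rewrite /derivable E.
  by rewrite /derive -E.
have d1 : is_derive (0 : R) 1 ( *%R c) c.
  apply: (is_derive_eq (is_deriveM (is_derive_cst c (0 : R) (1 : R))
    (is_derive_id (0 : R) (1 : R)))).
  by rewrite /GRing.scale/= mulr0 addr0 mulr1.
have [_] := is_derive1_comp d0 d1; rewrite mulrC => <-.
rewrite /derive E; set F := (fun h : R => _).
set G := (fun h : R => h^-1 *: (_ - _)).
suff -> : F = G by [].
apply/funext => h; rewrite /F /G /=.
by rewrite mulr0 !scale0r scalerA /GRing.scale/= !addr0 !mulr1 [h * c]mulrC.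
Qed.

(** The factors vanish to infinite order on the faces of the box. A large [s] steepens the sides: at
    fixed p and q the bump tends to the indicator of the open box. *)
Definition box_bump (p q : option 'I_N -> R) (s : R) z : R :=
  \prod_(i : option 'I_N)
    (flat 0 (s * (vcoor i z - p i)) * flat 0 (s * (q i - vcoor i z))).

Definition closed_box (p q : option 'I_N -> R) : set V :=
  [set z | forall i, p i <= vcoor i z <= q i].

Lemma flat0_le1 (t : R) : flat 0 t <= 1.
Proof.
rewrite /flat; case: ifPn => // t0.
by rewrite expr0 mul1r -[leRHS]expR0 ler_expR oppr_le0 invr_ge0 ltW.
Qed.

Lemma flat0_eq0 (t : R) : t <= 0 -> flat 0 t = 0.
Proof. by rewrite /flat ltNge => ->. Qed.

Lemma flat0_gt0 (t : R) : 0 < t -> 0 < flat 0 t.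
Proof. by rewrite /flat => ->; rewrite expr0 mul1r expR_gt0. Qed.

Lemma smooth_box_bump p q s : smooth (box_bump p q s).
Proof.
apply: smooth_prod => i; apply: (@smoothM _ _ (fun z => _) (fun z => _)).
  have -> : (fun z => flat 0 (s * (vcoor i z - p i))) =
      flat 0 \o (fun z => s * vcoor i z + (- (s * p i))).
    by apply/funext => z /=; rewrite mulrBr.
  exact/smooth_flat_form/affine_vcoor.
have -> : (fun z => flat 0 (s * (q i - vcoor i z))) =
    flat 0 \o (fun z => - s * vcoor i z + s * q i).
  by apply/funext => z /=; rewrite mulrBr mulNr addrC.
exact/smooth_flat_form/affine_vcoor.
Qed.

Lemma box_bump_ge0 p q s z : 0 <= box_bump p q s z.
Proof. by apply: prodr_ge0 => i _; rewrite mulr_ge0// flat_ge0. Qed.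

Lemma box_bump_le1 p q s z : box_bump p q s z <= 1.
Proof.
apply: prodr_ile1 => i _; rewrite mulr_ge0 ?flat_ge0//=.
by rewrite mulr_ile1 ?flat_ge0 ?flat0_le1.
Qed.

Lemma box_bump_gt0 p q s z : 0 < s -> (forall i, p i < vcoor i z < q i) ->
  0 < box_bump p q s z.
Proof.
move=> s0 H; apply: prodr_gt0 => i _; have /andP[h1 h2] := H i.
by rewrite mulr_gt0// flat0_gt0// mulr_gt0// subr_gt0.
Qed.

Lemma box_bump_eq0 p q s z : 0 < s -> ~ closed_box p q z -> box_bump p q s z = 0.
Proof.
move=> s0 /existsNP[i /negP]; rewrite negb_and -!ltNge => H.
rewrite /box_bump (bigD1 i)//=; case/orP: H => H.
  by rewrite (@flat0_eq0 (s * (_ - p i))) ?mul0r// pmulr_rle0// subr_le0 ltW.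
by rewrite (@flat0_eq0 (s * (q i - _))) ?mulr0 ?mul0r// pmulr_rle0// subr_le0 ltW.
Qed.

Lemma compact_closed_box p q : compact (closed_box p q).
Proof.
rewrite (_ : closed_box p q =
    [set v : 'rV[R]_N | forall j, `[p (Some j), q (Some j)]%classic (v ord0 j)] `*`
    `[p None, q None]%classic).
  apply: compact_setX; last exact: segment_compact.
  by apply: (@rV_compact _ _ (fun j => `[p (Some j), q (Some j)]%classic)) => j;
    exact: segment_compact.
apply/seteqP; split => [z H|z [/= H1 H2] [j|]].
- split => [j|]; rewrite /= in_itv/=; [exact: (H (Some j))|exact: (H None)].
- by have := H1 j; rewrite in_itv.
- by move: H2; rewrite in_itv.
Qed.

Lemma V_hausdorff : hausdorff_space V.
Proof. exact: norm_hausdorff. Qed.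

Lemma supp_subset f (A : set V) : closed A -> (forall z, ~ A z -> f z = 0) ->
  supp f `<=` A.
Proof.
move=> cA H; rewrite (closure_id A).1//; apply: closureS => z /= /eqP fz.
by apply: contrapT => /H.
Qed.

Lemma test_function_box f p q : smooth f ->
  (forall z, ~ closed_box p q z -> f z = 0) -> test_function f.
Proof.
move=> sf H; split => //; have cb := @compact_closed_box p q.
have clb := compact_closed V_hausdorff cb.
apply: subclosed_compact cb _; [exact: closed_closure|exact: supp_subset].
Qed.

Lemma test_box_bump p q s : 0 < s -> test_function (box_bump p q s).
Proof.
move=> s0; apply: (@test_function_box _ p q); first exact: smooth_box_bump.
by move=> z; exact: box_bump_eq0.
Qed.

Lemma supp_box_bump p q s : 0 < s -> supp (box_bump p q s) `<=` closed_box p q.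
Proof.
move=> s0; apply: supp_subset; last by move=> z; exact: box_bump_eq0.
exact: compact_closed V_hausdorff (@compact_closed_box p q).
Qed.

Lemma supp_notin f z : ~ supp f z -> f z = 0.
Proof.
by move=> nz; apply/eqP; apply: contra_notT nz => fz; exact: subset_closure.
Qed.

Lemma test_function_supp f : test_function f ->
  exists2 M, 0 < M & forall z, ~ closed_box (fun=> - M) (fun=> M) z -> f z = 0.
Proof.
move=> [_ /compact_bounded [M [_ HM]]].
exists (`|M| + 1); first by rewrite ltr_wpDl.
move=> z nz; apply: supp_notin => sz; apply: nz => i.
have Mz : `|z| <= `|M| + 1.
  by apply: HM => //; rewrite (le_lt_trans (ler_norm M))// ltrDl.
rewrite -ler_norml; apply: le_trans Mz; case: i => [j|] /=.
  apply: (@le_trans _ _ `|z.1|); last by rewrite prod_normE le_max lexx.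
  by rewrite /Num.norm/= mx_normrE (bigmaxD1 (ord0, j))//= le_max lexx.
by rewrite prod_normE le_max lexx orbT.
Qed.

End bumps.

Section cauchy_schwarz.
Context d (T : measurableType d) (R : realType) (mu : {measure set T -> \bar R}).
Local Open Scope ereal_scope.

(** Integrating (t|f| - |g|)^2 >= 0 gives 2tc <= t^2 a + b for all t >= 0; t = c/a is the right
    choice when a > 0. *)
Lemma cauchy_schwarz D (f g : T -> R) : measurable D ->
  measurable_fun D f -> measurable_fun D g ->
  n2 mu D f < +oo -> n2 mu D g < +oo ->
  (\int[mu]_(x in D) (`|f x * g x|)%:E) ^+ 2 <= n2 mu D f * n2 mu D g.
Proof.
move=> mD mf mg Hf Hg; set X := \int[mu]_(x in D) _.
have X0 : 0 <= X by apply: integral_ge0 => x _; rewrite lee_fin.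
have IX := integrable_abse (integrable_mul mD mf mg Hf Hg).
have Xoo : X < +oo by have := integrable_lty mD IX.
have XE : X = (fine X)%:E by rewrite fineK// ge0_fin_numE.
have fE := n2_fin Hf; have gE := n2_fin Hg.
set a := fine (n2 mu D f) in fE *; set b := fine (n2 mu D g) in gE *.
set c := fine X in XE *.
have a0 : (0 <= a)%R by exact/fine_ge0/n2_ge0.
have b0 : (0 <= b)%R by exact/fine_ge0/n2_ge0.
have c0 : (0 <= c)%R by exact: fine_ge0.
have H (t : R) : (0 <= t)%R -> (2 * t * c <= t ^+ 2 * a + b)%R.
  move=> t0; rewrite -lee_fin EFinD !EFinM -XE -fE -gE -[n2 mu D g]mul1e.
  rewrite /X -ge0_integralZl_EFin ?mulr_ge0//; last first.
    by apply/measurable_EFinP; apply: measurableT_comp => //; exact: measurable_funM.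
  rewrite /n2 -integral_lin ?sqr_ge0//; do ?exact: measurable_funX;
    do ?(by move=> x _; exact: sqr_ge0).
  apply: ge0_le_integral => //.
  - by move=> x _; rewrite -EFinM lee_fin !mulr_ge0.
  - apply/measurable_EFinP; apply: measurable_funM; first exact: measurable_cst.
    by apply: measurableT_comp => //; exact: measurable_funM.
  - apply/measurable_EFinP; apply: measurable_funD; apply: measurable_funM => //;
      exact: measurable_funX.
  - move=> x _; rewrite -EFinM lee_fin normrM mul1r.
    rewrite -(real_normK (num_real (f x))) -(real_normK (num_real (g x))).
    have := sqr_ge0 (t * `|f x| - `|g x|)%R; nra.
rewrite XE fE gE -EFin_expe -EFinM lee_fin.
have [a00|a1] := eqVneq a 0%R; last first.
  have {}a1 : (0 < a)%R by rewrite lt_neqAle eq_sym a1.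
  have := H (c / a)%R (divr_ge0 c0 a0).
  have -> : (2 * (c / a) * c = 2 * (c ^+ 2 / a))%R by ring.
  have -> : ((c / a) ^+ 2 * a = c ^+ 2 / a)%R by field; rewrite gt_eqF.
  move=> h; have {h} : (c ^+ 2 / a <= b)%R by lra.
  by rewrite ler_pdivrMr// mulrC.
(* With a = 0 this value of t turns the bound into b + 1 <= b unless c = 0. *)
have := H ((b + 1) / (2 * c))%R; rewrite a00 mul0r.
have [->|c1] := eqVneq c 0%R; first by rewrite expr0n.
have {}c1 : (0 < c)%R by rewrite lt_neqAle eq_sym c1.
rewrite mulr0 add0r => /(_ _) W; exfalso.
have : (0 <= (b + 1) / (2 * c))%R by rewrite divr_ge0 ?mulr_ge0// addr_ge0.
move/W; have -> : (2 * ((b + 1) / (2 * c)) * c = b + 1)%R by field; rewrite gt_eqF.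
lra.
Qed.

End cauchy_schwarz.

(** * Test functions: bounds, integrability, integration by parts *)

Section test_functions.
Context {R : realType} {N : nat}.
Local Notation V := ('rV[R]_N * R)%type.
Local Notation Z := ('rV[R]_N * measurableTypeR R)%type.
Local Notation mu := (@lebesgue_strip R N).
Implicit Types (f g phi psi : V -> R) (v w z : V).

Lemma is_derive_line f z v (h : R) : smooth f ->
  is_derive h 1 (fun t : R => f (z + t *: v)) ('D_v f (z + h *: v)).
Proof.
move=> sf; have df := @smooth_derivable _ _ f (z + h *: v) v sf.
have E : (fun s : R => s^-1 *: (f (s *: v + (z + h *: v)) - f (z + h *: v))) =
    (fun s : R => s^-1 *: (f (z + (s *: 1 + h) *: v) - f (z + h *: v))).
  apply/funext => s; congr (_ *: (f _ - _)).
  by rewrite -[s%:A]/(s * 1) mulr1 scalerDl addrCA.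
by apply: DeriveDef; rewrite /derivable /derive -E.
Qed.

Lemma continuous_line f z v : continuous f -> continuous (fun t : R => f (z + t *: v)).
Proof.
move=> cf t; apply: (@continuous_comp _ _ _ (fun t : R => z + t *: v) f).
  by apply: cvgD; [exact: cvg_cst|exact: scalel_continuous].
exact: cf.
Qed.

Lemma D_notin_supp f w z : ~ supp f z -> 'D_w f z = 0.
Proof.
move=> nz; have oc : open (~` supp f) by apply: closed_openC; exact: closed_closure.
have E : \near z, f z = cst 0 z.
  have := open_nbhs_nbhs (conj oc nz); apply: filterS => y ny /=.
  exact: supp_notin.
have [->|w0] := eqVneq w 0; first by rewrite derive0.
by rewrite (near_eq_derive w E) derive_cst.
Qed.

Lemma supp_D f w : supp ('D_w f) `<=` supp f.
Proof.
apply: supp_subset; first exact: closed_closure.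
by move=> z; exact: D_notin_supp.
Qed.

Lemma test_D f w : test_function f -> test_function ('D_w f).
Proof.
move=> [sf cf]; split; first exact: smooth_D.
apply: subclosed_compact cf _; [exact: closed_closure|exact: supp_D].
Qed.

Lemma test_intro f g : test_function f -> smooth g ->
  (forall z, f z = 0 -> g z = 0) -> test_function g.
Proof.
move=> tf sg H; have [M M0 HM] := test_function_supp tf.
by apply: (test_function_box sg (p := fun=> - M) (q := fun=> M)) => z /HM /H.
Qed.

Lemma testD f g : test_function f -> test_function g -> test_function (f \+ g).
Proof.
move=> tf tg; have [M M0 HM] := test_function_supp tf.
have [M' M'0 HM'] := test_function_supp tg.
apply: (@test_function_box _ _ _ (fun=> - Num.max M M') (fun=> Num.max M M')).
  by apply: smoothD; [case: tf|case: tg].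
move=> z nz; rewrite /= HM ?HM' ?addr0// => cz; apply: nz => i;
  have /andP[h1 h2] := cz i; rewrite lerNl in h1; by rewrite lerNl !le_max h1 h2 ?orbT.
Qed.

Lemma testM f g : test_function f -> smooth g -> test_function (f \* g).
Proof.
move=> tf sg; apply: (test_intro tf); last by move=> z /= ->; rewrite mul0r.
by case: tf => sf _; exact: (smoothM sf sg).
Qed.

Lemma testZ f (c : R) : test_function f -> test_function (fun z => c * f z).
Proof.
move=> tf; apply: (test_intro tf); last by move=> z ->; rewrite mulr0.
by apply: smoothZ; case: tf.
Qed.

Lemma test_measurable f : test_function f -> measurable_fun [set: Z] f.
Proof.
by move=> [sf _]; apply: continuous_measurable_strip; exact: smooth_cont.
Qed.

Lemma test_bounded f : test_function f -> exists2 C, 0 < C & forall z, `|f z| <= C.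
Proof.
move=> tf; have [sf cf] := tf.
have /compact_bounded [M [_ HM]] : compact (f @` supp f).
  apply: continuous_compact => //; apply: continuous_subspaceT.
  exact: smooth_cont.
exists (`|M| + 1); first by rewrite ltr_wpDl.
move=> z; have [sz|nz] := pselect (supp f z); last first.
  by rewrite supp_notin// normr0 addr_ge0.
apply: HM; last by exists z.
by rewrite (le_lt_trans (ler_norm M))// ltrDl.
Qed.

Lemma measurable_closed_box (p q : option 'I_N -> R) :
  measurable (closed_box p q : set Z).
Proof.
rewrite (_ : closed_box p q =
    [set v : 'rV[R]_N | forall j, `[p (Some j), q (Some j)]%classic (v ord0 j)] `*`
    `[p None, q None]%classic).
  apply: measurableX => //.
  exact: (@measurable_rV_box R N (fun j => `[p (Some j), q (Some j)]%classic)).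
apply/seteqP; split => [z H|z [/= H1 H2] [j|]].
- split => [j|]; rewrite /= in_itv/=; [exact: (H (Some j))|exact: (H None)].
- by have := H1 j; rewrite in_itv.
- by move: H2; rewrite in_itv.
Qed.

Lemma closed_box_lty (p q : option 'I_N -> R) : (mu (closed_box p q) < +oo)%E.
Proof.
rewrite (_ : closed_box p q =
    [set v : 'rV[R]_N | forall j, `[p (Some j), q (Some j)]%classic (v ord0 j)] `*`
    `[p None, q None]%classic); last first.
  apply/seteqP; split => [z H|z [/= H1 H2] [j|]].
  - split => [j|]; rewrite /= in_itv/=; [exact: (H (Some j))|exact: (H None)].
  - by have := H1 j; rewrite in_itv.
  - by move: H2; rewrite in_itv.
have mA := @measurable_rV_box R N (fun j => `[p (Some j), q (Some j)]%classic)
  (fun j => measurable_itv _).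
have mB := @lebesgue_rV_box R N (fun j => `[p (Some j), q (Some j)]%classic)
  (fun j => measurable_itv _).
rewrite -[mu _]/((lebesgue_rV R N \x lebesgue_measure)%E _) product_measure1E//.
set a := (X in (X * _)%E); have -> : a = (\prod_(j < N) lebesgue_measure `[p (Some j), q (Some j)]%classic)%E by exact: mB.
have fin (c b : R) : (lebesgue_measure `[c, b]%classic < +oo)%E.
  by rewrite lebesgue_measure_itv/=; case: ifP => _; rewrite ?ltry// -EFinD ltry.
apply: lte_mul_pinfty; [exact: prode_ge0| |exact: fin].
elim/big_ind: _ => // [x y fx fy|i _]; first by rewrite fin_numM.
by rewrite ge0_fin_numE.
Qed.

Lemma integrable_box (p q : option 'I_N -> R) (C : R) :
  mu.-integrable setT (fun z => (C * \1_(closed_box p q) z)%:E).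
Proof.
have mK := measurable_closed_box p q.
have -> : (fun z : Z => (C * \1_(closed_box p q) z)%:E) =
    (EFin \o cst C) \_ (closed_box p q).
  apply/funext => z; rewrite patchE indicE /=.
  by case: ifPn => _; rewrite ?mulr1 ?mulr0.
apply/(integrable_mkcond _ mK); apply: measurable_bounded_integrable => //.
- exact: closed_box_lty.
- exists `|C|; split; first exact: num_real.
  by move=> x Cx z _ /=; exact: ltW.
Qed.

Lemma test_integrable f : test_function f -> mu.-integrable setT (EFin \o f).
Proof.
move=> tf; have [M M0 HM] := test_function_supp tf.
set K := closed_box _ _ in HM; have mK : measurable (K : set Z).
  exact: measurable_closed_box.
have mf := test_measurable tf; have [C C0 HC] := test_bounded tf.
have -> : EFin \o f = (EFin \o f) \_ (K : set Z).
  apply/funext => z; rewrite patchE; case: ifPn => //=; rewrite notin_setE.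
  by move=> /HM ->.
apply/(integrable_mkcond _ mK); apply: measurable_bounded_integrable => //.
- exact: closed_box_lty.
- exact: measurable_funTS.
- exists C; split; first exact: num_real.
  by move=> x Cx z _ /=; apply: le_trans (HC z) (ltW Cx).
Qed.

Lemma test_mul_integrable f g : test_function f -> smooth g ->
  mu.-integrable setT (fun z => (f z * g z)%:E).
Proof. by move=> tf sg; exact: test_integrable (testM tf sg). Qed.

Lemma test_n2 D f : measurable (D : set Z) -> test_function f ->
  (n2 mu D f < +oo)%E.
Proof.
move=> mD tf; have sf := tf.1.
have := integrable_lty measurableT (test_mul_integrable tf sf).
apply: le_lt_trans; apply: ge0_subset_integral => //.
- by apply: measurable_sqrE; exact: test_measurable.
- by move=> z _; rewrite lee_fin sqr_ge0.
Qed.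

Lemma smooth_lipschitz f v (C : R) z h : smooth f ->
  (forall z, `|'D_v f z| <= C) -> `|f (z + h *: v) - f z| <= C * `|h|.
Proof.
move=> sf HC.
have mvt (a b : R) : a <= b -> `|f (z + b *: v) - f (z + a *: v)| <= C * (b - a).
  move=> ab; have cf : {within `[a, b], continuous (fun t : R => f (z + t *: v))}.
    by apply: continuous_subspaceT; exact: continuous_line (smooth_cont sf).
  have df t : t \in `]a, b[ -> is_derive t 1 (fun t : R => f (z + t *: v)) ('D_v f (z + t *: v)).
    by move=> _; exact: is_derive_line.
  have [c _ ->] := MVT_segment ab df cf.
  by rewrite normrM ler_pM// ger0_norm// subr_ge0.
have := mvt; have [h0|/ltW h0] := leP 0 h.
  by move=> /(_ _ _ h0); rewrite scale0r addr0 subr0 [`|h|]ger0_norm.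
by move=> /(_ _ _ h0); rewrite scale0r addr0 sub0r distrC [`|h|]ler0_norm.
Qed.

Lemma derive_seq f v z : derivable f z v ->
  (fun n : nat => n.+1%:R * (f (z + n.+1%:R^-1 *: v) - f z)) @ \oo --> 'D_v f z.
Proof.
move=> df; have : (fun h : R => h^-1 *: (f (h *: v + z) - f z)) @ 0^' --> 'D_v f z.
  exact: df.
move=> /cvgr_dnbhsP /(_ (fun n => n.+1%:R^-1)) H.
rewrite (_ : (fun n => _) =
  (fun n => (n.+1%:R^-1)^-1 *: (f (n.+1%:R^-1 *: v + z) - f z))).
  by apply: H; split; [move=> n; rewrite invr_eq0 pnatr_eq0|exact: cvg_harmonic].
by apply/funext => n; rewrite invrK [_ *: v + z]addrC.
Qed.

Lemma vcoor_norm i z : `|vcoor i z| <= `|z|.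
Proof.
case: i => [j|] /=; last by rewrite prod_normE le_max lexx orbT.
apply: (@le_trans _ _ `|z.1|); last by rewrite prod_normE le_max lexx.
by rewrite /Num.norm/= mx_normrE (bigmaxD1 (ord0, j))//= le_max lexx.
Qed.

Lemma vcoorD i z w : vcoor i (z + w) = vcoor i z + vcoor i w.
Proof. by case: i => [j|]; rewrite /= ?mxE. Qed.

Lemma test_translate f w : test_function f -> test_function (fun z => f (z + w)).
Proof.
move=> [sf cf]; have [M M0 HM] := test_function_supp (conj sf cf).
apply: (@test_function_box _ _ _ (fun=> - (M + `|w|)) (fun=> M + `|w|)).
  apply: (@smooth_precomp _ _ (fun z => z + w) id f) => //.
    by move=> z; apply: cvgD; [exact: cvg_id|exact: cvg_cst].
  by move=> z h v; rewrite addrAC.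
move=> z nz; apply: HM => cz; apply: nz => i; have := cz i.
rewrite -!ler_norml => h; have -> : vcoor i z = vcoor i (z + w) - vcoor i w.
  by rewrite vcoorD addrK.
by rewrite (le_trans (ler_normB _ _))// lerD// vcoor_norm.
Qed.

(** By translation invariance the difference quotients of [psi] have integral 0; they converge
    pointwise to the derivative and are dominated by a constant on a box that contains all the
    translated supports. *)
Lemma integral_D_test psi v : test_function psi ->
  (\int[mu]_z ('D_v psi z)%:E = 0)%E.
Proof.
move=> tf; have sf := tf.1; have td := test_D v tf.
have [C C0 HC] := test_bounded td.
have [M M0 HM] := test_function_supp tf.
pose M' := M + `|v|; set K : set Z := closed_box (fun=> - M') (fun=> M').
have mK : measurable K by exact: measurable_closed_box.
pose F n z : R := n.+1%:R * (psi (z + n.+1%:R^-1 *: v) - psi z).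
have mpsi := test_measurable tf.
have tt n := test_translate (n.+1%:R^-1 *: v) tf.
have tF n : test_function (F n).
  have := testZ n.+1%:R (testD (tt n) (testZ (-1) tf)).
  rewrite (_ : (fun z => _) = F n)//.
  by apply/funext => z; rewrite /F /= mulN1r.
have IF0 n : (\int[mu]_z (F n z)%:E = 0)%E.
  have I1 := test_integrable (tt n); have I2 := test_integrable tf.
  under eq_integral => z _ do rewrite /F EFinM EFinB.
  rewrite integralZl//; last exact: integrableB.
  rewrite integralB// (integral_strip_translate _ (f := EFin \o psi)); last first.
    exact/measurable_EFinP.
  by rewrite subee ?mule0//; exact: integrable_fin_num.
have [||||//|_ _] := @dominated_convergence _ _ _ mu setT measurableT
  (fun n z => (F n z)%:E) (fun z => ('D_v psi z)%:E) (fun z => (C * \1_K z)%:E).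
- by move=> n; apply/measurable_EFinP; exact: test_measurable.
- by apply/measurable_EFinP; exact: test_measurable.
- apply: aeW => z _; apply: cvg_EFin; first exact: nearW.
  exact: derive_seq (@smooth_derivable _ _ psi z v sf).
- exact: integrable_box.
- apply: aeW => z n _; rewrite lee_fin indicE.
  have [zK|zK] := boolP (z \in K).
    rewrite mulr1 /F normrM ger0_norm//.
    rewrite -ler_pdivlMl ?ltr0n//; apply: le_trans (smooth_lipschitz _ _ sf HC) _.
    by rewrite ger0_norm// mulrC.
  have nzK : ~ K z by move/negP: zK; rewrite inE.
  rewrite mulr0 /F !HM ?subr0 ?mulr0 ?normr0// => cz; apply: nzK => i; have := cz i.
    rewrite -!ler_norml => /le_trans; apply; rewrite /M' lerDl.
    exact: normr_ge0.
  rewrite -!ler_norml => h; have -> : vcoor i z = vcoor i (z + n.+1%:R^-1 *: v) -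
      vcoor i (n.+1%:R^-1 *: v) by rewrite vcoorD addrK.
  rewrite (le_trans (ler_normB _ _))// lerD// (le_trans (vcoor_norm _ _))//.
  rewrite normrZ ger0_norm// ler_piMl// invf_le1 ?ltr0n//.
  by rewrite ler1n.
rewrite (_ : [sequence _]_n = cst 0%E); last by apply/funext => n; exact: IF0.
by move/cvg_lim => <- //; exact: lim_cst.
Qed.

Lemma integral_supp (D : set Z) (h : Z -> \bar R) : measurable D ->
  (forall z, ~ D z -> h z = 0%E) -> (\int[mu]_(z in D) h z = \int[mu]_z h z)%E.
Proof.
move=> mD h0; rewrite integral_mkcond; apply: eq_integral => z _.
by rewrite patchE; case: ifPn => //; rewrite notin_setE => /h0 ->.
Qed.

(** The product of [phi] and [f] is a test function, and the integral of its derivative is 0. *)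
Lemma integral_parts f phi v : smooth f -> test_function phi ->
  (\int[mu]_z (f z * 'D_v phi z)%:E = - \int[mu]_z ('D_v f z * phi z)%:E)%E.
Proof.
move=> sf tp; have sp := tp.1.
have I1 : mu.-integrable setT (fun z => (f z * 'D_v phi z)%:E).
  by under eq_fun do rewrite mulrC; exact: test_mul_integrable (test_D v tp) sf.
have I2 : mu.-integrable setT (fun z => ('D_v f z * phi z)%:E).
  by under eq_fun do rewrite mulrC; exact: test_mul_integrable tp (smooth_D v sf).
have := integral_D_test v (testM tp sf).
have E z : 'D_v (phi \* f) z = f z * 'D_v phi z + 'D_v f z * phi z.
  rewrite (deriveM (@smooth_derivable _ _ phi z v sp) (@smooth_derivable _ _ f z v sf)).
  by rewrite /GRing.scale/= [phi z * _]mulrC addrC.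
under eq_integral do rewrite E EFinD.
rewrite integralD// => H.
by rewrite -[LHS](addeK _ (integrable_fin_num measurableT I2)) H add0e.
Qed.

End test_functions.

(** * Uniqueness of weak derivatives *)

Section box_sigma_algebra.
Context {R : realType} {N : nat}.
Local Notation V := ('rV[R]_N * R)%type.
Local Notation Z := ('rV[R]_N * measurableTypeR R)%type.

Definition open_box (p q : option 'I_N -> R) : set V :=
  [set z | forall i, p i < vcoor i z < q i].

Definition open_boxes : set (set V) :=
  [set A | exists p q, A = open_box p q].

Lemma open_boxes_setI : setI_closed open_boxes.
Proof.
move=> _ _ [p [q ->]] [p' [q' ->]].
exists (fun i => Num.max (p i) (p' i)), (fun i => Num.min (q i) (q' i)).
apply/seteqP; split => [z [H H'] i|z H].
  by rewrite gt_max lt_min; have /andP[-> ->] := H i; have /andP[-> ->] := H' i.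
split => i; have := H i; rewrite gt_max lt_min => /andP[/andP[h1 h2] /andP[h3 h4]];
  exact/andP.
Qed.

Lemma measurable_open_box p q : measurable (open_box p q : set Z).
Proof.
rewrite (_ : open_box p q =
    [set v : 'rV[R]_N | forall j, `]p (Some j), q (Some j)[%classic (v ord0 j)] `*`
    `]p None, q None[%classic).
  apply: measurableX => //.
  exact: (@measurable_rV_box R N (fun j => `]p (Some j), q (Some j)[%classic)).
apply/seteqP; split => [z H|z [/= H1 H2] [j|]].
- split => [j|]; rewrite /= in_itv/=; [exact: (H (Some j))|exact: (H None)].
- by have := H1 j; rewrite in_itv.
- by move: H2; rewrite in_itv.
Qed.

Lemma open_boxes_coor i (Y : set R) : measurable Y ->
  <<s open_boxes >> (vcoor i @^-1` Y).
Proof.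
move=> mY; have {}mY : (@RGenOpens.G R).-sigma.-measurable Y
  by rewrite -RGenOpens.measurableE.
suff : <<s @RGenOpens.G R >> `<=` [set Y | <<s open_boxes >> (vcoor i @^-1` Y)] by move=> /(_ _ mY).
apply: smallest_sub.
  split => /=.
  - by rewrite preimage_set0; exact: sigma_algebra0.
  - by move=> A HA; rewrite setTD preimage_setC; exact: sigma_algebraC.
  - by move=> F HF; rewrite preimage_bigcup; exact: sigma_algebra_bigcup.
move=> _ [a [b ->]] /=.
(* Boxes are bounded in every direction: the other sides are taken as ]-n, n[ and the union over n
   removes them. *)
rewrite (_ : _ @^-1` _ = \bigcup_n open_box
    (fun j => if j == i then a else - n%:R) (fun j => if j == i then b else n%:R)).
  by apply: sigma_algebra_bigcup => n; apply: sub_sigma_algebra; eexists; eexists.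
apply/seteqP; split => [z /= zab|z [n _ /(_ i)]]; last by rewrite eqxx /= in_itv.
exists (Num.bound `|z|) => // j; case: eqP => [->|_]; first by rewrite in_itv in zab.
rewrite -ltr_norml; apply: le_lt_trans (vcoor_norm j z) _.
exact: archi_boundP.
Qed.

(** Open boxes generate the measurable sets and are stable under intersection, as the pi-lambda
    theorem requires. *)
Lemma box_sigma_algebra (A : set Z) : measurable A -> <<s open_boxes >> A.
Proof.
move: A; apply: smallest_sub; first exact: smallest_sigma_algebra.
rewrite subUset; split => [_ [X mX <-]|_ [Y mY <-]]; rewrite setTI; last first.
  exact: (open_boxes_coor None).
suff : (measurable : set (set 'rV[R]_N)) `<=`
  [set X | <<s open_boxes >> (fst @^-1` X)] by move=> /(_ _ mX).
apply: smallest_sub.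
  split => /=.
  - by rewrite preimage_set0; exact: sigma_algebra0.
  - by move=> B HB; rewrite setTD preimage_setC; exact: sigma_algebraC.
  - by move=> F HF; rewrite preimage_bigcup; exact: sigma_algebra_bigcup.
rewrite -bigcup_seq; apply: bigcup_sub => j _ _ [Y mY <-]; rewrite setTI.
exact: (open_boxes_coor (Some j)).
Qed.

End box_sigma_algebra.

Section fundamental_lemma.
Context {R : realType} {N : nat}.
Local Notation V := ('rV[R]_N * R)%type.
Local Notation Z := ('rV[R]_N * measurableTypeR R)%type.
Local Notation mu := (@lebesgue_strip R N).
Local Open Scope ereal_scope.

(* Dynkin's pi-lambda argument on the class of sets with vanishing integral. *)
Lemma integral_box_ae0 (h : Z -> R) : mu.-integrable setT (EFin \o h) ->
  \int[mu]_z (h z)%:E = 0 ->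
  (forall p q, \int[mu]_(z in open_box p q) (h z)%:E = 0) ->
  {ae mu, forall z, h z = 0%R}.
Proof.
move=> Ih h0 hbox.
pose DD : set (set Z) := [set A | measurable A /\ \int[mu]_(z in A) (h z)%:E = 0].
have dyn : dynkin DD.
  split.
  - by split.
  - move=> A [mA A0]; split; first exact: measurableC.
    have := @integral_setU _ _ _ mu A (~` A) (EFin \o h) mA (measurableC mA).
    rewrite setUv => /(_ (measurable_int mu Ih)).
    have dA : [disjoint A & ~` A] by apply/disj_setPS => z [].
    by move=> /(_ dA); rewrite h0 A0 add0e.
  - move=> F tF FD; split; first by apply: bigcupT_measurable => k; case: (FD k).
    rewrite (integral_bigcup (F := F) (g := EFin \o h))//.
    + by apply: eseries0 => k _ _; case: (FD k).
    + by move=> k; case: (FD k).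
    + apply: (integrableS measurableT) => //.
      by apply: bigcupT_measurable => k; case: (FD k).
have all0 A : measurable (A : set Z) -> \int[mu]_(z in A) (h z)%:E = 0.
  move=> /box_sigma_algebra; rewrite -setI_closed_g_dynkin_g_sigma_algebra.
    suff W : dynkin DD /\ open_boxes `<=` DD by move=> /(_ _ W)[].
    by split => // _ [p [q ->]]; split;
      [exact: measurable_open_box|exact: hbox].
  exact: open_boxes_setI.
have := @integral_ae_eq _ _ _ mu setT measurableT (cst 0) (EFin \o h) Ih.
move=> /(_ (measurable_cst _)) [].
  by move=> E _ mE; rewrite all0// integral0.
by move=> A [mA A0 HA]; exists A; split => // z hz; apply: HA => /= hz'; apply: hz;
  have := hz' I => -[].
Qed.

Local Close Scope ereal_scope.

Lemma flat0_cvg1 (c : R) : 0 < c ->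
  (fun n : nat => flat 0 (n.+1%:R * c - 1)) @ \oo --> (1 : R).
Proof.
move=> c0; apply/cvgrPdist_le => e e0.
have b0 : 0 <= (1 + e^-1) / c by rewrite divr_ge0 ?addr_ge0 ?invr_ge0// ltW.
exists (Num.bound ((1 + e^-1) / c)) => // n /= Nn.
have a0 : e^-1 <= n.+1%:R * c - 1.
  rewrite lerBrDr addrC -ler_pdivrMr//; apply: le_trans (ltW (archi_boundP b0)) _.
  by rewrite ler_nat ltnW.
have ei0 : 0 < e^-1 by rewrite invr_gt0.
have a1 := lt_le_trans ei0 a0; set a := _ - 1 in a0 a1 *.
rewrite ger0_norm ?subr_ge0 ?flat0_le1// /flat a1 expr0 mul1r.
rewrite lerBlDr -lerBlDl; apply: le_trans (expR_ge1Dx _).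
by rewrite lerD2l lerN2 -[e]invrK lef_pV2.
Qed.

Lemma cvg_prod_seq (I : Type) (r : seq I) (F : I -> nat -> R) (L : I -> R) :
  (forall i, F i @ \oo --> L i) ->
  (fun n => \prod_(i <- r) F i n) @ \oo --> \prod_(i <- r) L i.
Proof.
move=> H; elim: r => [|i r IH].
  by rewrite big_nil (_ : (fun _ => _) = cst 1); [exact: cvg_cst|
    apply/funext => n; rewrite big_nil].
rewrite big_cons (_ : (fun _ => _) = (F i \* (fun n => \prod_(j <- r) F j n))).
  exact: cvgM.
by apply/funext => n; rewrite big_cons.
Qed.

(** The box is shrunk by 1/(n+1) while the slope is n + 1, so each factor is [flat 0] at (n+1) t - 1
    with t the signed distance to a face: the support stays inside the box and the limit is the
    indicator of the open box. *)
Definition inner_bump (p q : option 'I_N -> R) (n : nat) : V -> R :=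
  box_bump (fun i => p i + n.+1%:R^-1) (fun i => q i - n.+1%:R^-1) n.+1%:R.

Lemma inner_bump_cvg p q z :
  (fun n => inner_bump p q n z) @ \oo --> (\1_(open_box p q) z : R).
Proof.
rewrite indicE; have E n : inner_bump p q n z = \prod_(i : option 'I_N)
    (flat 0 (n.+1%:R * (vcoor i z - p i) - 1) * flat 0 (n.+1%:R * (q i - vcoor i z) - 1)).
  apply: eq_bigr => i _; congr (flat 0 _ * flat 0 _); have n0 : n.+1%:R != 0 :> R.
  - by rewrite pnatr_eq0.
  - by field.
  - by rewrite pnatr_eq0.
  - by field.
under eq_fun do rewrite E.
have [/set_mem zB|] := boolP (z \in open_box p q).
  rewrite (_ : true%:R = \prod_(i : option 'I_N) 1); last by rewrite big1.
  apply: cvg_prod_seq => i; rewrite -[X in _ --> X]mulr1; have /andP[h1 h2] := zB i.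
  by apply: cvgM; apply: flat0_cvg1; rewrite subr_gt0.
rewrite notin_setE => /existsNP[i /negP]; rewrite negb_and -!leNgt => H.
rewrite (_ : (fun _ => _) = cst 0); first exact: cvg_cst.
apply/funext => n; rewrite (bigD1 i)//=.
have neg (t : R) : t <= 0 -> flat 0 (n.+1%:R * t - 1) = 0.
  move=> t0; apply: flat0_eq0; rewrite subr_le0 (@le_trans _ _ 0)//.
  by rewrite pmulr_rle0.
by case/orP: H => H; rewrite [X in X * _](_ : _ = 0) ?mul0r//;
  [rewrite neg ?mul0r// subr_le0|rewrite [X in _ * X]neg ?mulr0// subr_le0].
Qed.

Lemma closed_boxS p q p' q' : (forall i, p i <= p' i) -> (forall i, q' i <= q i) ->
  closed_box p' q' `<=` @closed_box R N p q.
Proof.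
move=> pp qq z H i; have /andP[h1 h2] := H i.
by rewrite (le_trans (pp i) h1) (le_trans h2 (qq i)).
Qed.

Lemma open_box_closed p q : open_box p q `<=` @closed_box R N p q.
Proof. by move=> z H i; have /andP[/ltW -> /ltW ->] := H i. Qed.

(** Dominated convergence along the bumps [inner_bump], which are admissible test functions because
    the closed box lies in [D]. *)
Lemma integral_open_box_eq0 (D : set Z) (g : Z -> R) p q : measurable D ->
  measurable_fun D g -> (n2 mu D g < +oo)%E ->
  (forall phi, test_function phi -> supp phi `<=` D ->
    (\int[mu]_(z in D) (g z * phi z)%:E = 0)%E) ->
  closed_box p q `<=` D ->
  mu.-integrable D (fun z => (g z * \1_(open_box p q) z)%:E) /\
  (\int[mu]_(z in D) (g z * \1_(open_box p q) z)%:E = 0)%E.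
Proof.
move=> mD mg g2 H0 pqD; have mK := measurable_closed_box p q.
have mB := measurable_open_box p q.
have m1K : measurable_fun D (\1_(closed_box p q) : Z -> R) by exact: measurable_indic.
have I1 : (n2 mu D (\1_(closed_box p q)) < +oo)%E.
  have := integrable_lty measurableT (integrable_box p q 1).
  apply: le_lt_trans; rewrite /n2 [leLHS]integral_mkcond.
  apply: ge0_le_integral => //.
  - by move=> z _; rewrite patchE; case: ifPn => // _; rewrite lee_fin sqr_ge0.
  - apply/(measurable_restrictT _ mD); exact: measurable_sqrE.
  - by apply/measurable_EFinP; apply: measurable_funM => //; exact: measurable_indic.
  move=> z _; rewrite patchE mul1r; case: ifPn => _; last by rewrite lee_fin.
  by rewrite lee_fin indicE; case: (_ \in _); rewrite ?expr1n ?expr0n.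
have dom := integrable_abse (integrable_mul mD mg m1K g2 I1).
have [|||||I2 _] := @dominated_convergence _ _ _ mu D mD
  (fun n z => (g z * inner_bump p q n z)%:E)
  (fun z => (g z * \1_(open_box p q) z)%:E)
  (abse \o (fun z => (g z * \1_(closed_box p q) z)%:E)).
- move=> n; apply/measurable_EFinP; apply: measurable_funM => //.
  by apply: measurable_funTS; apply: test_measurable; exact: test_box_bump.
- apply/measurable_EFinP; apply: measurable_funM => //; exact: measurable_indic.
- apply: aeW => z _; apply: cvg_EFin; first exact: nearW.
  by apply: cvgM; [exact: cvg_cst|exact: inner_bump_cvg].
- exact: dom.
- apply: aeW => z n _; rewrite /= lee_fin !normrM ler_wpM2l// indicE.
  rewrite ger0_norm ?box_bump_ge0//.
  have [zK|] := boolP (z \in _); first by rewrite normr1 box_bump_le1.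
  rewrite notin_setE normr0 => zK; rewrite /inner_bump box_bump_eq0 ?ltr0n// => cz.
  by apply: zK; apply: closed_boxS cz => i; rewrite ?lerDl ?gerBl.
move=> c0; split => //; apply: cvg_unique c0 _ => //.
rewrite (_ : [sequence _]_n = cst 0%E); first exact: cvg_cst.
apply/funext => n; apply: H0; first exact: test_box_bump.
have nn : 0 < n.+1%:R :> R by rewrite ltr0n.
apply: subset_trans (@supp_box_bump _ _ _ _ _ nn) _.
by apply: subset_trans pqD; apply: closed_boxS => i; rewrite ?lerDl ?gerBl.
Qed.

(** The intersection of two boxes is a box, so g times the indicator of one box has zero integral
    over every other, and the pi-lambda argument applies. *)
Lemma open_box_ae0 (D : set Z) (g : Z -> R) p q : measurable D ->
  measurable_fun D g -> (n2 mu D g < +oo)%E ->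
  (forall phi, test_function phi -> supp phi `<=` D ->
    (\int[mu]_(z in D) (g z * phi z)%:E = 0)%E) ->
  closed_box p q `<=` D ->
  {ae mu, forall z, open_box p q z -> g z = 0}.
Proof.
move=> mD mg g2 H0 pqD; have mB := measurable_open_box p q.
pose h := (fun z => g z * \1_(open_box p q) z) : Z -> R.
have hD z : ~ D z -> h z = 0.
  move=> nz; rewrite /h indicE [z \in _](_ : _ = false) ?mulr0//.
  by apply/negbTE; rewrite notin_setE => /open_box_closed /pqD.
have [I1 h0] := integral_open_box_eq0 mD mg g2 H0 pqD.
have IT : mu.-integrable setT (EFin \o h).
  have /(integrable_mkcond _ mD) := I1; apply: eq_integrable => // z _ /=.
  by rewrite patchE; case: ifPn => //; rewrite notin_setE => /hD ->.
have : {ae mu, forall z, h z = 0}.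
  apply: integral_box_ae0 IT _ _.
    rewrite -(integral_supp (D := D))// => z /hD /= -> //.
  move=> p' q'; pose p1 i := Num.max (p i) (p' i); pose q1 i := Num.min (q i) (q' i).
  have sub1 : closed_box p1 q1 `<=` D.
    by apply: subset_trans pqD; apply: closed_boxS => i; rewrite ?le_max ?ge_min ?lexx.
  have [_ <-] := integral_open_box_eq0 mD mg g2 H0 sub1.
  rewrite [LHS]integral_mkcond [RHS]integral_mkcond; apply: eq_integral => z _.
  rewrite !patchE /h !indicE.
  have E : (z \in open_box p1 q1) = (z \in open_box p q) && (z \in open_box p' q').
    apply/idP/andP => [/set_mem H|[/set_mem H /set_mem H']].
      by split; apply/mem_set => i; have := H i; rewrite gt_max lt_min
        => /andP[/andP[h1 h2] /andP[h3 h4]]; exact/andP.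
    apply/mem_set => i; rewrite gt_max lt_min.
    by have /andP[-> ->] := H i; have /andP[-> ->] := H' i.
  rewrite E; case: (boolP (z \in open_box p' q')) => z1; rewrite ?andbT ?andbF ?mulr0 ?if_same//.
  case: ifPn => //; rewrite notin_setE => nz; rewrite [_ \in _](_ : _ = false) ?mulr0//.
  by apply/negbTE; rewrite notin_setE => /open_box_closed /pqD.
apply: filterS => z hz Bz; move: hz; rewrite /h indicE mem_set// mulr1//.
Qed.

Lemma measurable_strip (l : \bar R) : measurable (strip l : set Z).
Proof.
have -> : strip l = snd @^-1` [set y : R | 0 < y /\ (y%:E < l)%E] :> set Z by [].
rewrite -[X in measurable X]setTI; apply: measurable_snd => //.
case: l => [l| |].
- rewrite (_ : [set y | _] = `]0, l[%classic) //.
  by apply/seteqP; split => y /=; rewrite in_itv/= lte_fin; [move=> []->|move=> /andP].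
- rewrite (_ : [set y | _] = `]0, +oo[%classic) //.
  by apply/seteqP; split => y /=; rewrite in_itv/= andbT ?ltry; [move=> []|].
- by rewrite (_ : [set y | _] = set0) // -subset0 => y /= [_]; rewrite ltNge leNye.
Qed.

(** Test functions have their support in the open strip, so the vanishing is proved on boxes
    compactly inside it and spread by a countable union. *)
Lemma strip_cover (l : \bar R) : exists p q : nat -> option 'I_N -> R,
  (forall n, closed_box (p n) (q n) `<=` strip l) /\
  strip l `<=` \bigcup_n open_box (p n) (q n).
Proof.
have harm (e : R) : 0 < e -> exists n : nat, forall m, (n <= m)%N -> m.+1%:R^-1 < e.
  move=> e0; have i0 : 0 <= e^-1 by rewrite invr_ge0 ltW.
  exists (Num.bound e^-1) => m nm; rewrite invf_plt ?posrE//.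
  by apply: lt_le_trans (archi_boundP i0) _; rewrite ler_nat leqW.
exists (fun n i => if i is Some _ then - n%:R else n.+1%:R^-1).
(* For l = -oo the upper end 0 lies below the lower end 1/(n+1), which makes the box empty, like the
   strip. *)
exists (fun n i => if i is Some _ then n%:R
  else if l is l'%:E then l' - n.+1%:R^-1 else if l == -oo%E then 0 else n%:R).
have n0 n : 0 < n.+1%:R^-1 :> R by rewrite invr_gt0.
split => [n z /(_ None) /= /andP[h1 h2]|z [z0 zl]].
  split; first exact: lt_le_trans h1.
  case: l h2 => [l h2| |/=]; rewrite ?ltry//.
    by rewrite lte_fin; apply: le_lt_trans h2 _; rewrite gtrBl.
  by move=> h2; have := lt_le_trans (n0 n) (le_trans h1 h2); rewrite ltxx.
have [n1 H1] := harm _ z0.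
have [n2 H2] : exists n2, forall m, (n2 <= m)%N ->
    z.2 < (if l is l'%:E then l' - m.+1%:R^-1 else if l == -oo%E then 0 else m%:R).
  case: l zl => [l| |] /=; last by rewrite ltNge leNye.
    rewrite lte_fin -subr_gt0 => /harm [n Hn]; exists n => m /Hn h.
    by rewrite ltrBrDr -ltrBrDl.
  move=> _; exists (Num.bound z.2) => m nm.
  by apply: lt_le_trans (archi_boundP (ltW z0)) _; rewrite ler_nat.
exists (maxn (Num.bound `|z|) (maxn n1 n2)) => //; set n := maxn _ _.
have [/= b1 b2 b3] : [/\ Num.bound `|z| <= n, n1 <= n & n2 <= n]%N.
  by rewrite /n !leq_max !leqnn ?orbT.
move=> [j|]; last by rewrite H1 ?H2.
rewrite -ltr_norml; apply: le_lt_trans (vcoor_norm (Some j) z) _.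
by apply: lt_le_trans (archi_boundP (normr_ge0 z)) _; rewrite ler_nat.
Qed.

Lemma strip_ae0 (l : \bar R) (g : Z -> R) : measurable_fun (strip l) g ->
  (n2 mu (strip l) g < +oo)%E ->
  (forall phi, test_function phi -> supp phi `<=` strip l ->
    (\int[mu]_(z in strip l) (g z * phi z)%:E = 0)%E) ->
  {ae mu, forall z, strip l z -> g z = 0}.
Proof.
move=> mg g2 H0; have [p [q [H1 H2]]] := strip_cover l.
have : {ae mu, forall z, forall n, open_box (p n) (q n) z -> g z = 0}.
  apply: ae_foralln => n.
  exact: open_box_ae0 (measurable_strip l) mg g2 H0 (H1 n).
move=> [A [mA A0 HA]]; exists A; split => // z nz; apply: HA => /= Hz.
by apply: nz => /H2 [n _]; exact: Hz.
Qed.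

(** [weak_deriv] picks an arbitrary weak derivative; this is what allows one to compute with it. Any
    two differ by a function orthogonal to all test functions. *)
Lemma weak_deriv_unique (l : \bar R) v (f g1 g2 : V -> R) : L2 l f ->
  is_weak_deriv l v f g1 -> is_weak_deriv l v f g2 ->
  {ae mu, forall z, strip l z -> g1 z = g2 z}.
Proof.
move=> _ [[m1 n1] H1] [[m2 n2'] H2]; have mS := measurable_strip l.
have : {ae mu, forall z, strip l z -> (g1 \- g2) z = 0}.
  apply: strip_ae0; first exact: measurable_funB.
    exact: n2B_lty.
  move=> phi tp sp; have mp : measurable_fun (strip l) phi.
    by apply: measurable_funTS; exact: test_measurable.
  have p2 := test_n2 mS tp.
  have I1 := integrable_mul mS m1 mp n1 p2.
  have I2 := integrable_mul mS m2 mp n2' p2.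
  under eq_integral do rewrite /= mulrBl EFinB.
  rewrite integralB//; have := H2 phi tp sp; rewrite H1// => /eqP.
  rewrite eqe_opp => /eqP ->; rewrite subee//; exact: integrable_fin_num.
by apply: filterS => z H /H /eqP; rewrite subr_eq0 => /eqP.
Qed.

Lemma weak_deriv_test (l : \bar R) v (f : V -> R) : test_function f ->
  is_weak_deriv l v f ('D_v f).
Proof.
move=> tf; have mS := measurable_strip l; split.
  split; first by apply: measurable_funTS; apply: test_measurable; exact: test_D.
  exact/test_n2/test_D.
move=> phi tp sp.
have E1 := @integral_supp _ _ _ (fun z => (f z * 'D_v phi z)%:E) mS.
have E2 := @integral_supp _ _ _ (fun z => ('D_v f z * phi z)%:E) mS.
rewrite E1; last by move=> z nz; rewrite D_notin_supp ?mulr0// => /sp.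
rewrite E2; last by move=> z nz; rewrite (@supp_notin _ _ phi) ?mulr0// => /sp.
exact: integral_parts tf.1 tp.
Qed.

Lemma L2_test (l : \bar R) (f : V -> R) : test_function f -> L2 l f.
Proof.
move=> tf; split; first by apply: measurable_funTS; exact: test_measurable.
by apply: test_n2 => //; exact: measurable_strip.
Qed.

Lemma weak_derivB (l : \bar R) v (f1 f2 g1 g2 : V -> R) : L2 l f1 -> L2 l f2 ->
  is_weak_deriv l v f1 g1 -> is_weak_deriv l v f2 g2 ->
  is_weak_deriv l v (f1 \- f2) (g1 \- g2).
Proof.
move=> [mf1 nf1] [mf2 nf2] [[m1 n1] H1] [[m2 n2'] H2].
have mS := measurable_strip l; split.
  by split; [exact: measurable_funB|exact: n2B_lty].
move=> phi tp sp.
have mp : measurable_fun (strip l) phi.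
  by apply: measurable_funTS; exact: test_measurable.
have mdp : measurable_fun (strip l) ('D_v phi).
  by apply: measurable_funTS; apply: test_measurable; exact: test_D.
have p2 := test_n2 mS tp; have dp2 := test_n2 mS (test_D v tp).
have I1 := integrable_mul mS m1 mp n1 p2.
have I2 := integrable_mul mS m2 mp n2' p2.
have J1 := integrable_mul mS mf1 mdp nf1 dp2.
have J2 := integrable_mul mS mf2 mdp nf2 dp2.
under eq_integral do rewrite /= mulrBl EFinB.
under [in RHS]eq_integral do rewrite /= mulrBl EFinB.
rewrite !integralB// H1// H2//.
rewrite -(fineK (integrable_fin_num mS I1)) -(fineK (integrable_fin_num mS I2)).
by rewrite -!EFinN -!EFinD; congr EFin; ring.
Qed.

End fundamental_lemma.

(** * Rearrangements on measure spaces *)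

Section decreasing_rearrangement.
Context d (T : measurableType d) (R : realType)
  (m : {sigma_finite_measure set T -> \bar R}).
Implicit Types f g w : T -> R.

Definition dfun f (t : R) : \bar R := m [set q | t < f q].

(** Decreasing rearrangement on the half-line. When no level has a small enough superlevel set the
    infimum is that of the empty set, 0; hence the nonemptiness hypotheses that follow. *)
Definition star f (r : R) : R := inf [set t | 0 <= t /\ (dfun f t <= r%:E)%E].

Lemma measurable_gt f (t : R) : measurable_fun setT f -> measurable [set q | t < f q].
Proof.
by move=> mf; rewrite -[X in measurable X]setTI; apply: measurable_fun_ltr => //;
  exact: measurable_cst.
Qed.

Lemma dfun_ge0 f t : (0 <= dfun f t)%E. Proof. exact: measure_ge0. Qed.

Lemma le_dfun f s t : measurable_fun setT f -> s <= t -> (dfun f t <= dfun f s)%E.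
Proof.
move=> mf st; apply: le_measure; rewrite ?inE; try exact: measurable_gt.
by move=> q /=; exact: le_lt_trans.
Qed.

(** Right continuity of the distribution function: {t < f} is the increasing union of the sets {t +
    1/(n+1) < f}. *)
Lemma dfun_gt_right f t (r : \bar R) : measurable_fun setT f ->
  (r < dfun f t)%E -> exists2 t', t < t' & (r < dfun f t')%E.
Proof.
move=> mf rt; apply: contrapT => H.
have H' (n : nat) : (dfun f (t + n.+1%:R^-1) <= r)%E.
  rewrite leNgt; apply/negP => h; apply: H; exists (t + n.+1%:R^-1) => //.
  by rewrite ltrDl invr_gt0.
have : (dfun f (t + n.+1%:R^-1))%E @[n --> \oo] --> dfun f t.
  rewrite {2}/dfun (_ : [set q | t < f q] = \bigcup_n [set q | t + n.+1%:R^-1 < f q]).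
    apply: nondecreasing_cvg_mu.
    - by move=> n; exact: measurable_gt.
    - by apply: bigcupT_measurable => n; exact: measurable_gt.
    - apply/nondecreasing_seqP => n; apply/subsetPset => q /=; apply: le_lt_trans.
      by rewrite lerD2l lef_pV2 ?posrE// ler_nat.
  apply/seteqP; split => [q /= tq|q [n _] /=]; last first.
    by apply: lt_trans; rewrite ltrDl invr_gt0.
  have : 0 < f q - t by rewrite subr_gt0.
  move=> e0; have i0 : 0 <= (f q - t)^-1 by rewrite invr_ge0 ltW.
  exists (Num.bound (f q - t)^-1) => //=; rewrite -ltrBrDl invf_plt ?posrE//.
  by apply: lt_le_trans (archi_boundP i0) _; rewrite ler_nat.
move=> c; have : (dfun f t <= r)%E by apply: cvge_to_le c _; exact: nearW.
by rewrite leNgt rt.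
Qed.

Lemma star_ge0 f r : 0 <= star f r.
Proof.
rewrite /star; have [->|/set0P ne] := eqVneq [set t | 0 <= t /\ (dfun f t <= r%:E)%E] set0.
  by rewrite inf0.
by apply: lb_le_inf => // t [].
Qed.

Lemma star_empty f r : ~ (exists t, 0 <= t /\ (dfun f t <= r%:E)%E) -> star f r = 0.
Proof.
move=> H; rewrite /star (_ : [set t | _] = set0) ?inf0//.
by rewrite -subset0 => t ht; apply: H; exists t.
Qed.

(** The Galois connection through which superlevel sets of the rearrangement are computed;
    strictness comes from right continuity of the distribution function. *)
Lemma star_lt f r t : measurable_fun setT f ->
  (exists t, 0 <= t /\ (dfun f t <= r%:E)%E) -> 0 <= t ->
  (t < star f r) = (r%:E < dfun f t)%E.
Proof.
move=> mf ne t0; apply/idP/idP => [|rt].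
  apply: contraTT; rewrite -!leNgt => dt; apply: ge_inf; last by split.
  by exists 0 => s [].
have [t' tt' rt'] := dfun_gt_right mf rt.
apply: lt_le_trans tt' _; apply: lb_le_inf => // s [s0 sr].
rewrite leNgt; apply/negP => st; have := le_dfun mf (ltW st).
by move=> /le_trans /(_ sr); rewrite leNgt rt'.
Qed.

Lemma chebyshev_dfun f t : measurable_fun setT f -> (forall q, 0 <= f q) -> 0 <= t ->
  ((t ^+ 2)%:E * dfun f t <= n2 m setT f)%E.
Proof.
move=> mf f0 t0; have mA := measurable_gt t mf.
rewrite /dfun -[X in m X]setIT -integral_indic// -ge0_integralZl_EFin ?sqr_ge0//.
- apply: ge0_le_integral => //.
  + by move=> q _; rewrite -EFinM lee_fin mulr_ge0 ?sqr_ge0// indicE.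
  + by apply/measurable_EFinP; apply: measurable_funM => //; exact: measurable_indic.
  + exact: measurable_sqrE.
  + move=> q _; rewrite -EFinM lee_fin indicE.
    case: (boolP (_ \in _)) => [/set_mem /= h|_].
      by rewrite mulr1 lerXn2r ?nnegrE// ltW.
    by rewrite mulr0 sqr_ge0.
- by apply/measurable_EFinP; exact: measurable_indic.
Qed.

(** Square integrability gives superlevel sets of measure at most r for every r > 0, which excludes
    the degenerate empty infimum in [star]. Nonnegativity is required everywhere, not almost
    everywhere. *)
Definition good f := [/\ measurable_fun setT f, forall q, 0 <= f q & (n2 m setT f < +oo)%E].

Lemma good_ne f r : good f -> 0 < r -> exists t, 0 <= t /\ (dfun f t <= r%:E)%E.
Proof.
move=> [mf f0 f2] r0; have E := n2_fin f2; set a := fine _ in E.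
have a0 : 0 <= a by exact/fine_ge0/n2_ge0.
have t1 : 1 <= 1 + a / r by rewrite lerDl divr_ge0// ltW.
have t0 : 0 <= 1 + a / r by apply: le_trans t1.
(* With t = 1 + a/r one has t^2 r >= t r >= a, so Chebyshev's bound a / t^2 is at most r. *)
exists (1 + a / r); split => //.
have := chebyshev_dfun mf f0 t0; rewrite E.
rewrite -[X in (_ -> X)%type]/(is_true (dfun f (1 + a / r) <= r%:E)%E).
have tt0 : 0 < (1 + a / r) ^+ 2 by rewrite exprn_gt0// (lt_le_trans ltr01).
rewrite -lee_pdivlMl// => /le_trans; apply; rewrite -EFinM lee_fin.
rewrite ler_pdivrMl//; apply: (@le_trans _ _ ((1 + a / r) * r)).
  by rewrite mulrDl mul1r divfK ?gt_eqF// lerDr ltW.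
by rewrite ler_wpM2r ?(ltW r0)// expr2 ler_peMl.
Qed.

Lemma star_noninc f r s : measurable_fun setT f ->
  (exists t, 0 <= t /\ (dfun f t <= r%:E)%E) -> r <= s -> star f s <= star f r.
Proof.
move=> mf [t [t0 tr]] rs; apply: lb_le_inf; first by exists t.
move=> t' [t'0 t'r]; apply: ge_inf; first by exists 0 => ? [].
by split => //; apply: le_trans t'r _; rewrite lee_fin.
Qed.

(** Tonelli on the region 0 < s < f(q) under the graph. The weight [w] allows a second application
    to the other factor of a product. *)
Lemma layer_weight f w : measurable_fun setT f -> measurable_fun setT w ->
  (forall q, 0 <= f q) -> (forall q, 0 <= w q) ->
  (\int[m]_q (f q * w q)%:E =
   \int[lebesgue_measure]_(s in `]0%R, +oo[) \int[m]_q (\1_[set q | s < f q] q * w q)%:E)%E.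
Proof.
move=> mf mw f0 w0.
pose F (z : T * measurableTypeR R) : R := (\1_[set z | 0 < z.2 /\ z.2 < f z.1] z * w z.1)%R.
have mset : measurable [set z : T * measurableTypeR R | 0 < z.2 /\ z.2 < f z.1].
  rewrite (_ : [set z | _] = [set z : T * measurableTypeR R | 0 < z.2] `&`
    [set z : T * measurableTypeR R | z.2 < f z.1])//.
  apply: measurableI; rewrite -[X in measurable X]setTI; apply: measurable_fun_ltr => //.
  exact: measurableT_comp mf measurable_fst.
have mF : measurable_fun setT F.
  apply: measurable_funM; first exact: measurable_indic.
  exact: measurableT_comp mw measurable_fst.
have F0 z : (0 <= (F z)%:E)%E by rewrite lee_fin mulr_ge0// indicE.
have mEF : measurable_fun setT (EFin \o F) by exact/measurable_EFinP.
have := @fubini_tonelli _ _ T (measurableTypeR R) R m lebesgue_measure (EFin \o F) mEF F0.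
rewrite /fubini_F /fubini_G /= => H.
transitivity (\int[m]_x \int[lebesgue_measure]_y (F (x, y))%:E)%E.
  apply: eq_integral => q _; under [RHS]eq_integral do rewrite /F /= mulrC EFinM.
  rewrite ge0_integralZl_EFin//=; last first.
    apply/measurable_EFinP; apply: measurableT_comp (measurable_indic mset) _.
    exact: pair1_measurable.
  have -> : (\int[lebesgue_measure]_s (\1_[set z : T * R | 0 < z.2 /\ z.2 < f z.1] (q, s))%:E
      = (f q)%:E :> \bar R)%E; last by rewrite -EFinM mulrC.
  rewrite (_ : (fun s => _) = (fun s => (\1_(`]0, f q[%classic) s)%:E)); last first.
    apply/funext => s; rewrite !indicE; congr EFin; congr (nat_of_bool _)%:R.
    apply/idP/idP => [/set_mem /= [h1 h2]|/set_mem /=]; first by apply/mem_set; rewrite /= in_itv/= h1.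
    by rewrite in_itv/= => /andP[h1 h2]; apply/mem_set.
  transitivity (lebesgue_measure (`]0, f q[%classic : set R)).
    by rewrite integral_indic ?setIT.
  rewrite lebesgue_measure_itv/= lte_fin.
  have [h|h] := ltP 0 (f q); first by rewrite -EFinD subr0.
  by congr EFin; apply/eqP; rewrite eq_le h f0.
rewrite H [RHS]integral_mkcond; apply: eq_integral => s _.
rewrite patchE; case: ifPn => [/set_mem|/negP hs].
  rewrite /= in_itv/= andbT => s0; apply: eq_integral => q _; rewrite /F; congr (_ * _)%:E.
  rewrite !indicE; congr (nat_of_bool _)%:R.
  by apply/idP/idP => /set_mem /=; [move=> [_ ?]|move=> ?]; exact/mem_set.
apply: integral0_eq => q _; rewrite /F indicE; case: (boolP (_ \in _)); rewrite ?mul0r//.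
by move=> /set_mem /= [s0 _]; exfalso; apply: hs; apply/mem_set; rewrite /= in_itv/= s0.
Qed.

Lemma measurable_layer f w : measurable_fun setT f -> measurable_fun setT w ->
  (forall q, 0 <= w q) ->
  measurable_fun (`]0%R, +oo[%classic : set (measurableTypeR R))
    (fun s : measurableTypeR R => \int[m]_q (\1_[set q | s < f q] q * w q)%:E)%E.
Proof.
move=> mf mw w0; apply: measurable_funTS.
pose F (z : measurableTypeR R * T) : R := (\1_[set z | z.1 < f z.2] z * w z.2)%R.
have mF : measurable_fun setT F.
  apply: measurable_funM; last exact: measurableT_comp mw measurable_snd.
  apply: measurable_indic; rewrite -[X in measurable X]setTI.
  apply: measurable_fun_ltr => //; exact: measurableT_comp mf measurable_snd.
apply: (@measurable_fun_fubini_tonelli_F _ _ _ _ _ m (EFin \o F)).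
  exact/measurable_EFinP.
by move=> z; rewrite lee_fin mulr_ge0// indicE.
Qed.

Lemma layer_cake f : measurable_fun setT f -> (forall q, 0 <= f q) ->
  (\int[m]_q (f q)%:E = \int[lebesgue_measure]_(s in `]0%R, +oo[) dfun f s)%E.
Proof.
move=> mf f0; rewrite -[LHS](_ : \int[m]_q (f q * cst 1 q)%:E = _)%E; last first.
  by apply: eq_integral => q _; rewrite mulr1.
rewrite layer_weight//; apply: eq_integral => s _.
under eq_integral do rewrite mulr1.
by rewrite integral_indic ?setIT//; exact: measurable_gt.
Qed.


End decreasing_rearrangement.

Lemma measure_eq_ae d (T : measurableType d) (R : realType)
    (mu : {measure set T -> \bar R}) (A B : set T) : measurable A -> measurable B ->
  {ae mu, forall x, A x <-> B x} -> mu A = mu B.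
Proof.
move=> mA mB AB; rewrite -[A]setIT -[B]setIT -!integral_indic//.
apply: ge0_ae_eq_integral => //.
- by apply/measurable_EFinP; exact: measurable_indic.
- by apply/measurable_EFinP; exact: measurable_indic.
apply: filterS AB => x [h1 h2] _; congr EFin; rewrite !indicE; congr (nat_of_bool _)%:R.
by apply/idP/idP => /set_mem h; apply/mem_set; [exact: h1|exact: h2].
Qed.

Section joint_measurability.
Context d d' (X : measurableType d) (T : measurableType d') (R : realType)
  (m : {sigma_finite_measure set T -> \bar R}).

Lemma measurable_dfun (F : X * T -> R) (c : R) : measurable_fun setT F ->
  measurable_fun setT (fun x => dfun m (fun q => F (x, q)) c).
Proof.
move=> mF; have := @measurable_fun_xsection _ _ X T R m _ (measurable_gt c mF).
by apply: eq_measurable_fun => x _ /=; congr (m _); apply/seteqP; split => q /=;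
  rewrite /xsection /= => h; [exact: set_mem|exact: mem_set].
Qed.

(** Superlevel sets are measurable because c < hat means 2|y| < dfun c, and dfun is measurable in x.
    The union over integer levels says that the infimum defining [star] runs over a nonempty set. *)
Lemma measurable_hat_joint (F : X * T -> R) : measurable_fun setT F ->
  measurable_fun [set: X * measurableTypeR R]
    (fun z => star m (fun q => F (z.1, q)) (2 * `|z.2|)).
Proof.
move=> mF; apply: (measurability _ (RGenOInfty.measurableE R)).
move=> _ [_ [c ->] <-]; rewrite setTI.
pose D t (z : X * measurableTypeR R) := dfun m (fun q => F (z.1, q)) t.
pose N (z : X * measurableTypeR R) : \bar R := (2 * `|z.2|)%:E.
have mD t : measurable_fun setT (D t).
  exact: measurableT_comp (measurable_dfun t mF) measurable_fst.
have mN : measurable_fun setT N.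
  apply/measurable_EFinP; apply: measurable_funM; first exact: measurable_cst.
  exact: measurableT_comp (@normr_measurable _ _) measurable_snd.
have msec x : measurable_fun setT (fun q => F (x, q)).
  by apply: (measurableT_comp mF); exact: pair1_measurable.
have [c0|c0] := ltP c 0.
  rewrite (_ : _ @^-1` _ = setT) //; apply/seteqP; split => // z _ /=.
  by rewrite in_itv/= andbT; apply: lt_le_trans c0 (star_ge0 _ _ _).
rewrite (_ : _ @^-1` _ = (\bigcup_(n in [set: nat]) [set z | (D n%:R z <= N z)%E]) `&`
    [set z | (N z < D c z)%E]).
  apply: measurableI.
    apply: bigcupT_measurable => n; rewrite -[X in measurable X]setTI.
    exact: measurable_lee.
  by rewrite -[X in measurable X]setTI; exact: measurable_lte.
have ne z : (exists t, 0 <= t /\ (D t z <= N z)%E) -> exists n : nat, (D n%:R z <= N z)%E.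
  move=> [t [t0 tz]]; exists (Num.bound t); apply: le_trans tz.
  by apply: le_dfun => //; exact/ltW/archi_boundP.
apply/seteqP; split => z /=; rewrite in_itv/= andbT.
  move=> h; have nez : exists t, 0 <= t /\ (D t z <= N z)%E.
    by apply: contrapT => /(star_empty) e; move: h; rewrite e ltNge c0.
  have [n hn] := ne _ nez; split; first by exists n.
  by rewrite -star_lt.
by move=> [[n _ hn] h]; rewrite star_lt//; exists n%:R; split.
Qed.

End joint_measurability.

Section symmetric_rearrangement.
Context d (T : measurableType d) (R : realType)
  (m : {sigma_finite_measure set T -> \bar R}).
Implicit Types f g : T -> R.
Local Notation lam := (@lebesgue_measure R).
Local Notation rearr_dfun := dfun.
Local Notation dfun := (dfun m).

Definition hat f (y : R) : R := star m f (2 * `|y|).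

Lemma hat_ge0 f y : 0 <= hat f y. Proof. exact: star_ge0. Qed.

Lemma hat_lt f y t : good m f -> y != 0 -> 0 <= t ->
  (t < hat f y) = ((2 * `|y|)%:E < dfun f t)%E.
Proof.
move=> gf y0 t0; apply: star_lt => //; first by case: gf.
by apply: good_ne gf _; rewrite mulr_gt0// normr_gt0.
Qed.

Lemma lebesgue_interval_norm (D : \bar R) : (0 <= D)%E ->
  lam [set y | ((2 * `|y|)%:E < D)%E] = D.
Proof.
case: D => [D|_|//]; last first.
  rewrite (_ : [set y | _] = setT); last by apply/seteqP; split => y //= _; rewrite ltry.
  by rewrite -set_itvNyy lebesgue_measure_itv.
rewrite lee_fin => D0.
rewrite (_ : [set y | _] = `](- (D / 2)), (D / 2)[%classic); last first.
  apply/seteqP; split => y /=; rewrite in_itv/= lte_fin -ltr_norml ltr_pdivlMr// mulrC//.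
rewrite lebesgue_measure_itv/= lte_fin; case: ifPn => h.
  by rewrite -EFinD; congr EFin; field.
by congr EFin; move: h; rewrite -leNgt => h; lra.
Qed.

Lemma measurable_norm_lt (D : \bar R) :
  measurable ([set y | ((2 * `|y|)%:E < D)%E] : set (measurableTypeR R)).
Proof.
rewrite -[X in measurable X]setTI; apply: emeasurable_fun_infty_o => //.
apply/measurable_EFinP; apply: measurable_funM; first exact: measurable_cst.
exact: normr_measurable.
Qed.

Lemma ae_neq0 : {ae lam, forall y : R, y != 0}.
Proof.
exists [set 0]; split; [exact: measurable_set1|exact: lebesgue_measure_set1|].
by move=> y /= /negP; rewrite negbK => /eqP.
Qed.

Lemma measurable_hat f : measurable_fun setT f ->
  measurable_fun [set: measurableTypeR R] (hat f).
Proof.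
move=> mf.
have mF : measurable_fun setT (fun z : measurableTypeR R * T => f z.2).
  exact: measurableT_comp mf measurable_snd.
have := measurable_hat_joint m mF.
move=> /measurableT_comp /(_ (@pair1_measurable _ _ (measurableTypeR R) _ 0)).
exact.
Qed.

(* Superlevel sets of a symmetric rearrangement are intervals centred at 0. *)
Lemma dfun_hat f t : good m f -> 0 <= t -> (rearr_dfun lam) (hat f) t = dfun f t.
Proof.
move=> gf t0; rewrite -[RHS]lebesgue_interval_norm ?dfun_ge0//.
have mf : measurable_fun setT f by case: gf.
apply: measure_eq_ae.
- exact: (@measurable_gt _ (measurableTypeR R) R (hat f) t (measurable_hat mf)).
- exact: measurable_norm_lt.
by apply: ae_imp ae_neq0 _ => y y0; rewrite /= hat_lt.
Qed.

(** Equimeasurability and the layer-cake formula for the p-th powers: s < f^p is s^(1/p) < f. *)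
Lemma hat_Lp f (p : R) : good m f -> 0 < p ->
  (\int[lam]_y (hat f y `^ p)%:E = \int[m]_q (f q `^ p)%:E)%E.
Proof.
move=> gf p0; have [mf f0 _] := gf; have mh := measurable_hat mf.
have root (s x : R) : 0 < s -> 0 <= x -> (s < x `^ p) = (s `^ p^-1 < x).
  move=> s0 x0; have sE : (s `^ p^-1) `^ p = s.
    by rewrite -powRrM mulVf ?gt_eqF// powRr1// ltW.
  rewrite -{1}sE; apply/idP/idP.
    apply: contraTT; rewrite -!leNgt => h.
    by apply: ge0_ler_powR; rewrite ?nnegrE ?powR_ge0// ltW.
  by apply: gt0_ltr_powR; rewrite ?nnegrE ?powR_ge0.
rewrite (@layer_cake _ (measurableTypeR R) R lam (fun y => hat f y `^ p)); last 2 first.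
- exact: (measurableT_comp (@measurable_powR R p) mh).
- by move=> y; exact: powR_ge0.
rewrite (@layer_cake _ _ _ _ (fun q => f q `^ p)); last 2 first.
- exact: (measurableT_comp (@measurable_powR R p) mf).
- by move=> q; exact: powR_ge0.
apply: eq_integral => s /set_mem; rewrite /= in_itv/= andbT => s0.
transitivity ((rearr_dfun lam) (hat f) (s `^ p^-1)).
  by congr (lam _); apply/seteqP; split => y /=; rewrite root ?hat_ge0.
rewrite dfun_hat ?powR_ge0//.
by congr (m _); apply/seteqP; split => y /=; rewrite root.
Qed.

(** Two layer-cake formulas reduce the claim to superlevel sets. Those of the rearrangements are, up
    to a null set, intervals centred at 0, hence nested: their intersection has the smaller of the
    two measures, which bounds the intersection of the original sets. *)
Lemma hardy_littlewood f g : good m f -> good m g ->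
  (\int[m]_q (f q * g q)%:E <= \int[lam]_y (hat f y * hat g y)%:E)%E.
Proof.
move=> gf gg; have [mf f0 _] := gf; have [mg g0 _] := gg.
have mhf := measurable_hat mf; have mhg := measurable_hat mg.
have ind0 (U : Type) (A : set U) q : 0 <= \1_A q :> R by rewrite indicE.
have mind s : measurable_fun setT (\1_[set q | s < f q] : T -> R).
  by apply: measurable_indic; exact: measurable_gt.
have mindh s : measurable_fun [set: measurableTypeR R] (\1_[set y | s < hat f y] : R -> R).
  by apply: measurable_indic; exact: measurable_gt.
rewrite layer_weight// (@layer_weight _ (measurableTypeR R) R lam (hat f) (hat g))//;
  try by move=> y; exact: hat_ge0.
apply: ge0_le_integral => //.
- by move=> s _; apply: integral_ge0 => q _; rewrite lee_fin mulr_ge0.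
- exact: measurable_layer.
- by apply: (@measurable_layer _ (measurableTypeR R) R lam (hat f) (hat g)) => // y;
    exact: hat_ge0.
move=> s; rewrite /= in_itv/= andbT => s0.
under eq_integral do rewrite mulrC.
under [leRHS]eq_integral do rewrite mulrC.
rewrite layer_weight// (@layer_weight _ (measurableTypeR R) R lam (hat g)
  (\1_[set y | s < hat f y]))//; try by move=> y; exact: hat_ge0.
apply: ge0_le_integral => //.
- by move=> t _; apply: integral_ge0 => q _; rewrite lee_fin mulr_ge0.
- exact: measurable_layer.
- exact: (@measurable_layer _ (measurableTypeR R) R lam (hat g)
    (\1_[set y | s < hat f y])).
move=> t; rewrite /= in_itv/= andbT => t0.
have ii (U : Type) (A B : set U) x : \1_A x * \1_B x = \1_(A `&` B) x :> R.
  rewrite !indicE -natrM mulnb; congr (nat_of_bool _)%:R.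
  by apply/andP/idP => [[/set_mem ? /set_mem ?]|/set_mem [? ?]];
    [exact: mem_set|split; exact: mem_set].
under eq_integral do rewrite ii.
under [leRHS]eq_integral do rewrite ii.
have mA := measurable_gt t mg; have mB := measurable_gt s mf.
have mA' := @measurable_gt _ (measurableTypeR R) R (hat g) t mhg.
have mB' := @measurable_gt _ (measurableTypeR R) R (hat f) s mhf.
rewrite !integral_indic ?setIT//; try exact: measurableI.
have E : lam ([set y | t < hat g y] `&` [set y | s < hat f y]) =
    mine (dfun g t) (dfun f s).
  rewrite -[RHS]lebesgue_interval_norm; last by rewrite le_min !dfun_ge0.
  apply: measure_eq_ae; first exact: measurableI.
    exact: measurable_norm_lt.
  apply: ae_imp ae_neq0 _ => y y0; rewrite /= !hat_lt ?ltW// lt_min.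
  by split => [[-> ->]|/andP].
suff : (m ([set q | (t < g q)%R] `&` [set q | (s < f q)%R]) <= mine (dfun g t) (dfun f s))%E.
  by rewrite -E.
rewrite le_min; apply/andP; split; apply: le_measure; rewrite ?inE//;
  try exact: measurableI; by move=> q [].
Qed.

Lemma n2_hat f : good m f -> n2 lam setT (hat f) = n2 m setT f.
Proof.
move=> gf; have [_ f0 _] := gf; have p20 : 0 < 2%:R :> R by rewrite ltr0n.
rewrite -[RHS](_ : \int[m]_q (f q `^ 2%:R)%:E = _)%E; last first.
  by apply: eq_integral => q _; rewrite powR_mulrn.
rewrite -(hat_Lp gf p20); apply: eq_integral => y _.
by rewrite powR_mulrn ?hat_ge0.
Qed.

Lemma integral_mul_fin d' (U : measurableType d') (mu : {measure set U -> \bar R})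
    (f g : U -> R) : measurable_fun setT f -> measurable_fun setT g ->
  (n2 mu setT f < +oo)%E -> (n2 mu setT g < +oo)%E ->
  (\int[mu]_q (f q * g q)%:E)%E \is a fin_num.
Proof.
by move=> *; apply: integrable_fin_num => //; exact: integrable_mul.
Qed.

Lemma n2_sub_expand d' (U : measurableType d') (mu : {measure set U -> \bar R})
    (f g : U -> R) : measurable_fun setT f -> measurable_fun setT g ->
  (forall x, 0 <= f x) -> (forall x, 0 <= g x) ->
  (n2 mu setT (f \- g)%R + 2%:E * \int[mu]_q (f q * g q)%:E =
   n2 mu setT f + n2 mu setT g)%E.
Proof.
move=> mf mg f0 g0; have mfg := measurable_funM mf mg.
have := @integral_lin _ U R mu setT (fun q => (f q - g q) ^+ 2) (f \* g) 1 2 measurableT.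
rewrite !mul1e => <-//; last 3 first.
- by apply: measurable_funX; exact: measurable_funB.
- by move=> q _; exact: sqr_ge0.
- by move=> q _; exact: mulr_ge0.
have := @integral_lin _ U R mu setT (fun q => f q ^+ 2) (fun q => g q ^+ 2) 1 1 measurableT.
rewrite !mul1e => <-//; try exact: measurable_funX; try by move=> q _; exact: sqr_ge0.
by apply: eq_integral => q _; congr EFin; rewrite /=; ring.
Qed.

(** In the expansion of the squares the norms of f and g are preserved, and the product term can
    only grow, by the Hardy-Littlewood inequality. *)
Lemma hat_nonexpansive f g : good m f -> good m g ->
  (n2 lam setT (hat f \- hat g)%R <= n2 m setT (f \- g)%R)%E.
Proof.
move=> gf gg; have [mf f0 f2] := gf; have [mg g0 g2] := gg.
have mhf := measurable_hat mf; have mhg := measurable_hat mg.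
have hf2 : (n2 lam setT (hat f) < +oo)%E by rewrite n2_hat.
have hg2 : (n2 lam setT (hat g) < +oo)%E by rewrite n2_hat.
have E1 := n2_sub_expand lam mhf mhg (hat_ge0 f) (hat_ge0 g).
have E2 := n2_sub_expand m mf mg f0 g0.
have F1 := @integral_mul_fin _ _ lam _ _ mhf mhg hf2 hg2.
have F2 := @integral_mul_fin _ _ m _ _ mf mg f2 g2.
have HL := hardy_littlewood gf gg.
rewrite !n2_hat// -E2 in E1.
have N1 := n2B_lty measurableT mhf mhg hf2 hg2.
have N2 := n2B_lty measurableT mf mg f2 g2.
move: E1 HL; rewrite (n2_fin N1) (n2_fin N2) -(fineK F1) -(fineK F2) !lee_fin.
by rewrite -!EFinM -!EFinD => -[]; lra.
Qed.


Lemma hat_mono f y y' : good m f -> y != 0 -> `|y| <= `|y'| -> hat f y' <= hat f y.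
Proof.
move=> gf y0 yy'; apply: star_noninc; first by case: gf.
  by apply: good_ne gf _; rewrite mulr_gt0// normr_gt0.
by rewrite ler_pM2l.
Qed.

End symmetric_rearrangement.

(** * Variation of the rearrangement in y *)

Section variation.
Context d (T : measurableType d) (R : realType)
  (m : {sigma_finite_measure set T -> \bar R}).
Variables (D : set T) (f g : T -> R) (k : R).
Hypotheses (mD : measurable D) (gf : good m f) (mg : measurable_fun setT g)
  (g2 : (n2 m setT g < +oo)%E) (k0 : 0 <= k) (f0 : forall q, ~ D q -> f q = 0).
(* On a graph, this is the coarea inequality when almost every value is attained
   at least k times. *)
Hypothesis coarea : forall a b, 0 <= a -> a < b ->
  (0 < m (D `&` [set q | (f q <= a)%R]))%E -> (0 < m [set q | (b < f q)%R])%E ->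
  ((k * (b - a))%:E <= \int[m]_(q in [set q | (a < f q < b)%R]) `|g q|%:E)%E.
Local Notation lam := (@lebesgue_measure R).
Local Notation hatf := (hat m f).

Let mf : measurable_fun setT f. Proof. by case: gf. Qed.

(** At most 2(|y'| - |y|) of the mass lies between the levels a = hat(y') and t < b = hat(y), since
    dfun(a) <= 2|y'| and dfun(t) > 2|y|. The coarea hypothesis bounds k(t - a) by the integral of
    |g| over that set, and Cauchy-Schwarz concludes. *)
Lemma hat_variation_pointwise y y' : y != 0 -> y' != 0 -> ((2 * `|y'|)%:E < m D)%E ->
  hatf y' < hatf y ->
  (((k * (hatf y - hatf y')) ^+ 2)%:E <=
   (2 * (`|y'| - `|y|))%:E * n2 m [set q | (hatf y' < f q < hatf y)%R] g)%E.
Proof.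
move=> y0 y'0 y'D; set a := hatf y'; set b := hatf y => ab.
have a0 : 0 <= a by exact: hat_ge0.
have b0 : 0 <= b by exact: hat_ge0.
have da : (dfun m f a <= (2 * `|y'|)%:E)%E.
  by rewrite leNgt -(hat_lt gf y'0 a0) ltxx.
set G := n2 m [set q | _] g; have mab := measurable_preimage_between a b mf.
have Goo : (G < +oo)%E.
  apply: le_lt_trans g2; apply: ge0_subset_integral => //.
    exact: measurable_sqrE.
  by move=> q _; rewrite lee_fin sqr_ge0.
have E := n2_fin Goo; rewrite -/G in E; set c := fine G in E.
have c0 : 0 <= c by exact/fine_ge0/n2_ge0.
(* The set {f > a} has measure at most 2|y'| < m D, so a part of [D] of positive measure lies at
   levels <= a, as the coarea hypothesis requires. *)
have mDa : (0 < m (D `&` [set q | (f q <= a)%R]))%E.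
  have mle : measurable [set q | f q <= a].
    by rewrite -[X in measurable X]setTI; apply: measurable_fun_ler.
  rewrite lt_neqAle measure_ge0 andbT eq_sym; apply/negP => /eqP z0.
  have : (m D <= m (D `&` [set q | (f q <= a)%R]) + dfun m f a)%E.
    have mI : measurable (D `&` [set q | f q <= a]) by exact: measurableI.
    apply: le_trans (measureU2 _ mI (measurable_gt a mf)).
    apply: le_measure; rewrite ?inE//.
      by apply: measurableU => //; exact: measurable_gt.
    by move=> q Dq; case: (leP (f q) a); [left|right].
  by rewrite z0 add0e => /le_trans /(_ da); rewrite leNgt y'D.
have key t : a < t -> t < b -> (k * (t - a)) ^+ 2 <= 2 * (`|y'| - `|y|) * c.
  move=> at_ tb; have t0 : 0 <= t by exact: le_trans (ltW at_).
  have dt : ((2 * `|y|)%:E < dfun m f t)%E by rewrite -(hat_lt gf y0 t0).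
  have mat := measurable_preimage_between a t mf.
  have := coarea a0 at_ mDa (le_lt_trans _ dt).
  rewrite lee_fin mulr_ge0// => /(_ isT) co.
  set A := [set q | a < f q < t] in mat co.
  have mA : (m A <= (2 * (`|y'| - `|y|))%:E)%E.
    have : (m A + dfun m f t <= dfun m f a)%E.
      rewrite -measureU//; last 2 first.
      - exact: measurable_gt.
      - rewrite -subset0 => q [/= /andP[_ h] h']; move: (lt_trans h h').
        by rewrite ltxx.
      apply: le_measure; rewrite ?inE//; try exact: measurable_gt.
        by apply: measurableU => //; exact: measurable_gt.
      by move=> q [/andP[]//|]; exact: lt_trans.
    move=> /le_trans /(_ da) h; have := le_trans (leeD (lexx (m A)) (ltW dt)) h.
    rewrite mulrBr EFinB leeBrDr//.
  have CS : ((\int[m]_(q in A) `|g q|%:E) ^+ 2 <= m A * n2 m A g)%E.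
    have n1 : n2 m A (cst 1%R) = m A.
      by rewrite /n2; under eq_integral do rewrite /= expr1n; rewrite integral_cst// mul1e.
    have n1oo : (n2 m A (cst 1%R) < +oo)%E by rewrite n1; apply: le_lt_trans mA (ltry _).
    have gA : (n2 m A g < +oo)%E.
      apply: le_lt_trans g2; apply: ge0_subset_integral => //.
        exact: measurable_sqrE.
      by move=> q _; rewrite lee_fin sqr_ge0.
    have := @cauchy_schwarz _ _ _ m A (cst 1) g mat (measurable_cst _)
      (measurable_funTS mg) n1oo gA.
    by rewrite n1; under eq_integral do rewrite mul1r.
  rewrite -lee_fin; apply: (@le_trans _ _ ((\int[m]_(q in A) `|g q|%:E) ^+ 2)%E).
    rewrite EFin_expe !expe2; apply: lee_pmul => //; rewrite lee_fin mulr_ge0// subr_ge0 ltW//.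
  apply: le_trans CS _; rewrite EFinM -E; apply: lee_pmul => //.
    exact: n2_ge0.
  apply: ge0_subset_integral => //.
  - by apply: measurable_sqrE; exact: measurable_funTS.
  - by move=> q _; rewrite lee_fin sqr_ge0.
  - by move=> q /andP[h1 h2]; rewrite /= h1 (lt_trans h2).
rewrite E -EFinM lee_fin; set C := 2 * _ * c in key *.
set Q := (k * (b - a)) ^+ 2; have Q0 : 0 <= Q by exact: sqr_ge0.
apply/ler_addgt0Pr => e e0.
have S0 : 0 < 2 * Q + 2 * e by apply: ltr_wpDl; [exact: mulr_ge0|exact: mulr_gt0].
(* The level used is t = b - dl (b - a), since at b itself dfun is at most 2|y|. The choice of [dl]
   makes the loss 2 dl Q at most e. *)
pose dl := e / (2 * Q + 2 * e).
have dl0 : 0 < dl by rewrite divr_gt0.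
have dl1 : dl <= 2^-1 by rewrite ler_pdivrMr//; lra.
have dlQ : 2 * dl * Q <= e.
  rewrite /dl mulrAC mulrA ler_pdivrMr//; nra.
have ba0 : 0 < b - a by rewrite subr_gt0.
have := key (a + (1 - dl) * (b - a)) _ _.
rewrite addrAC subrr add0r mulrCA exprMn -/Q => /(_ _ _) h.
have {h} : (1 - dl) ^+ 2 * Q <= C by apply: h; nra.
nra.
Qed.

(** If |y| < beta/2 <= |y + h|, then y is within |h| of the end of the interval |y| < beta/2 towards
    which h points. *)
Lemma crossing_subset1 (h : R) (beta : \bar R) : exists u,
  [set y | ((2 * `|y|)%:E < beta <= (2 * `|y + h|)%:E)%E] `<=` `[u, u + `|h|].
Proof.
case: beta => [beta| |]; last 2 first.
- by exists 0 => y /=; rewrite leye_eq andbF.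
- by exists 0 => y /=.
have norm_lt (x : R) : `|x| < beta / 2 -> - (beta / 2) < x /\ x < beta / 2.
  by rewrite ltr_norml => /andP.
have norm_ge (x : R) : beta / 2 <= `|x| -> x <= - (beta / 2) \/ beta / 2 <= x.
  by rewrite ler_normr => /orP[|]; [right|left; lra].
exists (if 0 <= h then beta / 2 - h else - (beta / 2)) => y /=.
rewrite lte_fin lee_fin in_itv/= => /andP[h1 h2].
have [|h3 h4] := norm_lt y; first lra.
have [|h5|h5] := norm_ge (y + h); [lra| |];
  by case: ifPn => h0; rewrite ?(ger0_norm h0) ?ltr0_norm ?ltNge//; apply/andP;
  split; move: h0; rewrite -?ltNge => h0; lra.
Qed.

Lemma crossing_subset2 (h : R) (beta : \bar R) : exists u,
  [set y | ((2 * `|y + h|)%:E < beta <= (2 * `|y|)%:E)%E] `<=` `[u, u + `|h|].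
Proof.
have [u Hu] := crossing_subset1 (- h) beta.
exists (u - h) => y /= H; have := Hu (y + h); rewrite /= addrK normrN !in_itv/=.
by move=> /(_ H) /andP[h1 h2]; apply/andP; split; lra.
Qed.

Let lebesgue_measure_pt2 (a b : R) : lam [set a; b] = 0%E.
Proof.
apply/eqP; rewrite -measure_le0; apply: le_trans (measureU2 _ _ _) _.
- exact: measurable_set1.
- exact: measurable_set1.
have e c : lam [set c] = 0%E by exact: lebesgue_measure_set1.
by rewrite [X in (X + _ <= _)%E]e [X in (_ + X <= _)%E]e adde0.
Qed.

Lemma lebesgue_between h t : 0 <= t ->
  (lam [set y | (hatf (y + h) < t < hatf y)%R || (hatf y < t < hatf (y + h))%R]
   <= (2 * `|h|)%:E)%E.
Proof.
move=> t0; set A := [set y | _].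
have mh : measurable_fun [set: measurableTypeR R] hatf by exact: measurable_hat.
have mhh : measurable_fun [set: measurableTypeR R] (fun y => hatf (y + h)).
  apply: (measurableT_comp mh).
  by apply: measurable_funD => //; exact: measurable_cst.
have mt (F G : R -> R) : measurable_fun [set: measurableTypeR R] F ->
    measurable_fun [set: measurableTypeR R] G ->
    measurable ([set y | F y < G y] : set (measurableTypeR R)).
  by move=> mF mG; rewrite -[X in measurable X]setTI; exact: measurable_fun_ltr.
have mA : measurable (A : set (measurableTypeR R)).
  rewrite (_ : A = ([set y | hatf (y + h) < t] `&` [set y | t < hatf y]) `|`
     ([set y | hatf y < t] `&` [set y | t < hatf (y + h)])).
    by apply: measurableU; apply: measurableI; apply: mt => //; exact: measurable_cst.
  by apply/seteqP; split => y /=; [move=> /orP[/andP[]|/andP[]]; [left|right]|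
    move=> [[h1 h2]|[h1 h2]]; rewrite /A /= h1 h2 ?orbT].
have [u1 H1] := crossing_subset1 h (dfun m f t).
have [u2 H2] := crossing_subset2 h (dfun m f t).
pose I1 : set (measurableTypeR R) := `[u1, (u1 + `|h|)%R]%classic.
pose I2 : set (measurableTypeR R) := `[u2, (u2 + `|h|)%R]%classic.
have mI (u : R) : (lam `[u, (u + `|h|)%R]%classic <= (`|h|)%:E)%E.
  rewrite lebesgue_measure_itv/= lte_fin; case: ifPn => _; last by rewrite lee_fin.
  by rewrite -EFinD lee_fin addrAC subrr add0r.
apply: (@le_trans _ _ (lam (I1 `|` I2))); last first.
  apply: le_trans (measureU2 _ _ _) _; [exact: measurable_itv|exact: measurable_itv|].
  by apply: le_trans (leeD (mI _) (mI _)) _; rewrite -EFinD lee_fin; lra.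
have mI12 : measurable (I1 `|` I2) by apply: measurableU; exact: measurable_itv.
rewrite -[leRHS](@measureU0 _ _ _ _ (I1 `|` I2) ([set 0] `|` [set - h]))//; last 2 first.
- by apply: measurableU; exact: measurable_set1.
- exact: (@lebesgue_measure_pt2).
apply: le_measure; rewrite ?inE//.
  by apply: measurableU => //; apply: measurableU; exact: measurable_set1.
move=> y Ay; have [->|y0] := eqVneq y 0; first by right; left.
have [yh|yh] := eqVneq (y + h) 0; first by right; right => /=; lra.
left; move: Ay => /= /orP[] /andP[h1 h2]; [left; apply: H1|right; apply: H2] => /=;
  by rewrite -(hat_lt gf) // h2 /= leNgt -(hat_lt gf)// -leNgt ltW.
Qed.

(** The pointwise bound is integrated over y with |y + h| - |y| <= |h|, and the integrals are
    exchanged: g(q)^2 is counted for those y for which f(q) lies between hat(y) and hat(y + h), a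
    set of measure at most 2|h|. The two factors 2|h| give the 4. *)
Lemma hat_variation h :
  (\int[lam]_(y in [set y | ((2 * `|y|)%:E < m D /\ (2 * `|y + h|)%:E < m D)%E])
     ((k * (hatf (y + h) - hatf y)) ^+ 2)%:E <= (4 * h ^+ 2)%:E * n2 m setT g)%E.
Proof.
set E := [set y | _].
have mh : measurable_fun [set: measurableTypeR R] hatf by exact: measurable_hat.
have mshift : measurable_fun [set: measurableTypeR R] (fun y : measurableTypeR R => y + h : measurableTypeR R).
  by apply: measurable_funD => //; exact: measurable_cst.
have mhh := measurableT_comp mh mshift.
have mE : measurable (E : set (measurableTypeR R)).
  rewrite (_ : E = [set y | ((2 * `|y|)%:E < m D)%E] `&`
      (fun y => y + h) @^-1` [set y | ((2 * `|y|)%:E < m D)%E])//.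
  apply: measurableI; first exact: measurable_norm_lt.
  rewrite -[X in measurable X]setTI; apply: mshift => //; exact: measurable_norm_lt.
pose S : set (measurableTypeR R * T) := [set z |
  (hatf (z.1 + h) < f z.2 < hatf z.1) || (hatf z.1 < f z.2 < hatf (z.1 + h))].
pose F (z : measurableTypeR R * T) : R := g z.2 ^+ 2 * \1_S z.
have mt (G H : measurableTypeR R * T -> R) : measurable_fun setT G -> measurable_fun setT H ->
    measurable [set z | G z < H z].
  by move=> mG mH; rewrite -[X in measurable X]setTI; exact: measurable_fun_ltr.
have mf2 := measurableT_comp mf (@measurable_snd _ _ (measurableTypeR R) T).
have mh1 := measurableT_comp mh (@measurable_fst _ _ (measurableTypeR R) T).
have mhh1 := measurableT_comp mhh (@measurable_fst _ _ (measurableTypeR R) T).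
have mS : measurable S.
  rewrite (_ : S = ([set z | hatf (z.1 + h) < f z.2] `&` [set z | f z.2 < hatf z.1]) `|`
     ([set z | hatf z.1 < f z.2] `&` [set z | f z.2 < hatf (z.1 + h)])).
    by apply: measurableU; apply: measurableI; exact: mt.
  by apply/seteqP; split => z /=; [move=> /orP[/andP[]|/andP[]]; [left|right]|
    move=> [[h1 h2]|[h1 h2]]; rewrite /S /= h1 h2 ?orbT].
have mF : measurable_fun setT (EFin \o F).
  apply/measurable_EFinP; apply: measurable_funM; last exact: measurable_indic.
  by apply: measurable_funX; exact: (measurableT_comp mg measurable_snd).
have F0 z : (0 <= (EFin \o F) z)%E by rewrite lee_fin mulr_ge0 ?sqr_ge0// indicE.
have := @fubini_tonelli _ _ (measurableTypeR R) T R lam m (EFin \o F) mF F0.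
have mFF := @measurable_fun_fubini_tonelli_F _ _ (measurableTypeR R) T R m (EFin \o F) mF F0.
have mFG := @measurable_fun_fubini_tonelli_G _ _ (measurableTypeR R) T R lam (EFin \o F) mF F0.
rewrite /fubini_F /fubini_G /= in mFF mFG * => FT.
have h20 : 0 <= 2 * `|h| by rewrite mulr_ge0.
apply: (@le_trans _ _ (\int[lam]_(y in E) ((2 * `|h|)%:E * \int[m]_q (F (y, q))%:E))%E).
  apply: ae_ge0_le_integral => //.
  - by move=> y _; rewrite lee_fin sqr_ge0.
  - apply/measurable_EFinP; apply: measurable_funX; apply: measurable_funTS.
    by apply: measurable_funM; [exact: measurable_cst|exact: measurable_funB].
  - by move=> y _; rewrite mule_ge0// integral_ge0// => q _; exact: F0 (y, q).
  - apply: measurable_funTS; apply: emeasurable_funM => //; exact: measurable_cst.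
  have aeh : {ae lam, forall y : R, y + h != 0}.
    exists [set - h]; split; [exact: measurable_set1|exact: lebesgue_measure_set1|].
    by move=> y /= /negP; rewrite negbK addr_eq0 => /eqP.
  apply: ae_imp2 (@ae_neq0 R) aeh _ => y y0 yh0 [Ey Eyh].
  have bound u v (A : set T) : u != 0 -> v != 0 -> ((2 * `|v|)%:E < m D)%E ->
      hatf v < hatf u -> `|v| - `|u| <= `|h| ->
      (forall q, (hatf v < f q < hatf u) -> S (y, q)) ->
      (((k * (hatf u - hatf v)) ^+ 2)%:E <= (2 * `|h|)%:E * \int[m]_q (F (y, q))%:E)%E.
    move=> u0 v0 vD uv vuh HS; apply: le_trans (hat_variation_pointwise u0 v0 vD uv) _.
    apply: lee_pmul; rewrite ?n2_ge0//.
    - rewrite lee_fin mulr_ge0// subr_ge0 leNgt; apply/negP => vu.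
      by have := hat_mono gf v0 (ltW vu); rewrite leNgt uv.
    - by rewrite lee_fin ler_pM2l.
    rewrite /n2 integral_mkcond; apply: ge0_le_integral => //.
    - by move=> q _; rewrite patchE; case: ifPn => // _; rewrite lee_fin sqr_ge0.
    - apply/(measurable_restrictT _ (measurable_preimage_between _ _ mf)).
      by apply: measurable_sqrE; exact: measurable_funTS.
    - by apply: (measurableT_comp mF); exact: pair1_measurable.
    move=> q _; rewrite patchE; case: ifPn => [/set_mem /HS Sq|_]; last exact: F0 (y, q).
    by rewrite /F indicE mem_set// mulr1.
  have [lt1|lt2|->] := ltgtP (hatf (y + h)) (hatf y).
  - rewrite -sqrrN -mulrN opprB; apply: bound => //.
      by rewrite lerBlDl; exact: ler_normD.
    by move=> q hq; rewrite /S /= hq.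
  - apply: bound => //.
      have -> : `|y| = `|y + h - h| by rewrite addrK.
      by rewrite lerBlDl; exact: ler_normB.
    by move=> q hq; rewrite /S /= hq orbT.
  - rewrite subrr mulr0 expr0n mule_ge0// integral_ge0// => q _; exact: F0 (y, q).
apply: (@le_trans _ _ (\int[lam]_y ((2 * `|h|)%:E * \int[m]_q (F (y, q))%:E))%E).
  apply: ge0_subset_integral => //.
  - by apply: emeasurable_funM => //; exact: measurable_cst.
  - by move=> y _; rewrite mule_ge0// integral_ge0// => q _; exact: F0 (y, q).
rewrite ge0_integralZl_EFin//; last by move=> y _; rewrite integral_ge0// => q _; exact: F0 (y, q).
rewrite FT; have -> : 4 * h ^+ 2 = (2 * `|h|) * (2 * `|h|).
  by rewrite -(real_normK (num_real h)); ring.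
rewrite [(2 * `|h| * _)%:E]EFinM -muleA; apply: lee_pmul => //.
  by apply: integral_ge0 => q _; apply: integral_ge0 => y _; exact: F0 (y, q).
rewrite /n2 -ge0_integralZl_EFin//; last 2 first.
- by move=> q _; rewrite lee_fin sqr_ge0.
- exact: measurable_sqrE.
apply: ge0_le_integral => //.
- by move=> q _; rewrite integral_ge0// => y _; exact: F0 (y, q).
- by apply: emeasurable_funM; [exact: measurable_cst|exact: measurable_sqrE].
move=> q _; rewrite /F /=; under eq_integral do rewrite EFinM.
have mSq : measurable ([set y | S (y, q)] : set (measurableTypeR R)).
  by rewrite -[X in measurable X]setTI; apply: (@pair2_measurable _ _ (measurableTypeR R) T q).
rewrite ge0_integralZl_EFin ?sqr_ge0//; last first.
  apply/measurable_EFinP; apply: (measurableT_comp (measurable_indic mS)).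
  exact: pair2_measurable.
rewrite muleC; apply: lee_wpmul2r; first by rewrite lee_fin sqr_ge0.
have -> : (\int[lam]_y (\1_S (y, q))%:E = lam [set y | S (y, q)])%E.
  rewrite -[RHS](_ : lam ([set y | S (y, q)] `&` setT) = _); last by rewrite setIT.
  by rewrite -integral_indic.
by have [_ fq0 _] := gf; have := lebesgue_between h (fq0 q); rewrite /S.
Qed.

End variation.

(** * Mollification and approximation by test functions *)

Section product_sigma_finite.
Context d1 d2 (T1 : measurableType d1) (T2 : measurableType d2) (R : realType)
  (m1 : {sigma_finite_measure set T1 -> \bar R})
  (m2 : {sigma_finite_measure set T2 -> \bar R}).

(** The product measure again, carrying its sigma-finiteness, so that Tonelli's theorem applies to
    products of strips. *)
Definition sf_product : set (T1 * T2) -> \bar R := (m1 \x m2)%E.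

HB.instance Definition _ := Measure.copy sf_product (m1 \x m2)%E.

Let sf_product_sigma_finite : sigma_finite setT sf_product.
Proof.
have /sigma_finiteP[F [TF ndF Foo]] := sigma_finiteT m1.
have /sigma_finiteP[G [TG ndG Goo]] := sigma_finiteT m2.
exists (fun k => F k `*` G k).
  rewrite -setXTT TF TG predeqE => -[x y]; split.
    move=> [/= [i _ Fix] [j _ Gjy]]; exists (maxn i j) => //; split.
    - by move: x Fix; exact/subsetPset/ndF/leq_maxl.
    - by move: y Gjy; exact/subsetPset/ndG/leq_maxr.
  by move=> [i _ []/= ? ?]; split; exists i.
move=> k; have [? ?] := Foo k; have [? ?] := Goo k.
split; first exact: measurableX.
by rewrite /sf_product product_measure1E// lte_mul_pinfty// ge0_fin_numE.
Qed.

HB.instance Definition _ := Measure_isSigmaFinite.Build _ _ _ sf_product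
  sf_product_sigma_finite.

End product_sigma_finite.

Section mollifier.
Context {R : realType} {N : nat}.
Local Notation V := ('rV[R]_N * R)%type.
Local Notation Z := ('rV[R]_N * measurableTypeR R)%type.
Local Notation mu := (@lebesgue_strip R N).
Implicit Types (f g k W : V -> R) (v w z : V).

Definition vdir (i : option 'I_N) : V := if i is Some j then dir_x j else dir_y.

Lemma vcoor_inj z w : (forall i, vcoor i z = vcoor i w) -> z = w.
Proof.
move=> H; apply: injective_projections; last exact: (H None).
by apply/rowP => j; have := H (Some j); rewrite /= !(ord1 0).
Qed.

Lemma vcoor_vdir i j : vcoor j (vdir i) = (i == j)%:R.
Proof.
case: i j => [i|] [j|] //=; last by rewrite mxE.
by rewrite mxE eqxx /= eq_sym.
Qed.

Lemma vcoorZ i (h : R) z : vcoor i (h *: z) = h * vcoor i z.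
Proof. by case: i => [i|] //=; rewrite mxE. Qed.

Lemma vcoor_sum (I : Type) (s : seq I) (F : I -> V) j :
  vcoor j (\sum_(i <- s) F i) = \sum_(i <- s) vcoor j (F i).
Proof.
elim: s => [|i s IH]; first by rewrite !big_nil; case: j => [j|] //=; rewrite mxE.
by rewrite !big_cons vcoorD IH.
Qed.

Lemma vcoor_decomp w : w = \sum_(i : option 'I_N) vcoor i w *: vdir i.
Proof.
apply: vcoor_inj => j; rewrite vcoor_sum (bigD1 j)//= vcoorZ vcoor_vdir eqxx mulr1.
rewrite big1 ?addr0// => i /negbTE ij; by rewrite vcoorZ vcoor_vdir ij mulr0.
Qed.

(** The vector w is split into its coordinate steps, along each of which the mean value theorem
    applies. *)
Lemma test_lipschitz k : test_function k ->
  exists2 C, 0 <= C & forall z w, `|k (z + w) - k z| <= C * `|w|.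
Proof.
move=> tk; have sk := tk.1.
have /choice[C HC] : forall i, exists C, 0 < C /\ forall z, `|'D_(vdir i) k z| <= C.
  by move=> i; have [C C0 HC] := test_bounded (test_D (vdir i) tk); exists C.
exists (\sum_i C i); first by apply: sumr_ge0 => i _; rewrite ltW//; case: (HC i).
move=> z w; rewrite {1}(vcoor_decomp w).
have H (s : seq (option 'I_N)) z0 : `|k (z0 + \sum_(i <- s) vcoor i w *: vdir i) - k z0|
    <= (\sum_(i <- s) C i) * `|w|.
  elim: s z0 => [|i s IH] z0; first by rewrite !big_nil addr0 subrr normr0 mul0r.
  rewrite !big_cons mulrDl addrA.
  rewrite -(subrKA (k (z0 + vcoor i w *: vdir i))) [leRHS]addrC.
  have [Ci0 HCi] := HC i.
  have h2 : `|k (z0 + vcoor i w *: vdir i) - k z0| <= C i * `|w|.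
    by apply: le_trans (smooth_lipschitz _ _ sk HCi) _; rewrite ler_pM2l// vcoor_norm.
  by apply: le_trans (ler_normD _ _) _; exact: lerD (IH (z0 + vcoor i w *: vdir i)) h2.
exact: H.
Qed.

(** Mean value theorem for t -> k(z + t v) - t D_v k(z), whose derivative is O(t) by the Lipschitz
    bound on D_v k. *)
Lemma test_taylor k v : test_function k -> exists2 C, 0 <= C &
  forall z h, `|k (z + h *: v) - k z - h * 'D_v k z| <= C * h ^+ 2.
Proof.
move=> tk; have sk := tk.1; have tDk := test_D v tk.
have [C C0 HC] := test_bounded (test_D v tDk); exists C; first exact: ltW.
move=> z h.
(* One end of the interval is 0, so the intermediate point c satisfies |c| <= b - a. *)
have mvt (a b : R) : a <= b -> (a = 0 \/ b = 0) ->
    `|(k (z + b *: v) - b * 'D_v k z) - (k (z + a *: v) - a * 'D_v k z)| <=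
    C * (b - a) * (b - a).
  move=> ab ab0; have [//||c cab ->] := @MVT_segment R (fun t => k (z + t *: v) - t * 'D_v k z)
    (fun t => 'D_v k (z + t *: v) - 'D_v k z) a b ab _ _.
  - move=> x _; apply: is_deriveB; first exact: is_derive_line.
    have H : is_derive x 1 ('D_v k z \*: (@id R)) ('D_v k z *: 1) by apply: is_deriveZ.
    rewrite (_ : *%R^~ _ = 'D_v k z \*: (@id R)); last by apply/funext => t; rewrite mulrC.
    by move: H; rewrite /GRing.scale/= mulr1.
  - apply: continuous_subspaceT => x; apply: cvgB.
      by have := continuous_line (z := z) (v := v) (smooth_cont sk); apply.
    by apply: cvgM; [exact: cvg_id|exact: cvg_cst].
  rewrite normrM [`|b - a|]ger0_norm ?subr_ge0// ler_pM ?subr_ge0//.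
  apply: le_trans (smooth_lipschitz _ _ (smooth_D v sk) HC) _.
  rewrite ler_pM2l//; move: cab; rewrite in_itv/= => /andP[ac cb].
  by rewrite ler_norml; case: ab0 => e; subst; apply/andP; split; lra.
have [h0|/ltW h0] := leP 0 h.
  have := mvt 0 h h0 (or_introl erefl).
  by rewrite scale0r addr0 mul0r !subr0 -mulrA -expr2 addrAC.
have := mvt h 0 h0 (or_intror erefl).
rewrite scale0r addr0 mul0r !subr0 sub0r -mulrA -expr2 sqrrN -normrN.
by congr (`|_| <= _); ring.
Qed.

Definition cube (M : R) : set V := closed_box (fun=> - M) (fun=> M).

Lemma cubeP M z : cube M z <-> forall i, `|vcoor i z| <= M.
Proof. by split => H i; have := H i; rewrite ler_norml. Qed.

Lemma measurable_cube M : measurable (cube M : set Z).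
Proof. exact: measurable_closed_box. Qed.

Lemma test_cube k : test_function k -> exists2 M, 0 < M & forall z, ~ cube M z -> k z = 0.
Proof. by move=> /test_function_supp. Qed.

Lemma cube_translate M A z w : `|z| <= A -> cube M (w - z) -> cube (M + A) w.
Proof.
move=> zA /cubeP H; apply/cubeP => i; rewrite -(subrK z w) vcoorD.
by rewrite (le_trans (ler_normD _ _))// lerD// (le_trans (vcoor_norm _ _)).
Qed.

Section kernel.
Variables (W : V -> R).
Hypotheses (mW : measurable_fun [set: Z] W) (W2 : (n2 mu setT W < +oo)%E).

Let WI (M : R) : R := \int[mu]_w `|W w * \1_(cube M) w|.

Let integrable_cube M : mu.-integrable setT (fun w => (W w * \1_(cube M) w)%:E).
Proof.
apply: integrable_mul => //; first by apply: measurable_indic; exact: measurable_cube.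
have -> : n2 mu setT (\1_(cube M)) = mu (cube M).
  transitivity (\int[mu]_w (\1_(cube M : set Z) w)%:E)%E; last first.
    by rewrite integral_indic ?setIT//; exact: measurable_cube.
  by apply: eq_integral => w _; rewrite indicE; case: (_ \in _); rewrite ?expr1n ?expr0n.
exact: closed_box_lty.
Qed.

Let WI_ge0 M : 0 <= WI M.
Proof. by apply: Rintegral_ge0. Qed.

(** [W] is only square integrable, but the kernels vanish off a cube, on which [W] is integrable:
    limits under the integral reduce to uniform bounds on kernels. *)
Lemma kernel_bound (K : V -> R) (M c : R) : measurable_fun [set: Z] K -> 0 <= c ->
  (forall w, `|K w| <= c) -> (forall w, ~ cube M w -> K w = 0) ->
  mu.-integrable setT (fun w => (W w * K w)%:E) /\
  `|\int[mu]_w (W w * K w)| <= c * WI M.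
Proof.
move=> mK c0 Kc K0.
have le w : `|W w * K w| <= c * `|W w * \1_(cube M) w|.
  rewrite !normrM mulrCA; apply: ler_wpM2l => //.
  rewrite indicE; case: (boolP (w \in cube M)) => [|/negP h]; first by rewrite normr1 mulr1.
  by rewrite K0 ?normr0 ?mulr0// => cw; apply: h; exact: mem_set.
have iA := integrable_abse (integrable_cube M).
have icA : mu.-integrable setT (fun w => (c * `|W w * \1_(cube M) w|)%:E).
  by under eq_fun do rewrite EFinM; apply: integrableZl.
have iK : mu.-integrable setT (fun w => (W w * K w)%:E).
  apply: le_integrable icA => //.
    by apply/measurable_EFinP; exact: measurable_funM.
  by move=> w _; rewrite /= lee_fin [leRHS]ger0_norm ?mulr_ge0.
split => //; apply: le_trans (le_normr_Rintegral _ _) _ => //.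
rewrite /WI -RintegralZl//; apply: le_Rintegral => //.
exact: (integrable_abse iK).
Qed.

(** A correlation rather than a convolution: the kernel is translated, not reflected, and
    derivatives fall on it with a minus sign. *)
Definition mollify k z : R := \int[mu]_w (W w * k (w - z)).

Lemma mollify_integrable k z : test_function k ->
  mu.-integrable setT (fun w => (W w * k (w - z))%:E).
Proof.
move=> tk; have tt := test_translate (- z) tk.
have [C C0 HC] := test_bounded tt; have [M M0 HM] := test_cube tt.
by have [] := @kernel_bound (fun w => k (w - z)) M C (test_measurable tt) (ltW C0) HC HM.
Qed.

Lemma mollify_continuous k : test_function k -> continuous (mollify k).
Proof.
move=> tk z; have [C C0 HC] := test_lipschitz tk; have [M M0 HM] := test_cube tk.
apply/cvgrPdist_le => e e0.
pose I := C * WI (M + (`|z| + 1)) + 1.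
have I0 : 0 < I by rewrite ltr_wpDl// mulr_ge0.
have bound z' : `|z - z'| <= 1 -> `|mollify k z - mollify k z'| <= I * `|z - z'|.
  move=> zz'; rewrite /mollify -RintegralB//; last 2 first.
  - exact: mollify_integrable.
  - exact: mollify_integrable.
  under eq_Rintegral do rewrite -mulrBr.
  have [] := @kernel_bound (fun w => k (w - z) - k (w - z')) (M + (`|z| + 1)) (C * `|z - z'|).
  - by apply: measurable_funB; apply: test_measurable; exact: test_translate.
  - exact: mulr_ge0.
  - by move=> w; have := HC (w - z) (z - z'); rewrite addrA subrK distrC.
  - move=> w nw; rewrite !HM ?subr0// => h; apply: nw; apply: cube_translate h; rewrite ?lerDl//.
    rewrite -(subrK z z') addrC; apply: le_trans (ler_normD _ _) _.
    by rewrite lerD2l distrC.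
  move=> _ /le_trans; apply; rewrite mulrAC ler_wpM2r// /I lerDl//.
near=> z'; apply: le_trans (bound _ _) _.
  by near: z'; apply: cvgr_dist_le; [exact: cvg_id|].
rewrite mulrC -ler_pdivlMr//; near: z'; apply: cvgr_dist_le; first exact: cvg_id.
by rewrite divr_gt0.
Unshelve. all: by end_near.
Qed.

(** The second-order Taylor bound on the kernel, uniform in the point, is integrated against [W]
    over one cube that contains the supports for all |h| <= 1. *)
Lemma is_derive_mollify k z v : test_function k ->
  is_derive z v (mollify k) (mollify (\- 'D_v k) z).
Proof.
move=> tk; have [C C0 HC] := test_taylor v tk; have [M M0 HM] := test_cube tk.
have tD := test_D v tk.
have tN : test_function (\- 'D_v k).
  by rewrite (_ : \- _ = fun z => -1 * 'D_v k z); [exact: testZ|apply/funext => ?; rewrite mulN1r].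
pose I := C * WI (M + (`|z| + `|v|)) + 1.
have I0 : 0 < I by rewrite ltr_wpDl// mulr_ge0.
have D0 w : ~ cube M w -> 'D_v k w = 0.
  move=> nw; apply: D_notin_supp => sw; apply: nw; move: sw.
  by apply: supp_subset => //; exact: compact_closed V_hausdorff (@compact_closed_box _ _ _ _).
have bound (h : R) : `|h| <= 1 ->
    `|mollify k (z + h *: v) - mollify k z - h * mollify (\- 'D_v k) z| <= I * h ^+ 2.
  move=> h1; rewrite /mollify -RintegralZl//; last exact: mollify_integrable.
  have i1 := @mollify_integrable k z tk.
  have i2 := @mollify_integrable k (z + h *: v) tk.
  have i3 : mu.-integrable setT (fun w => (h * (W w * (\- 'D_v k) (w - z)))%:E).
    by under eq_fun do rewrite EFinM; apply: integrableZl => //; exact: mollify_integrable.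
  rewrite -RintegralB// -RintegralB//; last by rewrite (_ : _ \o _ = (fun w => (W w * k (w - (z + h *: v)))%:E - (W w * k (w - z))%:E)%E)//; exact: integrableB.
  have [] := @kernel_bound (fun w => k (w - (z + h *: v)) - k (w - z) + h * 'D_v k (w - z))
    (M + (`|z| + `|v|)) (C * h ^+ 2).
  - apply: measurable_funD; first by apply: measurable_funB; apply: test_measurable; exact: test_translate.
    by apply: test_measurable; apply: (testZ h); exact: test_translate tD.
  - by rewrite mulr_ge0// sqr_ge0.
  - move=> w; have := HC (w - z) (- h); rewrite sqrrN scaleNr.
    by congr (`|_| <= _); rewrite opprD addrA mulNr opprK.
  - move=> w nw; rewrite !HM ?D0 ?mulr0 ?subr0 ?addr0// => hh; apply: nw; apply: cube_translate hh.
    + by rewrite lerDl.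
    + by rewrite lerDl.
    + rewrite (le_trans (ler_normD _ _))// lerD2l normrZ; exact: ler_piMl.
  move=> _ h'; apply: (@le_trans _ _ (C * h ^+ 2 * WI (M + (`|z| + `|v|)))); last first.
    by rewrite mulrAC ler_wpM2r ?sqr_ge0// /I lerDl.
  apply: le_trans h'; rewrite le_eqVlt; apply/orP; left; apply/eqP.
  by congr `|_|; apply: eq_Rintegral => w _ /=; ring.
have cv : (fun h : R => h^-1 *: (mollify k (h *: v + z) - mollify k z)) @ 0^' -->
    mollify (\- 'D_v k) z.
  apply/cvgrPdist_le => e e0; near=> h.
  have h0 : h != 0 by near: h; exact: nbhs_dnbhs_neq.
  have h1 : `|h| <= 1 by near: h; exact: dnbhs0_le.
  have he : `|h| <= e / I by near: h; apply: dnbhs0_le; rewrite divr_gt0.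
  rewrite -(ler_pM2l (x := `|h|)) ?normr_gt0// -normrM mulrBr [_ *: _]/(_ * _) mulVKf//.
  rewrite distrC [h *: v + z]addrC; apply: le_trans (bound h h1) _.
  rewrite -real_normK ?num_real// expr2 mulrC -mulrA ler_pM2l ?normr_gt0//.
  by rewrite -ler_pdivlMr.
split; last exact: (cvg_lim (@Rhausdorff R) cv).
by apply/cvg_ex; exists (mollify (\- 'D_v k) z).
Unshelve. all: by end_near.
Qed.

(** Each derivative of a mollification is a mollification by another test function, so the induction
    on the order runs over all kernels. *)
Lemma smooth_mollify k : test_function k -> smooth (mollify k).
Proof.
move=> tk; apply/smoothP => n; elim: n k tk => [|n IH] k tk.
  split; first exact: mollify_continuous.
  by move=> z v; have [] := is_derive_mollify z v tk.
split.
  split; first exact: mollify_continuous.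
  by move=> z v; have [] := is_derive_mollify z v tk.
move=> w; rewrite (_ : 'D_w _ = mollify (\- 'D_w k)).
  apply: IH; have tD := test_D w tk.
  by rewrite (_ : \- _ = fun z => -1 * 'D_w k z); [exact: testZ|apply/funext => ?; rewrite mulN1r].
by apply/funext => z; apply: derive_val; exact: is_derive_mollify.
Qed.

End kernel.

Section jensen.
Variables (k : V -> R) (M : R).
Hypotheses (tk : test_function k) (k0 : forall w, 0 <= k w)
  (k1 : (\int[mu]_w (k w)%:E = 1)%E) (kM : forall w, ~ cube M w -> k w = 0).

Let mk : measurable_fun [set: Z] k. Proof. exact: test_measurable. Qed.

(** Jensen for the probability density [k], as Cauchy-Schwarz for f sqrt(k) and sqrt(k). *)
Lemma jensen_kernel (f : Z -> R) : measurable_fun setT f ->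
  (((\int[mu]_w (f w * k w))%R ^+ 2)%:E <= \int[mu]_w (f w ^+ 2 * k w)%:E)%E.
Proof.
move=> mf; have [fi|] := ltP (\int[mu]_w (f w ^+ 2 * k w)%:E)%E +oo%E; last first.
  by rewrite leye_eq => /eqP ->; exact: leey.
pose s w := Num.sqrt (k w).
have ms : measurable_fun [set: Z] s.
  have -> : s = (fun x : R => x `^ 2^-1) \o k.
    by apply/funext => w; rewrite /s /= powR12_sqrt.
  exact: measurableT_comp (measurable_powR _) mk.
have ss w : s w ^+ 2 = k w by rewrite sqr_sqrtr.
have e1 : n2 mu setT (fun w => f w * s w) = (\int[mu]_w (f w ^+ 2 * k w)%:E)%E.
  by apply: eq_integral => w _; rewrite exprMn ss.
have e2 : n2 mu setT s = 1%E by rewrite -k1; apply: eq_integral => w _; rewrite ss.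
have CS := @cauchy_schwarz _ _ _ mu setT (fun w => f w * s w) s measurableT
  (measurable_funM mf ms) ms.
rewrite e1 e2 mule1 in CS; apply: le_trans (CS fi (ltry _)).
have ifs : mu.-integrable setT (fun w => (f w * s w * s w)%:E).
  apply: integrable_mul => //; first exact: measurable_funM.
  - by rewrite e1.
  - by rewrite e2 ltry.
have -> : \int[mu]_w (f w * k w) = \int[mu]_w (f w * s w * s w).
  by apply: eq_Rintegral => w _; rewrite -mulrA -expr2 ss.
have h : (`|\int[mu]_w (f w * s w * s w)|%R%:E <= \int[mu]_w `|f w * s w * s w|%:E)%E.
  by rewrite EFin_normr_Rintegral//; exact: le_abse_integral (measurable_int _ ifs).
by rewrite -(real_normK (num_real _)) EFin_expe !expe2; apply: lee_pmul.
Qed.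

(** Jensen's inequality integrated over z, then Tonelli. The bound [B] is asked only for w in the
    support of the kernel, so that it is enough to control small translations. *)
Lemma jensen_n2 (S : set Z) (F : Z * Z -> R) (B : R) : measurable S -> 0 <= B ->
  measurable_fun setT F ->
  measurable_fun S (fun z => \int[mu]_w (F (z, w) * k w)) ->
  (forall w, cube M w -> (n2 mu S (fun z => F (z, w)) <= B%:E)%E) ->
  (n2 mu S (fun z => \int[mu]_w (F (z, w) * k w))%R <= B%:E)%E.
Proof.
move=> mS B0 mF mJ HB.
pose m := sf_product (lebesgue_rV R N) (@lebesgue_measure R).
pose H (p : Z * Z) : R := \1_S p.1 * (F p ^+ 2 * k p.2).
have mH : measurable_fun setT (EFin \o H).
  apply/measurable_EFinP; apply: measurable_funM.
    exact: measurableT_comp (measurable_indic mS) measurable_fst.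
  apply: measurable_funM; first exact: measurable_funX.
  exact: measurableT_comp mk measurable_snd.
have H0 p : (0 <= (EFin \o H) p)%E.
  by rewrite lee_fin mulr_ge0// ?indicE// mulr_ge0// sqr_ge0.
have := @fubini_tonelli _ _ Z Z R m m (EFin \o H) mH H0.
have mH2 := @measurable_fun_fubini_tonelli_F _ _ Z Z R m (EFin \o H) mH H0.
have mH3 := @measurable_fun_fubini_tonelli_G _ _ Z Z R m (EFin \o H) mH H0.
rewrite /fubini_F /fubini_G /= in mH2 mH3 * => FT.
apply: (@le_trans _ _ (\int[mu]_z \int[mu]_w (H (z, w))%:E)%E).
  rewrite /n2 integral_mkcond.
  apply: (ge0_le_integral mu measurableT _ ((measurable_restrictT _ mS).1 (measurable_sqrE mJ)) mH2).
    by move=> z _; apply: erestrict_ge0 => w _; rewrite lee_fin sqr_ge0.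
  move=> z _; rewrite patchE; case: ifPn => [Sz|nS]; last first.
    by apply: integral_ge0 => w _; exact: H0 (z, w).
  apply: (le_trans (@jensen_kernel (fun w => F (z, w)) _)).
    by apply: (measurableT_comp mF); exact: pair1_measurable.
  by rewrite le_eqVlt; apply/orP; left; apply/eqP; apply: eq_integral => w _;
    rewrite /H /= indicE Sz mul1r.
rewrite [X in (X <= _)%E](_ : _ = \int[mu]_w \int[mu]_z (H (z, w))%:E)%E; last exact: FT.
have mkE : measurable_fun setT (fun w : Z => (k w)%:E) by exact/measurable_EFinP.
have kE0 w : setT w -> (0 <= (k w)%:E)%E by move=> _; rewrite lee_fin.
apply: (@le_trans _ _ (\int[mu]_w (B%:E * (k w)%:E))%E); last first.
  by rewrite (ge0_integralZl_EFin mu measurableT kE0 mkE B0) k1 mule1.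
have mBk : measurable_fun setT (fun w : Z => B%:E * (k w)%:E)%E.
  by apply: emeasurable_funM => //; exact: measurable_cst.
apply: (ge0_le_integral mu measurableT _ mH3 mBk).
  by move=> w _; apply: integral_ge0 => z _; exact: H0 (z, w).
move=> w _; have [cw|ncw] := pselect (cube M w); last first.
  rewrite (kM ncw) mule0 integral0_eq// => z _.
  by rewrite /H /= (kM ncw) !mulr0.
rewrite muleC -(mule1 (k w)%:E) -muleA mul1e.
have HE z : (H (z, w))%:E = ((k w)%:E * (((fun z => (F (z, w) ^+ 2)%:E) \_ S) z))%E.
  by rewrite patchE /H /= indicE; case: ifPn => _; rewrite ?mul1r ?mul0r ?mule0// -EFinM mulrC.
under eq_integral do rewrite HE.
have mFw : measurable_fun setT (fun z => F (z, w)).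
  by apply: (measurableT_comp mF); exact: pair2_measurable.
have mFS := (measurable_restrictT _ mS).1 (measurable_sqrE (measurable_funTS mFw)).
rewrite (ge0_integralZl_EFin mu measurableT _ mFS (k0 w)); last first.
  by move=> z _; apply: erestrict_ge0 => z' _; rewrite lee_fin sqr_ge0.
by rewrite -integral_mkcond; apply: lee_wpmul2l; [rewrite lee_fin|exact: HB].
Qed.

Variable W : V -> R.
Hypotheses (mW : measurable_fun [set: Z] W) (W2 : (n2 mu setT W < +oo)%E).

Lemma mollify_shift z : mollify W k z = \int[mu]_w (W (w + z) * k w).
Proof.
rewrite /mollify /Rintegral; congr fine.
have mWk : measurable_fun setT (fun w : Z => (W w * k (w - z))%:E).
  apply/measurable_EFinP; apply: measurable_funM => //.
  exact: test_measurable (test_translate (- z) tk).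
by rewrite -(integral_strip_translate z mWk); apply: eq_integral => w _; rewrite addrK.
Qed.

Let measurable_addZ : measurable_fun setT (fun p : Z * Z => p.2 + p.1 : Z).
Proof.
apply: measurable_fun_pair => /=.
  apply: measurable_fun_rVP => i.
  rewrite (_ : _ \o _ = (fun p : Z * Z => rV_coor i p.2.1 + rV_coor i p.1.1)).
    apply: measurable_funD; apply: measurableT_comp (measurable_rV_coor i) _;
    exact: measurableT_comp measurable_fst _.
  by apply/funext => p /=; rewrite /rV_coor mxE.
by apply: measurable_funD; exact: measurableT_comp measurable_snd _.
Qed.

Let mW2 : measurable_fun setT (fun p : Z * Z => W (p.2 + p.1)).
Proof. exact: measurableT_comp mW measurable_addZ. Qed.

Let measurable_translate (v : V) : measurable_fun setT (fun z : Z => z + v : Z).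
Proof.
have := measurable_strip_map v.1 1 v.2; apply: eq_measurable_fun => z _.
by rewrite mul1r.
Qed.

Let integrable_shift z : mu.-integrable setT (fun w => (W (w + z) * k w)%:E).
Proof.
apply: integrable_mul => //.
- exact: measurableT_comp mW (measurable_translate z).
- rewrite (_ : n2 _ _ _ = n2 mu setT W)//.
  by apply: ge0_integral_strip_translate => [|w]; [exact: measurable_sqrE|rewrite lee_fin sqr_ge0].
- exact: test_n2.
Qed.

(** A difference of mollifications is the average of the differences of translates, so mean square
    difference quotients do not increase. *)
Lemma n2_mollify_diff (S : set Z) (v : V) (B : R) : measurable S -> 0 <= B ->
  (forall w, cube M w -> (n2 mu S (fun z => W (z + w + v) - W (z + w))%R <= B%:E)%E) ->
  (n2 mu S (fun z => mollify W k (z + v) - mollify W k z)%R <= B%:E)%E.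
Proof.
move=> mS B0 HB; pose F (p : Z * Z) : R := W (p.2 + (p.1 + v)) - W (p.2 + p.1).
have e : (fun z => mollify W k (z + v) - mollify W k z) =
    (fun z => \int[mu]_w (F (z, w) * k w)).
  apply/funext => z; rewrite !mollify_shift -RintegralB//; [|exact: integrable_shift|exact: integrable_shift].
  by apply: eq_Rintegral => w _; rewrite -mulrBl.
rewrite e; apply: jensen_n2 => //.
- have m1 : measurable_fun setT (fun p : Z * Z => (p.1 + v : Z, p.2)).
    by apply: measurable_fun_pair => //; exact: measurableT_comp (measurable_translate v) measurable_fst.
  by apply: measurable_funB => //; exact: measurableT_comp mW2 m1.
- rewrite -e; apply: measurable_funTS; apply: continuous_measurable_strip => z.
  have mc := mollify_continuous mW W2 tk; apply: cvgB; last exact: mc.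
  by apply: (continuous_comp (f := fun z => z + v)); [apply: cvgD; [exact: cvg_id|exact: cvg_cst]|exact: mc].
- move=> w cw; apply: le_trans (HB w cw); rewrite le_eqVlt; apply/orP; left; apply/eqP.
  by apply: eq_n2 => z _; rewrite /F /= ![w + _]addrC [z + v + w]addrAC.
Qed.

Lemma n2_mollify_sub (S : set Z) (B : R) : measurable S -> 0 <= B ->
  (forall w, cube M w -> (n2 mu S (fun z => W (z + w) - W z)%R <= B%:E)%E) ->
  (n2 mu S (fun z => mollify W k z - W z)%R <= B%:E)%E.
Proof.
move=> mS B0 HB; pose F (p : Z * Z) : R := W (p.2 + p.1) - W p.1.
have ki : mu.-integrable setT (EFin \o k) by exact: test_integrable.
have e : (fun z => mollify W k z - W z) = (fun z => \int[mu]_w (F (z, w) * k w)).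
  apply/funext => z; rewrite !mollify_shift.
  have -> : W z = \int[mu]_w (W z * k w).
    by rewrite RintegralZl// /Rintegral k1 mulr1.
  rewrite -RintegralB//.
  - by apply: eq_Rintegral => w _; rewrite -mulrBl.
  - exact: integrable_shift.
  by rewrite /comp; under eq_fun do rewrite EFinM; exact: integrableZl.
rewrite e; apply: jensen_n2 => //.
- by apply: measurable_funB => //; exact: measurableT_comp mW measurable_fst.
- rewrite -e; apply: measurable_funTS; apply: measurable_funB => //.
  by apply: continuous_measurable_strip; exact: mollify_continuous.
- move=> w cw; apply: le_trans (HB w cw); rewrite le_eqVlt; apply/orP; left; apply/eqP.
  by apply: eq_n2 => z _; rewrite /F /= [w + z]addrC.
Qed.

End jensen.

End mollifier.

Section n2_more.
Context d (T : measurableType d) (R : realType) (mu : {measure set T -> \bar R}).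
Local Open Scope ereal_scope.

Lemma n2_fatou_le (D : set T) (F : nat -> T -> R) (f : T -> R) (C : \bar R) : measurable D ->
  (forall n, measurable_fun D (F n)) ->
  (forall x, D x -> (fun n => F n x) @ \oo --> f x) ->
  (forall n, n2 mu D (F n) <= C) -> n2 mu D f <= C.
Proof.
move=> mD mF Ff HC.
have := @fatou _ _ _ mu D mD (fun n x => (F n x ^+ 2)%:E).
have h0 (n : nat) (x : T) : D x -> 0 <= (F n x ^+ 2)%:E by rewrite lee_fin sqr_ge0.
move=> /(_ (fun n => measurable_sqrE (mF n)) h0) H.
have -> : n2 mu D f = \int[mu]_(x in D) limn_einf (fun n => (F n x ^+ 2)%:E).
  apply: eq_integral => x /set_mem Dx.
  have c : (fun n => (F n x ^+ 2)%:E) @ \oo --> (f x ^+ 2)%:E.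
    by apply: cvg_EFin; [exact: nearW|rewrite !expr2; apply: cvgM; exact: Ff].
  by rewrite (cvg_limn_einf_sup c).1.
apply: le_trans H _; rewrite limn_einf_lim; apply: lime_le; first exact: is_cvg_einfs.
apply: nearW => n; apply: le_trans (HC n); apply: ereal_inf_lbound.
by exists n => /=.
Qed.

Lemma n2_near_le (D : set T) (F : nat -> T -> R) (f : T -> R) (C e : R) : measurable D ->
  (forall n, measurable_fun D (F n)) -> measurable_fun D f ->
  n2 mu D f <= C%:E -> (fun n => n2 mu D (F n \- f)%R) @ \oo --> 0 -> (0 < e)%R ->
  exists n0, forall n, (n0 <= n)%N -> n2 mu D (F n) <= (C + e)%:E.
Proof.
move=> mD mF mf fC c e0.
have C0 : (0 <= C)%R by rewrite -lee_fin; apply: le_trans fC; exact: n2_ge0.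
(* Young's inequality with parameter eta costs eta C <= e/2 on the limit and (1 + 1/eta) dl = e/2 on
   the error. *)
pose eta := (e / (2 * C + 2))%R.
have eta0 : (0 < eta)%R by rewrite divr_gt0// ltr_wpDl// mulr_ge0.
have etaC : (eta * C <= e / 2)%R.
  rewrite /eta mulrAC ler_pdivrMr ?ltr_wpDl ?mulr_ge0//; nra.
pose dl := (e / 2 / (1 + eta^-1))%R.
have eta1 : (0 < 1 + eta^-1)%R by rewrite addr_gt0// invr_gt0.
have dl0 : (0 < dl)%R by rewrite !divr_gt0.
have /cvge0P := c; move=> /(_ (fun=> n2_ge0 _ _ _)) /(_ _ dl0) [n0 Hn].
exists n0 => n /Hn h.
have -> : n2 mu D (F n) = n2 mu D (f \+ (F n \- f))%R.
  by apply: eq_n2 => x _; rewrite /= addrC subrK.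
apply: le_trans (n2D_le _ eta0 mD mf (measurable_funB (mF n) mf)) _.
apply: (@le_trans _ _ ((1 + eta)%:E * C%:E + (1 + eta^-1)%:E * dl%:E)).
  by apply: leeD; apply: lee_pmul; rewrite ?n2_ge0// lee_fin ltW// ?addr_gt0.
rewrite -!EFinM -EFinD lee_fin /dl [((1 + eta^-1) * _)%R]mulrC divfK ?gt_eqF//; nra.
Qed.

End n2_more.

Section approximation.
Context {R : realType} {N : nat}.
Local Notation V := ('rV[R]_N * R)%type.
Local Notation Z := ('rV[R]_N * measurableTypeR R)%type.
Local Notation mu := (@lebesgue_strip R N).
Implicit Types (f g k W : V -> R) (v w z : V).
Local Notation cube := (@cube R N).

Lemma norm_le_vcoor z A : 0 <= A -> (forall i, `|vcoor i z| <= A) -> `|z| <= A.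
Proof.
move=> A0 H; rewrite prod_normE ge_max; apply/andP; split; last exact: (H None).
rewrite /Num.norm/= mx_normrE; apply/bigmax_leP; split => // -[i j] _ /=.
by rewrite (ord1 i); exact: (H (Some j)).
Qed.

Lemma cube_norm A z : 0 <= A -> cube A z <-> `|z| <= A.
Proof.
move=> A0; rewrite cubeP; split => [|H i]; first exact: norm_le_vcoor.
by apply: le_trans (vcoor_norm _ _) H.
Qed.

Lemma norm_vdir i : `|vdir i : V| <= 1.
Proof.
by apply: norm_le_vcoor => // j; rewrite vcoor_vdir; case: (i == j); rewrite ?normr1 ?normr0.
Qed.

Lemma lebesgue_cube_gt0 A : 0 < A -> (0 < mu (cube A))%E.
Proof.
move=> A0; rewrite (_ : cube A =
    [set v : 'rV[R]_N | forall j, `[- A, A]%classic (v ord0 j)] `*` `[- A, A]%classic); last first.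
  apply/seteqP; split => [z H|z [/= H1 H2] [j|]].
  - split => [j|]; rewrite /= in_itv/=; [exact: (H (Some j))|exact: (H None)].
  - by have := H1 j; rewrite in_itv.
  - by move: H2; rewrite in_itv.
have mA := @measurable_rV_box R N (fun j => `[- A, A]%classic) (fun j => measurable_itv _).
have mB := @lebesgue_rV_box R N (fun j => `[- A, A]%classic) (fun j => measurable_itv _).
rewrite -[mu _]/((lebesgue_rV R N \x lebesgue_measure)%E _) product_measure1E//.
set a := (X in (X * _)%E).
have -> : a = (\prod_(j < N) lebesgue_measure `[(- A)%R, A]%classic)%E by exact: mB.
have pos : (0 < lebesgue_measure `[(- A)%R, A]%classic)%E.
  by rewrite lebesgue_measure_itv/= lte_fin gtrN// -EFinD lte_fin opprK addr_gt0.
apply: mule_gt0 => //; elim/big_ind: _ => //; exact: mule_gt0.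
Qed.

(** A bump divided by its integral, which is positive because the bump is positive on the cube of
    half size. *)
Lemma smoothing_kernel (A : R) : 0 < A -> exists k, [/\ test_function k,
  forall w, 0 <= k w, (\int[mu]_w (k w)%:E = 1)%E & forall w, ~ cube A w -> k w = 0].
Proof.
move=> A0; pose B : V -> R := box_bump (fun=> - A) (fun=> A) 1.
have tB : test_function B by apply: test_box_bump.
have iB := test_integrable tB.
have B0 w : 0 <= B w by exact: box_bump_ge0.
have BA w : ~ cube A w -> B w = 0 by exact: box_bump_eq0.
pose J := \int[mu]_w B w.
have JE : (\int[mu]_w (B w)%:E = J%:E)%E.
  by rewrite /J /Rintegral fineK//; exact: integrable_fin_num.
have J0 : 0 < J.
  rewrite lt_neqAle Rintegral_ge0 ?andbT// eq_sym; apply/eqP => e0.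
  have : (\int[mu]_w `|(B w)%:E| = 0)%E.
    by under eq_integral do rewrite gee0_abs ?lee_fin//; rewrite JE e0.
  move=> /(ae_eq_integral_abs mu measurableT (measurable_int _ iB)) => ae0.
  have := lebesgue_cube_gt0 (divr_gt0 A0 (ltr0n _ 2)).
  suff -> : mu (cube (A / 2)) = 0%E by rewrite ltxx.
  apply/negligibleP; first exact: measurable_cube.
  apply: negligibleS ae0 => w /cubeP cw /= /(_ I) [Bw].
  have : 0 < B w.
    apply: box_bump_gt0 => // i; have := cw i; rewrite ler_norml => /andP[h1 h2].
    by apply/andP; split; lra.
  by rewrite Bw ltxx.
exists (fun w => J^-1 * B w); split.
- exact: testZ.
- by move=> w; rewrite mulr_ge0// invr_ge0 ltW.
- under eq_integral do rewrite EFinM.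
  rewrite integralZl//; first by rewrite JE -EFinM mulVf ?gt_eqF.
- by move=> w /BA ->; rewrite mulr0.
Qed.

Section cutoff.
Let B : V -> R := fun z => (box_bump (fun=> - 1) (fun=> 1) 1 (0 : V))^-1 *
  box_bump (fun=> - 1) (fun=> 1) 1 z.
Let r (n : nat) : R := n.+1%:R^-1.
Let chi (n : nat) : V -> R := fun z => B (r n *: z).

Let tB : test_function B. Proof. exact/testZ/test_box_bump. Qed.

Let B1 : B 0 = 1.
Proof.
rewrite /B mulVf// gt_eqF//; apply: box_bump_gt0 => // i.
have -> : vcoor i 0 = 0 :> R by case: i => [i|] //=; rewrite mxE.
by rewrite ltrN10 ltr01.
Qed.

Let r0 n : 0 < r n. Proof. by rewrite invr_gt0. Qed.

Let smooth_chi n : smooth (chi n).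
Proof.
apply: (@smooth_precomp _ _ (fun z => r n *: z) (fun z => r n *: z) B); last exact: tB.1.
- by move=> z; apply: cvgZr; exact: cvg_id.
- by move=> z h v; rewrite scalerDr !scalerA mulrC.
Qed.

Let D_chi n v z : 'D_v (chi n) z = r n * 'D_v B (r n *: z).
Proof.
have dB := @smooth_derivable _ _ B (r n *: z) v tB.1.
have [|||_ ->] := @derive_precomp _ _ (fun z => r n *: z) (fun z => r n *: z) B z v.
- by move=> z'; apply: cvgZr; exact: cvg_id.
- by move=> z' h v'; rewrite scalerDr !scalerA mulrC.
- exact: (@smooth_derivable _ _ B _ _ tB.1).
by rewrite deriveZdir.
Qed.

Let chi_cvg z : (fun n => chi n z) @ \oo --> (1 : R).
Proof.
rewrite -B1; have c0 : (fun n => r n *: z) @ \oo --> (0 : V).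
  by rewrite -[X in _ --> X](scale0r z); apply: cvgZr_tmp; exact: cvg_harmonic.
exact: cvg_comp c0 (@smooth_cont _ _ B tB.1 (0 : V)).
Qed.

(** [chi n] is a bump of value 1 at 0, dilated n + 1 times: it tends to 1 boundedly while its
    derivatives are O(1/n), so the term psi D(chi n) of the product rule vanishes in mean square and
    the bounds on derivatives keep their constants. *)
Lemma cutoff (S : set Z) (psi : V -> R) (C : option 'I_N -> R) (e : R) : measurable S ->
  smooth psi -> (n2 mu S psi < +oo)%E ->
  (forall i, (n2 mu S ('D_(vdir i) psi) <= (C i)%:E)%E) -> 0 < e ->
  exists phi, [/\ test_function phi, (n2 mu S (phi \- psi)%R <= e%:E)%E &
    forall i, (n2 mu S ('D_(vdir i) phi) <= (C i + e)%:E)%E].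
Proof.
move=> mS sp p2 DC e0; pose phi n := chi n \* psi.
have [M M0 HM] := test_bounded tB.
have sm f : smooth f -> measurable_fun S f.
  by move=> sf; apply: measurable_funTS; exact: continuous_measurable_strip (smooth_cont sf).
have dct f : smooth f -> (n2 mu S f < +oo)%E ->
    (fun n => n2 mu S ((chi n \* f) \- f)%R) @ \oo --> 0%E.
  move=> sf f2; pose F (n : nat) (z : Z) : \bar R := (((chi n \* f) z - f z) ^+ 2)%:E.
  have mf : measurable_fun S f by exact: sm.
  have mF n : measurable_fun S (F n).
    by apply: measurable_sqrE; apply: measurable_funB; [exact: sm (smoothM (smooth_chi n) sf)|].
  have ig : mu.-integrable S (fun z => ((M + 1) ^+ 2)%:E * (f z ^+ 2)%:E)%E.
    apply: integrableZl => //; apply/integrableP; split; first exact: measurable_sqrE.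
    by under eq_integral do rewrite gee0_abs ?lee_fin ?sqr_ge0//.
  have [|||_ _] := @dominated_convergence _ _ _ mu S mS F (cst 0%E) _ mF _ _ ig.
  - exact: measurable_cst.
  - apply: aeW => z Sz; apply: cvg_EFin; first exact: nearW.
    have -> : 0 = (1 * f z - f z) ^+ 2 :> R by rewrite mul1r subrr expr0n.
    rewrite /= !expr2; apply: cvgM; (apply: cvgB; [apply: cvgM|]);
      by [exact: chi_cvg|exact: cvg_cst].
  - apply: aeW => z n Sz; rewrite /F -EFinM gee0_abs ?lee_fin ?sqr_ge0//.
    rewrite -exprMn -[leLHS]real_normK ?num_real// -[leRHS]real_normK ?num_real//.
    have -> : (chi n \* f) z - f z = (chi n z - 1) * f z by rewrite mulrBl mul1r.
    rewrite lerXn2r ?nnegrE// !normrM ler_wpM2r//.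
    rewrite (le_trans (ler_normB _ _))// normr1 ger0_norm ?lerD2r ?HM//.
    by rewrite addr_ge0// ltW.
  - by rewrite integral0.
have c0 := dct psi sp p2.
have DE n i : 'D_(vdir i) (phi n) = (chi n \* 'D_(vdir i) psi) \+ (psi \* 'D_(vdir i) (chi n)).
  exact: (D_mul _ ((smoothP _).1 (smooth_chi n) 0%N) ((smoothP _).1 sp 0%N)).
have c1 i : (fun n => n2 mu S ('D_(vdir i) (phi n) \- 'D_(vdir i) psi)%R) @ \oo --> 0%E.
  have sD : smooth ('D_(vdir i) psi) by exact: smooth_D.
  have [M' M'0 HM'] := test_bounded (test_D (vdir i) tB).
  apply: (@squeeze0e _ _ (fun n => 2%:E *
     (n2 mu S ((chi n \* 'D_(vdir i) psi) \- 'D_(vdir i) psi)%R +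
      (r n * r n)%:E * ((M' ^+ 2)%:E * n2 mu S psi)))%E).
  - by move=> n; exact: n2_ge0.
  - move=> n; have sDc : smooth ('D_(vdir i) (chi n)) by exact/smooth_D/smooth_chi.
    apply: (@le_trans _ _ (2%:E * (n2 mu S ((chi n \* 'D_(vdir i) psi) \- 'D_(vdir i) psi)%R +
       n2 mu S (psi \* 'D_(vdir i) (chi n))%R))%E).
      rewrite (@eq_n2 _ _ _ mu S _ (((chi n \* 'D_(vdir i) psi) \- 'D_(vdir i) psi) \+
        (psi \* 'D_(vdir i) (chi n)))).
        apply: n2D_le2 => //; last exact: sm (smoothM sp sDc).
        by apply: measurable_funB; [exact: sm (smoothM (smooth_chi n) sD)|exact: sm sD].
      by move=> z _; rewrite DE /= addrAC.
    apply: lee_pmul => //; first by rewrite adde_ge0 ?n2_ge0.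
    rewrite leeD2l// muleA -EFinM (_ : r n * r n * M' ^+ 2 = (r n * M') ^+ 2); last by ring.
    rewrite -n2Z//; last exact: sm.
    apply: le_n2 => //.
    + by apply: sm; exact: smoothM.
    + by apply: measurable_funM; [exact: measurable_cst|exact: sm].
    + move=> z _; rewrite /= D_chi -[leLHS]real_normK ?num_real// -[leRHS]real_normK ?num_real//.
      rewrite lerXn2r ?nnegrE// !normrM mulrC ler_wpM2r// (ger0_norm (ltW (r0 n))).
      by rewrite ler_wpM2l ?(ltW (r0 n))// [`|M'|]gtr0_norm.
  - apply: cvge0Z; apply: cvge0D; first exact: dct (le_lt_trans (DC i) (ltry _)).
    have fin : ((M' ^+ 2)%:E * n2 mu S psi)%E \is a fin_num.
      by rewrite (n2_fin p2) -EFinM.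
    rewrite -(fineK fin); under eq_fun do rewrite -EFinM.
    apply: cvg_EFin; first exact: nearW.
    rewrite -[X in _ --> X](mul0r (fine ((M' ^+ 2)%:E * n2 mu S psi)%E)).
    apply: cvgM; last exact: cvg_cst.
    by rewrite -[X in _ --> X](mul0r 0); apply: cvgM; exact: cvg_harmonic.
have /choice[n1 Hn1] : forall i, exists n0, forall n, (n0 <= n)%N ->
    (n2 mu S ('D_(vdir i) (phi n)) <= (C i + e)%:E)%E.
  move=> i; have sD : smooth ('D_(vdir i) psi) by exact: smooth_D.
  apply: n2_near_le (DC i) (c1 i) e0 => //; last exact: sm.
  by move=> n; exact: (sm _ (smooth_D _ (smoothM (smooth_chi n) sp))).
have /cvge0P := c0; move=> /(_ (fun=> n2_ge0 _ _ _)) /(_ _ e0) [n0 Hn0].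
pose n := maxn n0 (\max_i n1 i).
exists (phi n); split.
- apply: (@test_function_box _ _ _ (fun=> - n.+1%:R) (fun=> n.+1%:R)).
    exact: (smoothM (smooth_chi n) sp).
  move=> z nz; rewrite /phi /= /chi /B [box_bump _ _ 1 (_ *: _)]box_bump_eq0// ?mulr0 ?mul0r//.
  move=> /(@cubeP R N) H; apply: nz; apply/(@cubeP R N) => i; have := H i.
  have -> : `|vcoor i (r n *: z)| = r n * `|vcoor i z|.
    by rewrite vcoorZ normrM (ger0_norm (ltW (r0 n))).
  by rewrite /r mulrC ler_pdivrMr// mul1r.
- by apply: Hn0; rewrite leq_maxl.
- by move=> i; apply: Hn1; rewrite leq_max (leq_bigmax i) orbT.
Qed.

End cutoff.

Section smoothing.
Variables (W : V -> R) (S : set Z) (C : option 'I_N -> R) (d0 : R).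
Hypotheses (mW : measurable_fun [set: Z] W) (W2 : (n2 mu setT W < +oo)%E)
  (mS : measurable S) (C0 : forall i, 0 <= C i) (d00 : 0 < d0).
(** The bounds hold for all translates of length at most d0, so they pass to averages over a kernel
    of radius at most d0. *)
Hypothesis diffW : forall i h w, `|h| <= d0 -> `|w| <= d0 ->
  (n2 mu S (fun z => W (z + w + h *: vdir i) - W (z + w))%R <= (C i * h ^+ 2)%:E)%E.

Let mWs (w : V) : measurable_fun S (fun z => W (z + w)).
Proof.
apply: measurable_funTS; apply: (measurableT_comp mW).
have := measurable_strip_map w.1 1 w.2; apply: eq_measurable_fun => z _.
by rewrite mul1r.
Qed.

(** The translation by w is made of N + 1 coordinate steps, each of length at most |w|, with
    intermediate points within d0. [K] is crude: it only serves the convergence of the mollification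
    to [W]. *)
Lemma n2_translate_sub : exists2 K, 0 <= K & forall w, (N.+1%:R * `|w| <= d0) ->
  (n2 mu S (fun z => W (z + w) - W z)%R <= (K * `|w| ^+ 2)%:E)%E.
Proof.
suff H (s : seq (option 'I_N)) : exists2 K, 0 <= K & forall w, ((size s)%:R * `|w| <= d0) ->
    (n2 mu S (fun z => W (z + \sum_(i <- s) vcoor i w *: vdir i) - W z)%R
     <= (K * `|w| ^+ 2)%:E)%E.
  have [K K0 HK] := H (index_enum (option 'I_N)); exists K => // w h.
  rewrite {1}(vcoor_decomp w); apply: HK.
  by rewrite [index_enum _]unlock -enumT -cardT card_option card_ord.
elim: s => [|i s [K K0 HK]].
  exists 0 => // w _; rewrite mul0r (_ : (fun z => _) = cst 0).
    by rewrite /n2; under eq_integral do rewrite expr0n; rewrite integral0.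
  by apply/funext => z; rewrite big_nil addr0 subrr.
exists (2 * (C i + K)) => [|w]; first by rewrite mulr_ge0// addr_ge0.
rewrite /= -natr1 mulrDl mul1r => h; have w0 := normr_ge0 w.
have sw0 : 0 <= (size s)%:R * `|w| by rewrite mulr_ge0.
set x := \sum_(j <- s) vcoor j w *: vdir j.
have xs : `|x| <= d0.
  apply: (@le_trans _ _ ((size s)%:R * `|w|)); last by lra.
  rewrite /x; elim: (s) => [|j s' IH]; first by rewrite big_nil normr0 mul0r.
  rewrite big_cons /= -natr1 mulrDl mul1r addrC; apply: le_trans (ler_normD _ _) _.
  apply: lerD IH _; rewrite normrZ -[leRHS]mulr1.
  by apply: ler_pM => //; [exact: vcoor_norm|exact: norm_vdir].
have wd : `|vcoor i w| <= d0 by apply: le_trans (vcoor_norm _ _) _; lra.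
rewrite (@eq_n2 _ _ _ mu S _ ((fun z => W (z + x + vcoor i w *: vdir i) - W (z + x)) \+
   (fun z => W (z + x) - W z))); last first.
  by move=> z _; rewrite /= big_cons [_ *: _ + _]addrC addrA subrKA.
have m1 : measurable_fun S (fun z => W (z + x) - W z).
  by apply: measurable_funB; [exact: mWs|exact: measurable_funTS].
have m2 : measurable_fun S (fun z => W (z + x + vcoor i w *: vdir i) - W (z + x)).
  apply: measurable_funB; last exact: mWs.
  by under eq_fun do rewrite -addrA; exact: mWs.
apply: le_trans (n2D_le2 _ mS m2 m1) _.
have b1 := diffW i wd xs.
have b2 : (n2 mu S (fun z => W (z + x) - W z)%R <= (K * `|w| ^+ 2)%:E)%E by apply: HK; lra.
apply: (@le_trans _ _ (2%:E * ((C i * vcoor i w ^+ 2)%:E + (K * `|w| ^+ 2)%:E))%E).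
  by apply: lee_pmul => //; [rewrite adde_ge0 ?n2_ge0|exact: leeD].
rewrite -EFinD -EFinM lee_fin -mulrA ler_pM2l// mulrDl lerD2r ler_wpM2l//.
by rewrite -[leLHS]real_normK ?num_real// lerXn2r ?nnegrE// vcoor_norm.
Qed.

(** Mollification bounds the difference quotients by the same C i, Fatou's lemma passes to the
    derivatives, and the cutoff makes the support compact; the cutoff alone spoils the constants, by
    as little as wanted. *)
Lemma test_approximation (e : R) : 0 < e ->
  exists phi, [/\ test_function phi, (n2 mu S (phi \- W)%R <= e%:E)%E &
    forall i, (n2 mu S ('D_(vdir i) phi) <= (C i + e)%:E)%E].
Proof.
move=> e0; have [K K0 HK] := n2_translate_sub.
(* Radius of the kernel: the first term keeps N + 1 steps within d0, the others make K A^2 <=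
   e/4. *)
pose A := Num.min (d0 / N.+1%:R) (Num.min 1 (e / 4 / (K + 1))).
have K1 : 0 < K + 1 by rewrite ltr_wpDl.
have A0 : 0 < A by rewrite !lt_min !divr_gt0 ?ltr01.
have Ad : N.+1%:R * A <= d0 by rewrite mulrC -ler_pdivlMr// ge_min lexx.
have A1 : A <= 1 by rewrite !ge_min lexx orbT.
have AK : K * A ^+ 2 <= e / 4.
  have : A <= e / 4 / (K + 1) by rewrite !ge_min lexx !orbT.
  by rewrite ler_pdivlMr// => h; nra.
have Ad0 : A <= d0.
  by apply: le_trans Ad; rewrite ler_peMl// ?ler1n// ltW.
have [k [tk k0 k1 kA]] := smoothing_kernel A0.
pose psi := mollify W k.
have sp : smooth psi by exact: smooth_mollify.
have mp : measurable_fun S psi.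
  by apply: measurable_funTS; exact: continuous_measurable_strip (smooth_cont sp).
have mWS : measurable_fun S W by exact: measurable_funTS.
have b1 : (n2 mu S (psi \- W)%R <= (e / 4)%:E)%E.
  apply: (@n2_mollify_sub _ _ k A tk k0 k1 kA W mW W2 S (e / 4)) => //; first by rewrite divr_ge0// ltW.
  move=> w cw; have wA : `|w| <= A by apply/(cube_norm w (ltW A0)).
  apply: le_trans (HK w _) _.
    by apply: le_trans Ad; rewrite ler_pM2l.
  rewrite lee_fin; apply: le_trans AK; rewrite ler_wpM2l//.
  by rewrite lerXn2r ?nnegrE// ltW.
have p2 : (n2 mu S psi < +oo)%E.
  rewrite (@eq_n2 _ _ _ mu S _ ((psi \- W) \+ W)); last by move=> z _; rewrite /= subrK.
  apply: n2D_lty => //; first exact: measurable_funB.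
    exact: le_lt_trans b1 (ltry _).
  apply: le_lt_trans W2; apply: ge0_subset_integral => //.
    exact: measurable_sqrE.
  by move=> z _; rewrite lee_fin sqr_ge0.
have Db i : (n2 mu S ('D_(vdir i) psi) <= (C i)%:E)%E.
  have [n0 Hn0] : exists n0 : nat, forall n, (n0 <= n)%N -> (n.+1%:R^-1 : R) <= d0.
    have /cvgr_dist_le : (fun n : nat => (n.+1%:R^-1 : R)) @ \oo --> (0 : R) by exact: cvg_harmonic.
    move=> /(_ _ d00) [n0 _ Hn0]; exists n0 => n /Hn0 /=; rewrite sub0r normrN ger0_norm//.
  (* The index is shifted by n0 so that every step 1/(n + n0 + 1) is at most d0. *)
  pose F n z : R := (n + n0).+1%:R * (psi (z + (n + n0).+1%:R^-1 *: vdir i) - psi z).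
  apply: (@n2_fatou_le _ _ _ mu S F) => //.
  - move=> n; apply: measurable_funM; first exact: measurable_cst.
    apply: measurable_funB => //; apply: measurable_funTS; apply: continuous_measurable_strip => z.
    apply: (continuous_comp (f := fun z => z + _)); last exact: smooth_cont sp _.
    by apply: cvgD; [exact: cvg_id|exact: cvg_cst].
  - move=> z _; have H := derive_seq (@smooth_derivable _ _ psi z (vdir i) sp).
    pose G (n : nat) : R := n.+1%:R * (psi (z + n.+1%:R^-1 *: vdir i) - psi z).
    by rewrite -(cvg_shiftn n0 G) in H; exact: H.
  - move=> n; rewrite /F n2Z//; last first.
      apply: measurable_funB => //; apply: measurable_funTS; apply: continuous_measurable_strip => z.
      apply: (continuous_comp (f := fun z => z + _)); last exact: smooth_cont sp _.
      by apply: cvgD; [exact: cvg_id|exact: cvg_cst].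
    set h : R := (n + n0).+1%:R^-1.
    have h0 : 0 < h by rewrite invr_gt0.
    have hd : `|h| <= d0 by rewrite (ger0_norm (ltW h0)); exact: Hn0 (leq_addl _ _).
    have : (n2 mu S (fun z => psi (z + h *: vdir i) - psi z)%R <= (C i * h ^+ 2)%:E)%E.
      apply: (@n2_mollify_diff _ _ k A tk k0 k1 kA W mW W2 S (h *: vdir i) (C i * h ^+ 2)) => //; first by rewrite mulr_ge0 ?sqr_ge0.
      move=> w cw; have wA : `|w| <= A by apply/(cube_norm w (ltW A0)).
      by apply: diffW => //; apply: le_trans Ad0.
    move=> hb; apply: (@le_trans _ _ (((n + n0).+1%:R ^+ 2)%:E * (C i * h ^+ 2)%:E)%E).
      by apply: lee_pmul => //; rewrite ?n2_ge0// lee_fin sqr_ge0.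
    rewrite -EFinM lee_fin mulrCA -exprMn /h divff ?pnatr_eq0// expr1n mulr1//.
have e4 : 0 < e / 4 by rewrite divr_gt0.
have [phi [tp c1 c2]] := cutoff mS sp p2 Db e4.
have mphi : measurable_fun S phi by apply: measurable_funTS; exact: test_measurable.
exists phi; split => //.
- rewrite (@eq_n2 _ _ _ mu S _ ((phi \- psi) \+ (psi \- W))); last by move=> z _; rewrite /= subrKA.
  have m1 : measurable_fun S (phi \- psi) by exact: measurable_funB.
  have m2 : measurable_fun S (psi \- W) by exact: measurable_funB.
  apply: le_trans (n2D_le2 _ mS m1 m2) _.
  apply: (@le_trans _ _ (2%:E * ((e / 4)%:E + (e / 4)%:E))%E).
    by apply: lee_pmul => //; [rewrite adde_ge0 ?n2_ge0|exact: leeD].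
  by rewrite -EFinD -EFinM lee_fin; lra.
- by move=> i; apply: le_trans (c2 i) _; rewrite lee_fin lerD2l; lra.
Qed.

End smoothing.

Section even_approximation.
Variables (U : V -> R) (b : \bar R) (C : option 'I_N -> R).
Let S : set Z := [set z | ((`|z.2|)%:E < b)%E].
Hypotheses (mU : measurable_fun [set: Z] U) (U2 : (n2 mu setT U < +oo)%E) (b0 : (0 < b)%E)
  (C0 : forall i, 0 <= C i) (Ueven : forall z, U (z.1, - z.2) = U z).
(** For a rearrangement this is monotonicity in |y|. It bounds the mean square distance between [U]
    and its dilation by the difference of their mean squares. *)
Hypothesis scaleU : forall l : R, 0 < l < 1 ->
  {ae mu, forall z, 0 <= U z <= U (z.1, l * z.2)}.
Hypothesis diffx : forall j h,
  (n2 mu setT (fun z => U (z + h *: vdir (Some j)) - U z)%R <= (C (Some j) * h ^+ 2)%:E)%E.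
Hypothesis diffy : forall h,
  (n2 mu [set z : Z | S z /\ S (z + h *: vdir None)%R] (fun z => U (z + h *: vdir None) - U z)%R
    <= (C None * h ^+ 2)%:E)%E.

Lemma measurable_band (c : \bar R) : measurable [set z : Z | ((`|z.2|)%:E < c)%E].
Proof.
rewrite -[X in measurable X]setTI; apply: emeasurable_fun_infty_o => //.
by apply/measurable_EFinP; exact: measurableT_comp (@normr_measurable _ _) measurable_snd.
Qed.

Let mS : measurable S. Proof. exact: measurable_band. Qed.

Let iota (z : V) : V := (z.1, - z.2).

Lemma n2_band_reflect (f : V -> R) : measurable_fun S f ->
  n2 mu S (f \o iota) = n2 mu S f.
Proof.
move=> mf; rewrite /n2 [LHS]integral_mkcond [RHS]integral_mkcond.
rewrite -(@ge0_integral_strip_opp _ _ ((fun z => (f z ^+ 2)%:E) \_ S)).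
- apply: eq_integral => z _; rewrite !patchE; congr (if _ then _ else _).
  by apply/idP/idP => /set_mem h; apply/mem_set; move: h; rewrite /S /= normrN.
- by apply/(measurable_restrictT _ mS); exact: measurable_sqrE.
- by move=> z; rewrite patchE; case: ifPn => // _; rewrite lee_fin sqr_ge0.
Qed.

Let iota_affine (z : V) (h : R) (v : V) : iota (z + h *: v) = iota z + h *: iota v.
Proof.
by apply: injective_projections => //=; rewrite opprD; congr (_ + _); rewrite -mulrN.
Qed.

Let iota_continuous : continuous iota.
Proof.
move=> z; have c1 : fst @ z --> z.1 by exact: cvg_fst.
have c2 : (fun z : V => - z.2) @ z --> - z.2 by apply: cvgN; exact: cvg_snd.
exact: cvg_pair c1 c2.
Qed.

(** Averaging with the reflection y -> -y keeps the distance to the even function [U] and, by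
    convexity, the bounds on derivatives. Reflection changes the sign of the y-derivative, hence the
    two variants s = 1 and s = -1. *)
Lemma even_test (phi : V -> R) (e : R) : test_function phi ->
  (n2 mu S (phi \- U)%R <= e%:E)%E ->
  exists psi, [/\ test_function psi, forall z, psi (iota z) = psi z,
    (n2 mu S (psi \- U)%R <= e%:E)%E &
    forall i, (n2 mu S ('D_(vdir i) psi) <= n2 mu S ('D_(vdir i) phi))%E].
Proof.
move=> tp pe; have sp := tp.1.
have spi : smooth (phi \o iota) by apply: (@smooth_precomp _ _ iota iota phi).
have tpi : test_function (phi \o iota).
  have [M M0 HM] := test_cube tp.
  apply: (@test_function_box _ _ _ (fun=> - M) (fun=> M)) => // z nz; apply: HM => H.
  apply: nz; move: H => /(@cubeP R N) H; apply/(@cubeP R N) => i; have := H i.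
  by case: i => [i|] //=; rewrite normrN.
have sm f : smooth f -> measurable_fun S f.
  by move=> sf; apply: measurable_funTS; exact: continuous_measurable_strip (smooth_cont sf).
have half_ f : measurable_fun S f ->
    (n2 mu S (fun z => 2^-1 * (f z + f (iota z)))%R <= n2 mu S f)%E /\
    (n2 mu S (fun z => 2^-1 * (f z + - f (iota z)))%R <= n2 mu S f)%E.
  move=> mf; have mfi : measurable_fun S (f \o iota).
    have mr : measurable_fun setT (f \_ S) by exact/(measurable_restrictT _ mS).
    have mi : measurable_fun setT (iota : Z -> Z).
      by apply: measurable_fun_pair => //; apply: measurableT_comp => //; exact: oppr_measurable.
    apply: eq_measurable_fun (measurable_funTS (measurableT_comp mr mi)) => z.
    by rewrite !inE /S /= => Sz; rewrite patchE mem_set//= /S /= normrN.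
  have half0 s : s = 1 \/ s = -1 -> (n2 mu S (fun z => 2^-1 * (f z + s * f (iota z)))%R <= n2 mu S f)%E.
    move=> s1; have s2 : s ^+ 2 = 1 by case: s1 => ->; rewrite ?sqrrN expr1n.
    have mg : measurable_fun S (fun z => s * (f \o iota) z).
      by apply: measurable_funM => //; exact: measurable_cst.
    have h : (n2 mu S (f \+ (fun z => s * (f \o iota) z))%R <= 2%:E * (n2 mu S f + n2 mu S f))%E.
      by apply: le_trans (n2D_le2 _ mS mf mg) _; rewrite n2Z// s2 mul1e n2_band_reflect.
    rewrite n2Z//; last exact: measurable_funD.
    apply: (@le_trans _ _ ((2^-1 ^+ 2)%:E * (2%:E * (n2 mu S f + n2 mu S f)))%E).
      by apply: lee_pmul => //; exact: n2_ge0.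
    rewrite -mule2n -mule_natl !muleA -!EFinM (_ : 2^-1 ^+ 2 * 2 * 2 = 1 :> R) ?mul1e//.
    by field.
  split; last first.
    by have := half0 (-1) (or_intror erefl); under eq_n2 do rewrite mulN1r.
  by have := half0 1 (or_introl erefl); under eq_n2 do rewrite mul1r.
have half f mf := (half_ f mf).1; have half2 f mf := (half_ f mf).2.
pose psi z := 2^-1 * (phi z + phi (iota z)).
exists psi; split.
- exact: testZ (testD tp tpi).
- by move=> z; rewrite /psi /iota /= opprK -surjective_pairing addrC.
- rewrite (@eq_n2 _ _ _ mu S _ (fun z => 2^-1 * ((phi \- U) z + (phi \- U) (iota z)))).
    apply: le_trans (half _ _) pe; apply: measurable_funB; first exact: sm.
    exact: measurable_funTS.
  by move=> z _; rewrite /= /psi [U (iota z)]Ueven; field.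
- move=> i; have sD : smooth ('D_(vdir i) phi) by exact: smooth_D.
  have dpi z : 'D_(vdir i) (phi \o iota) z = 'D_(iota (vdir i)) phi (iota z).
    have dd := @smooth_derivable _ _ phi (iota z) (iota (vdir i)) sp.
    by have [] := @derive_precomp _ _ iota iota phi z (vdir i) iota_continuous iota_affine dd.
  have Dpsi z : 'D_(vdir i) psi z = 2^-1 * ('D_(vdir i) phi z + 'D_(iota (vdir i)) phi (iota z)).
    have d1 := @smooth_derivable _ _ phi z (vdir i) sp.
    have d2 := @smooth_derivable _ _ _ z (vdir i) spi.
    have -> : psi = 2^-1 \*: (phi \+ (phi \o iota)) by [].
    by rewrite deriveZ; [rewrite deriveD// dpi|exact: derivableD].
  case: i dpi Dpsi sD => [j|] dpi Dpsi sD.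
    rewrite (@eq_n2 _ _ _ mu S _ (fun z => 2^-1 *
       ('D_(vdir (Some j)) phi z + 'D_(vdir (Some j)) phi (iota z)))).
      by apply: half; exact: sm.
    move=> z _; rewrite Dpsi; suff -> : iota (vdir (Some j)) = vdir (Some j) by [].
    by rewrite /iota /= /dir_x /= oppr0.
  rewrite (@eq_n2 _ _ _ mu S _ (fun z => 2^-1 *
       ('D_(vdir None) phi z + - 'D_(vdir None) phi (iota z)))); last first.
    move=> z _; rewrite Dpsi.
    have -> : iota (vdir None) = (-1) *: vdir None.
      by apply: injective_projections => /=; rewrite ?scaler0// /GRing.scale/= mulr1.
    by rewrite deriveZdir ?mulN1r//; exact: smooth_derivable.
  exact: half2 (sm _ sD).
Qed.

(** W(x, y) = U(x, l y) with l = 1/(1 + eta) is controlled on the larger band |y| < b / l, which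
    leaves room to mollify over |y| < b; the dilation multiplies the constants by at most 1 +
    eta. *)
Lemma even_test_approximation (e : R) : 0 < e ->
  exists phi, [/\ test_function phi, forall z, phi (iota z) = phi z,
    (n2 mu S (phi \- U)%R <= e%:E)%E &
    forall i, (n2 mu S ('D_(vdir i) phi) <= (C i + e)%:E)%E].
Proof.
move=> e0; have UE := n2_fin U2; set A := fine _ in UE.
have A0 : 0 <= A by exact/fine_ge0/n2_ge0.
pose B := A + \sum_i C i + 1.
have sC0 : 0 <= \sum_i C i by apply: sumr_ge0.
have B1 : 1 <= B by rewrite lerDr addr_ge0.
(* [B] dominates the mean square of [U] and every C i, so each error of relative size eta is at most
   e/8. *)
pose eta := e / 8 / B; have eta0 : 0 < eta by rewrite !divr_gt0// (lt_le_trans _ B1).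
have etaB : eta * B = e / 8 by rewrite divfK// gt_eqF// (lt_le_trans _ B1).
have etaA : eta * A <= e / 8 by rewrite -etaB ler_pM2l// /B -addrA lerDl addr_ge0.
have etaC i : eta * C i <= e / 8.
  rewrite -etaB ler_pM2l// /B (bigD1 i)//= addrAC addrCA lerDl addr_ge0 ?addr_ge0 ?sumr_ge0//.
pose ka := 1 + eta; have ka1 : 1 < ka by rewrite ltrDl.
have ka0 : 0 < ka by exact: lt_trans ka1.
pose l := ka^-1; have l01 : 0 < l < 1 by rewrite invr_gt0 ka0 invf_lt1.
have /andP[l0 l1] := l01.
pose W (z : V) := U (z.1, l * z.2).
have msc : measurable_fun [set: Z] (fun z : Z => (z.1, l * z.2) : Z).
  have := @measurable_strip_map R N 0 l 0; apply: eq_measurable_fun => z _.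
  by rewrite !addr0.
have mW : measurable_fun [set: Z] W by exact: measurableT_comp mU msc.
have scale (g : Z -> \bar R) : measurable_fun setT g -> (forall z, 0 <= g z)%E ->
    (\int[mu]_z g (z.1, (l * z.2)%R) = ka%:E * \int[mu]_z g z)%E.
  move=> mg g0; have := @ge0_integral_strip_map _ _ 0 l 0 g l0 mg g0.
  move=> <-; rewrite muleA -EFinM mulfV ?gt_eqF// mul1e.
  by apply: eq_integral => z _; rewrite !addr0.
have sqm f : measurable_fun [set: Z] f -> measurable_fun setT (fun z : Z => (f z ^+ 2)%:E).
  exact: measurable_sqrE.
have sq0 f (z : Z) : (0 <= (f z ^+ 2)%:E :> \bar R)%E by rewrite lee_fin sqr_ge0.
have mtr (w : V) : measurable_fun setT (fun z : Z => z + w : Z).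
  have := measurable_strip_map w.1 1 w.2; apply: eq_measurable_fun => z _.
  by rewrite mul1r.
have W2E : n2 mu setT W = (ka * A)%:E.
  by rewrite /n2 (scale (fun z => (U z ^+ 2)%:E)) ?EFinM -?UE//; exact: sqm.
have W2 : (n2 mu setT W < +oo)%E by rewrite W2E ltry.
have WU : (n2 mu S (W \- U)%R <= (e / 8)%:E)%E.
  apply: (@le_trans _ _ (n2 mu setT (W \- U)%R)).
    apply: ge0_subset_integral => //; apply: sqm; exact: measurable_funB.
  apply: (@le_trans _ _ (eta * A)%:E); last by rewrite lee_fin.
  (* From 0 <= U <= W one gets (W - U)^2 + U^2 <= W^2; as the integral of W^2 is 1 + eta times that
     of U^2, the distance is at most eta times the latter. *)
  have : (n2 mu setT (W \- U)%R + n2 mu setT U <= n2 mu setT W)%E.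
    rewrite /n2 -ge0_integralD//; last 2 first.
    - by apply: sqm; exact: measurable_funB.
    - exact: sqm.
    apply: ae_ge0_le_integral => //.
    - by move=> z _; rewrite adde_ge0.
    - by apply: emeasurable_funD; apply: sqm => //; exact: measurable_funB.
    - exact: sqm.
    apply: ae_imp (scaleU l01) _ => z /andP[h1 h2] _.
    by rewrite -EFinD lee_fin /= -/(W z); rewrite -/(W z) in h2; nra.
  rewrite W2E UE -leeBrDr// -EFinB; congr (_ <= _%:E)%E.
  by rewrite /ka; ring.
(* For finite b, 2 d0 is the width gained by the dilation: a point of the band moved by at most 2
   d0, then contracted by l, is still in the band. The 2 accounts for the shift of the kernel and
   for the step h. *)
have [d0 d00 Hd0] : exists2 d0 : R, 0 < d0 & forall y t, ((`|y|)%:E < b)%E -> `|t| <= 2 * d0 ->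
    ((`|l * (y + t)|)%:E < b)%E.
  case: (b) b0 => [c| |//] c0.
    exists (eta * c / 2) => [|y t]; first by rewrite divr_gt0// mulr_gt0.
    rewrite !lte_fin => yc td; rewrite normrM (ger0_norm (ltW l0)) /l ltr_pdivrMl//.
    apply: le_lt_trans (ler_normD _ _) _.
    by move: td; rewrite [2 * _]mulrC divfK// => td; rewrite /ka mulrDl mul1r ltr_leD.
  by exists 1 => // y t _ _; rewrite ltry.
pose C' i := ka * C i.
have C'0 i : 0 <= C' i by rewrite mulr_ge0// ltW.
have diffW i h w : `|h| <= d0 -> `|w| <= d0 ->
    (n2 mu S (fun z => W (z + w + h *: vdir i) - W (z + w))%R <= (C' i * h ^+ 2)%:E)%E.
  move=> hd wd; case: i => [j|].
    pose g (z : Z) : R := W (z + h *: vdir (Some j)) - W z.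
    have mg : measurable_fun setT g.
      by apply: measurable_funB => //; exact: measurableT_comp mW (mtr _).
    apply: (@le_trans _ _ (\int[mu]_z (g (z + w)%R ^+ 2)%:E)%E).
      apply: ge0_subset_integral => //.
        exact: (measurableT_comp (sqm _ mg) (mtr w)).
      by move=> z _; rewrite lee_fin sqr_ge0.
    rewrite (ge0_integral_strip_translate w (sqm _ mg))// /C' -mulrA EFinM.
    pose g' (z : Z) : R := U (z + h *: vdir (Some j)) - U z.
    have mg' : measurable_fun setT g'.
      by apply: measurable_funB => //; exact: measurableT_comp mU (mtr _).
    rewrite [X in (X <= _)%E](_ : _ = ka%:E * n2 mu setT g')%E.
      by apply: lee_pmul => //; [rewrite lee_fin ltW|exact: n2_ge0|exact: diffx].
    rewrite /n2 -(scale (fun z => (g' z ^+ 2)%:E) (sqm _ mg'))//; apply: eq_integral => z _.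
    rewrite /g /g' /W /=; congr ((U (_, _) - _) ^+ 2)%:E.
    by rewrite /= scaler0 !addr0.
  (* A step h for [W] is a step l h for [U]; the gain l^2 <= 1 is dropped, and the Jacobian 1/l =
     [ka] remains. *)
  pose g' (z : Z) : R := U (z + (l * h) *: vdir None) - U z.
  pose T : set Z := [set z | S z /\ S (z + (l * h) *: vdir None)].
  have mT : measurable T.
    apply: measurableI => //; rewrite -[X in measurable X]setTI; exact: mtr.
  have mg' : measurable_fun setT g'.
    by apply: measurable_funB => //; exact: measurableT_comp mU (mtr _).
  pose G : Z -> \bar R := (fun z => (g' z ^+ 2)%:E) \_ T.
  have mG : measurable_fun setT G.
    by apply/(measurable_restrictT _ mT); exact: measurable_funTS (sqm _ mg').
  have G0 z : (0 <= G z)%E by rewrite /G patchE; case: ifPn.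
  have GE : (\int[mu]_z G z <= (C None * h ^+ 2)%:E)%E.
    rewrite -integral_mkcond; apply: le_trans (diffy (l * h)) _.
    rewrite lee_fin ler_wpM2l// exprMn ler_piMl ?sqr_ge0//.
    by rewrite expr_le1 ?(ltW l0) ?(ltW l1).
  rewrite /C' -mulrA EFinM; apply: (@le_trans _ _ (ka%:E * \int[mu]_z G z)%E); last first.
    by apply: lee_pmul => //; [rewrite lee_fin ltW|exact: integral_ge0].
  rewrite -scale// -(ge0_integral_strip_translate w); last 2 first.
  - exact: measurableT_comp mG msc.
  - by move=> z; exact: G0.
  rewrite /n2 integral_mkcond; apply: ge0_le_integral => //.
  - by move=> z _; rewrite patchE; case: ifPn => // _; rewrite lee_fin sqr_ge0.
  - apply/(measurable_restrictT _ mS); apply: measurable_sqrE; apply: measurable_funTS.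
    have mWw u : measurable_fun setT (fun z : Z => W (z + u)) by exact: measurableT_comp mW (mtr u).
    apply: measurable_funB; last exact: mWw.
    by under eq_fun do rewrite -addrA; exact: mWw.
  - exact: (measurableT_comp (measurableT_comp mG msc) (mtr w)).
  move=> z _; rewrite patchE; case: ifPn => [/set_mem Sz|_]; last exact: G0.
  have wd2 := le_trans (vcoor_norm None w) wd.
  rewrite /G patchE mem_set /g' /W /=.
    rewrite le_eqVlt; apply/orP; left; apply/eqP; congr ((U (_, _) - _) ^+ 2)%:E.
      by rewrite /= !scaler0 !addr0.
    by rewrite /= /GRing.scale/= !mulr1 !mulrDr.
  move: Sz; rewrite /S /= => Sz; rewrite /T /S /=; split.
    by apply: Hd0 => //; apply: le_trans wd2 _; lra.
  rewrite /GRing.scale/= mulr1 -mulrDr -addrA; apply: Hd0 => //.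
  by apply: le_trans (ler_normD _ _) _; rewrite /= in wd2; lra.
have e8 : 0 < e / 8 by rewrite divr_gt0.
have [phi [tp c1 c2]] := test_approximation mW W2 mS C'0 d00 diffW e8.
have mphi : measurable_fun S phi by apply: measurable_funTS; exact: test_measurable.
have c3 : (n2 mu S (phi \- U)%R <= e%:E)%E.
  have mUS := measurable_funTS mU; have mWS := measurable_funTS mW.
  rewrite (@eq_n2 _ _ _ mu S _ ((phi \- W) \+ (W \- U))); last by move=> z _; rewrite /= subrKA.
  have m1 : measurable_fun S (phi \- W) by exact: measurable_funB.
  have m2 : measurable_fun S (W \- U) by exact: measurable_funB.
  apply: le_trans (n2D_le2 _ mS m1 m2) _.
  apply: (@le_trans _ _ (2%:E * ((e / 8)%:E + (e / 8)%:E))%E).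
    by apply: lee_pmul => //; [rewrite adde_ge0 ?n2_ge0|exact: leeD].
  by rewrite -EFinD -EFinM lee_fin; lra.
have [psi [tpsi ev p1 p2]] := even_test tp c3.
exists psi; split => // i; apply: le_trans (p2 i) _; apply: le_trans (c2 i) _.
by rewrite lee_fin /C' /ka mulrDl mul1r -addrA lerD2l; have := etaC i; lra.
Qed.

End even_approximation.

End approximation.

(** * Limits of gradients and traces *)

Section parallelogram.
Context d (T : measurableType d) (R : realType) (mu : {measure set T -> \bar R}).

Lemma n2_parallelogram (D : set T) (f g : T -> R) : measurable D ->
  measurable_fun D f -> measurable_fun D g ->
  (4%:E * n2 mu D (fun x => 2^-1 * (f x + g x))%R + n2 mu D (f \- g)%R =
   2%:E * n2 mu D f + 2%:E * n2 mu D g)%E.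
Proof.
move=> mD mf mg.
have mp : measurable_fun D (fun x => 2^-1 * (f x + g x)).
  by apply: measurable_funM; [exact: measurable_cst|exact: measurable_funD].
rewrite -(@integral_lin _ _ _ mu D (fun x => f x ^+ 2) (fun x => g x ^+ 2) 2 2)//;
  try (by move=> x _; exact: sqr_ge0); try exact: measurable_funX.
rewrite -[X in (_ + X)%E]mul1e.
rewrite -(@integral_lin _ _ _ mu D (fun x => (2^-1 * (f x + g x)) ^+ 2)
  (fun x => (f x - g x) ^+ 2) 4 1)//; try (by move=> x _; exact: sqr_ge0).
- by apply: eq_integral => x _; congr EFin; field.
- exact: measurable_funX.
- by apply: measurable_funX; exact: measurable_funB.
Qed.

End parallelogram.

Section gradient_limit.
Context {R : realType} {N : nat}.
Local Notation V := ('rV[R]_N * R)%type.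
Local Notation Z := ('rV[R]_N * measurableTypeR R)%type.
Local Notation mu := (@lebesgue_strip R N).
Variables (U : V -> R) (S : set Z) (C : option 'I_N -> R).
Hypotheses (mS : measurable S) (mU : measurable_fun S U) (C0 : forall i, 0 <= C i).

(** Competitors at tolerance e, a convex set. Each partial derivative has its own bound in the
    definition, so the bounds survive separately in the limit although only their sum is
    minimised. *)
Definition near_test (e : R) (phi : V -> R) := [/\ test_function phi,
  forall z, phi (z.1, - z.2) = phi z, (n2 mu S (phi \- U)%R <= e%:E)%E &
  forall i, (n2 mu S ('D_(vdir i) phi) <= (C i + e)%:E)%E].

Hypothesis near_testP : forall e, 0 < e -> exists phi, near_test e phi.

Let energy (phi : V -> R) : R := \sum_i fine (n2 mu S ('D_(vdir i) phi)).

Let energy_ge0 phi : 0 <= energy phi.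
Proof. by apply: sumr_ge0 => i _; exact/fine_ge0/n2_ge0. Qed.

Let near_mono e e' phi : e <= e' -> near_test e phi -> near_test e' phi.
Proof.
move=> ee [tp ev h1 h2]; split => //; first by apply: le_trans h1 _; rewrite lee_fin.
by move=> i; apply: le_trans (h2 i) _; rewrite lee_fin lerD2l.
Qed.

Let mt (phi : V -> R) : smooth phi -> measurable_fun S phi.
Proof. by move=> sp; apply: measurable_funTS; exact: continuous_measurable_strip (smooth_cont sp). Qed.

Let D_mid (phi psi : V -> R) v : smooth phi -> smooth psi ->
  'D_v (fun z => 2^-1 * (phi z + psi z)) = (fun z => 2^-1 * ('D_v phi z + 'D_v psi z)).
Proof.
move=> sp sq; apply/funext => z.
have d1 := @smooth_derivable _ _ phi z v sp; have d2 := @smooth_derivable _ _ psi z v sq.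
rewrite (_ : (fun z => _) = 2^-1 \*: (phi \+ psi))//.
by rewrite deriveZ; [rewrite deriveD|exact: derivableD].
Qed.

Let D_sub (phi psi : V -> R) v : smooth phi -> smooth psi ->
  'D_v (phi \- psi) = ('D_v phi \- 'D_v psi).
Proof.
move=> sp sq; apply/funext => z.
have d1 := @smooth_derivable _ _ phi z v sp; have d2 := @smooth_derivable _ _ psi z v sq.
by rewrite deriveB.
Qed.

Let mid_le (f g : V -> R) (c : R) : measurable_fun S f -> measurable_fun S g ->
  (n2 mu S f <= c%:E)%E -> (n2 mu S g <= c%:E)%E ->
  (n2 mu S (fun z => 2^-1 * (f z + g z))%R <= c%:E)%E.
Proof.
move=> mf mg fc gc; have := n2_parallelogram mu mS mf mg.
have p0 := n2_ge0 mu S (f \- g).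
move=> E; rewrite -(@lee_pmul2l _ 4%:E)//.
apply: (@le_trans _ _ (2%:E * n2 mu S f + 2%:E * n2 mu S g)%E).
  by rewrite -E leeDl.
apply: (@le_trans _ _ (2%:E * c%:E + 2%:E * c%:E)%E).
  by apply: leeD; apply: lee_pmul => //; exact: n2_ge0.
by rewrite -!EFinM -EFinD lee_fin; lra.
Qed.

Let near_mid e phi psi : near_test e phi -> near_test e psi ->
  near_test e (fun z => 2^-1 * (phi z + psi z)).
Proof.
move=> [tp ep p1 p2] [tq eq q1 q2]; split.
- exact: testZ (testD tp tq).
- by move=> z; rewrite ep eq.
- rewrite (@eq_n2 _ _ _ mu S _ (fun z => 2^-1 * ((phi \- U) z + (psi \- U) z))).
    by apply: mid_le => //; apply: measurable_funB => //; apply: mt; [exact: tp.1|exact: tq.1].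
  by move=> z _ /=; field.
- move=> i; rewrite D_mid; [|exact: tp.1|exact: tq.1].
  by apply: (mid_le (mt (smooth_D _ tp.1)) (mt (smooth_D _ tq.1))).
Qed.

Let energies e : set R := [set energy phi | phi in near_test e].
(** Shrinking e removes competitors, so [least] increases, and stays bounded, as e tends to 0. *)
Let least e : R := inf (energies e).

Let has_inf_energies e : 0 < e -> has_inf (energies e).
Proof.
move=> e0; have [phi np] := near_testP e0; split; first by exists (energy phi), phi.
by exists 0 => _ [psi _ <-].
Qed.

Let least_le e phi : 0 < e -> near_test e phi -> least e <= energy phi.
Proof. by move=> e0 np; apply: ge_inf; [exact: (has_inf_energies e0).2|exists phi]. Qed.

Let least_mono e e' : 0 < e -> e <= e' -> least e' <= least e.
Proof.
move=> e0 ee; apply: lb_le_inf; first exact: (has_inf_energies e0).1.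
move=> _ [phi np <-]; apply: least_le; [exact: lt_le_trans ee|exact: near_mono np].
Qed.

Let n2D_fin phi i : test_function phi ->
  n2 mu S ('D_(vdir i) phi) = (fine (n2 mu S ('D_(vdir i) phi)))%:E.
Proof. by move=> tp; apply: n2_fin; exact: (test_n2 mS (test_D _ tp)). Qed.

Let least_bound e : 0 < e -> e <= 1 -> least e <= \sum_i (C i + 1).
Proof.
move=> e0 e1; have [phi np] := near_testP e0.
apply: le_trans (least_le e0 np) _; apply: ler_sum => i _.
have [tp _ _ /(_ i) h] := np; rewrite -lee_fin -n2D_fin//; apply: le_trans h _.
by rewrite lee_fin lerD2l.
Qed.

Let sum_parallelogram (a b c d : option 'I_N -> R) :
  (forall i, 4 * a i + b i = 2 * c i + 2 * d i) ->
  4 * (\sum_i a i) + \sum_i b i = 2 * (\sum_i c i) + 2 * (\sum_i d i).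
Proof. by move=> H; rewrite !mulr_sumr -!big_split /=; apply: eq_bigr => i _. Qed.

Let fine_parallelogram (a b c d : \bar R) : a \is a fin_num -> b \is a fin_num ->
  c \is a fin_num -> d \is a fin_num ->
  (4%:E * a + b = 2%:E * c + 2%:E * d)%E ->
  4 * fine a + fine b = 2 * fine c + 2 * fine d.
Proof. by case: a b c d => [a| |] [b| |] [c| |] [d| |] //= _ _ _ _ []. Qed.

Let energy_mid phi psi : test_function phi -> test_function psi ->
  4 * energy (fun z => 2^-1 * (phi z + psi z)) + energy (phi \- psi) =
  2 * energy phi + 2 * energy psi.
Proof.
move=> tp tq; have sp := tp.1; have sq := tq.1; apply: sum_parallelogram => i.
have par := n2_parallelogram mu mS (mt (smooth_D (vdir i) sp)) (mt (smooth_D (vdir i) sq)).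
have tm : test_function (fun z => 2^-1 * (phi z + psi z)) by exact: testZ (testD tp tq).
have td : test_function (phi \- psi).
  rewrite (_ : phi \- psi = phi \+ (fun z => -1 * psi z)); last by apply/funext => z /=; rewrite mulN1r.
  exact: testD tp (testZ _ tq).
have fin f : test_function f -> n2 mu S ('D_(vdir i) f) \is a fin_num.
  by move=> tf; rewrite ge0_fin_numE ?n2_ge0//; exact: (test_n2 mS (test_D _ tf)).
have := fin _ tm; have := fin _ td; have := fin _ tp; have := fin _ tq.
by move: par; rewrite -(D_mid (vdir i) sp sq) -(D_sub (vdir i) sp sq) => par f1 f2 f3 f4; exact: fine_parallelogram f4 f3 f2 f1 par.
Qed.

Let energyBC (phi psi : V -> R) : smooth phi -> smooth psi ->
  energy (phi \- psi) = energy (psi \- phi).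
Proof.
move=> sp sq; have E i : n2 mu S ('D_(vdir i) (phi \- psi)) = n2 mu S ('D_(vdir i) (psi \- phi)).
  apply: etrans (congr1 (n2 mu S) (D_sub _ sp sq)) _.
  exact: etrans (n2BC _ _ _ _) (congr1 (n2 mu S) (esym (D_sub _ sq sp))).
by apply: eq_bigr => i _; rewrite E.
Qed.

(** In the parallelogram identity a4 = 2 a1 + 2 a2 - 4 a3, with a3 at least the infimum l1. The two
    infima differ by less than d/8 and each excess is at most d/8, for a total below 6d/8. *)
Let energy_gap (a1 a2 a3 a4 l1 l2 l3 en em l d : R) : 0 < d -> a1 <= l1 + en -> a2 <= l2 + em ->
  l2 <= l -> l3 <= l1 -> en <= d / 8 -> em <= d / 8 -> l - d / 8 < l3 -> l1 <= a3 ->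
  4 * a3 + a4 = 2 * a1 + 2 * a2 -> a4 <= d.
Proof. by lra. Qed.

(** This is the Hilbert space argument for the point of least norm in a convex set, run along sets
    that shrink with the tolerance; it yields strong convergence of the gradients where only bounds
    are known. *)
Lemma gradient_limit : exists (phi : nat -> V -> R) (g : option 'I_N -> V -> R),
  [/\ forall n, test_function (phi n), forall n z, phi n (z.1, - z.2) = phi n z,
      (fun n => n2 mu S (phi n \- U)%R) @ \oo --> 0%E &
      forall i, [/\ measurable_fun S (g i),
        (fun n => n2 mu S ('D_(vdir i) (phi n) \- g i)%R) @ \oo --> 0%E &
        (n2 mu S (g i) <= (C i)%:E)%E]].
Proof.
pose e n : R := n.+1%:R^-1; have e0 n : 0 < e n by rewrite invr_gt0.
have e1 n : e n <= 1 by rewrite invf_le1// ler1n.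
have emono n m : (n <= m)%N -> e m <= e n by move=> nm; rewrite lef_pV2 ?posrE// ler_nat.
have ecvg (d : R) : 0 < d -> exists n0, forall n, (n0 <= n)%N -> e n <= d.
  move=> d0; have /cvgr_dist_le : e @ \oo --> (0 : R) by exact: cvg_harmonic.
  move=> /(_ _ d0) [n0 _ Hn0]; exists n0 => n /Hn0 /=.
  by rewrite sub0r normrN ger0_norm// ltW.
have /choice[phi Hphi] : forall n, exists phi, near_test (e n) phi /\
    energy phi <= least (e n) + e n.
  move=> n; have [_ [phi np <-] h] := inf_adherent (e0 n) (has_inf_energies (e0 n)).
  by exists phi; split => //; exact: ltW.
have tp n : test_function (phi n) by have [[]] := Hphi n.
pose L := sup (range (fun n => least (e n))).
have hs : has_sup (range (fun n => least (e n))).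
  split; first by exists (least (e 0%N)), 0%N.
  by exists (\sum_i (C i + 1)) => _ [n _ <-]; exact: least_bound.
have cauchy (d : R) : 0 < d -> exists n0, forall n m, (n0 <= n)%N -> (n0 <= m)%N ->
    energy (phi n \- phi m) <= d.
  move=> d0; have d8 : 0 < d / 8 by rewrite divr_gt0.
  have [_ [n1 _ <-] Hn1] := sup_adherent d8 hs; rewrite -/L in Hn1.
  have [n2' Hn2] := ecvg _ d8.
  exists (maxn n1 n2') => n m; wlog nm : n m / (n <= m)%N.
    move=> H hn hm; have /orP[nm|mn] := leq_total n m; first exact: H.
    rewrite (_ : energy _ = energy (phi m \- phi n)); first exact: H.
    exact: energyBC (tp n).1 (tp m).1.
  rewrite !geq_max => /andP[n1n n2n] _; have [npn qn] := Hphi n; have [npm qm] := Hphi m.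
  (* [phi m] is also a competitor at the coarser tolerance e n, hence so is the midpoint, whose
     energy is then at least [least (e n)]. *)
  have npm' : near_test (e n) (phi m) by apply: near_mono npm; exact: emono.
  have E := energy_mid (tp n) (tp m).
  have h := least_le (e0 n) (near_mid npn npm').
  have b1 : least (e m) <= L by apply: sup_upper_bound => //; exists m.
  have b2 : least (e n1) <= least (e n) by apply: least_mono => //; exact: emono.
  have b3 := Hn2 n n2n; have b4 := Hn2 m (leq_trans n2n nm).
  exact: energy_gap d0 qn qm b1 b2 b3 b4 Hn1 h E.
have /choice[g Hg] : forall i, exists g, measurable_fun S g /\
    (fun n => n2 mu S ('D_(vdir i) (phi n) \- g)%R) @ \oo --> 0%E.
  move=> i; have [||g mg cg] := @n2_complete _ _ _ mu S (fun n => 'D_(vdir i) (phi n)) mS.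
  - by move=> n; exact: mt (smooth_D _ (tp n).1).
  - move=> d d0; have [n0 Hn0] := cauchy d d0; exists n0 => n m hn hm.
    have td : test_function (phi n \- phi m).
      rewrite (_ : phi n \- phi m = phi n \+ (fun z => -1 * phi m z)); last by apply/funext => z /=; rewrite mulN1r.
      exact: testD (tp n) (testZ _ (tp m)).
    have := n2D_fin i td; rewrite D_sub; [|exact: (tp n).1|exact: (tp m).1] => ->.
    rewrite lee_fin; apply: le_trans (Hn0 n m hn hm).
    rewrite /energy (bigD1 i)//= (D_sub (vdir i) (tp n).1 (tp m).1).
    by rewrite lerDl; apply: sumr_ge0 => j _; exact/fine_ge0/n2_ge0.
  - by exists g.
exists phi, g; split => //.
- by move=> n z; have [[_ ->]] := Hphi n.
- apply/cvge0P => [n|d d0]; first exact: n2_ge0.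
  have [n0 Hn0] := ecvg _ d0; exists n0 => n /Hn0 h.
  by have [[_ _ hu _] _] := Hphi n; apply: le_trans hu _; rewrite lee_fin.
- move=> i; have [mg cg] := Hg i; split => //.
  apply: (@n2_limit_le _ _ _ mu S (fun n => 'D_(vdir i) (phi n)) (g i) (C i) mS) => //.
    by move=> n; exact: mt (smooth_D _ (tp n).1).
  move=> d d0; have [n0 Hn0] := ecvg _ d0; exists n0 => n /Hn0 h.
  have [[_ _ _ hD] _] := Hphi n; apply: le_trans (hD i) _.
  by rewrite lee_fin lerD2l.
Qed.

End gradient_limit.

(** * Traces of test functions on y = s and their limits *)

Section traces.
Context {R : realType} {N : nat}.
Local Notation V := ('rV[R]_N * R)%type.
Local Notation Z := ('rV[R]_N * measurableTypeR R)%type.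
Local Notation mu := (@lebesgue_strip R N).
Local Notation lam := (@lebesgue_measure R).

Lemma line_y (x : 'rV[R]_N) (t : R) : ((x, 0) : V) + t *: dir_y = (x, t).
Proof.
by apply: injective_projections => /=; rewrite ?scaler0 ?addr0// add0r /GRing.scale/= mulr1.
Qed.

Lemma is_derive_y (phi : V -> R) (x : 'rV[R]_N) (y : R) : smooth phi ->
  is_derive y 1 (fun t => phi (x, t)) ('D_dir_y phi (x, y)).
Proof.
move=> sp; have := is_derive_line (x, 0) dir_y y sp; rewrite line_y.
by rewrite (_ : (fun t : R => phi _) = (fun t => phi (x, t)))//; apply/funext => t; rewrite line_y.
Qed.

Lemma continuous_y (phi : V -> R) (x : 'rV[R]_N) : continuous phi ->
  continuous (fun t => phi (x, t)).
Proof.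
move=> cp; have := continuous_line (z := (x, 0)) (v := dir_y) cp.
by rewrite (_ : (fun t : R => phi _) = (fun t => phi (x, t)))//; apply/funext => t; rewrite line_y.
Qed.

(* phi^2(x, s) is the increment over [s, s + r] of ((y - s) / r - 1) phi^2. *)
Lemma trace_pointwise (phi : V -> R) (x : 'rV[R]_N) (s r : R) : smooth phi -> 0 < r ->
  ((phi (x, s) ^+ 2)%:E <= \int[lam]_(y in `]s, (s + r)%R[)
    ((r^-1 + 1) * (phi (x, y) ^+ 2 + 'D_dir_y phi (x, y) ^+ 2))%:E)%E.
Proof.
move=> sp r0; pose p t := phi (x, t); pose q (t : R) : R := 'D_dir_y phi (x, t).
have cp : continuous p by exact/continuous_y/smooth_cont.
have cq : continuous q by exact: continuous_y (smooth_cont (smooth_D _ sp)).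
have dp (t : R) : is_derive t (1 : R) p (q t) by exact: is_derive_y.
pose a t : R := r^-1 * (t - s) - 1.
have da (t : R) : is_derive t (1 : R) a r^-1.
  have h1 : is_derive t 1 (r^-1 \*: (@id R)) (r^-1 *: 1) by apply: is_deriveZ.
  have h3 : is_derive t (1 : R) (cst (r^-1 * s + 1) : R -> R) 0 by exact: is_derive_cst.
  have := is_deriveB h1 h3; rewrite subr0 /GRing.scale/= mulr1.
  rewrite (_ : _ - _ = a)//; apply/funext => u.
  by rewrite /a mulrBr opprD addrA.
pose F t := a t * (p t * p t).
pose f t := a t * (p t * q t + p t * q t) + (p t * p t) * r^-1.
have dF (t : R) : is_derive t (1 : R) F (f t).
  have h1 : is_derive t 1 (p * p) (p t *: q t + p t *: q t) by exact: is_deriveM.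
  have h2 : is_derive t 1 (a * (p * p)) (a t *: (p t *: q t + p t *: q t) + (p * p) t *: r^-1).
    exact: is_deriveM.
  exact: h2.
have ca : continuous a by move=> t; have [/derivable1_diffP/differentiable_continuous] := da t.
have cF : continuous F by move=> t; have [/derivable1_diffP/differentiable_continuous] := dF t.
have cf : continuous f.
  move=> t; apply: cvgD; apply: cvgM; try exact: cvg_cst; first exact: ca.
    by apply: cvgD; apply: cvgM; [exact: cp|exact: cq|exact: cp|exact: cq].
  by apply: cvgM; exact: cp.
have sr : s < s + r by rewrite ltrDl.
have ftc := @continuous_FTC2 R f F s (s + r) sr.
have : (\int[lam]_(y in `[s, (s + r)%R]) (f y)%:E = (F (s + r))%:E - (F s)%:E)%E.
  apply: ftc.
  - exact: continuous_subspaceT.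
  - split.
    + by move=> t _; have [] := dF t.
    + by apply: cvg_at_right_filter; exact: cF.
    + by apply: cvg_at_left_filter; exact: cF.
  - by move=> t _; rewrite derive1E; have [_ ->] := dF t.
have -> : F (s + r) = 0 by rewrite /F /a addrAC subrr add0r mulVf ?gt_eqF// subrr mul0r.
have -> : F s = - phi (x, s) ^+ 2 by rewrite /F /a subrr mulr0 sub0r mulN1r expr2.
rewrite -EFinB sub0r opprK => <-.
pose B y := (r^-1 + 1) * (p y ^+ 2 + q y ^+ 2).
have cB : continuous B.
  move=> t; apply: cvgM; first exact: cvg_cst.
  by apply: cvgD; rewrite expr2; apply: cvgM; [exact: cp|exact: cp|exact: cq|exact: cq].
have mB (D : set (measurableTypeR R)) : measurable_fun D B.
  by apply: measurable_funTS; exact: continuous_measurable_fun.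
rewrite [leRHS](_ : _ = \int[lam]_(y in `[s, (s + r)%R]) (B y)%:E)%E; last first.
  have mBE : measurable_fun (`]s, (s + r)%R[%classic : set (measurableTypeR R)) (fun y => (B y)%:E).
    by apply/measurable_EFinP; exact: mB.
  have := @integral_itv_bndoo R s (s + r) (fun y => (B y)%:E) true false mBE.
  by move=> ->.
apply: le_integral => //.
- apply: continuous_compact_integrable; first exact: segment_compact.
  exact: continuous_subspaceT.
- apply: continuous_compact_integrable; first exact: segment_compact.
  exact: continuous_subspaceT.
move=> y /set_mem; rewrite /= in_itv/= => /andP[sy ysr]; rewrite lee_fin /f /B.
have a1 : -1 <= a y <= 0.
  rewrite /a lerBrDr addNr mulr_ge0 ?invr_ge0 ?subr_ge0 ?(ltW r0)//= subr_le0.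
  by rewrite mulrC ler_pdivrMr// mul1r lerBlDl.
have ri : 0 < r^-1 by rewrite invr_gt0.
have h : a y * (p y * q y + p y * q y) <= p y ^+ 2 + q y ^+ 2.
  have /andP[a1' a0] := a1; have s1 := sqr_ge0 (p y + q y); have s2 := sqr_ge0 (p y - q y).
  have s3 := sqr_ge0 (p y); have s4 := sqr_ge0 (q y).
  have e1 : a y * (p y * q y + p y * q y) = - (- a y) * (2 * (p y * q y)) by ring.
  have ha : 0 <= - a y <= 1 by rewrite oppr_ge0 a0 /= lerNl.
  move: ha => /andP[ha0 ha1]; rewrite e1; nra.
have s4 := sqr_ge0 (q y).
have h2 : p y * p y / r <= r^-1 * (p y ^+ 2 + q y ^+ 2).
  by rewrite [r^-1 * _]mulrDr -expr2 [_ / r]mulrC lerDl mulr_ge0// ltW.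
by rewrite [leRHS]mulrDl mul1r [leRHS]addrC; exact: lerD h h2.
Qed.

Lemma trace_le (phi : V -> R) (S : set Z) (s r : R) : test_function phi -> measurable S ->
  0 < r -> (forall x y, s < y < s + r -> S (x, y)) ->
  (n2 (lebesgue_rV R N) setT (fun x => phi (x, s)) <=
   (r^-1 + 1)%:E * (n2 mu S phi + n2 mu S ('D_dir_y phi)))%E.
Proof.
move=> tp mS r0 HS; have sp := tp.1.
have ri : 0 < r^-1 by rewrite invr_gt0.
pose f (z : Z) : R := phi z ^+ 2 + 'D_dir_y phi z ^+ 2.
have mphi := test_measurable tp; have mD := test_measurable (test_D dir_y tp).
have mf : measurable_fun setT f by apply: measurable_funD; exact: measurable_funX.
have f0 z : 0 <= f z by rewrite addr_ge0// sqr_ge0.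
rewrite -[(n2 mu S phi)%E]mul1e -[n2 mu S ('D_dir_y phi)]mul1e.
rewrite -(@integral_lin _ _ _ mu S (fun z => phi z ^+ 2) (fun z => 'D_dir_y phi z ^+ 2) 1 1)//;
  try (by move=> x _; exact: sqr_ge0); try (by apply: measurable_funX; exact: measurable_funTS).
under [X in (_ <= _ * X)%E]eq_integral do rewrite !mul1r.
rewrite -ge0_integralZl_EFin//; last 3 first.
- by move=> z _; rewrite lee_fin f0.
- by apply/measurable_EFinP; exact: measurable_funTS.
- by rewrite addr_ge0// ltW.
rewrite integral_mkcond.
have m1 : measurable_fun setT ((fun z => (r^-1 + 1)%:E * (f z)%:E) \_ S)%E.
  apply/(measurable_restrictT _ mS); apply: emeasurable_funM; first exact: measurable_cst.
  by apply/measurable_EFinP; exact: measurable_funTS.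
have p1 z : (0 <= ((fun z => (r^-1 + 1)%:E * (f z)%:E) \_ S) z)%E.
  by rewrite patchE; case: ifPn => // _; rewrite -EFinM lee_fin mulr_ge0// addr_ge0// ltW.
rewrite [leRHS](@integral_strip_iterated R N _ m1 p1).
apply: ge0_le_integral => //.
- by move=> x _; rewrite lee_fin sqr_ge0.
- apply: measurable_sqrE; have := measurableT_comp mphi (@pair2_measurable _ _ 'rV[R]_N (measurableTypeR R) s).
  exact.
- exact: (@measurable_fun_fubini_tonelli_F _ _ _ _ _ lam _ m1 p1).
move=> x _; apply: le_trans (trace_pointwise x s sp r0) _.
rewrite integral_mkcond; apply: ge0_le_integral => //.
- by move=> y _; rewrite patchE; case: ifPn => // _; rewrite lee_fin mulr_ge0 ?f0// addr_ge0// ltW.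
- apply/(measurable_restrictT _ (measurable_itv _)); apply: measurable_funTS.
  apply/measurable_EFinP; apply: measurable_funM; first exact: measurable_cst.
  exact: (measurableT_comp mf (@pair1_measurable _ _ 'rV[R]_N (measurableTypeR R) x)).
- exact: (measurableT_comp m1 (@pair1_measurable _ _ 'rV[R]_N (measurableTypeR R) x)).
move=> y _; rewrite patchE; case: ifPn => [|_]; last exact: p1.
move=> /set_mem; rewrite /= in_itv/= => sy; rewrite patchE mem_set ?EFinM//.
exact: HS.
Qed.

(** By [trace_le] the values on y = s are Cauchy in mean square as soon as the functions and their
    y-derivatives are. A neighbourhood of s on one side is enough, which is all that an endpoint of
    the band has. *)
Lemma trace_limit (phi : nat -> V -> R) (S : set Z) (U g : V -> R) (s r : R) :
  (forall n, test_function (phi n)) -> measurable S ->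
  measurable_fun S U -> measurable_fun S g ->
  (fun n => n2 mu S (phi n \- U)%R) @ \oo --> 0%E ->
  (fun n => n2 mu S ('D_dir_y (phi n) \- g)%R) @ \oo --> 0%E ->
  0 < r -> (forall x y, s < y < s + r -> S (x, y)) ->
  exists2 tau : 'rV[R]_N -> R, measurable_fun setT tau &
    (fun n => n2 (lebesgue_rV R N) setT (fun x => phi n (x, s) - tau x)%R) @ \oo --> 0%E.
Proof.
move=> tp mS mU mg cU cg r0 HS.
have ms n : measurable_fun setT (fun x => phi n (x, s)).
  have := measurableT_comp (test_measurable (tp n)) (@pair2_measurable _ _ 'rV[R]_N (measurableTypeR R) s).
  exact.
have ri : 0 < r^-1 + 1 by rewrite addr_gt0// invr_gt0.
have [||tau mtau ctau] := @n2_complete _ _ _ (lebesgue_rV R N) setT (fun n x => phi n (x, s)) measurableT.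
- exact: ms.
(* The functions and their y-derivatives each contribute 4d, and (1/r + 1) 8d = e. *)
- move=> e e0; pose d := e / (r^-1 + 1) / 8.
  have d0 : 0 < d by rewrite !divr_gt0.
  have /cvge0P := cU => /(_ (fun=> n2_ge0 _ _ _) _ d0) [n1 H1].
  have /cvge0P := cg => /(_ (fun=> n2_ge0 _ _ _) _ d0) [n2' H2].
  exists (maxn n1 n2') => n m; rewrite !geq_max => /andP[an bn] /andP[am bm].
  have td : test_function (phi n \- phi m).
    rewrite (_ : phi n \- phi m = phi n \+ (fun z => -1 * phi m z)); last by apply/funext => z /=; rewrite mulN1r.
    exact: testD (tp n) (testZ _ (tp m)).
  have sub (F : nat -> V -> R) (G : V -> R) : (forall n, measurable_fun S (F n)) ->
      measurable_fun S G -> (n2 mu S (F n \- G)%R <= d%:E)%E ->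
      (n2 mu S (F m \- G)%R <= d%:E)%E -> (n2 mu S (F n \- F m)%R <= (4 * d)%:E)%E.
    move=> mF mG h1 h2.
    rewrite (@eq_n2 _ _ _ mu S _ ((F n \- G) \- (F m \- G))); last first.
      by move=> z _ /=; rewrite opprB addrA subrK.
    apply: le_trans (n2B_le2 _ mS _ _) _; try exact: measurable_funB.
    apply: (@le_trans _ _ (2%:E * (d%:E + d%:E))%E); last by rewrite -EFinD -EFinM lee_fin; lra.
    by apply: lee_pmul => //; [rewrite adde_ge0 ?n2_ge0|exact: leeD].
  have mF n' : measurable_fun S (phi n') by apply: measurable_funTS; exact: test_measurable.
  have mDF n' : measurable_fun S ('D_dir_y (phi n')).
    by apply: measurable_funTS; exact: test_measurable (test_D dir_y (tp n')).
  apply: le_trans (trace_le td mS r0 HS) _.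
  have -> : 'D_dir_y (phi n \- phi m) = 'D_dir_y (phi n) \- 'D_dir_y (phi m).
    apply/funext => z; have d1 := @smooth_derivable _ _ (phi n) z dir_y (tp n).1.
    by have d2 := @smooth_derivable _ _ (phi m) z dir_y (tp m).1; rewrite deriveB.
  apply: (@le_trans _ _ ((r^-1 + 1)%:E * ((4 * d)%:E + (4 * d)%:E))%E).
    apply: lee_pmul; [by rewrite lee_fin ltW|by rewrite adde_ge0 ?n2_ge0|exact: lexx|].
    apply: leeD; first exact: sub mF mU (H1 n an) (H1 m am).
    exact: (sub (fun n => 'D_dir_y (phi n)) g mDF mg (H2 n bn) (H2 m bm)).
  rewrite -EFinD -EFinM lee_fin /d le_eqVlt; apply/orP; left; apply/eqP; field.
  by rewrite gt_eqF//= gt_eqF//; move: ri; rewrite -[X in X + _](mulr1) => _; nra.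
- by exists tau.
Qed.

End traces.

(** * Absolutely continuous functions and the coarea inequality *)

Section edge_space.
Context {R : realType}.
Local Notation Y := (measurableTypeR R).
Local Notation T := (nat * measurableTypeR R)%type.
Local Notation lam := (@lebesgue_measure R).

Definition count_nat : set nat -> \bar R := @counting nat R.
HB.instance Definition _ := Measure.copy count_nat (@counting nat R).
HB.instance Definition _ := Measure_isSigmaFinite.Build _ _ _ count_nat
  (sigma_finite_counting R).

(* The disjoint union of countably many copies of the real line. *)
Definition tmeasure : {sigma_finite_measure set T -> \bar R} :=
  sf_product count_nat lam.

Local Open Scope ereal_scope.

Lemma integral_T (F : T -> \bar R) : measurable_fun setT F -> (forall q, 0 <= F q) ->
  \int[tmeasure]_q F q = \sum_(0 <= n <oo) \int[lam]_s F (n, s).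
Proof.
move=> mF F0; transitivity (\int[count_nat]_n \int[lam]_s F (n, s)).
  exact: (@fubini_tonelli1 _ _ nat Y R count_nat lam F mF F0).
rewrite -ge0_integral_count//.
by move=> n; apply: integral_ge0 => s _; exact: F0.
Qed.

Lemma measurable_slice (n : nat) (A : set Y) : measurable A ->
  measurable ([set q : T | q.1 = n /\ A q.2]).
Proof.
move=> mA; rewrite (_ : [set q | _] = [set n] `*` A); first exact: measurableX.
by apply/seteqP; split.
Qed.

Lemma measurable_fun_T d' (X : measurableType d') (F : T -> X) :
  (forall n, measurable_fun setT (fun s : Y => F (n, s))) -> measurable_fun setT F.
Proof.
move=> mF _ B mB; rewrite setTI.
rewrite (_ : F @^-1` B = \bigcup_n [set q : T | q.1 = n /\ B (F (n, q.2))]).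
  apply: bigcupT_measurable => n; apply: (@measurable_slice n ((fun s => F (n, s)) @^-1` B)).
  by rewrite -[X in measurable X]setTI; exact: mF.
by apply/seteqP; split => [[n s] /= h|[n s] [n' _] /= [<-]]; first by exists n.
Qed.

Lemma measurable_fun_XT d d' (X : measurableType d) (X' : measurableType d') (F : X * T -> X') :
  (forall n, measurable_fun setT (fun p : X * Y => F (p.1, (n, p.2)))) -> measurable_fun setT F.
Proof.
move=> mF _ B mB; rewrite setTI.
have mpi : measurable_fun setT (fun p : X * T => (p.1, p.2.2)).
  apply: measurable_fun_pair => //.
  exact: measurableT_comp measurable_snd measurable_snd.
have mn : measurable_fun setT (fun p : X * T => p.2.1).
  exact: measurableT_comp measurable_fst measurable_snd.
rewrite (_ : F @^-1` B = \bigcup_n ((fun p : X * T => p.2.1) @^-1` [set n] `&`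
   (fun p : X * T => (p.1, p.2.2)) @^-1` ((fun p : X * Y => F (p.1, (n, p.2))) @^-1` B))).
  apply: bigcupT_measurable => n; apply: measurableI.
    by rewrite -[X in measurable X]setTI; exact: mn.
  rewrite -[X in measurable X]setTI; apply: mpi => //.
  by rewrite -[X in measurable X]setTI; exact: mF.
apply/seteqP; split => [[x [n s]] /= h|[x [n s]] [n' _] /= [<-]//]; first by exists n.
Qed.

Lemma integral_slice (n : nat) (A : set Y) (F : T -> \bar R) : measurable A ->
  measurable_fun setT F -> (forall q, 0 <= F q) ->
  \int[tmeasure]_(q in [set q : T | q.1 = n /\ A q.2]) F q = \int[lam]_(s in A) F (n, s).
Proof.
move=> mA mF F0; have mS := measurable_slice n mA.
rewrite integral_mkcond integral_T; last 2 first.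
- by apply/(measurable_restrictT _ mS); exact: measurable_funTS.
- by move=> q; rewrite patchE; case: ifPn.
rewrite (@nneseriesD1 _ _ n)//; last first.
  by move=> k _; apply: integral_ge0 => s _; rewrite patchE; case: ifPn.
rewrite eseries0 ?adde0.
  rewrite [RHS]integral_mkcond; apply: eq_integral => s _; rewrite !patchE.
  congr (if _ then _ else _); apply/idP/idP => /set_mem /= h; apply/mem_set => //.
  by case: h.
move=> k _ /andP[_ kn]; apply: integral0_eq => s _; rewrite patchE.
by case: ifPn => // /set_mem [/= e _]; move: kn; rewrite e eqxx.
Qed.

Lemma ae_T (P : T -> Prop) : (forall n, {ae lam, forall s : R, P (n, s)}) ->
  {ae tmeasure, forall q, P q}.
Proof.
move=> H; have /choice[A HA] : forall n, exists A : set Y,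
    [/\ measurable A, lam A = 0 & ~` [set s | P (n, s)] `<=` A].
  by move=> n; have [A [mA A0 sA]] := H n; exists A.
pose B := \bigcup_n [set q : T | q.1 = n /\ A n q.2].
have mB : measurable B.
  by apply: bigcupT_measurable => n; apply: measurable_slice; have [] := HA n.
exists B; split => //; last first.
  move=> [n s] /= nP; exists n => //; split => //=; have [_ _ sA] := HA n.
  exact: sA.
apply/eqP; rewrite -measure_le0; apply: le_trans (measure_sigma_subadditive _ _ _ (@subset_refl _ B)) _ => //.
  by move=> n; apply: measurable_slice; have [] := HA n.
rewrite eseries0// => n _ _; have [mA A0 _] := HA n; have mS := measurable_slice n mA.
transitivity (\int[tmeasure]_(q in [set q : T | q.1 = n /\ A n q.2]) (cst 1 q)).
  by rewrite integral_cst// mul1e.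
rewrite integral_slice//.
by rewrite integral_cst// mul1e.
Qed.

Definition gap (l : \bar R) : set Y := [set s | (0 < s)%R /\ s%:E < l].

Lemma measurable_gap (l : \bar R) : measurable (gap l).
Proof.
rewrite (_ : gap l = [set s : Y | (0 < s)%R] `&` [set s | s%:E < l])//.
apply: measurableI; rewrite -[X in measurable X]setTI.
  by apply: measurable_fun_ltr => //; exact: measurable_cst.
by apply: emeasurable_fun_infty_o => //; exact/measurable_EFinP.
Qed.

Lemma n2_slice_lty (g : T -> R) n : measurable_fun setT g -> (n2 tmeasure setT g < +oo)%E ->
  (n2 lam setT (fun s => g (n, s)) < +oo)%E.
Proof.
move=> mg g2; apply: le_lt_trans g2; rewrite /n2 integral_T; last 2 first.
- exact: measurable_sqrE.
- by move=> q; rewrite lee_fin sqr_ge0.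
rewrite (@nneseriesD1 _ _ n)// ?leeDl//.
- by apply: nneseries_ge0 => k _ _; apply: integral_ge0 => s _; rewrite lee_fin sqr_ge0.
- by move=> k _; apply: integral_ge0 => s _; rewrite lee_fin sqr_ge0.
Qed.

End edge_space.

Section one_dimensional.
Context {R : realType}.
Local Notation Y := (measurableTypeR R).
Local Notation lam := (@lebesgue_measure R).
Variables (w g : R -> R).
Hypotheses (mg : measurable_fun [set: Y] g) (g2 : (n2 lam setT g < +oo)%E).
(** The form in which absolute continuity enters; it is preserved by w -> -w and by adding a
    constant. *)
Hypothesis wg : forall s s', s <= s' ->
  ((`|w s' - w s|)%:E <= \int[lam]_(r in `]s, s'[) (`|g r|)%:E)%E.

(** Cauchy-Schwarz on ]s, s'[ makes w Hoelder continuous of exponent 1/2. *)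
Lemma holder_half : exists2 A, 0 <= A &
  forall s s', `|w s' - w s| ^+ 2 <= A * `|s' - s|.
Proof.
have E := n2_fin g2; set A := fine _ in E; have A0 : 0 <= A by exact/fine_ge0/n2_ge0.
exists A => // s s'; wlog ss : s s' / s <= s'.
  move=> H; have /orP[h|h] := le_total s s'; first exact: H.
  by rewrite distrC [`|s' - s|]distrC; exact: H.
have mI : measurable (`]s, s'[%classic : set Y) by exact: measurable_itv.
have gI : (n2 lam (`]s, s'[%classic : set Y) g <= A%:E)%E.
  rewrite -E; apply: ge0_subset_integral => //.
    exact: measurable_sqrE.
  by move=> r _; rewrite lee_fin sqr_ge0.
have n1 : n2 lam (`]s, s'[%classic : set Y) (cst 1) = (s' - s)%:E.
  rewrite /n2; under eq_integral do rewrite /= expr1n.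
  rewrite integral_cst// mul1e; transitivity (lebesgue_measure (`]s, s'[%classic : set R)) => //.
  rewrite lebesgue_measure_itv/= lte_fin; case: ifPn => [_|].
    by rewrite EFinB.
  by rewrite -leNgt => h; congr EFin; apply/eqP; rewrite eq_sym subr_eq0 eq_le ss h.
have := @cauchy_schwarz _ _ _ lam (`]s, s'[%classic : set Y) (cst 1) g mI (measurable_cst _)
  (measurable_funTS mg).
rewrite n1 ltry => /(_ isT (le_lt_trans gI (ltry _))).
under eq_integral do rewrite mul1r.
move=> CS; rewrite (ger0_norm (_ : 0 <= s' - s)) ?subr_ge0// mulrC -lee_fin EFinM.
apply: (@le_trans _ _ ((s' - s)%:E * n2 lam (`]s, s'[%classic : set Y) g)%E).
  by apply: le_trans CS; rewrite expe2; apply: lee_pmul => //; exact: wg.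
by rewrite [leRHS]EFinM; apply: lee_pmul => //; [rewrite lee_fin subr_ge0|exact: n2_ge0].
Qed.

Lemma continuous_primitive : continuous w.
Proof.
have [A A0 HA] := holder_half.
move=> s; apply/cvgrPdist_le => e e0.
have A1 : 0 < A + 1 by rewrite ltr_wpDl.
have h0 : 0 < e ^+ 2 / (A + 1) by rewrite divr_gt0// exprn_gt0.
near=> r.
  have rs : `|s - r| <= e ^+ 2 / (A + 1).
    by near: r; apply: cvgr_dist_le h0; exact: cvg_id.
  have h := HA r s; rewrite -ler_sqr ?nnegrE ?(ltW e0)//.
  apply: le_trans h _; apply: (@le_trans _ _ ((A + 1) * `|s - r|)).
    by rewrite ler_wpM2r// lerDl.
  by rewrite mulrC -ler_pdivlMr.
Unshelve. all: by end_near.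
Qed.

Lemma measurable_primitive : measurable_fun [set: Y] w.
Proof. exact: continuous_measurable_fun continuous_primitive. Qed.

(* Between the last passage at w s and the next passage at w s', the values of w lie in between. *)
Lemma increment_up s s' a b : s <= s' -> a <= w s -> w s <= w s' -> w s' <= b ->
  ((w s' - w s)%:E <= \int[lam]_(r in `]s, s'[%classic `&` [set r | (a < w r < b)%R]) (`|g r|)%:E)%E.
Proof.
move=> ss asv wss sb; have cw := continuous_primitive.
pose A1 := [set r | s <= r <= s' /\ w r <= w s].
have cA1 : closed A1.
  rewrite (_ : A1 = `[s, s'] `&` (w @^-1` [set y | y <= w s])).
    apply: closedI; first exact: interval_closed.
    by apply: preimage_closed; [|exact: closed_le].
  by apply/seteqP; split => r /=; rewrite in_itv.
have A1s : A1 s by rewrite /A1 /= lexx ss.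
have ub1 : has_ubound A1 by exists s' => r [/andP[]].
have s1A : A1 (sup A1) by rewrite {1}(closure_id A1).1//; apply: closure_sup => //; exists s.
set s1 := sup A1 in s1A; have [/andP[ss1 s1s'] ws1] := s1A.
(* The first passage at w s' after s1, written as a supremum by reflecting the line. *)
pose A2 := [set r | - s' <= r <= - s1 /\ w s' <= w (- r)].
have cA2 : closed A2.
  rewrite (_ : A2 = `[- s', - s1] `&` ((fun r => w (- r)) @^-1` [set y | w s' <= y])).
    apply: closedI; first exact: interval_closed.
    apply: preimage_closed; last exact: closed_ge.
    by move=> r _; apply: (continuous_comp (f := -%R)); [exact: opp_continuous|exact: cw].
  by apply/seteqP; split => r /=; rewrite in_itv.
have A2s : A2 (- s') by rewrite /A2 /= lexx lerN2 s1s' opprK.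
have ub2 : has_ubound A2 by exists (- s1) => r [/andP[]].
have s2A : A2 (sup A2) by rewrite {1}(closure_id A2).1//; apply: closure_sup => //; exists (- s').
set s2 := - sup A2; have [/andP[] h1 h2 ws2] := s2A; rewrite -/s2 in ws2.
have s2s' : s2 <= s' by rewrite lerNl.
have s1s2 : s1 <= s2 by rewrite lerNr.
apply: (@le_trans _ _ (`|w s2 - w s1|)%:E).
  by rewrite lee_fin; apply: le_trans (ler_norm _); lra.
apply: le_trans (wg s1s2) _.
apply: ge0_subset_integral => //.
- by apply: measurableI; [exact: measurable_itv|exact: measurable_preimage_between measurable_primitive].
- by apply/measurable_EFinP; apply: measurable_funTS; exact: measurableT_comp (@normr_measurable _ _) mg.
move=> r /=; rewrite !in_itv/= => /andP[r1 r2].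
have sr : s < r by exact: le_lt_trans ss1 r1.
have rs' : r < s' by exact: lt_le_trans s2s'.
rewrite sr rs'; split => //; apply/andP; split.
  apply: le_lt_trans asv _; rewrite ltNge; apply/negP => wr.
  have : r <= s1 by apply: ub_le_sup => //; rewrite /A1 /= wr !ltW.
  by rewrite leNgt r1.
apply: lt_le_trans sb; rewrite ltNge; apply/negP => wr.
have : - r <= sup A2 by apply: ub_le_sup => //; rewrite /A2 /= opprK wr !lerN2 !ltW.
by rewrite lerNl leNgt r2.
Qed.

End one_dimensional.

Section increments.
Context {R : realType}.
Local Notation Y := (measurableTypeR R).
Local Notation lam := (@lebesgue_measure R).
Variables (w g : R -> R).
Hypotheses (mg : measurable_fun [set: Y] g) (g2 : (n2 lam setT g < +oo)%E).
Hypothesis wg : forall s s', s <= s' ->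
  ((`|w s' - w s|)%:E <= \int[lam]_(r in `]s, s'[) (`|g r|)%:E)%E.

Lemma increment_between s s' a b : s <= s' -> a <= w s <= b -> a <= w s' <= b ->
  ((`|w s' - w s|)%:E <= \int[lam]_(r in `]s, s'[%classic `&` [set r | (a < w r < b)%R]) (`|g r|)%:E)%E.
Proof.
move=> ss /andP[a1 b1] /andP[a2 b2].
have /orP[h|h] := le_total (w s) (w s').
  by rewrite ger0_norm ?subr_ge0//; exact: increment_up.
have wg' s0 s0' : s0 <= s0' ->
    ((`|- w s0' - - w s0|)%:E <= \int[lam]_(r in `]s0, s0'[) (`|g r|)%:E)%E.
  by move=> hs; rewrite -opprD normrN; exact: wg.
have := @increment_up _ (fun s => - w s) g mg g2 wg' s s' (- b) (- a) ss.
rewrite !lerN2 => /(_ b1 h a2); rewrite ler0_norm ?subr_le0// opprD.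
suff -> : [set r | - b < - w r < - a] = [set r | a < w r < b] by [].
by apply/seteqP; split => r /=; rewrite !ltrN2 andbC.
Qed.

End increments.

Section coarea.
Context {R : realType}.
Local Notation Y := (measurableTypeR R).
Local Notation T := (nat * measurableTypeR R)%type.
Local Notation lam := (@lebesgue_measure R).
Local Notation tm := (@tmeasure R).
Variables (W G : T -> R) (a b : R).
Hypotheses (ab : a < b) (mG : measurable_fun setT G) (G2 : (n2 tm setT G < +oo)%E).
Hypothesis WG : forall n s s', s <= s' ->
  ((`|W (n, s') - W (n, s)|)%:E <= \int[lam]_(r in `]s, s'[) (`|G (n, r)|)%:E)%E.

Let mGn n : measurable_fun [set: Y] (fun s => G (n, s)).
Proof. by apply: (measurableT_comp mG); exact: pair1_measurable. Qed.

Let Gn2 n : (n2 lam setT (fun s => G (n, s)) < +oo)%E.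
Proof. exact: n2_slice_lty. Qed.

Let mW : measurable_fun setT W.
Proof.
by apply: measurable_fun_T => n; exact: measurable_primitive (mGn n) (Gn2 n) (WG n).
Qed.

Let h (q : T) : \bar R := ((fun q => (`|G q|)%:E) \_ [set q | a < W q < b]) q.

Let mbtw : measurable [set q | a < W q < b].
Proof.
exact: measurable_preimage_between mW.
Qed.

Let mh : measurable_fun setT h.
Proof.
apply/(measurable_restrictT _ mbtw)/measurable_EFinP; apply: measurable_funTS.
exact: measurableT_comp (@normr_measurable _ _) mG.
Qed.

Let h0 q : (0 <= h q)%E.
Proof. by rewrite /h patchE; case: ifPn. Qed.

(** Cells of length 1/(k + 1) on the half-line s >= 0, where all edges lie. Counting the cells that
    may take a value approximates the number of its preimages. *)
Let grid (k j : nat) : set Y := [set s | j%:R <= s * k.+1%:R < j.+1%:R].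

Let mgrid k j : measurable (grid k j).
Proof.
have mf : measurable_fun [set: Y] (fun s : Y => s * k.+1%:R).
  by apply: measurable_funM => //; exact: measurable_cst.
rewrite (_ : grid k j = (fun s => s * k.+1%:R) @^-1` `[j%:R, j.+1%:R[).
  by rewrite -[X in measurable X]setTI; apply: mf => //; exact: measurable_itv.
by apply/seteqP; split => s; rewrite /grid /= in_itv.
Qed.

(** The cells of all copies of the line under a single index, so that sums over them are series; an
    index that codes no pair gives the empty cell. *)
Let cell (k i : nat) : set T :=
  if pickle_inv i is Some nj then [set q : T | q.1 = nj.1 /\ grid k nj.2 q.2] else set0.

Let mcell k i : measurable (cell k i).
Proof. by rewrite /cell; case: pickle_inv => // nj; exact: measurable_slice. Qed.

Let cell_disj k : trivIset setT (cell k).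
Proof.
apply/trivIsetP => i j _ _ ij; rewrite -subset0 => -[n s] []; rewrite /cell.
case Ei : (pickle_inv i) => [[ni ji]|//]; case Ej : (pickle_inv j) => [[nj jj]|//] /=.
move=> [e1 /andP[g1 g2]] [e2 /andP[g3 g4]]; subst ni nj.
have /(congr1 pickle) : (n, ji) = (n, jj).
  have l1 : (ji < jj.+1)%N by rewrite -(ltr_nat R) (le_lt_trans g1 g4).
  have l2 : (jj < ji.+1)%N by rewrite -(ltr_nat R) (le_lt_trans g3 g2).
  by congr pair; apply/eqP; rewrite eqn_leq; apply/andP; split.
have := pickle_invK (T := (nat * nat)%type) i; rewrite Ei /= => ->.
have := pickle_invK (T := (nat * nat)%type) j; rewrite Ej /= => -> e.
by move: ij; rewrite e eqxx.
Qed.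

Let Iv k i : \bar R := (\int[tm]_(q in cell k i) h q)%E.

Let Iv0 k i : (0 <= Iv k i)%E. Proof. exact: integral_ge0. Qed.

Let vals k i : set R := [set t | a < t < b /\ exists2 q, cell k i q & W q = t].

(** The increment of [W] between two points of a cell is bounded by the integral of |G| over the
    points between them where a < W < b, and these lie in the cell. *)
Let vals_diam k i t t' : vals k i t -> vals k i t' -> ((`|t' - t|)%:E <= Iv k i)%E.
Proof.
move=> [tab [[n s] cq Wq]] [tab' [[n' s'] cq' Wq']].
move: cq cq'; rewrite /Iv /cell; case: pickle_inv => // -[m j] /= [e1 gs] [e2 gs'].
subst n n'; rewrite integral_slice//.
wlog ss : s s' t t' tab tab' Wq Wq' gs gs' / s <= s'.
  move=> H; have /orP[hs|hs] := le_total s s'; first exact: (H s s').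
  by rewrite distrC; exact: (H s' s).
rewrite -Wq -Wq'.
have /andP[t1 t2] := tab; have /andP[t1' t2'] := tab'.
apply: le_trans (increment_between (a := a) (b := b) (mGn m) (Gn2 m) (WG m) ss _ _) _.
- by rewrite Wq !ltW.
- by rewrite Wq' !ltW.
have mB : measurable ([set r | a < W (m, r) < b] : set Y).
  exact: measurable_preimage_between (measurable_primitive (mGn m) (Gn2 m) (WG m)).
have mI : measurable (`]s, s'[%classic : set Y) by exact: measurable_itv.
have mhm : measurable_fun setT (fun r : Y => h (m, r)).
  by apply: (measurableT_comp mh); exact: pair1_measurable.
rewrite integral_mkcond [leRHS]integral_mkcond; apply: ge0_le_integral => //.
- by move=> r _; rewrite patchE; case: ifPn.
- apply/(measurable_restrictT _ (measurableI _ _ mI mB))/measurable_EFinP.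
  by apply: measurable_funTS; exact: measurableT_comp (@normr_measurable _ _) (mGn m).
- by apply/(measurable_restrictT _ (mgrid k j)); exact: measurable_funTS.
move=> r _; rewrite !patchE; case: ifPn => [/set_mem [/= ri rb]|_]; last by case: ifPn.
rewrite mem_set; first by rewrite /h patchE mem_set.
move: ri; rewrite in_itv/= => /andP[r1 r2]; move: gs gs' => /andP[g1 g2] /andP[g3 g4].
rewrite /grid /=; apply/andP; split.
  by apply: le_trans g1 _; rewrite ler_pM2r// ltW.
by apply: le_lt_trans g4; rewrite ler_pM2r// ltW.
Qed.

(** When the integral over the cell is finite, a closed interval of that length which contains the
    values in ]a, b[ taken in the cell; unlike the image of the cell it is visibly measurable. *)
Let K k i : set R := [set t | vals k i !=set0 /\ inf (vals k i) <= t <= inf (vals k i) + fine (Iv k i)].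

Let mK k i : measurable (K k i : set Y).
Proof.
have [ne|ne] := pselect (vals k i !=set0).
  rewrite (_ : K k i = `[inf (vals k i), inf (vals k i) + fine (Iv k i)]%classic).
    exact: measurable_itv.
  by apply/seteqP; split => t; rewrite /K /= in_itv/=; [case|].
by rewrite (_ : K k i = set0)// -subset0 => t [].
Qed.

Let lamK k i : (lam (K k i) <= Iv k i)%E.
Proof.
have [->|Ioo] := eqVneq (Iv k i) +oo%E; first exact: leey.
have If : Iv k i = (fine (Iv k i))%:E by rewrite fineK// ge0_fin_numE// ltey.
apply: (@le_trans _ _ (lam (`[inf (vals k i), inf (vals k i) + fine (Iv k i)]%classic : set Y))).
  apply: le_measure; rewrite ?inE//.
  by move=> t [_]; rewrite /= in_itv.
suff L : (lebesgue_measure (`[inf (vals k i), (inf (vals k i) + fine (Iv k i))%R]%classic : set R)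
  <= Iv k i)%E by exact: L.
rewrite lebesgue_measure_itv/= lte_fin; case: ifPn => // _.
by rewrite -EFinD addrAC subrr add0r -If.
Qed.

Let valsK k i t : (Iv k i < +oo)%E -> vals k i t -> K k i t.
Proof.
move=> Ioo vt; have If : Iv k i = (fine (Iv k i))%:E by rewrite fineK// ge0_fin_numE.
split; first by exists t.
apply/andP; split.
  by apply: ge_inf => //; exists a => t' [/andP[/ltW]].
rewrite -lerBlDr; apply: lb_le_inf; first by exists t.
move=> t' vt'; rewrite lerBlDl -lerBlDr -lee_fin -If.
by apply: le_trans (vals_diam vt' vt); rewrite lee_fin ler_norm.
Qed.

(** Discretised Banach indicatrix: the number of cells whose interval [K] contains t. *)
Let N k (t : Y) : \bar R := (\sum_(0 <= i <oo) (\1_(K k i) t : R)%:E)%E.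

Let mindic k i : measurable_fun setT (fun t : Y => (\1_(K k i) t : R)%:E).
Proof. by apply/measurable_EFinP; apply: measurable_indic; exact: mK. Qed.

Let N0 k t : (0 <= N k t)%E.
Proof. by apply: nneseries_ge0 => i _ _; rewrite lee_fin indicE. Qed.

Let mN k : measurable_fun setT (N k).
Proof. by apply: ge0_emeasurable_sum => i // t _ _; rewrite lee_fin indicE. Qed.

Let intN k : (\int[lam]_t N k t <= \int[tm]_q h q)%E.
Proof.
rewrite /N integral_nneseries//.
apply: (@le_trans _ _ (\sum_(0 <= i <oo) Iv k i)%E).
  apply: lee_nneseries => i _; first by move=> _; apply: integral_ge0 => t _; rewrite lee_fin indicE.
  by rewrite integral_indic ?setIT//; exact: lamK.
rewrite -ge0_integral_bigcup//; last exact: measurable_funTS.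
apply: ge0_subset_integral => //; exact: bigcupT_measurable.
Qed.

Let index k (q : T) : nat := pickle (q.1, Num.truncn (q.2 * k.+1%:R)).

Let cell_index k q : 0 <= q.2 -> cell k (index k q) q.
Proof.
move=> q0; rewrite /cell /index pickleK_inv; split => //=.
by apply: truncn_itv; rewrite mulr_ge0.
Qed.

Let Ioo k i : (\int[tm]_q h q < +oo)%E -> (Iv k i < +oo)%E.
Proof. by apply: le_lt_trans; apply: ge0_subset_integral. Qed.

Let index_K k q t : (\int[tm]_q h q < +oo)%E -> 0 <= q.2 -> W q = t -> a < t < b ->
  K k (index k q) t.
Proof.
move=> hoo q0 Wq tab; apply: valsK; first exact: Ioo.
by split => //; exists q => //; exact: cell_index.
Qed.

Let N_ge1 k i t : K k i t -> (1 <= N k t)%E.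
Proof.
move=> Kt; rewrite /N (@nneseriesD1 _ _ i)//.
rewrite indicE mem_set// leeDl//; apply: nneseries_ge0 => j _ _; rewrite lee_fin indicE//.
Qed.

Let N_ge2 k i j t : i != j -> K k i t -> K k j t -> (2%:E <= N k t)%E.
Proof.
move=> ij Ki Kj; rewrite /N (@nneseriesD1 _ _ i)//.
rewrite (@nneseriesD1 _ _ j)//=; last by rewrite eq_sym.
rewrite !indicE !mem_set// addeA -EFinD leeDl//.
by apply: nneseries_ge0 => ? _ _; rewrite lee_fin indicE.
Qed.

(** If almost every t in ]a, b[ is eventually counted c times, Fatou's lemma in k bounds c(b - a) by
    the lower limit of the integrals of [N k], each at most the integral of |G| over {a < W < b}. If
    the latter is infinite the claim is trivial. *)
Let count_le (c : R) : 0 <= c ->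
  ((\int[tm]_q h q < +oo)%E ->
   {ae lam, forall t : R, a < t < b -> exists k0, forall k, (k0 <= k)%N -> (c%:E <= N k t)%E}) ->
  ((c * (b - a))%:E <= \int[tm]_q h q)%E.
Proof.
move=> c0 H; have [hoo|] := ltP (\int[tm]_q h q)%E +oo%E; last first.
  by rewrite leye_eq => /eqP ->; exact: leey.
have mI : measurable (`]a, b[%classic : set Y) by exact: measurable_itv.
have -> : ((c * (b - a))%:E = \int[lam]_(t in (`]a, b[%classic : set Y)) c%:E)%E.
  rewrite integral_cst//; transitivity (c%:E * lebesgue_measure (`]a, b[%classic : set R))%E => //.
  by rewrite lebesgue_measure_itv/= lte_fin ab -EFinD EFinM.
have F := @fatou _ _ _ lam (`]a, b[%classic : set Y) mI N (fun k => measurable_funTS (mN k))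
  (fun k t _ => N0 k t).
apply: (@le_trans _ _ (\int[lam]_(t in (`]a, b[%classic : set Y)) limn_einf (N^~ t))%E).
  apply: ae_ge0_le_integral => //.
  - by move=> t _; rewrite limn_einf_lim; apply: lime_ge; [exact: is_cvg_einfs|
      apply: nearW => k; apply: le_ereal_inf_tmp => _ [k' _ <-]; exact: N0].
  - rewrite (_ : (fun _ => _) = (fun t => - limn_esup (fun k => - N k t))%E).
      apply: measurableT_comp => //; apply: measurable_fun_limn_esup => k.
      by apply: measurableT_comp => //; exact: measurable_funTS (mN k).
    by apply/funext => t; rewrite (limn_esupN (N^~ t)) oppeK.
  apply: ae_imp (H hoo) _ => t Ht /=; rewrite in_itv/= => /Ht [k0 Hk0].
  rewrite limn_einf_lim; apply: lime_ge; first exact: is_cvg_einfs.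
  exists k0 => // k /= k0k; apply: le_ereal_inf_tmp => _ [k' /= kk' <-].
  by apply: Hk0; exact: leq_trans kk'.
apply: le_trans F _; rewrite limn_einf_lim; apply: lime_le; first exact: is_cvg_einfs.
apply: nearW => k; apply: le_trans (intN k); apply: (@le_trans _ _ (\int[lam]_(t in (`]a, b[%classic : set Y)) N k t)%E).
  by apply: ereal_inf_lbound; exists k => /=.
by apply: ge0_subset_integral => //; exact: mN.
Qed.

Lemma coarea_once :
  (forall t, a < t < b -> exists2 q, 0 <= q.2 & W q = t) ->
  ((b - a)%:E <= \int[tm]_(q in [set q | (a < W q < b)%R]) (`|G q|)%:E)%E.
Proof.
move=> H; rewrite integral_mkcond -[b - a]mul1r; apply: count_le => // hoo.
apply: aeW => t tab; exists 0%N => k _; have [q q0 Wq] := H t tab.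
exact: N_ge1 (index_K k hoo q0 Wq tab).
Qed.

(** Two distinct points with the same value lie in distinct cells: always if they are on different
    lines, otherwise once 1/(k + 1) is smaller than their distance. The value is then counted
    twice. *)
Lemma coarea_twice :
  {ae lam, forall t : R, a < t < b -> exists q q', [/\ 0 <= q.2, 0 <= q'.2, q <> q', W q = t & W q' = t]} ->
  ((2 * (b - a))%:E <= \int[tm]_(q in [set q | (a < W q < b)%R]) (`|G q|)%:E)%E.
Proof.
move=> H; rewrite integral_mkcond; apply: count_le => // hoo.
apply: ae_imp H _ => t Ht tab; have [q [q' [q0 q0' qq' Wq Wq']]] := Ht tab.
have [k0 Hk0] : exists k0, forall k, (k0 <= k)%N -> index k q != index k q'.
  have [e1|ne1] := eqVneq q.1 q'.1; last first.
    exists 0%N => k _; apply: contra_neq ne1.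
    by move=> /(pcan_inj (@pickleK_inv (nat * nat)%type)) [].
  have ne2 : q.2 != q'.2.
    by apply/eqP => e2; apply: qq'; rewrite [q]surjective_pairing e1 e2 -surjective_pairing.
  have d0 : 0 < `|q.2 - q'.2| by rewrite normr_gt0 subr_eq0.
  exists (Num.bound (`|q.2 - q'.2|^-1)) => k kk; apply/eqP.
  move=> /(pcan_inj (@pickleK_inv (nat * nat)%type)) [_ e2].
  have i1 : 0 <= q.2 * k.+1%:R by rewrite mulr_ge0.
  have i2 : 0 <= q'.2 * k.+1%:R by rewrite mulr_ge0.
  have /andP[a1 a2] := truncn_itv i1; have /andP[a3 a4] := truncn_itv i2.
  rewrite -e2 in a3 a4; move: a1 a2 a3 a4; set n := Num.truncn _.
  rewrite -[n.+1%:R]natr1 => a1 a2 a3 a4.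
  have : `|q.2 * k.+1%:R - q'.2 * k.+1%:R| < 1 by rewrite ltr_norml; lra.
  rewrite -mulrBl normrM [`|k.+1%:R|]ger0_norm// ltNge => /negP; apply.
  rewrite -ler_pdivrMl// mulr1.
  have := archi_boundP (_ : 0 <= `|q.2 - q'.2|^-1); rewrite invr_ge0 ltW// => /(_ isT) /ltW /le_trans; apply.
  by rewrite ler_nat leqW.
exists k0 => k /Hk0 ne; exact: N_ge2 ne (index_K k hoo q0 Wq tab) (index_K k hoo q0' Wq' tab).
Qed.

End coarea.

(** * Functions on the edges of a graph *)

Section edges.
Context {R : realType} (G : metric_graph R).
Local Notation Y := (measurableTypeR R).
Local Notation T := (nat * measurableTypeR R)%type.
Local Notation lam := (@lebesgue_measure R).
Local Notation tm := (@tmeasure R).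
Implicit Types (f : edge G -> R -> R) (e : edge G).

Definition inner e : set R := gap (len e).

(* Edge e occupies ]0, len e[ on the copy of the line of index pickle e. *)
Definition gext f (q : T) : R :=
  if pickle_inv q.1 is Some e then
    if (0 < q.2) && ((q.2)%:E < len e)%E then f e q.2 else 0
  else 0.

Lemma gext_pickle f e s : inner e s -> gext f (pickle e, s) = f e s.
Proof. by move=> [s0 sl]; rewrite /gext /= pickleK_inv s0 sl. Qed.

Lemma gext_out f e s : ~ inner e s -> gext f (pickle e, s) = 0.
Proof.
rewrite /gext /= pickleK_inv => h; case: ifPn => // /andP[s0 sl].
by exfalso; apply: h.
Qed.

Lemma pickle_invP n : (exists e : edge G, n = pickle e) \/ pickle_inv n = None :> option (edge G).
Proof.
case E : (pickle_inv n) => [e|]; last by right.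
by left; exists e; have := pickle_invK (T := edge G) n; rewrite E.
Qed.

Lemma gextP (q : T) : (exists e s, q = (pickle e, s) /\ inner e s) \/ (forall f, gext f q = 0).
Proof.
case: q => n s; have [[e ->]|E] := pickle_invP n; last by right => f; rewrite /gext /= E.
have [ins|nis] := pselect (inner e s); first by left; exists e, s.
by right => f; exact: gext_out.
Qed.

Lemma gext_comp (phi : R -> R) f q : phi 0 = 0 ->
  gext (fun e s => phi (f e s)) q = phi (gext f q).
Proof.
move=> p0; rewrite /gext; case: pickle_inv => [e|]; last by rewrite p0.
by case: ifPn.
Qed.

Lemma gext_comp2 (phi : R -> R -> R) f f' q : phi 0 0 = 0 ->
  gext (fun e s => phi (f e s) (f' e s)) q = phi (gext f q) (gext f' q).
Proof.
move=> p0; rewrite /gext; case: pickle_inv => [e|]; last by rewrite p0.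
by case: ifPn.
Qed.

Lemma gext_ge0 f q : (forall e s, inner e s -> 0 <= f e s) -> 0 <= gext f q.
Proof.
move=> H; have [[e [s [-> ins]]]|->] := gextP q; last by [].
by rewrite gext_pickle// H.
Qed.

Lemma measurable_inner e : measurable (inner e : set Y).
Proof. exact: measurable_gap. Qed.

Lemma lebesgue_inner e : lam (inner e) = len e.
Proof.
suff : lebesgue_measure (inner e : set R) = len e by [].
have := len_gt0 e; case E : (len e) => [l| |] // l0.
  rewrite (_ : inner e = `]0, l[%classic).
    by rewrite lebesgue_measure_itv/= l0 -EFinB subr0.
  apply/seteqP; split => s; rewrite /inner /gap /= in_itv/= E lte_fin; first by move=> [-> ->].
  by move=> /andP[].
rewrite (_ : inner e = `]0, +oo[%classic).
  by rewrite lebesgue_measure_itv/= ltry.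
apply/seteqP; split => s; rewrite /inner /gap /= in_itv/= E ltry andbT; first by case.
by [].
Qed.

Lemma esum_edges (h : edge G -> \bar R) : (forall e, 0 <= h e)%E ->
  (\esum_(e in [set: edge G]) h e = \sum_(0 <= n <oo) oapp h 0 (pickle_inv n))%E.
Proof.
move=> h0; have o0 n : (0 <= oapp h 0 (pickle_inv n))%E by case: pickle_inv => /=.
rewrite nneseries_esumT//.
rewrite (esumID (range (@pickle (edge G))))// [X in (_ + X)%E]esum1 ?adde0; last first.
  move=> n [_ nr]; have [[e en]|->] := pickle_invP n; last by [].
  by exfalso; apply: nr; exists e.
rewrite setTI (reindex_esum setT (range (@pickle (edge G))) (@pickle (edge G))); last first.
  split => //; exact: in2W (pcan_inj (@pickleK_inv (edge G))).
by apply: eq_esum => e _; rewrite pickleK_inv.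
Qed.

Lemma measurable_gext f : (forall e, measurable_fun (inner e : set Y) (f e)) ->
  measurable_fun setT (gext f).
Proof.
move=> mf; apply: measurable_fun_T => n; have [[e ->]|E] := pickle_invP n; last first.
  by rewrite (_ : (fun s => _) = cst 0)//; apply/funext => s; rewrite /gext /= E.
have := (@measurable_restrictT _ _ Y _ _ _ (measurable_inner e)).1 (mf e).
apply: eq_measurable_fun => s _; rewrite patchE; case: ifPn => [/set_mem h|/negP h].
  by rewrite gext_pickle.
by rewrite gext_out// => ins; apply: h; exact: mem_set.
Qed.

Lemma integral_gext f : (forall e, measurable_fun (inner e : set Y) (f e)) ->
  (forall e s, inner e s -> 0 <= f e s) ->
  (\int[tm]_q (gext f q)%:E = \esum_(e in [set: edge G]) \int[lam]_(s in inner e) (f e s)%:E)%E.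
Proof.
move=> mf f0; rewrite integral_T; last 2 first.
- by apply/measurable_EFinP; exact: measurable_gext.
- by move=> q; rewrite lee_fin; exact: gext_ge0.
rewrite esum_edges; last by move=> e; apply: integral_ge0 => s; rewrite lee_fin; exact: f0.
apply: eq_eseriesr => n _; have [[e ->]|E] := pickle_invP n; last first.
  by rewrite E /=; apply: integral0_eq => s _; rewrite /gext /= E.
rewrite pickleK_inv /= [RHS]integral_mkcond; apply: eq_integral => s _.
rewrite patchE; case: ifPn => [/set_mem /gext_pickle ->//|/negP h].
by rewrite gext_out// => ins; apply: h; exact: mem_set.
Qed.

(** The union of the open edges, as a level set of the extension of the constant 1, which makes its
    measurability immediate. *)
Definition gsupp : set T := [set q | gext (fun _ _ => 1) q = 1].

Lemma gsuppP q : gsupp q <-> exists e s, q = (pickle e, s) /\ inner e s.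
Proof.
split => [|[e [s [-> ins]]]]; last by rewrite /gsupp /= gext_pickle.
have [//|H] := gextP q; rewrite /gsupp /= H => /eqP; by rewrite eq_sym oner_eq0.
Qed.

Lemma measurable_gsupp : measurable gsupp.
Proof.
rewrite -[X in measurable X]setTI.
have mg := measurable_gext (f := fun _ _ => 1) (fun e => measurable_cst _).
exact: (mg measurableT [set 1] (measurable_set1 _)).
Qed.

Lemma gext_notin f q : ~ gsupp q -> gext f q = 0.
Proof. by move=> h; have [/gsuppP//|->] := gextP q. Qed.

Lemma tmeasure_gsupp : tm gsupp = total_length G.
Proof.
have mD := measurable_gsupp.
transitivity (\int[tm]_q (gext (fun _ _ => 1) q)%:E)%E.
  rewrite -[X in tm X]setIT -integral_indic//; apply: eq_integral => q _; congr EFin.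
  rewrite indicE; case: (boolP (q \in gsupp)) => [/set_mem ->//|/negP h].
  by rewrite gext_notin// => hq; apply: h; exact: mem_set.
rewrite integral_gext//; apply: eq_esum => e _.
by rewrite integral_cst ?mul1e; [exact: lebesgue_inner|exact: measurable_inner].
Qed.

Definition pos_part (f : edge G -> R -> R) e s := Num.max (f e s) 0.

(** [distribution_fun] measures closed edges, while the extension only sees open ones: the
    superlevel sets differ by endpoints, which are null. At levels t >= 0 a function and its
    positive part have the same superlevel sets. *)
Lemma distribution_funE f t : 0 <= t -> (forall e, measurable_fun (inner e : set Y) (f e)) ->
  distribution_fun f t = dfun tm (gext (pos_part f)) t.
Proof.
move=> t0 mf.
have mp e : measurable_fun (inner e : set Y) (pos_part f e).
  by apply: measurable_maxr => //; exact: measurable_cst.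
have mA : measurable [set q | t < gext (pos_part f) q].
  exact: measurable_gt (measurable_gext mp).
rewrite /dfun -[X in tm X]setIT -integral_indic// integral_T//; last first.
  by apply/measurable_EFinP; exact: measurable_indic.
rewrite /distribution_fun esum_edges//; apply: eq_eseriesr => n _.
have [[e ->]|E] := pickle_invP n; last first.
  rewrite E /=; symmetry; apply: integral0_eq => s _; rewrite indicE memNset//=.
  by rewrite /gext /= E; apply/negP; rewrite -leNgt.
rewrite pickleK_inv /=.
pose B : set Y := [set s | t < gext (pos_part f) (pickle e, s)].
have mB : measurable B.
  have mg := measurableT_comp (measurable_gext mp) (@pair1_measurable _ _ nat Y (pickle e)).
  exact: (@measurable_gt _ Y R _ t mg).
have -> : (\int[lam]_s (\1_[set q | (t < gext (pos_part f) q)%R] (pickle e, s))%:E = lam B)%E.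
  transitivity (\int[lam]_s (\1_B s)%:E)%E; last by rewrite integral_indic ?setIT.
  by apply: eq_integral => s _; rewrite !indicE; congr (nat_of_bool _)%:R%:E; apply/idP/idP => /set_mem h; exact: mem_set.
pose A : set Y := [set s | on_graph (e, s) /\ t < f e s].
have BA : B `<=` A.
  move=> s; rewrite /B /A /=; have [ins|nis] := pselect (inner e s); last first.
    by rewrite gext_out// => /lt_le_trans /(_ t0); rewrite ltxx.
  rewrite gext_pickle// /pos_part lt_max => /orP[tf|/lt_le_trans /(_ t0)]; last by rewrite ltxx.
  by case: ins => s0 sl; split => //; split => /=; exact: ltW.
(* On an infinite edge [fine] of the length is 0, which is already an endpoint. *)
have AB : A `\` B `<=` [set 0; fine (len e)].
  move=> s [[[/= s0 sl] tf] nB]; have [->|s1] := eqVneq s 0; first by left.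
  have [sl'|sl'] := eqVneq (s%:E) (len e); first by right; rewrite -sl'.
  exfalso; apply: nB; rewrite /B /= gext_pickle /pos_part ?lt_max ?tf//.
  by split; rewrite lt_neqAle ?sl ?sl' ?s0 ?andbT// eq_sym.
have cAB : countable (A `\` B).
  by apply: sub_countable (subset_card_le AB) _; exact: finite_set_countable.
have mAB : measurable (A `\` B) by exact: countable_measurable.
have AE : A = B `|` (A `\` B) by rewrite setDE setUIr setUCr setIT setUidr.
transitivity (lam (B `|` (A `\` B))); first by rewrite -AE.
by rewrite measureU0//; exact: countable_lebesgue_measure0.
Qed.

Lemma rearrangementE f y : (forall e, measurable_fun (inner e : set Y) (f e)) ->
  rearrangement f y = hat tm (gext (pos_part f)) y.
Proof.
move=> mf; rewrite /rearrangement /hat /star; congr inf; rewrite predeqE => t.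
by split => -[t0 H]; split => //; [rewrite -distribution_funE|rewrite distribution_funE].
Qed.

End edges.

Section edge_families.
Context {R : realType} {N : nat} (G : metric_graph R).
Local Notation Y := (measurableTypeR R).
Local Notation T := (nat * measurableTypeR R)%type.
Local Notation V := ('rV[R]_N * R)%type.
Local Notation Z := ('rV[R]_N * measurableTypeR R)%type.
Local Notation lam := (@lebesgue_measure R).
Local Notation tm := (@tmeasure R).
Local Notation mu := (@lebesgue_strip R N).
Implicit Types (f : edge G -> V -> R).

Definition gextx f (p : 'rV[R]_N * T) : R := gext (fun e s => f e (p.1, s)) p.2.

Lemma measurable_section f (x : 'rV[R]_N) :
  (forall e, measurable_fun (strip (len e) : set Z) (f e)) ->
  forall e, measurable_fun (inner e : set Y) (fun s => f e (x, s)).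
Proof.
move=> mf e.
have m1 := (@measurable_restrictT _ _ Z _ _ _ (measurable_strip (len e))).1 (mf e).
have m2 := measurableT_comp m1 (@pair1_measurable _ _ 'rV[R]_N Y x).
apply: eq_measurable_fun (measurable_funTS m2) => s /set_mem ins /=.
by rewrite patchE mem_set.
Qed.

Lemma measurable_gextx f : (forall e, measurable_fun (strip (len e) : set Z) (f e)) ->
  measurable_fun setT (gextx f).
Proof.
move=> mf; apply: measurable_fun_XT => n; have [[e ->]|E] := pickle_invP G n; last first.
  by rewrite (_ : (fun p => _) = cst 0)//; apply/funext => p; rewrite /gextx /gext /= E.
have := (@measurable_restrictT _ _ Z _ _ _ (measurable_strip (len e))).1 (mf e).
apply: eq_measurable_fun => -[x s] _; rewrite patchE /gextx /=; case: ifPn => [/set_mem h|/negP h].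
  by rewrite gext_pickle.
by rewrite gext_out// => ins; apply: h; exact: mem_set.
Qed.

Lemma integral_gextx f : (forall e, measurable_fun (strip (len e) : set Z) (f e)) ->
  (forall e z, strip (len e) z -> 0 <= f e z) ->
  (\esum_(e in [set: edge G]) \int[mu]_(z in strip (len e)) (f e z)%:E =
   \int[lebesgue_rV R N]_x \int[tm]_q (gextx f (x, q))%:E)%E.
Proof.
move=> mf f0; rewrite esum_edges; last first.
  by move=> e; apply: integral_ge0 => z; rewrite lee_fin; exact: f0.
have mg := measurable_gextx mf.
have g0 p : (0 <= (gextx f p)%:E)%E.
  by rewrite lee_fin; apply: gext_ge0 => e s ins; exact: f0.
transitivity (\int[lebesgue_rV R N]_x \sum_(0 <= n <oo) \int[lam]_s (gextx f (x, (n, s)))%:E)%E; last first.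
  apply: eq_integral => x _; rewrite integral_T//.
  by apply/measurable_EFinP; apply: (measurableT_comp mg); exact: pair1_measurable.
have mgn n : measurable_fun setT (fun p : Z => (gextx f (p.1, (n, p.2)))%:E).
  apply/measurable_EFinP; apply: (measurableT_comp mg).
  apply: measurable_fun_pair => //; apply: measurable_fun_pair => //.
rewrite integral_nneseries//; last 2 first.
- move=> n; exact: (@measurable_fun_fubini_tonelli_F _ _ 'rV[R]_N Y R lam _ (mgn n) (fun p => g0 _)).
- by move=> n x _; apply: integral_ge0 => s _.
apply: eq_eseriesr => n _; rewrite -(@integral_strip_iterated _ _ _ (mgn n) (fun p => g0 _)).
have [[e ->]|E] := pickle_invP G n; last first.
  by rewrite E /=; symmetry; apply: integral0_eq => p _; rewrite /gextx /gext /= E.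
rewrite pickleK_inv /= integral_mkcond; apply: eq_integral => -[x s] _.
rewrite patchE /gextx /=; case: ifPn => [/set_mem h|/negP h]; first by rewrite gext_pickle.
by rewrite gext_out// => ins; apply: h; exact: mem_set.
Qed.

End edge_families.

(** * Traces and sections of Sobolev functions *)

Section trace_approximation.
Context {R : realType} {N : nat}.
Local Notation V := ('rV[R]_N * R)%type.
Local Notation Y := (measurableTypeR R).
Local Notation Z := ('rV[R]_N * measurableTypeR R)%type.
Local Notation mu := (@lebesgue_strip R N).
Local Notation lam := (@lebesgue_measure R).

Lemma eq_n2_ae d (T : measurableType d) (m : {measure set T -> \bar R}) (D : set T) (f g : T -> R) :
  measurable D -> measurable_fun D f -> measurable_fun D g ->
  {ae m, forall x, D x -> f x = g x} -> n2 m D f = n2 m D g.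
Proof.
move=> mD mf mg fg; apply: ge0_ae_eq_integral => //; try exact: measurable_sqrE;
  try by move=> x _; rewrite lee_fin sqr_ge0.
by apply: ae_imp fg _ => x H Dx; rewrite H.
Qed.

Lemma weak_derivP (l : \bar R) v (f : V -> R) :
  (exists g, is_weak_deriv l v f g) -> is_weak_deriv l v f (weak_deriv l v f).
Proof. by move=> [g Hg]; apply: (@xgetPex _ (cst 0) [set g | is_weak_deriv l v f g]); exists g. Qed.

Lemma L2_sub (l : \bar R) (f g : V -> R) : L2 l f -> L2 l g -> L2 l (f \- g).
Proof.
move=> [mf f2] [mg g2]; split; first exact: measurable_funB.
by apply: n2B_lty => //; exact: measurable_strip.
Qed.

Lemma H1_strip_weak_deriv (l : \bar R) (f : V -> R) i : H1_strip l f ->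
  is_weak_deriv l (vdir i) f (weak_deriv l (vdir i) f).
Proof. case=> _ hx hy; case: i => [i|]; first exact: weak_derivP (hx i).
exact: weak_derivP hy. Qed.

Lemma sqr_H1_norm_ge (l : \bar R) (f : V -> R) :
  (sqr_norm l f <= sqr_H1_norm l f)%E /\
  forall i, (n2 mu (strip l) (weak_deriv l (vdir i) f) <= sqr_H1_norm l f)%E.
Proof.
have g0 : (0 <= sqr_grad_x l f)%E by apply: sume_ge0 => i _; exact: n2_ge0.
have s0 : (0 <= sqr_norm l f)%E by exact: n2_ge0.
have y0 : (0 <= sqr_deriv_y l f)%E by exact: n2_ge0.
split; first by rewrite /sqr_H1_norm -addeA leeDl// adde_ge0.
case=> [i|]; last by rewrite /sqr_H1_norm leeDr// adde_ge0.
apply: (@le_trans _ _ (sqr_grad_x l f)); last first.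
  by rewrite /sqr_H1_norm -addeA addeCA leeDl// adde_ge0.
rewrite /sqr_grad_x (bigD1 i)//= leeDl//.
by apply: sume_ge0 => j _; exact: n2_ge0.
Qed.

(** [sqr_H1_norm] of phi - f uses weak derivatives picked for the difference; by uniqueness they are
    those of phi minus the one picked for f, so convergence splits into convergence of each
    derivative. *)
Lemma has_trace_approx (l : \bar R) (f : V -> R) (s : R) tau : H1_strip l f ->
  has_trace l f s tau ->
  measurable_fun setT tau /\ exists phi : nat -> V -> R,
    [/\ forall n, test_function (phi n),
       (fun n => n2 mu (strip l) (phi n \- f)%R) @ \oo --> 0%E,
       forall i, (fun n => n2 mu (strip l) ('D_(vdir i) (phi n) \- weak_deriv l (vdir i) f)%R)
          @ \oo --> 0%E &
       (fun n => n2 (lebesgue_rV R N) setT (fun x => phi n (x, s) - tau x)%R) @ \oo --> 0%E].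
Proof.
move=> Hf [mt [phi [tp c1 c2]]]; split => //; exists phi; split => //.
  apply: (squeeze0e _ _ c1) => n; first exact: n2_ge0.
  exact: (sqr_H1_norm_ge _ _).1.
move=> i; apply: (squeeze0e _ _ c1) => n; first exact: n2_ge0.
have Lf : L2 l f by case: Hf.
have Lp := L2_test l (tp n).
have w1 := weak_derivB Lp Lf (weak_deriv_test l (vdir i) (tp n)) (H1_strip_weak_deriv i Hf).
have w2 : is_weak_deriv l (vdir i) (phi n \- f) (weak_deriv l (vdir i) (phi n \- f)).
  by apply: weak_derivP; exists ('D_(vdir i) (phi n) \- weak_deriv l (vdir i) f).
have ae12 := weak_deriv_unique (L2_sub Lp Lf) w1 w2.
rewrite (eq_n2_ae _ _ _ ae12); first exact: (sqr_H1_norm_ge _ _).2.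
- exact: measurable_strip.
- by case: w1 => [[]].
- by case: w2 => [[]].
Qed.

Let measurable_ray (v : V) : measurable_fun setT (fun p : Y * Z => p.2 + p.1 *: v : Z).
Proof.
apply: measurable_fun_pair => /=.
  apply: measurable_fun_rVP => i.
  rewrite (_ : _ \o _ = (fun p : Y * Z => rV_coor i p.2.1 + p.1 * v.1 ord0 i)).
    apply: measurable_funD.
      apply: measurableT_comp (measurable_rV_coor i) _.
      exact: measurableT_comp measurable_fst measurable_snd.
    by apply: measurable_funM => //; exact: measurable_cst.
  by apply/funext => p /=; rewrite /rV_coor !mxE.
apply: measurable_funD; first exact: measurableT_comp measurable_snd measurable_snd.
by apply: measurable_funM => //; exact: measurable_cst.
Qed.

(* Jensen for f(z + v) - f(z) = \int_0^1 D_v f (z + r v) dr. *)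
Lemma test_increment (phi : V -> R) (v z : V) : test_function phi ->
  (((phi (z + v) - phi z) ^+ 2)%:E <=
   \int[lam]_(r in `[0%R, 1%R]) ('D_v phi (z + r *: v) ^+ 2)%:E)%E.
Proof.
move=> tp; have sp := tp.1; pose q (r : R) : R := 'D_v phi (z + r *: v).
have cq : continuous q by exact: continuous_line (smooth_cont (smooth_D v sp)).
have cp : continuous (fun r : R => phi (z + r *: v)).
  exact: continuous_line (smooth_cont sp).
have dp (r : R) : is_derive r (1 : R) (fun r : R => phi (z + r *: v)) (q r).
  exact: is_derive_line.
have ftc : (\int[lam]_(r in `[0%R, 1%R]) (q r)%:E = (phi (z + v))%:E - (phi z)%:E)%E.
  have := @continuous_FTC2 R q (fun r => phi (z + r *: v)) 0 1 ltr01.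
  rewrite scale1r scale0r addr0; apply.
  - exact: continuous_subspaceT.
  - split.
    + by move=> r _; have [] := dp r.
    + by apply: cvg_at_right_filter; exact: cp.
    + by apply: cvg_at_left_filter; exact: cp.
  - by move=> r _; rewrite derive1E; have [_ ->] := dp r.
have mI : measurable (`[0%R, 1%R]%classic : set Y) by exact: measurable_itv.
have mq : measurable_fun (`[0%R, 1%R]%classic : set Y) q.
  by apply: measurable_funTS; exact: continuous_measurable_fun.
have n1 : n2 lam (`[0%R, 1%R]%classic : set Y) (cst 1) = 1%E.
  rewrite /n2; under eq_integral do rewrite /= expr1n.
  rewrite integral_cst// mul1e; transitivity (lebesgue_measure (`[0%R, 1%R]%classic : set R)) => //.
  by rewrite lebesgue_measure_itv/= lte_fin ltr01 -EFinB subr0.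
have [q2|] := ltP (n2 lam (`[0%R, 1%R]%classic : set Y) q) +oo%E; last first.
  by rewrite leye_eq /n2 => /eqP ->; exact: leey.
have := @cauchy_schwarz _ _ _ lam (`[0%R, 1%R]%classic : set Y) (cst 1) q mI (measurable_cst _) mq.
rewrite n1 mul1e ltry => /(_ isT q2); under eq_integral do rewrite mul1r.
apply: le_trans; rewrite -real_normK ?num_real// EFin_expe !expe2.
have h : ((`|phi (z + v) - phi z|)%:E <= \int[lam]_(x in `[0%R, 1%R]) `|q x|%:E)%E.
  have mEq : measurable_fun (`[0%R, 1%R]%classic : set Y) (EFin \o q) by exact/measurable_EFinP.
  by have := le_abse_integral lam mI mEq; rewrite ftc -EFinB.
by apply: lee_pmul.
Qed.

(** As v has no y-component, translation along v preserves the strip, and after exchanging integrals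
    every r in [0, 1] contributes the same mean square of D_v phi. *)
Lemma test_diff_quotient (l : \bar R) (phi : V -> R) (v : V) : test_function phi -> v.2 = 0 ->
  (n2 mu (strip l) (fun z => phi (z + v) - phi z)%R <= n2 mu (strip l) ('D_v phi))%E.
Proof.
move=> tp v0; have mS := measurable_strip (R := R) (N := N) l.
pose m := sf_product (lebesgue_rV R N) lam.
pose D z := 'D_v phi z.
have mD : measurable_fun [set: Z] D by exact: test_measurable (test_D v tp).
have mI : measurable (`[0%R, 1%R]%classic : set Y) by exact: measurable_itv.
pose H (p : Y * Z) : R := (\1_(strip l) p.2 * \1_(`[0%R, 1%R]%classic : set Y) p.1) *
  D (p.2 + p.1 *: v) ^+ 2.
have mH : measurable_fun setT (EFin \o H).
  apply/measurable_EFinP; apply: measurable_funM.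
    apply: measurable_funM.
      exact: measurableT_comp (measurable_indic mS) measurable_snd.
    exact: measurableT_comp (measurable_indic mI) measurable_fst.
  by apply: measurable_funX; exact: measurableT_comp mD (measurable_ray v).
have H0 p : (0 <= (EFin \o H) p)%E by rewrite lee_fin mulr_ge0 ?sqr_ge0// mulr_ge0// indicE.
have := @fubini_tonelli _ _ Y Z R lam m (EFin \o H) mH H0.
have mF := @measurable_fun_fubini_tonelli_F _ _ Y Z R m (EFin \o H) mH H0.
have mG := @measurable_fun_fubini_tonelli_G _ _ Y Z R lam (EFin \o H) mH H0.
rewrite /fubini_F /fubini_G /= in mF mG * => FT.
have mtr (w : V) : measurable_fun setT (fun z : Z => z + w : Z).
  have := measurable_strip_map w.1 1 w.2; apply: eq_measurable_fun => z _.
  by rewrite mul1r.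
apply: (@le_trans _ _ (\int[mu]_z \int[lam]_r (H (r, z))%:E)%E).
  rewrite /n2 integral_mkcond; apply: ge0_le_integral => //.
  - by move=> z _; rewrite patchE; case: ifPn => // _; rewrite lee_fin sqr_ge0.
  - apply/(measurable_restrictT _ mS)/measurable_sqrE/measurable_funTS.
    have mp := test_measurable tp; apply: measurable_funB => //.
    exact: measurableT_comp mp (mtr v).
  move=> z _; rewrite patchE; case: ifPn => [Sz|_]; last first.
    by apply: integral_ge0 => r _; exact: H0 (r, z).
  apply: le_trans (test_increment v z tp) _.
  rewrite integral_mkcond le_eqVlt; apply/orP; left; apply/eqP; apply: eq_integral => r _.
  rewrite patchE /H /= !indicE Sz mul1r; case: ifPn => _; rewrite ?mul1r ?mul0r//.
rewrite [X in (X <= _)%E](_ : _ = \int[lam]_r \int[mu]_z (H (r, z))%:E)%E; last exact/esym.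
apply: (@le_trans _ _ (\int[lam]_(r in (`[0%R, 1%R]%classic : set Y)) n2 mu (strip l) D)%E); last first.
  rewrite -/D; move: (n2 mu (strip l) D) => c; rewrite integral_cst; last exact: mI.
  rewrite [X in (_ * X <= _)%E](_ : _ = 1%E) ?mule1//.
  transitivity (lebesgue_measure (`[0%R, 1%R]%classic : set R)) => //.
  by rewrite lebesgue_measure_itv/= lte_fin ltr01 -EFinB subr0.
rewrite [leRHS]integral_mkcond; apply: ge0_le_integral => //.
- by move=> r _; apply: integral_ge0 => z _; exact: H0 (r, z).
- by apply/(measurable_restrictT _ mI); exact: measurable_cst.
move=> r _; rewrite patchE; case: ifPn => rI; last first.
  rewrite integral0_eq// => z _; rewrite /H /= [\1_(`[_, _]%classic) _]indicE (negbTE rI).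
  by rewrite mulr0 mul0r.
rewrite /n2 integral_mkcond.
have mDS : measurable_fun setT ((fun z => (D z ^+ 2)%:E) \_ (strip l : set Z)).
  by apply/(measurable_restrictT _ mS); exact: measurable_sqrE (measurable_funTS mD).
rewrite -(ge0_integral_strip_translate (r *: v) mDS); last first.
  by move=> z; rewrite patchE; case: ifPn => // _; rewrite lee_fin sqr_ge0.
rewrite le_eqVlt; apply/orP; left; apply/eqP; apply: eq_integral => z _.
rewrite patchE /H /= !indicE rI mulr1.
have -> : (z + r *: v \in (strip l : set Z)) = (z \in (strip l : set Z)).
  by apply/idP/idP => /set_mem h; apply/mem_set; move: h; rewrite /strip /= v0 scaler0 addr0.
by case: ifPn => _; rewrite ?mul1r ?mul0r.
Qed.

(** The bound for test functions passes to the limit on both sides, since the functions converge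
    together with their derivatives along v. *)
Lemma diff_quotient (l : \bar R) (f g : V -> R) (phi : nat -> V -> R) (v : V) (h : R) : L2 l f -> L2 l g ->
  v.2 = 0 -> (forall n, test_function (phi n)) ->
  (fun n => n2 mu (strip l) (phi n \- f)%R) @ \oo --> 0%E ->
  (fun n => n2 mu (strip l) ('D_v (phi n) \- g)%R) @ \oo --> 0%E ->
  (n2 mu (strip l) (fun z => f (z + h *: v) - f z)%R <= (h ^+ 2)%:E * n2 mu (strip l) g)%E.
Proof.
move=> [mf f2] [mg g2] v0 tp cf cg; have mS := measurable_strip (R := R) (N := N) l.
have mtr (w : V) : measurable_fun setT (fun z : Z => z + w : Z).
  have := measurable_strip_map w.1 1 w.2; apply: eq_measurable_fun => z _.
  by rewrite mul1r.
have inS z : (strip l : set Z) (z + h *: v) <-> (strip l : set Z) z.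
  by rewrite /strip /= v0 scaler0 addr0.
have mshift (F : V -> R) : measurable_fun (strip l : set Z) F ->
    measurable_fun (strip l : set Z) (fun z => F (z + h *: v)).
  move=> mF; have mr := (@measurable_restrictT _ _ Z _ _ _ mS).1 mF.
  apply: eq_measurable_fun (measurable_funTS (measurableT_comp mr (mtr (h *: v)))) => z.
  by move=> /set_mem /inS Sz /=; rewrite patchE mem_set.
have n2shift (F : V -> R) : measurable_fun (strip l : set Z) F ->
    n2 mu (strip l) (fun z => F (z + h *: v)) = n2 mu (strip l) F.
  move=> mF; rewrite /n2 [LHS]integral_mkcond [RHS]integral_mkcond.
  rewrite -[RHS](ge0_integral_strip_translate (h *: v)).
  - apply: eq_integral => z _; rewrite !patchE; congr (if _ then _ else _).
    by apply/idP/idP => /set_mem hz; apply/mem_set; apply/inS.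
  - by apply/(measurable_restrictT _ mS); exact: measurable_sqrE.
  - by move=> z; rewrite patchE; case: ifPn => // _; rewrite lee_fin sqr_ge0.
have mp n : measurable_fun (strip l : set Z) (phi n) by apply: measurable_funTS; exact: test_measurable.
have mDp n : measurable_fun (strip l : set Z) ('D_v (phi n)).
  by apply: measurable_funTS; exact: test_measurable (test_D v (tp n)).
have E := n2_fin g2; rewrite -/(n2 mu (strip l) g) in E; set c := fine _ in E.
rewrite E -EFinM; have c0 : 0 <= c by exact/fine_ge0/n2_ge0.
apply: (@n2_limit_le _ _ _ mu (strip l) (fun n z => phi n (z + h *: v) - phi n z)) => //.
- by move=> n; apply: measurable_funB => //; exact: mshift.
- by apply: measurable_funB => //; exact: mshift.
- apply: (@squeeze0e _ _ (fun n => 2%:E * (n2 mu (strip l) (phi n \- f)%R + n2 mu (strip l) (phi n \- f)%R))%E).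
  + by move=> n; exact: n2_ge0.
  + move=> n; have m1 : measurable_fun (strip l : set Z) (phi n \- f) by exact: measurable_funB.
    rewrite -{1}(n2shift _ m1); apply: le_trans (n2B_le2 _ mS (mshift _ m1) m1).
    rewrite le_eqVlt; apply/orP; left; apply/eqP; apply: eq_n2 => z _ /=.
    by rewrite !opprB addrACA [RHS]addrACA; congr (_ + _); rewrite addrC.
  + by apply: cvge0Z; apply: cvge0D.
move=> e e0; pose d := e / (h ^+ 2 + 1).
have d0 : 0 < d by rewrite divr_gt0// ltr_wpDl// sqr_ge0.
have gc : (n2 mu (strip l) g <= c%:E)%E by rewrite E.
have [n0 Hn0] := n2_near_le mS mDp mg gc cg d0.
exists n0 => n /Hn0 hn.
apply: le_trans (test_diff_quotient l (tp n) _) _; first by rewrite /= v0 scaler0.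
have Dh : 'D_(h *: v) (phi n) = (fun z => h * 'D_v (phi n) z).
  by apply/funext => z; rewrite deriveZdir//; exact: (@smooth_derivable _ _ (phi n) z v (tp n).1).
rewrite Dh n2Z//; apply: (@le_trans _ _ ((h ^+ 2)%:E * (c + d)%:E)%E).
  by apply: lee_pmul => //; rewrite ?n2_ge0// lee_fin sqr_ge0.
rewrite -EFinM lee_fin mulrDr lerD2l /d mulrA ler_pdivrMr ?ltr_wpDl ?sqr_ge0//.
by rewrite mulrC ler_pM2l// lerDl.
Qed.

End trace_approximation.

(** * Absolutely continuous representatives of sections *)

Section primitives.
Context {R : realType}.
Local Notation Y := (measurableTypeR R).
Local Notation lam := (@lebesgue_measure R).

Lemma integrable_itv_n2 (a b : R) (g : R -> R) : measurable_fun [set: Y] g ->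
  (n2 lam setT g < +oo)%E -> lam.-integrable `]a, b[ (EFin \o g).
Proof.
move=> mg g2; have mI : measurable (`]a, b[%classic : set Y) by exact: measurable_itv.
have n1 : (n2 lam (`]a, b[%classic : set Y) (cst 1%R) < +oo)%E.
  rewrite /n2; under eq_integral do rewrite /= expr1n.
  rewrite integral_cst// mul1e.
  suff : (lebesgue_measure (`]a, b[%classic : set R) < +oo)%E by [].
  by rewrite lebesgue_measure_itv/=; case: ifPn => _; rewrite ?ltry// -EFinB ltry.
have gI : (n2 lam (`]a, b[%classic : set Y) g < +oo)%E.
  apply: le_lt_trans g2; apply: ge0_subset_integral => //.
    exact: measurable_sqrE.
  by move=> r _; rewrite lee_fin sqr_ge0.
have := integrable_mul mI (measurable_funTS mg) (measurable_cst (1 : R)) gI n1.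
by apply: eq_integrable => // r _; rewrite /= mulr1.
Qed.

(* The primitive of g vanishing on the negative half-line. *)
Definition primitive (g : R -> R) (s : R) : R := \int[lam]_(r in `]0, s[) g r.

Lemma primitive_le (g : R -> R) s s' : measurable_fun [set: Y] g -> (n2 lam setT g < +oo)%E ->
  s <= s' -> ((`|primitive g s' - primitive g s|)%:E <= \int[lam]_(r in `]s, s'[) (`|g r|)%:E)%E.
Proof.
move=> mg g2 ss; have ig a b := @integrable_itv_n2 a b g mg g2.
have [s0|s0] := ltP s 0.
  have -> : primitive g s = 0.
    rewrite /primitive set_itv_ge ?Rintegral_set0// bnd_simp -leNgt; exact: ltW.
  rewrite subr0 /primitive EFin_normr_Rintegral; [|exact: measurable_itv|exact: ig].
  apply: le_trans (le_abse_integral _ _ _) _; [exact: measurable_itv| |].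
    by apply/measurable_EFinP; exact: measurable_funTS.
  apply: ge0_subset_integral => //.
    apply/measurable_EFinP; apply: measurable_funTS; exact: measurableT_comp (@normr_measurable _ _) mg.
  by apply: subset_itvr; rewrite bnd_simp ltW.
have -> : primitive g s' - primitive g s = \int[lam]_(r in `]s, s'[) g r.
  have i2 : lam.-integrable `]0, s[ (EFin \o g) by exact: ig.
  have [<-|ne] := eqVneq s s'.
    by rewrite subrr set_itv_ge ?Rintegral_set0// bnd_simp ltxx.
  rewrite /primitive [X in _ - X](Rintegral_itv_bndo_bndc i2).
  by rewrite Rintegral_itvB ?bnd_simp ?ig// lt_neqAle ne.
rewrite EFin_normr_Rintegral; [|exact: measurable_itv|exact: ig].
apply: (le_abse_integral lam (measurable_itv _)).
by apply/measurable_EFinP; exact: measurable_funTS.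
Qed.

Variables (l : \bar R) (f g : R -> R) (p q : nat -> R -> R).
Let I : set Y := gap l.
Hypotheses (mf : measurable_fun I f) (mg : measurable_fun I g) (g2 : (n2 lam I g < +oo)%E)
  (dp : forall n (s : R), is_derive s (1 : R) (p n) (q n s)) (cq : forall n, continuous (q n)).
Hypotheses (cp : (fun n => n2 lam I (p n \- f)%R) @ \oo --> 0%E)
  (cqg : (fun n => n2 lam I (q n \- g)%R) @ \oo --> 0%E).

Let mI : measurable I. Proof. exact: measurable_gap. Qed.

Let cpn n : continuous (p n).
Proof. by move=> t; have [/derivable1_diffP/differentiable_continuous] := dp n t. Qed.

Let mp n : measurable_fun [set: Y] (p n). Proof. exact: continuous_measurable_fun. Qed.
Let mq n : measurable_fun [set: Y] (q n). Proof. exact: continuous_measurable_fun. Qed.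

(** The fundamental theorem of calculus for [p n], and mean square convergence of [q n] on a bounded
    interval, where the constant 1 is square integrable. *)
Let increment_cvg a b : a < b -> 0 <= a -> (b%:E <= l)%E ->
  (fun n => p n b - p n a) @ \oo --> \int[lam]_(r in `]a, b[) g r.
Proof.
move=> ab a0 bl; pose J : set Y := `]a, b[%classic.
have mJ : measurable J by exact: measurable_itv.
have JI : J `<=` I.
  move=> r; rewrite /J /I /= in_itv/= => /andP[ar rb]; split; first exact: le_lt_trans ar.
  by apply: lt_le_trans bl; rewrite lte_fin.
have mgJ : measurable_fun J g by exact: measurable_funS mg.
have subJ F : measurable_fun I F -> (n2 lam J F <= n2 lam I F)%E.
  move=> mF; apply: ge0_subset_integral => //; first exact: measurable_sqrE.
  by move=> r _; rewrite lee_fin sqr_ge0.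
have n1 : (n2 lam J (cst 1%R) < +oo)%E.
  rewrite /n2; under eq_integral do rewrite /= expr1n.
  rewrite integral_cst// mul1e.
  suff : (lebesgue_measure (`]a, b[%classic : set R) < +oo)%E by [].
  by rewrite lebesgue_measure_itv/=; case: ifPn => _; rewrite ?ltry// -EFinB ltry.
have qJ n : (n2 lam J (q n) < +oo)%E.
  have cc : compact `[a, b] by exact: segment_compact.
  apply: (@le_lt_trans _ _ (n2 lam (`[a, b]%classic : set Y) (q n))).
    apply: ge0_subset_integral => //.
    - by apply: measurable_sqrE; exact: measurable_funTS.
    - by move=> r _; rewrite lee_fin sqr_ge0.
    - by move=> r; rewrite /J /= !in_itv/= => /andP[/ltW -> /ltW ->].
  have cq2 : continuous (fun r => q n r ^+ 2).
    rewrite (_ : (fun r => q n r ^+ 2) = (q n \* q n)%R).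
      by move=> r; apply: continuousM; exact: cq.
    by apply/funext => r; rewrite expr2.
  have /integrableP[_] := @continuous_compact_integrable R (fun r => q n r ^+ 2) `[a, b]%classic cc
    (continuous_subspaceT cq2).
  by under eq_integral do rewrite /= ger0_norm ?sqr_ge0//.
have gJ : (n2 lam J g < +oo)%E by exact: le_lt_trans (subJ _ mg) g2.
have cJ : (fun n => n2 lam J (q n \- g)%R) @ \oo --> 0%E.
  apply: (squeeze0e _ _ cqg) => n; first exact: n2_ge0.
  by apply: subJ; apply: measurable_funB => //; exact: measurable_funTS.
have := @integral_mul_cvg _ _ _ lam J q g (cst 1) mJ (fun n => measurable_funTS (mq n)) mgJ
  (measurable_cst (1 : R)) gJ n1 qJ cJ.
under [X in _ --> X]eq_integral do rewrite mulr1.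
have ig : lam.-integrable J (EFin \o g).
  have := integrable_mul mJ mgJ (measurable_cst (1 : R)) gJ n1.
  by apply: eq_integrable => // r _; rewrite /= mulr1.
rewrite -[X in _ --> X](fineK (integrable_fin_num mJ ig)) => c.
rewrite (_ : (fun n => p n b - p n a) =
    fine \o (fun n => \int[lam]_(r in J) (q n r * cst (1 : R) r)%:E)%E).
  exact: fine_cvg c.
apply/funext => n /=; apply: EFin_inj.
rewrite (_ : (\int[lam]_(r in J) _)%E = (\int[lam]_(r in `[a, b]) (q n r)%:E)%E).
  have ftc := @continuous_FTC2 R (q n) (p n) a b ab.
  rewrite ftc; first by rewrite -EFinB.
- exact: continuous_subspaceT.
- split.
  + by move=> t _; have [] := dp n t.
  + by apply: cvg_at_right_filter; exact: cpn.
  + by apply: cvg_at_left_filter; exact: cpn.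
- by move=> t _; rewrite derive1E; have [_ ->] := dp n t.
under eq_integral do rewrite mulr1.
have m : measurable_fun (`]a, b[%classic : set Y) (EFin \o q n).
  by apply/measurable_EFinP; exact: measurable_funTS.
exact: esym (@integral_itv_bndoo R a b (EFin \o q n) true false m).
Qed.

Let pointwise_subseq : exists2 k : nat -> nat, (forall n, (n <= k n)%N) &
  {ae lam, forall s : R, I s -> (fun n => p (k n) s) @ \oo --> f s}.
Proof.
have [|||k nk ae] := @integral_cvg0_subseq _ _ _ lam I (fun n s => (p n s - f s) ^+ 2) mI.
- by move=> n; apply: measurable_funX; apply: measurable_funB => //; exact: measurable_funTS.
- by move=> n s; exact: sqr_ge0.
- exact: cp.
exists k => //; apply: ae_imp ae _ => s H Is; have c := H Is.
apply/cvgrPdist_le => e e0.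
have e20 : 0 < e ^+ 2 by rewrite exprn_gt0.
move/cvgrPdist_le : c => /(_ _ e20) [n0 _ Hn0]; exists n0 => // n /= /Hn0 /=.
rewrite sub0r normrN ger0_norm ?sqr_ge0// -real_normK ?num_real// ler_sqr ?nnegrE ?(ltW e0)//.
by rewrite distrC.
Qed.

Let subseq_cvg (k : nat -> nat) (u : nat -> R) (c : R) : (forall n, (n <= k n)%N) ->
  u @ \oo --> c -> (fun n => u (k n)) @ \oo --> c.
Proof.
move=> nk uc; apply/cvgrPdist_le => e e0; move/cvgrPdist_le : uc => /(_ _ e0) [n0 _ Hn0].
by exists n0 => // n /= n0n; apply: Hn0 => /=; exact: leq_trans (nk n).
Qed.

(** The limit of the values at 0 fixes the constant of integration: p(s) = p(0) + (p(s) - p(0))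
    passes to the limit along a subsequence converging almost everywhere. *)
Lemma representative_left (tau : R) : (fun n => p n 0) @ \oo --> tau ->
  {ae lam, forall s : R, I s -> f s = tau + primitive g s}.
Proof.
move=> c0; have [k nk ae] := pointwise_subseq; apply: ae_imp ae _ => s H Is.
have [s0 sl] := Is; apply: (cvg_unique (@Rhausdorff R)) (H Is) _.
rewrite (_ : (fun n => p (k n) s) = (fun n => p (k n) 0 + (p (k n) s - p (k n) 0))).
  apply: cvgD; first exact: (subseq_cvg (u := fun n => p n 0) nk).
  by apply: (subseq_cvg (u := fun n => p n s - p n 0) nk); apply: increment_cvg => //; exact: ltW.
by apply/funext => n; rewrite addrC subrK.
Qed.

Lemma representative_right (b tau : R) : b%:E = l -> (fun n => p n b) @ \oo --> tau ->
  {ae lam, forall s : R, I s -> f s = tau - \int[lam]_(r in `]s, b[) g r}.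
Proof.
move=> bl c0; have [k nk ae] := pointwise_subseq; apply: ae_imp ae _ => s H Is.
have [s0 sl] := Is; apply: (cvg_unique (@Rhausdorff R)) (H Is) _.
rewrite (_ : (fun n => p (k n) s) = (fun n => p (k n) b - (p (k n) b - p (k n) s))).
  apply: cvgB; first exact: (subseq_cvg (u := fun n => p n b) nk).
  apply: (subseq_cvg (u := fun n => p n b - p n s) nk); apply: increment_cvg.
  - by rewrite -lte_fin bl.
  - exact: ltW.
  - by rewrite bl.
by apply/funext => n; rewrite subKr.
Qed.

End primitives.

Section sections.
Context {R : realType}.
Local Notation Y := (measurableTypeR R).
Local Notation lam := (@lebesgue_measure R).

(** Truncation at 1 reduces to real-valued functions, since the integrands may be infinite. *)
Lemma integral_cvg0_subseq_ereal d (T : measurableType d) (m : {measure set T -> \bar R})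
    (h : nat -> T -> \bar R) :
  (forall n, measurable_fun setT (h n)) -> (forall n x, (0 <= h n x)%E) ->
  (fun n => \int[m]_x h n x)%E @ \oo --> 0%E ->
  exists2 k : nat -> nat, (forall n, (n <= k n)%N) &
    {ae m, forall x, (fun n => h (k n) x) @ \oo --> 0%E}.
Proof.
move=> mh h0 ch; pose h' n x := fine (mine (h n x) 1%E).
have m0 n x : (0 <= mine (h n x) 1%E)%E by rewrite le_min h0 lee01.
have mfin n x : mine (h n x) 1%E \is a fin_num.
  by rewrite ge0_fin_numE//; apply: le_lt_trans (ltry 1); rewrite ge_min lexx orbT.
have mmin n : measurable_fun setT (fun x => mine (h n x) 1%E).
  exact: measurable_mine.
have [|||k nk ae] := @integral_cvg0_subseq _ _ _ m setT h' measurableT.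
- by move=> n; apply: measurableT_comp (mmin n).
- by move=> n x; exact: fine_ge0.
- apply: (squeeze0e _ _ ch) => n.
    by apply: integral_ge0 => x _; rewrite lee_fin fine_ge0.
  apply: ge0_le_integral => //.
  + by move=> x _; rewrite lee_fin fine_ge0.
  + by apply/measurable_EFinP; apply: measurableT_comp (mmin n).
  + by move=> x _; rewrite fineK// ge_min lexx.
exists k => //; apply: ae_imp ae _ => x /(_ I) c.
apply/cvge0P => // e e0.
(* A truncated value at most 1/2 is below 1, hence is the value itself. *)
have em0 : 0 < Num.min e (1/2) by rewrite lt_min e0 divr_gt0.
move/cvgrPdist_le : c => /(_ _ em0)[n0 _ Hn0]; exists n0 => n /Hn0 /=.
rewrite sub0r normrN ger0_norm ?fine_ge0//.
rewrite -lee_fin fineK// minEle; case: ifPn => _.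
  by move=> h1; apply: le_trans h1 _; rewrite lee_fin ge_min lexx.
by rewrite lee_fin le_min => /andP[_]; rewrite ler_pdivlMr// mul1r leNgt ltr1n.
Qed.

Lemma primitiveB (g : R -> R) s s' : measurable_fun [set: Y] g -> (n2 lam setT g < +oo)%E ->
  0 <= s -> s <= s' -> primitive g s' - primitive g s = \int[lam]_(r in `]s, s'[) g r.
Proof.
move=> mg g2 s0 ss; have ig a b := @integrable_itv_n2 _ a b g mg g2.
have [<-|ne] := eqVneq s s'.
  by rewrite subrr set_itv_ge ?Rintegral_set0// bnd_simp ltxx.
rewrite /primitive [X in _ - X](Rintegral_itv_bndo_bndc (ig 0 s)).
by rewrite Rintegral_itvB ?bnd_simp ?ig// lt_neqAle ne.
Qed.

Lemma primitive0 (g : R -> R) : primitive g 0 = 0.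
Proof. by rewrite /primitive set_itv_ge ?Rintegral_set0// bnd_simp ltxx. Qed.

Lemma gap_inhabited (l : \bar R) (P : R -> Prop) : (0 < l)%E ->
  {ae lam, forall s : R, gap l s -> P s} -> exists2 s, gap l s & P s.
Proof.
move=> l0 [A [mA A0 PA]].
have [b b0 bl] : exists2 b : R, 0 < b & (b%:E <= l)%E.
  case: l l0 {PA} => [l|_|]//; last by exists 1; rewrite ?leey.
  by rewrite lte_fin => l0; exists l.
apply: contrapT => no.
have sub : `]0, b[%classic `<=` A.
  move=> s /=; rewrite in_itv/= => /andP[s0 sb]; apply: PA => /= Ps; apply: no; exists s.
    by split => //; apply: lt_le_trans bl; rewrite lte_fin.
  by apply: Ps; split => //; apply: lt_le_trans bl; rewrite lte_fin.
have := le_measure lam (mem_set (measurable_itv _)) (mem_set mA) sub.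
suff : (lebesgue_measure (`]0%R, b[%classic : set R) <= 0)%E -> False by rewrite -A0.
by rewrite lebesgue_measure_itv /= lte_fin b0 oppr0 adde0 leNgt lte_fin b0.
Qed.

Context {N : nat}.
Local Notation V := ('rV[R]_N * R)%type.
Local Notation Z := ('rV[R]_N * measurableTypeR R)%type.
Local Notation mu := (@lebesgue_strip R N).

Lemma n2_strip_sections (l : \bar R) (F : V -> R) : measurable_fun (strip l : set Z) F ->
  measurable_fun setT (fun x => n2 lam (gap l) (fun s => F (x, s))) /\
  n2 mu (strip l) F = (\int[lebesgue_rV R N]_x n2 lam (gap l) (fun s => F (x, s)))%E.
Proof.
move=> mF; pose H (z : Z) : \bar R := ((F \_ (strip l)) z ^+ 2)%:E.
have mH : measurable_fun setT H.
  by apply: measurable_sqrE; exact: (@measurable_restrictT _ _ Z _ _ _ (measurable_strip l)).1.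
have H0 z : (0 <= H z)%E by rewrite lee_fin sqr_ge0.
have E x : n2 lam (gap l) (fun s => F (x, s)) = (\int[lam]_s H (x, s))%E.
  rewrite /n2 integral_mkcond; apply: eq_integral => s _; rewrite /H !patchE.
  case: ifPn => [/set_mem h|/negP h]; first by rewrite mem_set.
  by rewrite ifN ?expr0n//; apply/negP => /set_mem h'; apply: h; exact: mem_set.
split.
  rewrite (_ : (fun x => _) = (fun x => \int[lam]_s H (x, s))%E); last exact/funext.
  exact: (@measurable_fun_fubini_tonelli_F _ _ 'rV[R]_N Y R lam _ mH H0).
under eq_integral do rewrite E.
rewrite -integral_strip_iterated// /n2 integral_mkcond; apply: eq_integral => z _.
by rewrite /H !patchE; case: ifPn => //; rewrite expr0n.
Qed.

Lemma ae_lty d (T : measurableType d) (m : {measure set T -> \bar R}) (h : T -> \bar R) :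
  measurable_fun setT h -> (forall x, (0 <= h x)%E) -> (\int[m]_x h x < +oo)%E ->
  {ae m, forall x, (h x < +oo)%E}.
Proof.
move=> mh h0 hoo.
have ih : m.-integrable setT h.
  by apply/integrableP; split => //; under eq_integral do rewrite gee0_abs//.
apply: ae_imp (integrable_ae measurableT ih) _ => x /(_ I).
by rewrite ge0_fin_numE.
Qed.

Lemma measurable_gap_section (l : \bar R) (F : V -> R) x :
  measurable_fun (strip l : set Z) F -> measurable_fun (gap l) (fun s => F (x, s)).
Proof.
move=> mF; have m1 := (@measurable_restrictT _ _ Z _ _ _ (measurable_strip l)).1 mF.
have m2 := measurableT_comp m1 (@pair1_measurable _ _ 'rV[R]_N Y x).
apply: eq_measurable_fun (measurable_funTS m2) => s /set_mem ins /=.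
by rewrite patchE mem_set.
Qed.

Section edge_traces.
Variables (l : \bar R) (f g : V -> R) (s0 : R) (tau : 'rV[R]_N -> R) (phi : nat -> V -> R).
Hypotheses (mf : measurable_fun (strip l : set Z) f) (mg : measurable_fun (strip l : set Z) g)
  (g2 : (n2 mu (strip l) g < +oo)%E) (mtau : measurable_fun setT tau)
  (tphi : forall n, test_function (phi n))
  (cphi : (fun n => n2 mu (strip l) (phi n \- f)%R) @ \oo --> 0%E)
  (cdphi : (fun n => n2 mu (strip l) ('D_dir_y (phi n) \- g)%R) @ \oo --> 0%E)
  (ctau : (fun n => n2 (lebesgue_rV R N) setT (fun x => phi n (x, s0) - tau x)%R) @ \oo --> 0%E).

Let sphi n : smooth (phi n). Proof. by case: (tphi n). Qed.

(** All convergences must hold along one subsequence, so it is extracted from the sum of the three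
    nonnegative errors; the same one serves almost every x. *)
Lemma trace_sections : {ae lebesgue_rV R N, forall x, exists k : nat -> nat,
  [/\ (n2 lam (gap l) (fun s => g (x, s)) < +oo)%E,
   (fun n => n2 lam (gap l) (fun s => phi (k n) (x, s) - f (x, s))%R) @ \oo --> 0%E,
   (fun n => n2 lam (gap l) (fun s => 'D_dir_y (phi (k n)) (x, s) - g (x, s))%R) @ \oo --> 0%E &
   (fun n => phi (k n) (x, s0)) @ \oo --> tau x]}.
Proof.
have mA n : measurable_fun (strip l : set Z) (phi n \- f)%R.
  by apply: measurable_funB => //; apply: measurable_funTS; exact: test_measurable.
have mB n : measurable_fun (strip l : set Z) ('D_dir_y (phi n) \- g)%R.
  by apply: measurable_funB => //; apply: measurable_funTS; apply: test_measurable; exact: test_D.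
have mC n : measurable_fun setT (fun x => phi n (x, s0) - tau x).
  apply: measurable_funB => //.
  exact: measurableT_comp (test_measurable (tphi n)) (@pair2_measurable _ _ 'rV[R]_N Y s0).
pose A n x := n2 lam (gap l) (fun s => phi n (x, s) - f (x, s)).
pose B n x := n2 lam (gap l) (fun s => 'D_dir_y (phi n) (x, s) - g (x, s)).
pose C n x : \bar R := ((phi n (x, s0) - tau x) ^+ 2)%:E.
have [eA eB] := (fun n => n2_strip_sections (mA n), fun n => n2_strip_sections (mB n)).
have mCE n : measurable_fun setT (C n) by exact: measurable_sqrE.
have A0 n x : (0 <= A n x)%E by exact: n2_ge0.
have B0 n x : (0 <= B n x)%E by exact: n2_ge0.
have C0 n x : (0 <= C n x)%E by rewrite lee_fin sqr_ge0.
have [|||k nk ae] := @integral_cvg0_subseq_ereal _ _ (lebesgue_rV R N) (fun n x => A n x + B n x + C n x)%E.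
- move=> n; apply: emeasurable_funD => //; apply: emeasurable_funD; [exact: (eA n).1|exact: (eB n).1].
- by move=> n x; apply: adde_ge0 => //; exact: adde_ge0.
- apply: (squeeze0e _ _ (cvge0D (cvge0D cphi cdphi) ctau)) => n.
    by apply: integral_ge0 => x _; apply: adde_ge0 => //; exact: adde_ge0.
  rewrite ge0_integralD//; last 2 first.
  + by move=> x _; rewrite adde_ge0.
  + by apply: emeasurable_funD; [exact: (eA n).1|exact: (eB n).1].
  by rewrite ge0_integralD//; [rewrite (eA n).2 (eB n).2|exact: (eA n).1|exact: (eB n).1].
have [mgs Eg] := n2_strip_sections mg; have g2x := g2; rewrite Eg in g2x.
have aeg := ae_lty mgs (fun x => n2_ge0 _ _ _) g2x.
apply: ae_imp2 ae aeg _ => x c gx; exists k; split => //.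
- by apply: squeeze0e c => n; [exact: A0|rewrite -addeA leeDl// adde_ge0].
- by apply: squeeze0e c => n; [exact: B0|rewrite addeAC leeDr// adde_ge0].
apply/cvgrPdist_le => e e0.
have e20 : 0 < e ^+ 2 by rewrite exprn_gt0.
have H0 n : (0 <= A (k n) x + B (k n) x + C (k n) x)%E by apply: adde_ge0 => //; exact: adde_ge0.
have [n0 H] := (cvge0P H0).1 c _ e20.
exists n0 => // n /= /H h; rewrite distrC -ler_sqr ?nnegrE ?(ltW e0)// real_normK ?num_real//.
by rewrite -lee_fin; apply: le_trans h; rewrite leeDr// adde_ge0.
Qed.

Lemma trace_left : s0 = 0 -> {ae lebesgue_rV R N, forall x,
  {ae lam, forall s : R, gap l s -> f (x, s) = tau x + primitive (fun r => g (x, r)) s}}.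
Proof.
move=> E; apply: ae_imp trace_sections _ => x [k [gx ca cb cc]].
apply: (@representative_left R l (fun s => f (x, s)) (fun s => g (x, s))
  (fun n s => phi (k n) (x, s)) (fun n s => 'D_dir_y (phi (k n)) (x, s))) => //.
- exact: measurable_gap_section.
- exact: measurable_gap_section.
- by move=> n s; exact: is_derive_y.
- by move=> n; exact: (@continuous_y _ _ _ x (smooth_cont (smooth_D _ (sphi (k n))))).
- by rewrite -E.
Qed.

Lemma trace_right : s0%:E = l -> {ae lebesgue_rV R N, forall x,
  {ae lam, forall s : R, gap l s -> f (x, s) = tau x - \int[lam]_(r in `]s, s0[) g (x, r)}}.
Proof.
move=> E; apply: ae_imp trace_sections _ => x [k [gx ca cb cc]].
apply: (@representative_right R l (fun s => f (x, s)) (fun s => g (x, s))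
  (fun n s => phi (k n) (x, s)) (fun n s => 'D_dir_y (phi (k n)) (x, s))) => //.
- exact: measurable_gap_section.
- exact: measurable_gap_section.
- by move=> n s; exact: is_derive_y.
- by move=> n; exact: (@continuous_y _ _ _ x (smooth_cont (smooth_D _ (sphi (k n))))).
Qed.
End edge_traces.


(** Both representations hold almost everywhere on the edge; comparing them at one common point s
    gives tau' - tau as the integral of g over the whole edge. *)
Lemma trace_left_right (l : \bar R) (f g : V -> R) (b : R) (tau tau' : 'rV[R]_N -> R) :
  (0 < b) -> b%:E = l -> measurable_fun [set: Z] g -> (n2 mu setT g < +oo)%E ->
  {ae lebesgue_rV R N, forall x,
    {ae lam, forall s : R, gap l s -> f (x, s) = tau x + primitive (fun r => g (x, r)) s}} ->
  {ae lebesgue_rV R N, forall x,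
    {ae lam, forall s : R, gap l s -> f (x, s) = tau' x - \int[lam]_(r in `]s, b[) g (x, r)}} ->
  {ae lebesgue_rV R N, forall x, tau' x = tau x + primitive (fun r => g (x, r)) b}.
Proof.
move=> b0 E mg g2 aeL aeR.
have mgx x : measurable_fun [set: Y] (fun r => g (x, r)).
  exact: measurableT_comp mg (@pair1_measurable _ _ 'rV[R]_N Y x).
have g2x : {ae lebesgue_rV R N, forall x, (n2 lam setT (fun r => g (x, r)) < +oo)%E}.
  have mH := measurable_sqrE mg; have H0 z : (0 <= (g z ^+ 2)%:E)%E by rewrite lee_fin sqr_ge0.
  apply: ae_lty; [|by move=> x; exact: n2_ge0|].
    exact: (@measurable_fun_fubini_tonelli_F _ _ 'rV[R]_N Y R lam _ mH H0).
  by move: g2; rewrite /n2 integral_strip_iterated.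
apply: ae_imp2 (ae_imp2 aeL aeR (fun x p q => conj p q)) g2x _ => x [pL pR] gx.
have l0 : (0 < l)%E by rewrite -E lte_fin.
have [s [s0 sl] [e1 e2]] := gap_inhabited l0 (ae_imp2 pL pR (fun s p q h => conj (p h) (q h))).
rewrite -E lte_fin in sl.
have := primitiveB (mgx x) gx (ltW s0) (ltW sl); rewrite -[RHS](subKr (tau' x)) -e2 e1.
by move=> h; rewrite -(subrK (primitive (fun r => g (x, r)) s) (primitive _ b)) h addrCA subrK.
Qed.

End sections.

(** * Coarea inequality on a connected graph *)

Section attained.
Context {R : realType} (G : metric_graph R).
Variables (w : edge G -> R -> R) (tau : vertex G -> R).
Hypotheses (cw : forall e, continuous (w e))
  (wtau : forall e s v, glued (e, s) v -> w e s = tau v).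

Lemma glued_on_graph (p : edge G * R) v : glued p v -> on_graph p.
Proof.
have l0 := ltW (len_gt0 p.1).
case: p l0 => e s l0 [[/= -> _]|[/= sl _]]; split=> //=; first by rewrite -lee_fin sl.
by rewrite sl.
Qed.

Lemma attained_edge e s s' t : on_graph (e, s) -> on_graph (e, s') -> w e s <= t <= w e s' ->
  exists2 r, on_graph (e, r) & w e r = t.
Proof.
move=> [/= s0 sl] [/= s'0 s'l] /andP[h1 h2].
have [ss|ss] := leP s s'.
  have [||r rs <-] := @IVT R (w e) s s' t ss.
  - exact: continuous_subspaceT.
  - by rewrite ge_min h1 le_max h2 orbT.
  exists r => //; move: rs; rewrite in_itv/= => /andP[r1 r2].
  by split=> /=; [exact: le_trans r1|apply: le_trans s'l; rewrite lee_fin].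
have [||r rs <-] := @IVT R (w e) s' s t (ltW ss).
- exact: continuous_subspaceT.
- by rewrite ge_min h1 le_max h2 !orbT.
exists r => //; move: rs; rewrite in_itv/= => /andP[r1 r2].
by split=> /=; [exact: le_trans r1|apply: le_trans sl; rewrite lee_fin].
Qed.

(* If the value t were not attained, the side of t on which the function lies would be
   constant on each edge, hence across adjacent vertices. *)
Lemma attained (p q : edge G * R) t : connected_graph G -> on_graph p -> on_graph q ->
  w p.1 p.2 < t < w q.1 q.2 -> exists2 r, on_graph r & w r.1 r.2 = t.
Proof.
case: p q => [e s] [e' s'] con ps qs /= /andP[h1 h2]; apply: contrapT => no.
have edge_lt f a b : on_graph (f, a) -> on_graph (f, b) -> w f a < t -> w f b < t.
  move=> ga gb la; rewrite ltNge; apply/negP => lb.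
  have [|r gr rt] := @attained_edge f a b t ga gb; first by rewrite (ltW la).
  by apply: no; exists (f, r).
have src0 (f : edge G) : glued (f, 0) (src f) by left.
have src_on (f : edge G) : on_graph (f, 0 : R) by exact: glued_on_graph (src0 f).
have step v v' : clos_refl_trans _ (@Defs.adjacent R G) v v' -> tau v < t -> tau v' < t.
  elim=> {v v'} [v v' [f [a [b [ga gb]]]]|//|v1 v2 v3 _ h12 _ h23 /h12/h23//].
  rewrite -(wtau ga) -(wtau gb); exact: (edge_lt _ _ _ (glued_on_graph ga) (glued_on_graph gb)).
have : w e' s' < t.
  apply: (edge_lt e' 0) => //; rewrite (wtau (src0 e')); apply: step (con (src e) _) _.
  by rewrite -(wtau (src0 e)); exact: (edge_lt e s).
by rewrite ltNge (ltW h2).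
Qed.

End attained.

Section graph_coarea.
Context {R : realType} (G : metric_graph R).
Local Notation Y := (measurableTypeR R).
Local Notation T := (nat * measurableTypeR R)%type.
Local Notation lam := (@lebesgue_measure R).
Local Notation tm := (@tmeasure R).

Lemma ae_inhabited d (X : measurableType d) (m : {measure set X -> \bar R}) (A : set X) (P : X -> Prop) :
  measurable A -> (0 < m A)%E -> {ae m, forall q, P q} -> exists2 q, A q & P q.
Proof.
move=> mA A0 [B [mB B0 PB]]; apply: contrapT => no.
have AB : A `<=` B by move=> q Aq; apply: PB => /= Pq; apply: no; exists q.
suff : (m A <= 0)%E by rewrite leNgt A0.
by rewrite -B0; exact: le_measure (mem_set mA) (mem_set mB) AB.
Qed.

Variables (f : edge G -> R -> R) (W g : T -> R) (tau : vertex G -> R).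
Hypotheses (con : connected_graph G)
  (mf : forall e, measurable_fun (inner e : set Y) (f e))
  (mg : measurable_fun setT g) (g2 : (n2 tm setT g < +oo)%E)
  (g0 : forall q, ~ gsupp G q -> g q = 0)
  (Wg : forall n s s', s <= s' ->
    ((`|W (n, s') - W (n, s)|)%:E <= \int[lam]_(r in `]s, s'[) (`|g (n, r)|)%:E)%E)
  (Wf : forall e, {ae lam, forall s : R, inner e s -> f e s = W (pickle e, s)})
  (Wtau : forall e s v, glued (e, s) v -> W (pickle e, s) = tau v).

Let F := gext (pos_part f).

Let mgn n : measurable_fun [set: Y] (fun s => g (n, s)).
Proof. by apply: (measurableT_comp mg); exact: pair1_measurable. Qed.

Let cW n : continuous (fun s => W (n, s)).
Proof. exact: continuous_primitive (mgn n) (n2_slice_lty n mg g2) (Wg n). Qed.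

Let mW : measurable_fun setT W.
Proof.
by apply: measurable_fun_T => n; exact: measurable_primitive (mgn n) (n2_slice_lty n mg g2) (Wg n).
Qed.


(** The hypothesis on values attained twice concerns continuous representatives of the section, and
    [W] is one. The endpoints of an edge, where [Wf] says nothing, are discarded as a null set. *)
Lemma continuous_rep_primitive : continuous_rep f (fun e s => W (pickle e, s)).
Proof.
split => [e|[e s] [e' s'] _ _ [[-> ->]//|[v [g1 g2']]]|e].
- exact: continuous_subspaceT.
- by rewrite /= (Wtau g1) (Wtau g2').
have n0 : {ae lam, forall s : R, s <> 0}.
  exists [set 0]; split => //; first exact: lebesgue_measure_set1.
  by move=> s /= /contrapT.
have n1 : {ae lam, forall s : R, s%:E <> len e}.
  case: (len e) => [l||]; last 2 first.
  - exact: aeW.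
  - exact: aeW.
  exists [set l]; split => //; first exact: lebesgue_measure_set1.
  by move=> s /= /contrapT [->].
apply: ae_imp2 (Wf e) (ae_imp2 n0 n1 (fun s p q => conj p q)) _ => s H [s0 s1] [/= h0 h1].
symmetry; apply: H; split; first by rewrite lt_neqAle h0 andbT eq_sym; apply/eqP.
by rewrite lt_neqAle h1 andbT; apply/eqP.
Qed.

(** The two sets of positive measure contain points where F is the positive part of W, so W takes a
    value <= a and a value > b, and by connectedness all values in between. Since a >= 0, the sets
    {a < F < b} and {a < W < b} agree almost everywhere on the graph, off which g vanishes. *)
Lemma graph_coarea (k : R) (a b : R) :
  k = 1 \/ k = 2 /\ attains_twice (fun (e : edge G) s => W (pickle e, s)) ->
  0 <= a -> a < b ->
  (0 < tm (gsupp G `&` [set q | (F q <= a)%R]))%E -> (0 < tm [set q | (b < F q)%R])%E ->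
  ((k * (b - a))%:E <= \int[tm]_(q in [set q | (a < F q < b)%R]) `|g q|%:E)%E.
Proof.
move=> kP a0 ab mlow mhigh.
have mF : measurable_fun setT F by apply: measurable_gext => e; exact: measurable_maxr.
have FW : {ae tm, forall q, gsupp G q -> F q = Num.max (W q) 0}.
  apply: ae_T => n; have [[e ->]|E] := pickle_invP G n; last first.
    by apply: aeW => s /gsuppP[e [s' [[En _] _]]]; rewrite En pickleK_inv in E.
  apply: (ae_imp (Wf e)) => s H /gsuppP[e' [s' [[/(pcan_inj pickleK) <- <-] ins]]].
  by rewrite /F gext_pickle// /pos_part H.
have meas_le : measurable (gsupp G `&` [set q | (F q <= a)%R]).
  apply: measurableI; first exact: measurable_gsupp.
  rewrite (_ : [set q | _] = F @^-1` `]-oo, a]%classic).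
    by rewrite -[X in measurable X]setTI; exact: mF.
  by apply/seteqP; split => q /=; rewrite in_itv.
have meas_gt : measurable [set q | (b < F q)%R].
  rewrite (_ : [set q | _] = F @^-1` `]b, +oo[%classic).
    by rewrite -[X in measurable X]setTI; exact: mF.
  by apply/seteqP; split => q /=; rewrite in_itv/= andbT.
have [p [/gsuppP[e [s [-> ins]]] /= lowp] /(_ _)] := ae_inhabited meas_le mlow FW.
have [p' /= highp'] := ae_inhabited meas_gt mhigh FW.
have [/gsuppP[e' [s' [Ep' ins']]] /(_ _) H'|nsupp _] := pselect (gsupp G p'); last first.
  by move: highp'; rewrite /F gext_notin// ltNge (le_trans a0 (ltW ab)).
move=> H.
have Hs : gsupp G (pickle e, s) by apply/gsuppP; exists e, s.
have Hs' : gsupp G p' by apply/gsuppP; exists e', s'.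
have Wlow : W (pickle e, s) <= a by move: lowp; rewrite (H Hs) ge_max => /andP[].
have Whigh : b < W (pickle e', s').
  move: highp'; rewrite (H' Hs') Ep' lt_max => /orP[//|].
  by rewrite ltNge (le_trans a0 (ltW ab)).
have onP e1 s1 : inner e1 s1 -> on_graph (e1, s1) by move=> [h1 h2]; split; exact: ltW.
have att t : a < t < b -> exists2 r : edge G * R, on_graph r & W (pickle r.1, r.2) = t.
  move=> /andP[at_ tb].
  apply: (@attained R G (fun e s => W (pickle e, s)) tau _ _ (e, s) (e', s') t con) => //=.
  - exact: onP.
  - exact: onP.
  - by rewrite (le_lt_trans Wlow at_) (lt_trans tb Whigh).
apply: (@le_trans _ _ (\int[tm]_(q in [set q | (a < W q < b)%R]) `|g q|%:E)%E); last first.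
  have mn : measurable_fun setT (fun q => `|g q|%:E).
    by apply/measurable_EFinP; exact: measurableT_comp (@normr_measurable _ _) mg.
  rewrite integral_mkcond [leRHS]integral_mkcond.
  rewrite (ge0_ae_eq_integral (g := (fun q => `|g q|%:E) \_ [set q | a < F q < b]))//.
  - exact: (measurable_restrictT _ (measurable_preimage_between a b mW)).1 (measurable_funTS mn).
  - exact: (measurable_restrictT _ (measurable_preimage_between a b mF)).1 (measurable_funTS mn).
  - by move=> q _; apply: erestrict_ge0.
  - by move=> q _; apply: erestrict_ge0.
  apply: ae_imp FW _ => q Hq _; have [/Hq Eq|nq] := pselect (gsupp G q); last first.
    by rewrite !patchE g0// normr0 !if_same.
  rewrite !patchE; congr (if _ then _ else _); apply/idP/idP => /set_mem /= /andP[h1 h2].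
    apply: mem_set; rewrite /= Eq lt_max h1 gt_max h2 /=; exact: le_lt_trans ab.
  move: h1 h2; rewrite Eq lt_max gt_max => /orP[h1|]; last by rewrite ltNge a0.
  by move=> /andP[h2 _]; apply: mem_set; rewrite /= h1.
case: kP => [->|[-> tw]].
  rewrite mul1r; apply: (@coarea_once _ _ _ _ _ ab mg g2 Wg) => t /att[[e1 s1] [/= s10 _] <-].
  by exists (pickle e1, s1).
apply: (@coarea_twice _ _ _ _ _ ab mg g2 Wg); apply: ae_imp tw _ => t H2 /att[r ron rt].
have [|[e1 s1] [[e2 s2] [[/= p0 _] [/= q0 _] npq pt qt]]] := H2 _; first by exists r.
exists (pickle e1, s1), (pickle e2, s2); split => //.
by case=> /(pcan_inj pickleK) E1 E2; apply: npq; left; rewrite E1 E2.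
Qed.

End graph_coarea.

Section strip_ae.
Context {R : realType} {N : nat}.
Local Notation Y := (measurableTypeR R).
Local Notation Z := ('rV[R]_N * measurableTypeR R)%type.
Local Notation lam := (@lebesgue_measure R).
Local Notation mu := (@lebesgue_strip R N).

Lemma rV_translate_ae (w : 'rV[R]_N) (P : 'rV[R]_N -> Prop) :
  {ae lebesgue_rV R N, forall x, P x} -> {ae lebesgue_rV R N, forall x, P (x + w)}.
Proof.
move=> [A [mA A0 PA]]; have mt := measurable_rV_translate w.
have mB : measurable ((fun v : 'rV[R]_N => v + w) @^-1` A).
  by rewrite -[X in measurable X]setTI; exact: mt.
exists ((fun v => v + w) @^-1` A); split => //; last by move=> x /= nP; exact: PA.
have mI : measurable_fun setT (fun v => (\1_A v : R)%:E).
  by apply/measurable_EFinP; exact: measurable_indic.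
have i0 v : (0 <= (\1_A v : R)%:E)%E by rewrite lee_fin.
transitivity (\int[lebesgue_rV R N]_v (\1_A (v + w) : R)%:E)%E.
  by rewrite -[X in _ X = _](setIT) -(integral_indic _ measurableT mB).
rewrite (ge0_integral_rV_translate w mI i0) integral_indic// setIT; exact: A0.
Qed.

Lemma strip_ae_fst (P : 'rV[R]_N -> Prop) :
  {ae lebesgue_rV R N, forall x, P x} -> {ae mu, forall z, P z.1}.
Proof.
move=> [A [mA A0 PA]]; exists (A `*` setT); split.
- exact: measurableX.
- rewrite /mu/= /lebesgue_strip/= product_measure1E//.
  by rewrite [X in (X * _)%E](_ : _ = 0%E)// mul0e.
- by move=> z /= nP; split => //; exact: PA.
Qed.

Lemma strip_ae_snd (P : R -> Prop) :
  {ae lam, forall y : R, P y} -> {ae mu, forall z, P z.2}.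
Proof.
move=> [A [mA A0 PA]]; exists (setT `*` A); split.
- exact: measurableX.
- rewrite /mu/= /lebesgue_strip/= product_measure1E//.
  by rewrite [X in (_ * X)%E](_ : _ = 0%E)// mule0.
- by move=> z /= nP; split => //; exact: PA.
Qed.

Lemma n2_strip_iterated (A : set Y) (F : Z -> R) : measurable A -> measurable_fun setT F ->
  n2 mu [set z | A z.2] F = (\int[lebesgue_rV R N]_x n2 lam A (fun s => F (x, s)))%E.
Proof.
move=> mA mF; have mD : measurable [set z : Z | A z.2] by exact: measurable_snd_set.
pose H (z : Z) : \bar R := ((F \_ [set z : Z | A z.2]) z ^+ 2)%:E.
have mH : measurable_fun setT H.
  apply: measurable_sqrE; apply: (@measurable_restrictT _ _ Z _ _ _ mD).1.
  exact: measurable_funTS.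
have H0 z : (0 <= H z)%E by rewrite lee_fin sqr_ge0.
transitivity (\int[mu]_z H z)%E.
  rewrite /n2 integral_mkcond; apply: eq_integral => z _; rewrite /H !patchE.
  by case: ifPn => //; rewrite expr0n.
rewrite (integral_strip_iterated mH H0); apply: eq_integral => x _.
rewrite /n2 [RHS]integral_mkcond; apply: eq_integral => s _; rewrite /H !patchE.
case: ifPn => [/set_mem h|/negP h]; first by rewrite mem_set.
by rewrite ifN ?expr0n//; apply/negP => /set_mem h'; apply: h; exact: mem_set.
Qed.

Lemma measurable_strip_shift (l : \bar R) (f : Z -> R) (v : 'rV[R]_N * R) : v.2 = 0 ->
  measurable_fun (strip l : set Z) f -> measurable_fun (strip l : set Z) (fun z : Z => f (z + v)).
Proof.
move=> v0 mf; have m1 := (@measurable_restrictT _ _ Z _ _ _ (measurable_strip l)).1 mf.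
have m2 := measurableT_comp m1 (@measurable_strip_map R N v.1 1 0).
apply: eq_measurable_fun (measurable_funTS m2) => z /set_mem zl /=.
have -> : ((z.1 + v.1)%R, (1 * z.2 + 0)%R) = (z + v)%R :> Z.
  by rewrite mul1r -v0; case: z {zl} => a b; case: v {v0 m2} => c d.
rewrite patchE mem_set//; move: zl; rewrite /strip /= v0.
by rewrite addr0.
Qed.

End strip_ae.

(** * The rearranged function *)

Section graph_sections.
Context {R : realType} {N : nat} (G : metric_graph R).
Local Notation Y := (measurableTypeR R).
Local Notation T := (nat * measurableTypeR R)%type.
Local Notation V := ('rV[R]_N * R)%type.
Local Notation Z := ('rV[R]_N * measurableTypeR R)%type.
Local Notation lam := (@lebesgue_measure R).
Local Notation tm := (@tmeasure R).
Local Notation mu := (@lebesgue_strip R N).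

Lemma ae_edges d (X : measurableType d) (m : {measure set X -> \bar R}) (P : edge G -> X -> Prop) :
  (forall e, {ae m, forall x, P e x}) -> {ae m, forall x, forall e, P e x}.
Proof.
move=> H; pose Q (n : nat) x := forall e, n = pickle e -> P e x.
have /ae_foralln HQ : forall n, {ae m, forall x, Q n x}.
  move=> n; have [[e ->]|E] := pickle_invP G n.
    by apply: ae_imp (H e) _ => x Px e' /(pcan_inj pickleK) <-.
  by apply: aeW => x e En; rewrite En pickleK_inv in E.
by apply: ae_imp HQ _ => x Hx e; exact: (Hx (pickle e)).
Qed.

Lemma measurable_gextx_section (f : edge G -> V -> R) x :
  (forall e, measurable_fun (strip (len e) : set Z) (f e)) ->
  measurable_fun setT (fun q => gextx f (x, q)).
Proof. by move=> mf; apply: (measurableT_comp (measurable_gextx mf)); exact: pair1_measurable. Qed.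

Lemma n2_gextx (f : edge G -> V -> R) :
  (forall e, measurable_fun (strip (len e) : set Z) (f e)) ->
  measurable_fun setT (fun x => n2 tm setT (fun q => gextx f (x, q))) /\
  (\esum_(e in [set: edge G]) n2 mu (strip (len e)) (f e) =
   \int[lebesgue_rV R N]_x n2 tm setT (fun q => gextx f (x, q)))%E.
Proof.
move=> mf; have mg := measurable_gextx mf.
split.
  exact: (@measurable_fun_fubini_tonelli_F _ _ 'rV[R]_N T R tm _ (measurable_sqrE mg)
    (fun p => sqr_ge0 _)).
rewrite (integral_gextx (f := fun e z => f e z ^+ 2)).
- apply: eq_integral => x _; apply: eq_integral => q _; congr _%:E.
  by rewrite /gextx /= -(@gext_comp _ _ (fun t => t ^+ 2))// expr0n.
- by move=> e; exact: measurable_funX.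
- by move=> e z _; exact: sqr_ge0.
Qed.


Lemma esum_edgesZ (c : R) (h : edge G -> \bar R) : 0 <= c -> (forall e, 0 <= h e)%E ->
  (\esum_(e in [set: edge G]) (c%:E * h e) = c%:E * \esum_(e in [set: edge G]) h e)%E.
Proof.
move=> c0 h0; rewrite !esum_edges//; last by move=> e; rewrite mule_ge0.
rewrite -nneseriesZl//; last by move=> n _; case: pickle_inv.
by apply: eq_eseriesr => n _; case: pickle_inv => //=; rewrite mule0.
Qed.

Variable u : edge G -> V -> R.
Hypotheses (con : connected_graph G) (H1u : H1_graph u).

Definition wd (i : option 'I_N) (e : edge G) : V -> R := weak_deriv (len e) (vdir i) (u e).
Definition energy_dir (i : option 'I_N) : \bar R :=
  (\esum_(e in [set: edge G]) n2 mu (strip (len e)) (wd i e))%E.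

(* The positive part only makes fiber x nonnegative everywhere instead of almost everywhere:
   the rearrangement depends on the levels t >= 0 alone. *)
Definition fiber (x : 'rV[R]_N) (q : T) : R := Num.max (gextx u (x, q)) 0.
Definition uhat (z : Z) : R := hat tm (fiber z.1) z.2.

Let mu_u e : measurable_fun (strip (len e) : set Z) (u e).
Proof. by case: H1u => h _ _; case: (h e) => -[]. Qed.

Let H1e e : H1_strip (len e) (u e). Proof. by case: H1u. Qed.

Let L2wd i e : L2 (len e) (wd i e).
Proof. by case: (H1_strip_weak_deriv i (H1e e)). Qed.

Let mwd i e : measurable_fun (strip (len e) : set Z) (wd i e).
Proof. by case: (L2wd i e). Qed.

Let H1sum : (\esum_(e in [set: edge G]) sqr_H1_norm (len e) (u e) < +oo)%E.
Proof. by case: H1u. Qed.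

Let n2_u_lty : (\esum_(e in [set: edge G]) n2 mu (strip (len e)) (u e) < +oo)%E.
Proof.
apply: le_lt_trans H1sum; apply: le_esum => e _; exact: (sqr_H1_norm_ge _ _).1.
Qed.

Lemma energy_dir_lty i : (energy_dir i < +oo)%E.
Proof.
apply: le_lt_trans H1sum; apply: le_esum => e _; exact: (sqr_H1_norm_ge _ _).2.
Qed.

Lemma energy_dir_ge0 i : (0 <= energy_dir i)%E.
Proof. by apply: esum_ge0 => e _; exact: n2_ge0. Qed.

Lemma fiberE x : fiber x = gext (pos_part (fun e s => u e (x, s))).
Proof.
apply/funext => q; rewrite /fiber /gextx /=.
by rewrite -(@gext_comp _ _ (fun t => Num.max t 0))// maxxx.
Qed.

Lemma measurable_fiber : measurable_fun setT (fun p : 'rV[R]_N * T => fiber p.1 p.2).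
Proof.
apply: measurable_maxr => //.
by have := measurable_gextx mu_u; apply: eq_measurable_fun => -[].
Qed.

Let mfx x : measurable_fun setT (fiber x).
Proof. by apply: (measurableT_comp measurable_fiber); exact: pair1_measurable. Qed.

Lemma fiber_le x q : fiber x q ^+ 2 <= gextx u (x, q) ^+ 2.
Proof.
rewrite /fiber maxEle; case: ifPn => // _; rewrite ?expr0n ?sqr_ge0//.
Qed.

Lemma fiber_sub_le x x' q : (fiber x q - fiber x' q) ^+ 2 <= (gextx u (x, q) - gextx u (x', q)) ^+ 2.
Proof.
rewrite /fiber; move: (gextx u (x, q)) (gextx u (x', q)) => a b.
have [h1|h1] := leP a 0; have [h2|h2] := leP b 0 => //.
- by rewrite subrr expr0n sqr_ge0.
- rewrite -subr_ge0 (_ : _ - _ = (- a) * (2 * b - a)); last by ring.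
  by apply: mulr_ge0; lra.
- rewrite -subr_ge0 (_ : _ - _ = (- b) * (2 * a - b)); last by ring.
  by apply: mulr_ge0; lra.
Qed.

Lemma good_fiber : {ae lebesgue_rV R N, forall x, good tm (fiber x)}.
Proof.
have [m E] := n2_gextx mu_u.
have n2i := n2_u_lty; rewrite E in n2i.
have ae := ae_lty m (fun x => n2_ge0 _ _ _) n2i; apply: ae_imp ae _ => x gx; split => //.
  by move=> q; rewrite /fiber le_max lexx orbT.
apply: le_lt_trans gx; apply: le_n2 => //; first exact: measurable_gextx_section.
by move=> q _; exact: fiber_le.
Qed.

Lemma uhatE e z : y_rearrangement u e z = uhat (z.1, edge_coord e z.2).
Proof.
by rewrite /y_rearrangement rearrangementE ?/uhat ?fiberE//; exact: measurable_section.
Qed.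

Lemma uhat_ge0 z : 0 <= uhat z. Proof. exact: hat_ge0. Qed.

Lemma uhat_even z : uhat (z.1, - z.2) = uhat z.
Proof. by rewrite /uhat /hat /= normrN. Qed.

Lemma measurable_uhat : measurable_fun [set: Z] uhat.
Proof. exact: (measurable_hat_joint tm measurable_fiber). Qed.

Lemma uhat_scale l : 0 < l < 1 -> {ae mu, forall z, 0 <= uhat z <= uhat (z.1, l * z.2)}.
Proof.
move=> /andP[l0 l1]; have n0 : {ae mu, forall z, (z.2 : R) != 0}.
  exact: (@strip_ae_snd R N (fun y => y != 0) (@ae_neq0 R)).
apply: ae_imp2 (strip_ae_fst good_fiber) n0 _ => -[x y] /= gx y0.
rewrite uhat_ge0 /=; apply: hat_mono => //; first by rewrite mulf_neq0// gt_eqF.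
by rewrite normrM ler_piMl// gtr0_norm// ltW.
Qed.

(** A translation in x moves fibres to fibres; on them taking positive parts and rearranging are
    both nonexpansive. *)
Lemma n2_uhat_sub (w : 'rV[R]_N) : (n2 mu setT (fun z => uhat (z + (w, 0%R)) - uhat z)%R <=
  \esum_(e in [set: edge G]) n2 mu (strip (len e)) (fun z => u e (z + (w, 0%R)) - u e z)%R)%E.
Proof.
have mshift : measurable_fun setT (fun z : Z => uhat (z + (w, 0))).
  have := measurableT_comp measurable_uhat (@measurable_strip_map R N w 1 0).
  apply: eq_measurable_fun => z _ /=; congr uhat.
  by rewrite mul1r; case: z.
have m1 : measurable_fun setT (fun z : Z => uhat (z + (w, 0)) - uhat z).
  exact: measurable_funB mshift measurable_uhat.
have md e : measurable_fun (strip (len e) : set Z) (fun z : Z => u e (z + (w, 0)) - u e z).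
  by apply: measurable_funB => //; exact: measurable_strip_shift.
have [m E] := n2_gextx md; rewrite E.
rewrite (_ : n2 _ _ _ = \int[lebesgue_rV R N]_x n2 lam setT (fun s => (uhat ((x, s) + (w, 0)) - uhat (x, s))%R))%E;
  last exact: (n2_strip_iterated measurableT m1).
have mH := measurable_sqrE m1.
apply: ae_ge0_le_integral => //.
- by move=> x _; exact: n2_ge0.
- exact: (@measurable_fun_fubini_tonelli_F _ _ 'rV[R]_N Y R lam _ mH (fun p => sqr_ge0 _)).
- by move=> x _; exact: n2_ge0.
- apply: ae_imp2 good_fiber (rV_translate_ae w good_fiber) _ => x gx gxw _.
  have := hat_nonexpansive gxw gx.
  rewrite (_ : (fun s => _) = (hat tm (fiber (x + w)) \- hat tm (fiber x))%R); last first.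
    by apply/funext => s; rewrite /uhat /= addr0.
  move=> h; apply: le_trans h _; apply: le_n2 => //.
  + exact: measurable_funB.
  + exact: measurable_gextx_section.
  move=> q _; apply: le_trans (fiber_sub_le _ _ _) _.
  rewrite [in leRHS]/gextx /= (@gext_comp2 _ _ (fun a b => a - b) (fun e s => u e ((x, s) + (w, 0)))) ?subr0//.
  rewrite (_ : (fun e s => u e ((x, s) + (w, 0))) = (fun e s => u e (x + w, s)))//.
  by apply/funext => e; apply/funext => s; rewrite -[in RHS](addr0 s).
Qed.

Lemma n2_uhat_lty : (n2 mu setT uhat < +oo)%E.
Proof.
have E0 : [set: Z] = [set z | setT z.2] by [].
rewrite E0 n2_strip_iterated//; last exact: measurable_uhat.
have [m E] := n2_gextx mu_u.
move: n2_u_lty; rewrite E; apply: le_lt_trans; apply: ae_ge0_le_integral => //.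
- by move=> x _; exact: n2_ge0.
- have mH := measurable_sqrE measurable_uhat.
  exact: (@measurable_fun_fubini_tonelli_F _ _ 'rV[R]_N Y R lam _ mH (fun p => sqr_ge0 _)).
- by move=> x _; exact: n2_ge0.
apply: ae_imp good_fiber _ => x gx _.
apply: (@le_trans _ _ (n2 lam setT (hat tm (fiber x)))); first exact: lexx.
rewrite (n2_hat gx); by apply: le_n2 => //; [exact: measurable_gextx_section|move=> q _; exact: fiber_le].
Qed.

(** The test functions that define the trace at the source of an edge also approximate [u e]
    together with its derivatives, which is the density that [diff_quotient] requires. *)
Lemma uhat_diff_x j h : (n2 mu setT (fun z => uhat (z + h *: vdir (Some j)) - uhat z)%R <=
  (h ^+ 2)%:E * energy_dir (Some j))%E.
Proof.
rewrite (_ : h *: vdir (Some j) = (h *: delta_mx ord0 j, 0)); last by congr pair; exact: mulr0.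
apply: le_trans (n2_uhat_sub _) _.
rewrite -esum_edgesZ; [|exact: sqr_ge0|by move=> e; exact: n2_ge0].
apply: le_esum => e _; case: H1u => _ _ [tau htau].
have g : glued (e, 0 : R) (src e) by left.
have [_ [phi [tphi c1 c2 _]]] := has_trace_approx (H1e e) (htau _ _ _ g).
have := @diff_quotient R N (len e) (u e) (wd (Some j) e) phi (vdir (Some j)) h.
rewrite (_ : h *: vdir (Some j) = (h *: delta_mx ord0 j, 0)); last by congr pair; exact: mulr0.
by apply => //; case: (H1e e).
Qed.


(** The weak y-derivative on one edge, extended by 0 so that primitives in y can be taken on the
    whole line. *)
Let edge_ext (e : edge G) (z : Z) : R := gextx (wd None) (z.1, (pickle e, z.2)).

Let edge_extE e : edge_ext e = wd None e \_ (strip (len e)).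
Proof.
apply/funext => -[x s]; rewrite /edge_ext /gextx patchE /=.
case: ifPn => [/set_mem h|/negP h]; first by rewrite gext_pickle.
by rewrite gext_out// => ins; apply: h; exact: mem_set.
Qed.

Let measurable_edge_ext e : measurable_fun [set: Z] (edge_ext e).
Proof.
by rewrite edge_extE; exact: (@measurable_restrictT _ _ Z _ _ _ (measurable_strip (len e))).1.
Qed.

Let n2_edge_ext e : (n2 mu setT (edge_ext e) < +oo)%E.
Proof.
rewrite (_ : n2 _ _ _ = n2 mu (strip (len e)) (wd None e)); first by case: (L2wd None e).
rewrite /n2 [RHS]integral_mkcond; apply: eq_integral => z _; rewrite edge_extE !patchE.
by case: ifPn => //; rewrite expr0n.
Qed.

Let n2_edge_ext_strip e : (n2 mu (strip (len e)) (edge_ext e) < +oo)%E.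
Proof.
apply: le_lt_trans (n2_edge_ext e); apply: ge0_subset_integral => //.
- exact: measurable_strip.
- exact: measurable_sqrE.
- by move=> z _; rewrite lee_fin sqr_ge0.
Qed.

Let edge_ext_in e z : strip (len e) z -> edge_ext e z = wd None e z.
Proof. by move=> h; rewrite edge_extE patchE mem_set. Qed.

Let approx_ext e s tau : has_trace (len e) (u e) s tau -> measurable_fun setT tau /\
  exists phi : nat -> V -> R,
    [/\ forall n, test_function (phi n),
       (fun n => n2 mu (strip (len e)) (phi n \- u e)%R) @ \oo --> 0%E,
       (fun n => n2 mu (strip (len e)) ('D_dir_y (phi n) \- edge_ext e)%R) @ \oo --> 0%E &
       (fun n => n2 (lebesgue_rV R N) setT (fun x => phi n (x, s) - tau x)%R) @ \oo --> 0%E].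
Proof.
move=> /(has_trace_approx (H1e e))[mtau [phi [tphi c1 c2 c3]]]; split => //; exists phi; split => //.
rewrite (_ : (fun n => _) = (fun n => n2 mu (strip (len e)) ('D_(vdir None) (phi n) \- wd None e)%R)).
  exact: c2.
by apply/funext => n; apply: eq_n2 => z zs /=; rewrite edge_ext_in.
Qed.

(** Along each edge W starts from the trace at the source and adds the primitive of the weak
    y-derivative. Its value at a finite far end is then the trace at the target, so W is consistent
    at every vertex. *)
Lemma primitive_sections : exists tau : vertex G -> 'rV[R]_N -> R,
  {ae lebesgue_rV R N, forall x, exists W : T -> R,
    [/\ (n2 tm setT (fun q => gextx (wd None) (x, q)) < +oo)%E,
     forall n s s', s <= s' -> ((`|W (n, s') - W (n, s)|)%:E <=
       \int[lam]_(r in `]s, s'[) (`|gextx (wd None) (x, (n, r))|)%:E)%E,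
     forall e, {ae lam, forall s : R, inner e s -> u e (x, s) = W (pickle e, s)} &
     forall e s v, glued (e, s) v -> W (pickle e, s) = tau v x]}.
Proof.
case: H1u => _ _ [tau htau]; exists tau.
have left_ae e : {ae lebesgue_rV R N, forall x, {ae lam, forall s : R, gap (len e) s ->
    u e (x, s) = tau (src e) x + primitive (fun r => edge_ext e (x, r)) s}}.
  have g : glued (e, 0 : R) (src e) by left.
  have [mtau [phi [tphi c1 c2 c3]]] := approx_ext (htau _ _ _ g).
  exact: (trace_left (@mu_u e) (measurable_funTS (@measurable_edge_ext e)) (n2_edge_ext_strip e) mtau tphi c1 c2 c3 erefl).
have right_ae e : {ae lebesgue_rV R N, forall x, forall b, b%:E = len e ->
    tau (tgt e) x = tau (src e) x + primitive (fun r => edge_ext e (x, r)) b}.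
  have [[b bl]|no] := pselect (exists b, b%:E = len e); last first.
    by apply: aeW => x b bl; exfalso; apply: no; exists b.
  have g : glued (e, b : R) (tgt e) by right.
  have [mtau [phi [tphi c1 c2 c3]]] := approx_ext (htau _ _ _ g).
  have b0 : 0 < b by rewrite -lte_fin bl; exact: len_gt0.
  apply: ae_imp (trace_left_right b0 bl (@measurable_edge_ext e) (n2_edge_ext e) (left_ae e) _) _.
    exact: (trace_right (@mu_u e) (measurable_funTS (@measurable_edge_ext e)) (n2_edge_ext_strip e) mtau tphi c1 c2 c3 bl).
  by move=> x Hx b' b'l; have [->] : b'%:E = b%:E :> \bar R by rewrite b'l.
have [m E] := n2_gextx (mwd None).
have fin : {ae lebesgue_rV R N, forall x, (n2 tm setT (fun q => gextx (wd None) (x, q)) < +oo)%E}.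
  by apply: (ae_lty m (fun x => n2_ge0 _ _ _)); rewrite -E; exact: energy_dir_lty.
have both := ae_imp2 (ae_edges left_ae) (ae_edges right_ae) (fun x p q => conj p q).
apply: ae_imp2 fin both _ => x gx [hl hr].
have mgx := measurable_gextx_section x (mwd None).
(* On copies of the line that carry no edge W is 0. *)
exists (fun q => if pickle_inv q.1 is Some e then
  tau (src e) x + primitive (fun r => gextx (wd None) (x, (q.1, r))) q.2 else 0); split.
- exact: gx.
- move=> n s s' ss; have [[e ->]|En] := pickle_invP G n; last first.
    by rewrite /= En subrr normr0; apply: integral_ge0.
  rewrite /= pickleK_inv opprD addrACA subrr add0r; apply: primitive_le => //.
    by apply: (measurableT_comp mgx); exact: pair1_measurable.
  exact: (@n2_slice_lty R (fun q => gextx (wd None) (x, q)) (pickle e) mgx gx).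
- by move=> e; rewrite /= pickleK_inv; exact: hl.
- move=> e s v [] /= [h <-]; rewrite pickleK_inv; first by rewrite h primitive0 addr0.
  by rewrite (hr e s h).
Qed.

(** The variation bound on each fibre, integrated over x. The case k = 1 rests on connectedness and
    gives a finite constant; k = 2 makes 4/k^2 equal to 1. *)
Lemma uhat_diff_y (k h : R) : k = 1 \/ k = 2 /\ attains_twice_ae u ->
  ((k ^+ 2)%:E * n2 mu [set z : Z | ((2 * `|z.2|)%:E < total_length G)%E /\
      ((2 * `|z.2 + h|)%:E < total_length G)%E] (fun z => uhat (z + h *: vdir None) - uhat z)%R <=
    (4 * h ^+ 2)%:E * energy_dir None)%E.
Proof.
move=> kP; rewrite (_ : h *: vdir None = (0, h)); last first.
  by congr pair; [exact: scaler0|exact: mulr1].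
pose A : set Y := [set y | ((2 * `|y|)%:E < total_length G)%E /\ ((2 * `|y + h|)%:E < total_length G)%E].
have mA : measurable A.
  rewrite (_ : A = [set y | ((2 * `|y|)%:E < total_length G)%E] `&`
    (fun y : Y => 1 * y + h : Y) @^-1` [set y | ((2 * `|y|)%:E < total_length G)%E]).
    apply: measurableI; first exact: measurable_norm_lt.
    rewrite -[X in measurable X]setTI; apply: (@measurable_affine R 1 h) => //.
    exact: measurable_norm_lt.
  by apply/seteqP; split => y /=; rewrite mul1r.
have mshift : measurable_fun setT (fun z : Z => uhat (z + (0, h))).
  have := measurableT_comp measurable_uhat (@measurable_strip_map R N 0 1 h).
  apply: eq_measurable_fun => z _ /=; congr uhat.
  by rewrite mul1r; case: z.
have m1 : measurable_fun setT (fun z : Z => uhat (z + (0, h)) - uhat z).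
  exact: measurable_funB mshift measurable_uhat.
have mk : measurable_fun setT (fun z : Z => k * (uhat (z + (0, h)) - uhat z)).
  by apply: measurable_funM m1; exact: measurable_cst.
have mD : measurable [set z : Z | A z.2] by exact: measurable_snd_set.
rewrite -(n2Z mu k mD (measurable_funTS m1)) (n2_strip_iterated mA mk).
have [m E] := n2_gextx (mwd None); rewrite /energy_dir E.
rewrite -ge0_integralZl//; [|by move=> x _; exact: n2_ge0|by rewrite lee_fin; nra].
have [tau prim] := primitive_sections.
have tw : {ae lebesgue_rV R N, forall x, k = 1 \/ k = 2 /\
    forall w, continuous_rep (fun e s => u e (x, s)) w -> attains_twice w}.
  case: kP => [->|[-> tw]]; first by apply: aeW => x; left.
  by apply: ae_imp tw _ => x; right.
apply: ae_ge0_le_integral => //.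
- by move=> x _; exact: n2_ge0.
- have mH : measurable_fun setT (fun z : Z => (((fun z : Z => k * (uhat (z + (0, h)) - uhat z)) \_
      [set z : Z | A z.2]) z ^+ 2)%:E).
    apply: measurable_sqrE; apply: (@measurable_restrictT _ _ Z _ _ _ mD).1.
    exact: measurable_funTS.
  have := @measurable_fun_fubini_tonelli_F _ _ 'rV[R]_N Y R lam _ mH (fun p => sqr_ge0 _).
  apply: eq_measurable_fun => x _; rewrite /fubini_F /n2 [RHS]integral_mkcond.
  apply: eq_integral => s _; rewrite !patchE.
  case: ifPn => [/set_mem h'|/negP h']; first by rewrite mem_set.
  by rewrite ifN ?expr0n//; apply/negP => /set_mem h''; apply: h'; exact: mem_set.
- by move=> x _; apply: mule_ge0; [rewrite lee_fin; nra|exact: n2_ge0].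
- exact: emeasurable_funM.
apply: ae_imp2 (ae_imp2 good_fiber prim (fun x p q => conj p q)) tw _ => x [gx [W [gW Wg Wf Wtau]]] kx _.
have mgx := measurable_gextx_section x (mwd None).
have g0 q : ~ gsupp G q -> gextx (wd None) (x, q) = 0 by exact: gext_notin.
have k0 : 0 <= k by case: kP => [->|[-> _]].
have msec := measurable_section x mu_u.
have kx' : k = 1 \/ k = 2 /\ attains_twice (fun (e : edge G) s => W (pickle e, s)).
  case: kx => [->|[-> tw']]; [by left|right; split => //]; apply: tw'.
  exact: (continuous_rep_primitive mgx gW Wg Wf Wtau).
have coarea a b : 0 <= a -> a < b ->
    (0 < tm (gsupp G `&` [set q | (fiber x q <= a)%R]))%E -> (0 < tm [set q | (b < fiber x q)%R])%E ->
    ((k * (b - a))%:E <= \int[tm]_(q in [set q | (a < fiber x q < b)%R]) `|gextx (wd None) (x, q)|%:E)%E.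
  by rewrite fiberE; exact: (graph_coarea con msec mgx gW g0 Wg Wf Wtau kx').
have := hat_variation (measurable_gsupp G) gx mgx gW k0 coarea h.
rewrite tmeasure_gsupp => hv.
have E3 : n2 lam A (fun s => k * (uhat ((x, s) + (0, h)) - uhat (x, s))) =
    n2 lam A (fun y => k * (hat tm (fiber x) (y + h) - hat tm (fiber x) y)).
  by apply: eq_n2 => y _; rewrite /uhat /= addr0.
by rewrite E3; exact: hv.
Qed.

Lemma uhat_Lp (p : R) : 0 < p ->
  (\int[mu]_z (uhat z `^ p)%:E = \esum_(e in [set: edge G])
    \int[mu]_(z in strip (len e)) (Num.max (u e z) 0 `^ p)%:E)%E.
Proof.
move=> p0; have m1 : measurable_fun setT (fun z : Z => (uhat z `^ p)%:E).
  by apply/measurable_EFinP; exact: measurableT_comp (measurable_powR p) measurable_uhat.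
have p1 (z : Z) : (0 <= (uhat z `^ p)%:E)%E by rewrite lee_fin powR_ge0.
rewrite (integral_strip_iterated m1 p1).
rewrite (integral_gextx (f := fun e z => Num.max (u e z) 0 `^ p)); first last.
- by move=> e z _; exact: powR_ge0.
- by move=> e; apply: (measurableT_comp (measurable_powR p)); exact: measurable_maxr.
have mF : measurable_fun setT (fun q : 'rV[R]_N * T => (fiber q.1 q.2 `^ p)%:E).
  by apply/measurable_EFinP; exact: measurableT_comp (measurable_powR p) measurable_fiber.
have F0 (q : 'rV[R]_N * T) : (0 <= (fiber q.1 q.2 `^ p)%:E)%E by rewrite lee_fin powR_ge0.
transitivity (\int[lebesgue_rV R N]_x \int[tm]_q (fiber x q `^ p)%:E)%E; last first.
  apply: eq_integral => x _; apply: eq_integral => q _; congr _%:E.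
  by rewrite fiberE /gextx /= -(@gext_comp _ _ (fun t => t `^ p))// powR0// gt_eqF.
apply: ge0_ae_eq_integral => //.
- exact: (@measurable_fun_fubini_tonelli_F _ _ 'rV[R]_N Y R lam _ m1 p1).
- exact: (@measurable_fun_fubini_tonelli_F _ _ 'rV[R]_N T R tm _ mF F0).
- by move=> x _; apply: integral_ge0.
- by move=> x _; apply: integral_ge0 => q _; rewrite lee_fin powR_ge0.
by apply: ae_imp good_fiber _ => x gx _; exact: (hat_Lp gx p0).
Qed.

End graph_sections.

(** * Sobolev functions on the circle and on the line *)

Section weak_deriv_limits.
Context {R : realType} {N : nat}.
Local Notation Y := (measurableTypeR R).
Local Notation V := ('rV[R]_N * R)%type.
Local Notation Z := ('rV[R]_N * measurableTypeR R)%type.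
Local Notation mu := (@lebesgue_strip R N).

Lemma cvge0_sum (I : Type) (r : seq I) (F : I -> nat -> \bar R) :
  (forall i, F i @ \oo --> 0%E) -> (fun n => \sum_(i <- r) F i n)%E @ \oo --> 0%E.
Proof.
move=> cF; elim: r => [|i r IH].
  by under eq_fun do rewrite big_nil; exact: cvg_cst.
by under eq_fun do rewrite big_cons; exact: cvge0D.
Qed.

(** Integration by parts holds for the approximating functions, and both sides are continuous in
    mean square against a fixed test function. *)
Lemma weak_deriv_limit (l : \bar R) v (psi : nat -> V -> R) (f g : V -> R) :
  (forall n, test_function (psi n)) -> L2 l f -> L2 l g ->
  (fun n => n2 mu (strip l) (psi n \- f)%R) @ \oo --> 0%E ->
  (fun n => n2 mu (strip l) ('D_v (psi n) \- g)%R) @ \oo --> 0%E ->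
  is_weak_deriv l v f g.
Proof.
move=> tpsi L2f L2g cf cg; split => // phi tphi sphi; have mS := measurable_strip (N := N) l.
have tD := test_D v tphi.
have mt (h : V -> R) : test_function h -> measurable_fun (strip l : set Z) h.
  by move=> th; apply: measurable_funTS; exact: test_measurable.
have [[mf f2] [mg g2]] := (L2f, L2g).
have c1 := integral_mul_cvg mS (fun n => mt _ (tpsi n)) mf (mt _ tD) f2 (test_n2 mS tD)
  (fun n => test_n2 mS (tpsi n)) cf.
have c2 := integral_mul_cvg mS (fun n => mt _ (test_D v (tpsi n))) mg (mt _ tphi) g2 (test_n2 mS tphi)
  (fun n => test_n2 mS (test_D v (tpsi n))) cg.
apply: (cvg_unique (@ereal_hausdorff R)) c1 _.
rewrite (_ : (fun n => _) = (fun n => - \int[mu]_(z in strip l) ('D_v (psi n) z * phi z)%:E)%E).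
  apply: cvgeN; exact: c2.
apply/funext => n.
have z1 z : ~ strip l z -> (psi n z * 'D_v phi z)%:E = 0%E.
  by move=> nz; rewrite D_notin_supp ?mulr0// => /sphi.
have z2 z : ~ strip l z -> ('D_v (psi n) z * phi z)%:E = 0%E.
  by move=> nz; rewrite (@supp_notin _ _ phi) ?mulr0// => /sphi.
rewrite (integral_supp mS z1) (integral_supp mS z2).
by apply: integral_parts => //; case: (tpsi n).
Qed.

Lemma n2_weak_deriv (l : \bar R) v (f g : V -> R) : L2 l f -> is_weak_deriv l v f g ->
  n2 mu (strip l) (weak_deriv l v f) = n2 mu (strip l) g.
Proof.
move=> L2f wg; have ww := weak_derivP (ex_intro _ _ wg).
apply: eq_n2_ae; [exact: measurable_strip|by case: ww => -[]|by case: wg => -[]|].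
exact: (weak_deriv_unique L2f ww wg).
Qed.

Section limit.
Variables (l : \bar R) (f : V -> R) (g : option 'I_N -> V -> R) (psi : nat -> V -> R).
Hypotheses (tpsi : forall n, test_function (psi n)) (L2f : L2 l f) (L2g : forall i, L2 l (g i))
  (cf : (fun n => n2 mu (strip l) (psi n \- f)%R) @ \oo --> 0%E)
  (cg : forall i, (fun n => n2 mu (strip l) ('D_(vdir i) (psi n) \- g i)%R) @ \oo --> 0%E).

Lemma limit_weak_deriv i : is_weak_deriv l (vdir i) f (g i).
Proof. exact: weak_deriv_limit tpsi L2f (L2g i) cf (cg i). Qed.

Lemma limit_H1 : H1_strip l f.
Proof.
split => // [i|]; first by exists (g (Some i)); exact: (limit_weak_deriv (Some i)).
by exists (g None); exact: (limit_weak_deriv None).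
Qed.

(** By uniqueness of weak derivatives, [sqr_H1_norm] of psi n - f is the sum of the mean square
    errors of psi n and of its derivatives. *)
Lemma limit_trace s (tau : 'rV[R]_N -> R) : measurable_fun setT tau ->
  (fun n => n2 (lebesgue_rV R N) setT (fun x => psi n (x, s) - tau x)%R) @ \oo --> 0%E ->
  has_trace l f s tau.
Proof.
move=> mtau ctau; split => //; exists psi; split => //.
have E i n : n2 mu (strip l) (weak_deriv l (vdir i) (psi n \- f)) =
    n2 mu (strip l) ('D_(vdir i) (psi n) \- g i).
  apply: n2_weak_deriv; first by apply: L2_sub => //; exact: L2_test.
  apply: weak_derivB => //; [exact: L2_test|exact: weak_deriv_test|exact: limit_weak_deriv].
rewrite (_ : (fun n => _) = (fun n => n2 mu (strip l) (psi n \- f)%R +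
    \sum_(i < N) n2 mu (strip l) ('D_(vdir (Some i)) (psi n) \- g (Some i))%R +
    n2 mu (strip l) ('D_(vdir None) (psi n) \- g None)%R)%E); last first.
  apply/funext => n; rewrite /sqr_H1_norm /sqr_deriv_y /sqr_grad_x -(E None); congr (_ + _ + _)%E.
  by apply: eq_bigr => i _; rewrite -(E (Some i)).
apply: cvge0D => //; apply: cvge0D => //.
by apply: (@cvge0_sum _ _ (fun (i : 'I_N) n => n2 mu (strip l) ('D_(vdir (Some i)) (psi n) \- g (Some i)))).
Qed.

End limit.
End weak_deriv_limits.

Section chart.
Context {R : realType} {N : nat}.
Local Notation Y := (measurableTypeR R).
Local Notation V := ('rV[R]_N * R)%type.
Local Notation Z := ('rV[R]_N * measurableTypeR R)%type.
Local Notation mu := (@lebesgue_strip R N).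
Variables (a c : R) (l : \bar R) (Se S : set Z).
Hypotheses (ac : a = 1 \/ a = -1 /\ c = 0) (mSe : measurable Se) (mS : measurable S) (SeS : Se `<=` S).

(** Position of an edge in R^N x R: a translation in y for the circle, the identity and the
    reflection for the two half-lines. All of them preserve the measure, and [Se] corresponds to the
    open strip. *)
Definition chart (z : V) : V := (z.1, a * z.2 + c).

Hypothesis stripSe : forall z : V, strip l z <-> Se (chart z).

Let aa : a * a = 1.
Proof. by case: ac => [->|[-> _]]; rewrite ?mulr1// mulrNN mulr1. Qed.

Let measurable_chart : measurable_fun setT (chart : Z -> Z).
Proof.
rewrite (_ : chart = fun z => (z.1 + 0, a * z.2 + c)); first exact: measurable_strip_map.
by apply/funext => z; rewrite addr0.
Qed.

Let integral_chart (F : Z -> \bar R) : measurable_fun setT F -> (forall z, 0 <= F z)%E ->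
  (\int[mu]_z F (chart z) = \int[mu]_z F z)%E.
Proof.
move=> mF F0; case: ac => [a1|[a1 c0]].
  rewrite -[RHS](ge0_integral_strip_map 0 c ltr01 mF F0) mul1e.
  by apply: eq_integral => z _; rewrite /chart a1 addr0.
rewrite -[RHS](ge0_integral_strip_opp mF F0).
by apply: eq_integral => z _; rewrite /chart a1 c0 addr0 mulN1r.
Qed.

Let chart_patch (f : V -> R) : (f \_ Se) \o chart = (f \o chart) \_ (strip l).
Proof.
apply/funext => z; rewrite /= !patchE; case: ifPn => [/set_mem /stripSe h|/negP h].
  by rewrite mem_set.
by rewrite ifN//; apply/negP => /set_mem /stripSe h'; apply: h; exact: mem_set.
Qed.

Let measurable_comp_chart (f : V -> R) : measurable_fun Se f -> measurable_fun (strip l : set Z) (f \o chart).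
Proof.
move=> mf; apply/(@measurable_restrictT _ _ Z _ _ _ (measurable_strip l)); rewrite -chart_patch.
apply: measurableT_comp measurable_chart.
exact: (@measurable_restrictT _ _ Z _ _ _ mSe).1.
Qed.

Lemma integral_comp_chart (F : Z -> \bar R) : measurable_fun setT F -> (forall z, 0 <= F z)%E ->
  (\int[mu]_(z in strip l) F (chart z) = \int[mu]_(z in Se) F z)%E.
Proof.
move=> mF F0; rewrite integral_mkcond [RHS]integral_mkcond -[RHS]integral_chart.
- apply: eq_integral => z _; rewrite !patchE; case: ifPn => [/set_mem /stripSe h|/negP h].
    by rewrite mem_set.
  by rewrite ifN//; apply/negP => /set_mem /stripSe h'; apply: h; exact: mem_set.
- by apply: (@measurable_restrictT _ _ Z _ _ _ mSe).1; exact: measurable_funTS.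
- by move=> z; apply: erestrict_ge0.
Qed.

Let n2_comp_chart (f : V -> R) : measurable_fun Se f -> n2 mu (strip l) (f \o chart) = n2 mu Se f.
Proof.
move=> mf; have m1 := (@measurable_restrictT _ _ Z _ _ _ mSe).1 mf.
transitivity (\int[mu]_(z in strip l) ((f \_ Se) (chart z) ^+ 2)%:E)%E.
  by apply: eq_n2 => z /stripSe h; rewrite /= patchE mem_set.
rewrite (@integral_comp_chart (fun z => ((f \_ Se) z ^+ 2)%:E) (measurable_sqrE m1) (fun z => sqr_ge0 _)).
by apply: eq_n2 => z h; rewrite patchE mem_set.
Qed.

(** Sign that the chain rule puts on a derivative after composition with the chart; its square is 1,
    so norms are unaffected. *)
Let eps (i : option 'I_N) : R := if i is Some _ then 1 else a.

Let epsM i : eps i * eps i = 1. Proof. by case: i => [j|] //=; rewrite mulr1. Qed.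

Let lin (v : V) : V := (v.1, a * v.2).

Let lin_vdir i : lin (vdir i) = eps i *: vdir i.
Proof.
case: i => [j|]; rewrite /lin /vdir /dir_x /dir_y /eps /=; last by congr pair; rewrite scaler0.
by rewrite mulr0 scale1r.
Qed.

Let chart_affine z h v : chart (z + h *: v) = chart z + h *: lin v.
Proof.
congr pair; rewrite /= mulrDr -!addrA; congr (_ + _); rewrite addrC; congr (_ + _).
by rewrite mulrCA.
Qed.

Let continuous_chart : continuous chart.
Proof.
move=> z; have c1 : fst @ z --> z.1 by exact: cvg_fst.
have c2 : (fun z : V => a * z.2 + c) @ z --> a * z.2 + c.
  by apply: cvgD; [apply: cvgM; [exact: cvg_cst|exact: cvg_snd]|exact: cvg_cst].
exact: cvg_pair c1 c2.
Qed.

Lemma test_comp_chart (phi : V -> R) : test_function phi -> test_function (phi \o chart).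
Proof.
move=> tphi; have [M M0 HM] := test_function_supp tphi.
apply: (@test_function_box _ _ _ (fun=> - (M + `|c|)) (fun=> M + `|c|)).
  by apply: smooth_precomp continuous_chart chart_affine _; case: tphi.
move=> z nz; apply: HM => box; apply: nz => i.
have := box i; rewrite -!ler_norml; case: i => [j|] /=.
  by move=> h; apply: le_trans h _; rewrite lerDl.
move=> h; rewrite -[z.2](addrK c) (le_trans (ler_normB _ _))// lerD2r.
rewrite (le_trans _ h)//; case: ac => [->|[-> ->]]; first by rewrite mul1r.
by rewrite !addr0 mulN1r normrN.
Qed.

Variables (U : V -> R) (g : option 'I_N -> V -> R) (phi : nat -> V -> R).
Hypotheses (mU : measurable_fun S U) (U2 : (n2 mu S U < +oo)%E)
  (mg : forall i, measurable_fun S (g i)) (g2 : forall i, (n2 mu S (g i) < +oo)%E)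
  (tphi : forall n, test_function (phi n))
  (cphi : (fun n => n2 mu S (phi n \- U)%R) @ \oo --> 0%E)
  (cDphi : forall i, (fun n => n2 mu S ('D_(vdir i) (phi n) \- g i)%R) @ \oo --> 0%E).

Let gchart i : V -> R := fun z => eps i * g i (chart z).

Let D_comp_chart n i : 'D_(vdir i) (phi n \o chart) = (fun z => eps i * 'D_(vdir i) (phi n) (chart z)).
Proof.
have sphi : smooth (phi n) by case: (tphi n).
apply/funext => z.
have d : derivable (phi n) (chart z) (lin (vdir i)) by exact: smooth_derivable.
have [_ ->] := derive_precomp continuous_chart chart_affine d.
rewrite lin_vdir.
exact: (deriveZdir _ (@smooth_derivable _ _ (phi n) (chart z) (vdir i) sphi)).
Qed.

Let mUe : measurable_fun Se U. Proof. exact: measurable_funS mU. Qed.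
Let mge i : measurable_fun Se (g i). Proof. exact: measurable_funS (@mg i). Qed.

Let n2_sub (f : V -> R) : measurable_fun S f -> (n2 mu Se f <= n2 mu S f)%E.
Proof.
move=> mf; apply: ge0_subset_integral => //; first exact: measurable_sqrE.
by move=> r _; rewrite lee_fin sqr_ge0.
Qed.

Let n2_gchart i : n2 mu (strip l) (gchart i) = n2 mu Se (g i).
Proof.
rewrite -n2_comp_chart//; apply: eq_integral => z _; rewrite /gchart /=.
by rewrite exprMn [eps i ^+ 2]epsM mul1r.
Qed.

Let L2U : L2 l (U \o chart).
Proof.
split; first exact: measurable_comp_chart.
by rewrite [sqr_norm _ _]n2_comp_chart//; apply: le_lt_trans U2; exact: n2_sub.
Qed.

Let L2g i : L2 l (gchart i).
Proof.
split; first by apply: measurable_funM; [exact: measurable_cst|exact: measurable_comp_chart].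
by rewrite [sqr_norm _ _]n2_gchart; apply: le_lt_trans (g2 i); exact: n2_sub.
Qed.

Let mphi n : measurable_fun S (phi n).
Proof. by apply: measurable_funTS; exact: test_measurable. Qed.

Let mDphi n i : measurable_fun S ('D_(vdir i) (phi n)).
Proof. by apply: measurable_funTS; apply: test_measurable; exact: test_D. Qed.

Let chart_cvg : (fun n => n2 mu (strip l) ((phi n \o chart) \- (U \o chart))%R) @ \oo --> 0%E.
Proof.
apply: (squeeze0e _ _ cphi) => n; first exact: n2_ge0.
have m1 : measurable_fun S (phi n \- U) by exact: measurable_funB.
by apply: le_trans (n2_sub m1); rewrite -(n2_comp_chart (measurable_funS mS SeS m1)).
Qed.

Let chart_cvgD i : (fun n => n2 mu (strip l) ('D_(vdir i) (phi n \o chart) \- gchart i)%R) @ \oo --> 0%E.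
Proof.
apply: (squeeze0e _ _ (@cDphi i)) => n; first exact: n2_ge0.
have m1 : measurable_fun S ('D_(vdir i) (phi n) \- g i) by exact: measurable_funB.
apply: le_trans (n2_sub m1); rewrite -(n2_comp_chart (measurable_funS mS SeS m1)).
rewrite (_ : n2 mu (strip l) ('D_(vdir i) (phi n \o chart) \- gchart i)%R =
  n2 mu (strip l) (('D_(vdir i) (phi n) \- g i) \o chart)%R)//.
apply: eq_integral => z _; rewrite D_comp_chart /gchart /= -mulrBr exprMn.
by rewrite [eps i ^+ 2]epsM mul1r.
Qed.

Lemma chart_H1 : H1_strip l (U \o chart).
Proof. exact: (limit_H1 (fun n => test_comp_chart (tphi n)) L2U L2g chart_cvg chart_cvgD). Qed.

Lemma chart_trace (s : R) (tau : 'rV[R]_N -> R) : measurable_fun setT tau ->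
  (fun n => n2 (lebesgue_rV R N) setT (fun x => phi n (x, (a * s + c)%R) - tau x)%R) @ \oo --> 0%E ->
  has_trace l (U \o chart) s tau.
Proof. exact: (limit_trace (fun n => test_comp_chart (tphi n)) L2U L2g chart_cvg chart_cvgD). Qed.

Lemma chart_sqr_norm : sqr_norm l (U \o chart) = n2 mu Se U.
Proof. exact: n2_comp_chart. Qed.

Lemma chart_weak_deriv i : n2 mu (strip l) (weak_deriv l (vdir i) (U \o chart)) = n2 mu Se (g i).
Proof.
rewrite -n2_gchart; apply: n2_weak_deriv L2U _.
exact: (limit_weak_deriv (fun n => test_comp_chart (tphi n)) L2U L2g chart_cvg chart_cvgD).
Qed.

Lemma chart_sqr_H1_norm : (sqr_H1_norm l (U \o chart) < +oo)%E.
Proof.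
have fin i : (n2 mu (strip l) (weak_deriv l (vdir i) (U \o chart)) < +oo)%E.
  by rewrite chart_weak_deriv; apply: le_lt_trans (g2 i); exact: n2_sub.
rewrite /sqr_H1_norm; apply: lte_add_pinfty; last exact: (fin None).
apply: lte_add_pinfty; last by apply: lte_sum_pinfty => i _; exact: (fin (Some i)).
by rewrite chart_sqr_norm; apply: le_lt_trans U2; exact: n2_sub.
Qed.

End chart.

Section hat_graphs.
Context {R : realType} {N : nat}.
Local Notation Y := (measurableTypeR R).
Local Notation V := ('rV[R]_N * R)%type.
Local Notation Z := ('rV[R]_N * measurableTypeR R)%type.
Local Notation mu := (@lebesgue_strip R N).

Lemma esum_bool (h : bool -> \bar R) : (forall e, 0 <= h e)%E ->
  (\esum_(e in [set: bool]) h e = h true + h false)%E.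
Proof.
move=> h0; rewrite esum_fset//; last exact: finite_finset.
rewrite (_ : [set: bool] = [set true] `|` [set false]).
  by rewrite fsbigU0 ?fsbig_set1// => -[] [].
by apply/seteqP; split => -[]//= _; [left|right].
Qed.

Lemma esum_unit (h : unit -> \bar R) : (forall e, 0 <= h e)%E ->
  (\esum_(e in [set: unit]) h e = h tt)%E.
Proof.
by move=> h0; rewrite (_ : [set: unit] = [set tt]) ?esum_set1//; apply/seteqP; split => -[].
Qed.

Variables (U : V -> R) (g : option 'I_N -> V -> R) (phi : nat -> V -> R) (b : \bar R).
Let S : set Z := [set z | ((`|z.2|)%:E < b)%E].
Hypotheses (mU : measurable_fun [set: Z] U) (U2 : (n2 mu S U < +oo)%E)
  (mg : forall i, measurable_fun S (g i)) (g2 : forall i, (n2 mu S (g i) < +oo)%E)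
  (tphi : forall n, test_function (phi n)) (even_phi : forall n z, phi n (z.1, - z.2) = phi n z)
  (cphi : (fun n => n2 mu S (phi n \- U)%R) @ \oo --> 0%E)
  (cDphi : forall i, (fun n => n2 mu S ('D_(vdir i) (phi n) \- g i)%R) @ \oo --> 0%E).

Definition coord_fun (C : coord_graph R) (e : edge C) (z : V) : R := U (z.1, edge_coord e z.2).

(* edge_coord unfolds C onto ]-b, b[, up to a negligible set. *)
Definition unfolds (C : coord_graph R) : Prop :=
  [/\ H1_graph (@coord_fun C),
    forall F : Z -> \bar R, measurable_fun setT F -> (forall z, 0 <= F z)%E ->
      (\esum_(e in [set: edge C]) \int[mu]_(z in strip (len e)) F (z.1, edge_coord e z.2) =
       \int[mu]_(z in S) F z)%E &
    forall i, (\esum_(e in [set: edge C]) n2 mu (strip (len e))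
      (weak_deriv (len e) (vdir i) (@coord_fun C e)) <= n2 mu S (g i))%E].

Let mS : measurable S. Proof. exact: measurable_band. Qed.
Let mUS : measurable_fun S U. Proof. exact: measurable_funTS. Qed.

Let half_measurable (s : bool) : measurable [set z : Z | if s then 0 < z.2 else z.2 < 0].
Proof.
case: s.
  apply: (measurable_snd_set (A := [set y : Y | 0 < y])).
  rewrite (_ : [set y | _] = `]0, +oo[%classic); first exact: measurable_itv.
  by apply/seteqP; split => y /=; rewrite in_itv/= andbT.
apply: (measurable_snd_set (A := [set y : Y | y < 0])).
rewrite (_ : [set y | _] = `]-oo, 0[%classic); first exact: measurable_itv.
by apply/seteqP; split => y /=; rewrite in_itv.
Qed.

(** Both half-lines carry the same sequence of test functions, so its limit on y = 0 is a common
    trace at their vertex. The set y = 0, missed by the open half-lines, is null. *)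
Lemma unfolds_line : b = +oo%E -> unfolds (line_graph (R := R)).
Proof.
move=> boo; pose H (s : bool) : set Z := [set z | if s then 0 < z.2 else z.2 < 0].
have ST : S = setT by apply/seteqP; split => z //= _; rewrite /S /= boo ltry.
have HS s : H s `<=` S by rewrite ST.
pose a (s : bool) : R := if s then 1 else -1.
have ac s : a s = 1 \/ a s = -1 /\ 0 = 0 :> R by case: s; [left|right].
have chartE (s : bool) (z : V) : chart (a s) 0 z = (z.1, if s then z.2 else - z.2).
  by case: s; rewrite /chart /a addr0 ?mul1r ?mulN1r.
have inH s (z : V) : strip +oo z <-> H s (chart (a s) 0 z).
  rewrite chartE /strip /H /= ltry; case: s; first by split=> [[]|].
  by rewrite oppr_lt0; split=> [[]|].
have fE (s : bool) : coord_fun (C := line_graph) s = U \o chart (a s) 0.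
  by apply/funext => z; rewrite /coord_fun /= chartE.
have [tau mtau ctau] := @trace_limit R N phi S U (g None) 0 1 tphi mS mUS (mg None) cphi (cDphi None) ltr01
  (fun x y _ => ltac:(by rewrite ST)).
split.
- split=> [s||].
  + by rewrite fE; apply: (chart_H1 (ac s) (half_measurable s) mS (HS s) (inH s) mUS U2 mg g2 tphi cphi cDphi).
  + rewrite esum_bool; last by move=> s; apply: le_trans (sqr_H1_norm_ge _ _).1; exact: n2_ge0.
    by apply: lte_add_pinfty; rewrite fE; apply: (chart_sqr_H1_norm (ac _) (half_measurable _) mS (HS _) (inH _) mUS U2 mg g2 tphi cphi cDphi).
  + exists (fun _ => tau) => s t v [[/= -> _]|[]//].
    rewrite fE; apply: (chart_trace (ac s) (half_measurable s) mS (HS s) (inH s) mUS U2 mg g2 tphi cphi cDphi) => //.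
    by rewrite mulr0 addr0.
- move=> F mF F0; rewrite esum_bool; last by move=> s; exact: integral_ge0.
  have I s : (\int[mu]_(z in strip (len (s : edge line_graph))) F (z.1, edge_coord (s : edge line_graph) z.2) = \int[mu]_(z in H s) F z)%E.
    rewrite -(integral_comp_chart (ac s) (half_measurable s) (inH s) mF F0).
    by apply: eq_integral => z _; rewrite chartE.
  rewrite !I -ge0_integral_setU//; last 4 first.
  + exact: (half_measurable true).
  + exact: (half_measurable false).
  + exact: measurable_funTS.
  + by apply/disj_setPS => z [/= h1 h2]; move: (lt_trans h1 h2); rewrite ltxx.
  rewrite integral_mkcond [RHS]integral_mkcond; apply: ge0_ae_eq_integral => //.
  + apply: (@measurable_restrictT _ _ Z _ _ _ _).1; last exact: measurable_funTS.
    by apply: measurableU; [exact: (half_measurable true)|exact: (half_measurable false)].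
  + by apply: (@measurable_restrictT _ _ Z _ _ _ mS).1; exact: measurable_funTS.
  + by move=> z _; apply: erestrict_ge0.
  + by move=> z _; apply: erestrict_ge0.
  apply: ae_imp (@strip_ae_snd R N (fun y => y != 0) (@ae_neq0 R)) _ => z z0 _.
  rewrite !patchE ST [in RHS]mem_set// mem_set//=.
  by case/orP: (lt_total z0) => h; [right|left].
move=> i; rewrite esum_bool; last by move=> s; exact: n2_ge0.
have I s : n2 mu (strip (len (s : edge line_graph))) (weak_deriv (len (s : edge line_graph)) (vdir i) (coord_fun (C := line_graph) s)) = n2 mu (H s) (g i).
  by rewrite fE; apply: (chart_weak_deriv (ac s) (half_measurable s) mS (HS s) (inH s) mUS U2 mg g2 tphi cphi cDphi).
rewrite !I /n2 -ge0_integral_setU//; last 5 first.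
- exact: (half_measurable true).
- exact: (half_measurable false).
- by apply: measurable_sqrE; apply: (measurable_funS mS) (mg i); rewrite ST.
- by move=> z _; rewrite lee_fin sqr_ge0.
- by apply/disj_setPS => z [/= h1 h2]; move: (lt_trans h1 h2); rewrite ltxx.
apply: ge0_subset_integral => //.
- by apply: measurableU; [exact: (half_measurable true)|exact: (half_measurable false)].
- exact: measurable_sqrE.
- by move=> z _; rewrite lee_fin sqr_ge0.
- by rewrite ST.
Qed.

(** One chart covers the whole band. The trace is built at y = -L/2 from inside the band and
    transferred to y = L/2 by evenness of the test functions. *)
Lemma unfolds_circle (L : R) (L0 : (0 < L%:E)%E) : b = (L / 2)%:E -> unfolds (circle_graph L0).
Proof.
move=> bL; have L1 : 0 < L by rewrite -lte_fin.
have ac : (1 : R) = 1 \/ (1 : R) = -1 /\ - (L / 2) = 0 by left.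
have inS (z : V) : strip L%:E z <-> S (chart 1 (- (L / 2)) z).
  rewrite /strip /S /chart /= bL !lte_fin mul1r ltr_norml; split=> [[h1 h2]|/andP[h1 h2]].
    by apply/andP; split; lra.
  by split; lra.
have fE (e : edge (circle_graph L0)) : coord_fun e = U \o chart 1 (- (L / 2)).
  by apply/funext => z; rewrite /coord_fun /chart /= mul1r.
have SS : S `<=` S by [].
have [tau mtau ctau] := @trace_limit R N phi S U (g None) (- (L / 2)) L tphi mS mUS (mg None) cphi (cDphi None) L1
  (fun x y => ltac:(move=> /andP[h1 h2]; rewrite /S /= bL lte_fin ltr_norml; apply/andP; split; lra)).
split.
- split=> [e||].
  + by rewrite fE; apply: (chart_H1 ac mS mS SS inS mUS U2 mg g2 tphi cphi cDphi).
  + rewrite esum_unit; last by move=> s; apply: le_trans (sqr_H1_norm_ge _ _).1; exact: n2_ge0.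
    by rewrite fE; apply: (chart_sqr_H1_norm ac mS mS SS inS mUS U2 mg g2 tphi cphi cDphi).
  + exists (fun _ => tau) => e s v sP.
    rewrite fE; apply: (chart_trace ac mS mS SS inS mUS U2 mg g2 tphi cphi cDphi) => //.
    case: sP => -[/= h _]; first by rewrite h mulr0 add0r.
    have -> : s = L by case: h.
    rewrite (_ : (fun n => _) = (fun n => n2 (lebesgue_rV R N) setT (fun x => phi n (x, - (L / 2)) - tau x)))//.
    apply/funext => n; apply: eq_n2 => x _; rewrite -[in RHS]even_phi /=.
    by congr (phi n (_, _) - _); lra.
- move=> F mF F0; rewrite esum_unit; last by move=> s; exact: integral_ge0.
  rewrite -(integral_comp_chart ac mS inS mF F0).
  by apply: eq_integral => z _; rewrite /chart /= mul1r.
move=> i; rewrite esum_unit; last by move=> s; exact: n2_ge0.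
by rewrite fE (chart_weak_deriv ac mS mS SS inS mUS U2 mg g2 tphi cphi cDphi).
Qed.

End hat_graphs.

(** * The rearrangement as a function on the circle or the line *)

Section rearranged.
Context {R : realType} {N : nat} (G : metric_graph R).
Local Notation Y := (measurableTypeR R).
Local Notation T := (nat * measurableTypeR R)%type.
Local Notation V := ('rV[R]_N * R)%type.
Local Notation Z := ('rV[R]_N * measurableTypeR R)%type.
Local Notation lam := (@lebesgue_measure R).
Local Notation tm := (@tmeasure R).
Local Notation mu := (@lebesgue_strip R N).

Definition half_length (l : \bar R) : \bar R := if l is L%:E then (L / 2)%:E else l.

Lemma lt_half_length l (y : R) : ((`|y|)%:E < half_length l)%E = ((2 * `|y|)%:E < l)%E.
Proof.
case: l => [L||] //=; last by rewrite !ltry.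
by rewrite !lte_fin ltr_pdivlMr// mulrC.
Qed.

Lemma half_length_gt0 l : (0 < l)%E -> (0 < half_length l)%E.
Proof. by case: l => [L||] //=; rewrite !lte_fin => L0; rewrite divr_gt0. Qed.

(** [hat_graph] matches on the total length together with a proof of its positivity; this eliminates
    the dependent match once, in a form applicable to any property of the coordinate graph. *)
Lemma hat_graph_ind (P : coord_graph R -> Prop) :
  (forall L (L0 : (0 < L%:E)%E), total_length G = L%:E -> P (circle_graph L0)) ->
  (total_length G = +oo%E -> P (line_graph (R := R))) -> P (hat_graph G).
Proof.
rewrite /hat_graph; move: (total_length_gt0 G); case: (total_length G) => [L||] l0 PL Poo //.
- exact: PL.
- exact: Poo.
Qed.

Variable u : edge G -> V -> R.
Hypotheses (con : connected_graph G) (H1u : H1_graph u).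

Let b := half_length (total_length G).
Let S : set Z := [set z | ((`|z.2|)%:E < b)%E].

(** The y-constant [C None] is 4/k^2 times the y-energy of u. With k = 1 it gives membership in H^1
    and the bounds in x for every u; with k = 2, the sharp bound in y. *)
Lemma rearrangement_unfolds (k : R) : k = 1 \/ k = 2 /\ attains_twice_ae u ->
  exists g : option 'I_N -> V -> R, [/\ unfolds (uhat u) g b (hat_graph G),
    forall j, (n2 mu S (g (Some j)) <= energy_dir u (Some j))%E &
    ((k ^+ 2)%:E * n2 mu S (g None) <= 4%:E * energy_dir u None)%E].
Proof.
move=> kP; have kn : k != 0 by case: kP => [->|[-> _]].
have k2 : 0 < k ^+ 2 by case: kP => [->|[-> _]]; rewrite exprn_gt0.
have Efin i : energy_dir u i = (fine (energy_dir u i))%:E.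
  by rewrite fineK// ge0_fin_numE ?energy_dir_ge0//; exact: energy_dir_lty.
pose C i := fine (energy_dir u i) * (if i is Some _ then 1 else 4 / k ^+ 2).
have C0 i : 0 <= C i.
  apply: mulr_ge0; first by apply: fine_ge0; exact: energy_dir_ge0.
  by case: i => [j|] //; rewrite divr_ge0// ltW.
have mU := measurable_uhat H1u; have U2 := n2_uhat_lty H1u.
have b0 : (0 < b)%E by apply: half_length_gt0; exact: total_length_gt0.
have diffx j h : (n2 mu setT (fun z => uhat u (z + h *: vdir (Some j)) - uhat u z)%R <=
    (C (Some j) * h ^+ 2)%:E)%E.
  apply: le_trans (uhat_diff_x H1u j h) _.
  by rewrite Efin -EFinM lee_fin /C mulr1 mulrC.
have diffy h : (n2 mu [set z : Z | S z /\ S (z + h *: vdir None)%R]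
    (fun z => uhat u (z + h *: vdir None) - uhat u z)%R <= (C None * h ^+ 2)%:E)%E.
  have := uhat_diff_y con H1u h kP.
  rewrite (_ : [set z : Z | _ /\ _] = [set z : Z | S z /\ S (z + h *: vdir None)%R]); last first.
    by apply/seteqP; split => z /=; rewrite /S /= !lt_half_length [h%:A]mulr1.
  rewrite Efin -EFinM => H; have k2E : (0 < (k ^+ 2)%:E)%E by rewrite lte_fin.
  have fk : (k ^+ 2)%:E \is a fin_num by [].
  rewrite -(lee_pmul2l fk k2E).
  apply: le_trans H _; rewrite -EFinM lee_fin /C.
  rewrite (_ : k ^+ 2 * _ = 4 * h ^+ 2 * fine (energy_dir u None))//.
  by field; exact: kn.
have near e : 0 < e -> exists phi, near_test (uhat u) S C e phi.
  exact: (even_test_approximation mU U2 b0 C0 (@uhat_even R N G u) (uhat_scale H1u) diffx diffy).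
have mS : measurable S by exact: measurable_band.
have U2S : (n2 mu S (uhat u) < +oo)%E.
  apply: le_lt_trans U2; apply: ge0_subset_integral => //; first exact: measurable_sqrE.
  by move=> r _; rewrite lee_fin sqr_ge0.
have [phi [g [tphi ephi cphi gP]]] := gradient_limit mS (measurable_funTS mU) near.
have mg i : measurable_fun S (g i) by case: (gP i).
have cg i : (fun n => n2 mu S ('D_(vdir i) (phi n) \- g i)%R) @ \oo --> 0%E by case: (gP i).
have gC i : (n2 mu S (g i) <= (C i)%:E)%E by case: (gP i).
have g2 i : (n2 mu S (g i) < +oo)%E by apply: le_lt_trans (gC i) _; exact: ltry.
exists g; split.
- apply: hat_graph_ind => [L L0 EL|Eoo].
    by apply: (unfolds_circle mU U2S mg g2 tphi ephi cphi cg); rewrite /b EL.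
  by apply: (unfolds_line mU U2S mg g2 tphi cphi cg); rewrite /b Eoo.
- by move=> j; rewrite Efin; apply: le_trans (gC _) _; rewrite lee_fin /C mulr1.
apply: (@le_trans _ _ ((k ^+ 2)%:E * (C None)%:E)%E).
  by apply: lee_pmul => //; [rewrite lee_fin ltW|exact: n2_ge0].
rewrite Efin -!EFinM lee_fin /C (_ : k ^+ 2 * _ = 4 * fine (energy_dir u None))//.
by field; exact: kn.
Qed.

Lemma y_rearrangementE : y_rearrangement u = @coord_fun R N (uhat u) (hat_graph G).
Proof. by apply/funext => e; apply/funext => z; rewrite (uhatE H1u). Qed.

(** Superlevel sets of a fibre lie in the graph, whose measure is the total length, so the
    rearrangement vanishes beyond half of it. *)
Lemma uhat_outside : {ae mu, forall z, ~ S z -> uhat u z = 0}.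
Proof.
have n0 : {ae mu, forall z, (z.2 : R) != 0} by exact: (@strip_ae_snd R N (fun y => y != 0) (@ae_neq0 R)).
apply: ae_imp2 (strip_ae_fst (good_fiber H1u)) n0 _ => -[x y] /= gx y0 nS.
apply/eqP; rewrite -[_ == _]negbK; apply/negP => ne.
have h0 : 0 < uhat u (x, y) by rewrite lt_neqAle eq_sym ne hat_ge0.
apply: nS; rewrite /S /= lt_half_length; move: h0; rewrite /uhat /= (hat_lt gx y0)//.
move=> /lt_le_trans; apply; rewrite -(@tmeasure_gsupp R G) /dfun.
apply: le_measure; rewrite ?inE.
- by have [mf _ _] := gx; rewrite -[X in measurable X]setTI; apply: measurable_fun_ltr.
- exact: measurable_gsupp.
move=> q /= q0; apply: contrapT => nq; move: q0.
by rewrite fiberE gext_notin// ltxx.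
Qed.

(** The integral over the band is that over the whole space, since the rearrangement is 0 elsewhere
    and p > 0. For a nonnegative u the positive part taken in the fibres is u itself. *)
Lemma rearrangement_Lp (p : R) : nonneg_graph u -> 0 < p ->
  Lp_pow p (y_rearrangement u) = Lp_pow p u.
Proof.
move=> pos p0; have [g [[_ unf _] _ _]] := rearrangement_unfolds (or_introl (erefl (1 : R))).
have mU := measurable_uhat H1u.
have mF : measurable_fun setT (fun z : Z => (`|uhat u z| `^ p)%:E).
  apply/measurable_EFinP; apply: measurableT_comp (measurable_powR p) _.
  exact: measurableT_comp (@normr_measurable _ _) mU.
have F0 (z : Z) : (0 <= (`|uhat u z| `^ p)%:E)%E by rewrite lee_fin powR_ge0.
rewrite y_rearrangementE /Lp_pow; have := unf _ mF F0; rewrite /coord_fun => ->.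
transitivity (\int[mu]_z (uhat u z `^ p)%:E)%E.
  have mS : measurable S by exact: measurable_band.
  rewrite integral_mkcond; apply: ge0_ae_eq_integral => //.
  - by apply: (@measurable_restrictT _ _ Z _ _ _ mS).1; exact: measurable_funTS.
  - by apply/measurable_EFinP; exact: measurableT_comp (measurable_powR p) mU.
  - by move=> z _; apply: erestrict_ge0.
  - by move=> z _; rewrite lee_fin powR_ge0.
  apply: ae_imp uhat_outside _ => z Hz _; rewrite patchE; case: ifPn => [_|/negP nS].
    by rewrite ger0_norm// uhat_ge0.
  by rewrite Hz ?powR0 ?gt_eqF// => Sz; apply: nS; exact: mem_set.
rewrite (uhat_Lp H1u p0); apply: eq_esum => e _.
have mu_u : measurable_fun (strip (len e) : set Z) (u e) by case: H1u => h _ _; case: (h e) => -[].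
apply: ge0_ae_eq_integral => //.
- exact: measurable_strip.
- apply/measurable_EFinP; apply: (measurableT_comp (measurable_powR p)); exact: measurable_maxr.
- apply/measurable_EFinP; apply: (measurableT_comp (measurable_powR p)).
  exact: measurableT_comp (@normr_measurable _ _) mu_u.
- by move=> z _; rewrite lee_fin powR_ge0.
apply: ae_imp (pos e) _ => z Hz zl; have u0 := Hz zl.
by rewrite ger0_norm// (max_idPl u0).
Qed.

Lemma rearrangement_grad_x : (grad_x_sqr_norm (y_rearrangement u) <= grad_x_sqr_norm u)%E.
Proof.
have [g [[_ _ der] gx _]] := rearrangement_unfolds (or_introl (erefl (1 : R))).
rewrite y_rearrangementE /grad_x_sqr_norm /sqr_grad_x.
rewrite esum_sum; last by move=> e i _ _; exact: n2_ge0.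
rewrite esum_sum; last by move=> e i _ _; exact: n2_ge0.
by apply: lee_sum => i _; apply: le_trans (der (Some i)) _; exact: gx.
Qed.

Lemma rearrangement_deriv_y : attains_twice_ae u ->
  (deriv_y_sqr_norm (y_rearrangement u) <= deriv_y_sqr_norm u)%E.
Proof.
move=> tw; have [g [[_ _ der] _ gy]] := rearrangement_unfolds (or_intror (conj (erefl (2 : R)) tw)).
rewrite y_rearrangementE; apply: le_trans (der None) _; move: gy.
by rewrite (_ : (2 : R) ^+ 2 = 4) ?lee_pmul2l//; ring.
Qed.

End rearranged.

Theorem proposition3p11 (R : realType) (G : metric_graph R) (N : nat)
    (u : edge G -> 'rV[R]_N * R -> R) :
  connected_graph G -> (0 < N)%N -> H1_graph u -> nonneg_graph u ->
  [/\ H1_graph (y_rearrangement u),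
      forall p : R, 1 <= p -> Lp_pow p (y_rearrangement u) = Lp_pow p u,
      (grad_x_sqr_norm (y_rearrangement u) <= grad_x_sqr_norm u)%E
    & attains_twice_ae u ->
      (deriv_y_sqr_norm (y_rearrangement u) <= deriv_y_sqr_norm u)%E].
Proof.
move=> con _ H1u pos; split.
- rewrite (y_rearrangementE H1u).
  by have [g [[]]] := rearrangement_unfolds con H1u (or_introl (erefl (1 : R))).
- move=> p p1; apply: rearrangement_Lp => //; exact: lt_le_trans p1.
- exact: rearrangement_grad_x.
- exact: rearrangement_deriv_y.
Qed.
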